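(* Let $M^5\subset\mathbb{C}^3$ be a local real analytic hypersurface passing through the origin, $0\in M^5$, which belongs to the General Class $\mathsf{IV}_{\mathsf 2}$, i.e. such that for some pair of local generators $\{\mathcal{L}_1,\mathcal{L}_2\}$ of $T^{1,0}M$, the five fields $$\Big\{\mathcal{L}_1,\ \mathcal{L}_2,\ \overline{\mathcal{L}}_1,\ \overline{\mathcal{L}}_2,\ [\mathcal{L}_1,\overline{\mathcal{L}}_1]\Big\}$$ constitute a frame for $\mathbb{C}\otimes_{\mathbb{R}}TM$, such that in addition the Levi form of $M$ is of rank $1$ at every point $p\in M$, and such that lastly the Freeman form of $M$ is nondegenerate at every point $p\in M$. Then $M$ may always be represented near the origin, in suitable local holomorphic coordinates $(z_1,z_2,w)\in\mathbb{C}^3$ (centered at the origin) with $w=u+\sqrt{-1}\,v$, by a real analytic equation of the form $$v=z_1\overline{z}_1+\tfrac12\,z_1z_1\overline{z}_2+\tfrac12\,z_2\overline{z}_1\overline{z}_1+\mathrm{O}_4(z_1,z_2,\overline{z}_1,\overline{z}_2)+u\,\mathrm{O}_2(z_1,z_2,\overline{z}_1,\overline{z}_2,u),$$ where both remainders, i.e. $R=\mathrm{O}_4(z_1,z_2,\overline{z}_1,\overline{z}_2)$ and $R=u\,\mathrm{O}_2(z_1,z_2,\overline{z}_1,\overline{z}_2,u)$, satisfy $$0\equiv R(0,0,\overline{z}_1,\overline{z}_2,u)\equiv R(z_1,z_2,0,0,u).$$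
   Context: $T^{1,0}M$ denotes the bundle $T^{1,0}\mathbb{C}^3|_M\cap(\mathbb{C}\otimes_{\mathbb{R}}TM)$, here of complex rank $2$, and $T^{0,1}M=\overline{T^{1,0}M}$; bars denote conjugation and $[\cdot,\cdot]$ the Lie bracket. ''Frame'' means a basis of the fiber at every point of the (local) manifold $M$. Levi form: let $\rho_0$ be a nowhere zero real $1$-form on $M$ whose kernel in $\mathbb{C}\otimes_{\mathbb{R}}TM$ is $T^{1,0}M\oplus T^{0,1}M$. The Levi form at $p$ is the Hermitian form on $T^{1,0}_pM$ given, for local sections $\mathcal{L},\mathcal{L}'$ of $T^{1,0}M$, by $(\mathcal{L}|_p,\mathcal{L}'|_p)\mapsto\rho_0\big(\sqrt{-1}\,[\mathcal{L},\overline{\mathcal{L}'}]\big)(p)$; its rank does not depend on the choice of $\rho_0$. Freeman form: when the Levi form has constant rank $1$, its kernel is a complex line subbundle $K^{1,0}M\subset T^{1,0}M$. For a local section $\mathcal{K}$ of $K^{1,0}M$ and a local section $\mathcal{L}$ of $T^{1,0}M$, the bracket $[\mathcal{K},\overline{\mathcal{L}}]$ is a section of $T^{1,0}M\oplus T^{0,1}M$, and its class modulo $K^{1,0}M\oplus T^{0,1}M$ depends at $p$ only on $\mathcal{K}|_p$ and on $\mathcal{L}|_p$ modulo $K^{1,0}_pM$; this is the Freeman form at $p$. It is nondegenerate at $p$ if $[\mathcal{K},\overline{\mathcal{L}}]|_p\notin K^{1,0}_pM\oplus T^{0,1}_pM$ whenever $\mathcal{K}|_p\neq0$ and $\mathcal{L}|_p\notin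 K^{1,0}_pM$. Equivalently, if $M$ is graphed as $v=\varphi(z_1,z_2,\overline{z}_1,\overline{z}_2,u)$, with $\mathcal{L}_j=\frac{\partial}{\partial z_j}+A_j\frac{\partial}{\partial u}$, $A_j=-\frac{\varphi_{z_j}}{\sqrt{-1}+\varphi_u}$, and $[\mathcal{L}_1,\overline{\mathcal{L}}_1]$ nowhere zero, then with $k=\frac{-\mathcal{L}_2(\overline{A}_1)+\overline{\mathcal{L}}_1(A_2)}{\mathcal{L}_1(\overline{A}_1)-\overline{\mathcal{L}}_1(A_1)}$ the field $k\mathcal{L}_1+\mathcal{L}_2$ generates $K^{1,0}M$ and nondegeneracy of the Freeman form means $\overline{\mathcal{L}}_1(k)\neq0$ at every point. Remainder notation: $\mathrm{O}_k(t_1,\dots,t_N)$ denotes an unspecified convergent power series (with complex coefficients) in $t_1,\dots,t_N$ all of whose monomials have total degree $\geqslant k$. The right-hand side of the graphing equation is real-valued. In the identities for $R$, the variables $z_j$ and $\overline{z}_j$ are treated as independent variables of the power series $R$. *)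

(* Defs.v *)
From HB Require Import structures.
From mathcomp Require Import all_boot all_order all_algebra complex.
From mathcomp Require Import all_classical all_reals all_analysis.

Set Implicit Arguments.
Unset Strict Implicit.
Unset Printing Implicit Defensive.

Import Order.TTheory GRing.Theory Num.Theory.
Import numFieldNormedType.Exports.

Local Open Scope classical_set_scope.
Local Open Scope ring_scope.

(* R[i] carries its topology and norm only when it is seen through one of the
   numeric field structures. *)
Definition Cplx (R : realType) : numClosedFieldType := R[i].

Notation C3 R := 'rV[Cplx R]_3.

Definition conjmx (R : realType) m n (A : 'M[Cplx R]_(m, n)) :
  'M[Cplx R]_(m, n) := map_mx (fun x => x^*) A.

Definition power_series (R : realType) n := {ffun 'I_n -> nat} -> Cplx R.

Definition mdegree n (a : {ffun 'I_n -> nat}) : nat := (\sum_i a i)%N.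

(* Sum of the monomials all of whose exponents are < N. *)
Definition ps_partial (R : realType) n (c : power_series R n) (t : 'rV[Cplx R]_n)
    (N : nat) : Cplx R :=
  \sum_(a : {ffun 'I_n -> 'I_N})
    c [ffun i => nat_of_ord (a i)] * \prod_i t 0 i ^+ a i.

Definition ps_eval (R : realType) n (c : power_series R n) (t : 'rV[Cplx R]_n) :
  Cplx R := limn (ps_partial c t).

(* Absolute convergence at some (r, ..., r) with r > 0, hence normal convergence
   on the closed polydisc of radius r. In Cplx R, [0 < r] entails that r is real. *)
Definition ps_convergent (R : realType) n (c : power_series R n) : Prop :=
  exists2 r : Cplx R, 0 < r &
  exists B : Cplx R, forall N, ps_partial (fun a => `|c a|) (const_mx r) N <= B.

(* O_k(t_1, ..., t_n) *)
Definition bigO_order (R : realType) n (k : nat) (c : power_series R n) : Prop :=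
  ps_convergent c /\ forall a, (mdegree a < k)%N -> c a = 0.

(* The coefficients of t_i * c. *)
Definition ps_mulvar (R : realType) n (i : 'I_n) (c : power_series R n) :
  power_series R n :=
  fun a => if a i == 0%N then 0 else c [ffun j => (a j - (j == i))%N].

(* c vanishes identically once the variables t_i, i \in I, are replaced by 0:
   only the monomials without these variables survive the substitution. *)
Definition ps_vanish_at (R : realType) n (I : {pred 'I_n}) (c : power_series R n) :
  Prop := forall a : {ffun 'I_n -> nat}, (forall i, i \in I -> a i = 0%N) -> c a = 0.

Definition real_analytic_at (R : realType) (p : C3 R) (f : C3 R -> Cplx R) :
  Prop :=
  exists2 c : power_series R (3 + 3), ps_convergent c &
    \forall q \near p, f q = ps_eval c (row_mx (q - p) (conjmx (q - p))).

Definition holomorphic_at (R : realType) (p : C3 R) (f : C3 R -> Cplx R) :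
  Prop :=
  exists2 c : power_series R 3, ps_convergent c &
    \forall q \near p, f q = ps_eval c (q - p).

(* Derivative of f at p in the real direction v. *)
Definition dir_deriv (R : realType) (f : C3 R -> Cplx R) (p v : C3 R) :
  Cplx R :=
  Complex (derive1 (fun t : R => complex.Re (f (p + (t%:C)%C *: v))) 0)
          (derive1 (fun t : R => complex.Im (f (p + (t%:C)%C *: v))) 0).

(* d/dz_j = (d/dx_j - i d/dy_j)/2 and d/dzbar_j = (d/dx_j + i d/dy_j)/2 *)
Definition d_z (R : realType) (j : 'I_3) (f : C3 R -> Cplx R) (p : C3 R) :
  Cplx R :=
  (dir_deriv f p (delta_mx 0 j) - 'i * dir_deriv f p ('i *: delta_mx 0 j)) / 2.

Definition d_zbar (R : realType) (j : 'I_3) (f : C3 R -> Cplx R) (p : C3 R) :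
  Cplx R :=
  (dir_deriv f p (delta_mx 0 j) + 'i * dir_deriv f p ('i *: delta_mx 0 j)) / 2.

Definition gradient (R : realType) (f : C3 R -> Cplx R) (p : C3 R) :
  'cV[Cplx R]_(3 + 3) :=
  col_mx (\col_j d_z j f p) (\col_j d_zbar j f p).

(* The row (a, b) stands for
   \sum_j a_j d/dz_j + \sum_j b_j d/dzbar_j. *)
Definition tvec (R : realType) := 'rV[Cplx R]_(3 + 3).

Definition tconj (R : realType) (v : tvec R) : tvec R :=
  row_mx (conjmx (rsubmx v)) (conjmx (lsubmx v)).

Definition vfield (R : realType) := C3 R -> tvec R.

Definition vconj (R : realType) (X : vfield R) : vfield R :=
  fun p => tconj (X p).

Definition vderiv (R : realType) (X : vfield R) (f : C3 R -> Cplx R)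
    (p : C3 R) : Cplx R := (X p *m gradient f p) 0 0.

(* Computed in the ambient space; at the points of a hypersurface to which X and
   Y are tangent, it depends only on the restrictions of X and Y to it. *)
Definition lie_bracket (R : realType) (X Y : vfield R) : vfield R :=
  fun p => \row_k (vderiv X (fun q => Y q 0 k) p - vderiv Y (fun q => X q 0 k) p).

Definition to_C (R : realType) (rho : C3 R -> R) : C3 R -> Cplx R :=
  fun p => ((rho p)%:C)%C.

(* M is the zero locus, in the open set U, of the real analytic function rho,
   with d rho nowhere zero on M. *)
Definition hypersurface (R : realType) (U : set (C3 R)) (rho : C3 R -> R)
    (M : set (C3 R)) : Prop :=
  [/\ open U,
      forall p, U p -> real_analytic_at p (to_C rho),
      M = U `&` [set p | rho p = 0] &
      forall p, M p -> gradient (to_C rho) p != 0].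

(* Fibers at p of the complexified tangent bundle of M, and of T^{1,0}M and
   T^{0,1}M. *)
Definition CTM (R : realType) (rho : C3 R -> R) (p : C3 R) : {vspace tvec R} :=
  lker (linfun (mulmxr (gradient (to_C rho) p) : tvec R -> 'M[Cplx R]_1)).

Definition T10 (R : realType) (rho : C3 R -> R) (p : C3 R) : {vspace tvec R} :=
  (CTM rho p :&: lker (linfun (@rsubmx (Cplx R) 1 3 3)))%VS.

Definition T01 (R : realType) (rho : C3 R -> R) (p : C3 R) : {vspace tvec R} :=
  (CTM rho p :&: lker (linfun (@lsubmx (Cplx R) 1 3 3)))%VS.

(* X restricts, on a neighborhood of p in M, to a section of T^{1,0}M. Off M,
   X is only an analytic extension of this section. *)
Definition section10 (R : realType) (rho : C3 R -> R) (M : set (C3 R))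
    (p : C3 R) (X : vfield R) : Prop :=
  (forall k, real_analytic_at p (fun q => X q 0 k)) /\
  (\forall q \near p, M q -> X q \in T10 rho q).

Definition cotvec (R : realType) := 'Hom(tvec R, (Cplx R)^o).

(* theta is a nowhere zero real 1-form on M with kernel T^{1,0}M + T^{0,1}M;
   only the restriction of theta p to the tangent space of M at p matters. *)
Definition contact_form (R : realType) (rho : C3 R -> R) (M : set (C3 R))
    (theta : C3 R -> cotvec R) : Prop :=
  forall p, M p ->
  [/\ forall v, v \in CTM rho p -> theta p (tconj v) = (theta p v)^*,
      ~~ (CTM rho p <= lker (theta p))%VS &
      (CTM rho p :&: lker (theta p) = T10 rho p + T01 rho p)%VS].

Definition levi (R : realType) (theta : C3 R -> cotvec R) (X Y : vfield R)
    (p : C3 R) : Cplx R :=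
  theta p ('i *: lie_bracket X (vconj Y) p).

(* Matrix of the Levi form in the frame L of T^{1,0}M. *)
Definition levi_mx (R : realType) (theta : C3 R -> cotvec R)
    (L : 'I_2 -> vfield R) (p : C3 R) : 'M[Cplx R]_2 :=
  \matrix_(j, k) levi theta (L j) (L k) p.

(* v \in K^{1,0}_p M; the sections X extend v, as the Levi form is defined on
   sections. *)
Definition levi_kernel (R : realType) (rho : C3 R -> R) (M : set (C3 R))
    (theta : C3 R -> cotvec R) (p : C3 R) (v : tvec R) : Prop :=
  v \in T10 rho p /\
  forall X Y, section10 rho M p X -> section10 rho M p Y -> X p = v ->
    levi theta X Y p = 0.

Definition sectionK (R : realType) (rho : C3 R -> R) (M : set (C3 R))
    (theta : C3 R -> cotvec R) (p : C3 R) (X : vfield R) : Prop :=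
  section10 rho M p X /\
  (\forall q \near p, M q -> levi_kernel rho M theta q (X q)).

Definition freeman_nondegenerate (R : realType) (rho : C3 R -> R)
    (M : set (C3 R)) (theta : C3 R -> cotvec R) (p : C3 R) : Prop :=
  forall K L, sectionK rho M theta p K -> section10 rho M p L ->
    K p != 0 -> ~ levi_kernel rho M theta p (L p) ->
    ~ exists a b, [/\ levi_kernel rho M theta p a, b \in T01 rho p &
                      lie_bracket K (vconj L) p = a + b].

Definition class_IV2 (R : realType) (rho : C3 R -> R) (M : set (C3 R))
    (theta : C3 R -> cotvec R) : Prop :=
  exists L : 'I_2 -> vfield R, forall p, M p ->
  [/\ (forall j, section10 rho M p (L j)) /\
      basis_of (T10 rho p) [:: L 0 p; L 1 p],
      basis_of (CTM rho p)
        [:: L 0 p; L 1 p; vconj (L 0) p; vconj (L 1) p;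
            lie_bracket (L 0) (vconj (L 0)) p],
      \rank (levi_mx theta L p) = 1%N &
      freeman_nondegenerate rho M theta p].

Definition holomorphic_coordinates (R : realType) (Z : C3 R -> C3 R) : Prop :=
  [/\ Z 0 = 0,
      forall j, holomorphic_at 0 (fun p => Z p 0 j) &
      \matrix_(j, k) d_z k (fun p => Z p 0 j) 0 \in unitmx].

(* Splitting of (z_1, z_2, w) into z = (z_1, z_2) and w. *)
Definition z_part (R : realType) (x : C3 R) : 'rV[Cplx R]_2 :=
  lsubmx (x : 'rV[Cplx R]_(2 + 1)).

Definition w_part (R : realType) (x : C3 R) : Cplx R := x 0 ord_max.

(* The variables of R1 are (z_1, z_2, zbar_1, zbar_2), those of R2 are
   (z_1, z_2, zbar_1, zbar_2, u), in this order. *)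
Definition normal_rhs (R : realType) (R1 : power_series R (2 + 2))
    (R2 : power_series R (2 + 2 + 1)) (z : 'rV[Cplx R]_2) (u : Cplx R) : Cplx R :=
  let z1 := z 0 0 in let z2 := z 0 1 in
  z1 * z1^* + 2^-1 * (z1 * z1 * z2^*) + 2^-1 * (z2 * z1^* * z1^*)
  + ps_eval R1 (row_mx z (conjmx z))
  + ps_eval R2 (row_mx (row_mx z (conjmx z)) (const_mx u)).

(* R(0, 0, zbar_1, zbar_2, u) = 0 = R(z_1, z_2, 0, 0, u) as power series. *)
Definition remainder_normalized (R : realType) n (c : power_series R n) : Prop :=
  ps_vanish_at [pred i : 'I_n | (i < 2)%N] c /\
  ps_vanish_at [pred i : 'I_n | (2 <= i < 4)%N] c.

(* Main.v *)
Require Import Defs.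
From HB Require Import structures.
From mathcomp Require Import all_boot all_order all_algebra complex.
From mathcomp Require Import all_classical all_reals all_analysis.
From mathcomp Require Import ring lra.
From mathcomp Require Import -(notations) mpoly.

Set Implicit Arguments.
Unset Strict Implicit.
Unset Printing Implicit Defensive.

Import Order.TTheory GRing.Theory Num.Theory.
Import numFieldNormedType.Exports.
(* conjmx stands for entrywise conjugation, not for the conjugation of a matrix by another *)
Import Defs.

Local Open Scope classical_set_scope.
Local Open Scope ring_scope.

(** Why the normal form exists.

    Write the defining function near the origin as rho (q) = P (q, conj q), where
    P (x, y) is holomorphic in six variables and hermitian. All the geometry takes
    place on this complexification.

    The Levi form is the matrix of the derivatives of P in x_j and y_k, restricted to
    the tangent space (levi_formula). As its rank is 1 at every point of M, the analytic
    field K obtained from the adjugate of the Levi matrix spans its kernel, and the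
    contraction of the matrix with K is proportional, all along M, to the (0,1) part of
    d rho. Differentiating this proportionality along M computes the third derivatives
    of rho in the directions k, a, b, with k the value of K at the origin and a, b of
    type (0,1): up to a multiple of the second derivatives in y, they are the values of
    the Levi form on the derivatives of K, that is on the Freeman form. They vanish if a
    or b is conj k, and nondegeneracy means that they do not vanish for a = b = conj l
    when l is not in the kernel (freeman_jet). The basis l, k, e with e transversal,
    suitably scaled, gives the linear coordinates of adapted_germ.

    A real analytic curve in M, transversal to the complex tangent space, is then turned
    into the u-axis, and the Segre varieties of its points into the levels w = u
    (straight_curve, segre_function). In these coordinates M is a graph
    v = phi (z, conj z, u) with phi (z, 0, u) = 0 = phi (0, zeta, u)
    (graphing_function). The part of phi linear in z_j at u = 0 is, up to higher order,
    the derivative of P in x_j along the Segre variety of the origin; since P vanishes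
    there, multiples of P may be added to it, and the 3-jet above gives
    zeta_1 + O(2) for j = 1 and zeta_1^2 / 2 + O(3) for j = 2 (phi1_jet, phi2_jet). The
    conjugate of the first of these germs is taken as a new coordinate z_1, after which
    the first part is zeta_1 exactly (straightened_graph).

    In the absence of pure monomials, a monomial of degree at most 3 in z and zeta has
    degree 1 in z or in zeta. All these coefficients are now known at u = 0, which leaves
    a remainder O(4); the terms with a factor u have no pure monomials either, so that
    the cofactor of u is O(2) (normal_form).

    The analytic tools, closure of convergent power series under composition, Taylor
    expansions and the implicit function theorem, rest on one principle: a sequence of
    polynomials, bounded for a weighted l^1 norm and with eventually constant
    coefficients, converges to a power series at a geometric rate (polylim_stable). *)


(** * Moduli of complex numbers *)

Section Modulus.
Variable R : realType.
Local Notation C := (Cplx R).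
Implicit Types z w : C.

(** The modulus as a real number: the order of the complex field is partial, so that
    estimates are carried out in R. *)
Definition nm (z : Cplx R) : R := complex.Re `|z|.

Lemma nmE z : `|z| = ((nm z)%:C)%C.
Proof. by rewrite /nm RRe_real ?normr_real. Qed.

Lemma nm_ge0 z : 0 <= nm z.
Proof. by rewrite -lecR -nmE normr_ge0. Qed.

Lemma nmD z w : nm (z + w) <= nm z + nm w.
Proof. by rewrite -lecR rmorphD /= -!nmE ler_normD. Qed.

Lemma nmN z : nm (- z) = nm z.
Proof. by rewrite /nm normrN. Qed.

Lemma nmB z w : nm (z - w) <= nm z + nm w.
Proof. by rewrite -(nmN w) nmD. Qed.

Lemma nmC z w : nm (z - w) = nm (w - z).
Proof. by rewrite -nmN opprB. Qed.

Lemma nmM z w : nm (z * w) = nm z * nm w.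
Proof. by apply: (@complexI R); rewrite rmorphM /= -!nmE normrM. Qed.

Lemma nm0 : nm 0 = 0.
Proof. by rewrite /nm normr0. Qed.

Lemma nm1 : nm 1 = 1.
Proof. by rewrite /nm normr1. Qed.

Lemma nm_eq0 z : (nm z == 0) = (z == 0).
Proof. by rewrite -[z == 0]normr_eq0 nmE -(inj_eq (@complexI R)). Qed.

Lemma nm_gt0 z : (0 < nm z) = (z != 0).
Proof. by rewrite lt_def nm_eq0 nm_ge0 andbT. Qed.

Lemma nm_le0 z : nm z <= 0 -> z = 0.
Proof. by move=> h; apply/eqP; rewrite -nm_eq0 eq_le h nm_ge0. Qed.

Lemma nmX z k : nm (z ^+ k) = nm z ^+ k.
Proof. by elim: k => [|k IH]; rewrite ?expr0 ?nm1 // !exprS nmM IH. Qed.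

Lemma nmV z : nm z^-1 = (nm z)^-1.
Proof.
have [->|z0] := eqVneq z 0; first by rewrite !(invr0, nm0).
apply: (mulfI (x := nm z)); first by rewrite nm_eq0.
by rewrite -nmM !mulfV ?nm1 // nm_eq0.
Qed.

Lemma nm_sum I (s : seq I) (P : pred I) (F : I -> C) :
  nm (\sum_(i <- s | P i) F i) <= \sum_(i <- s | P i) nm (F i).
Proof.
elim/big_rec2: _ => [|i a b _ h]; first by rewrite nm0.
by apply: le_trans (nmD _ _) _; rewrite lerD2l.
Qed.

Lemma nm_prod I (s : seq I) (P : pred I) (F : I -> C) :
  nm (\prod_(i <- s | P i) F i) = \prod_(i <- s | P i) nm (F i).
Proof. by elim/big_rec2: _ => [|i a b _ <-]; rewrite ?nm1 ?nmM. Qed.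

Lemma nmR (x : R) : nm (x%:C)%C = `|x|.
Proof. by rewrite /nm normc_def /= expr0n /= addr0 sqrtr_sqr. Qed.

Lemma nmJ z : nm z^* = nm z.
Proof. by rewrite /nm norm_conjC. Qed.

Lemma nmn k : nm k%:R = k%:R.
Proof. by rewrite /nm normr_nat -(rmorph_nat (real_complex R)). Qed.

Lemma nmi : nm 'i = 1.
Proof. by rewrite /nm normCi. Qed.

Lemma Re_le_nm z : `|complex.Re z| <= nm z.
Proof. by rewrite -lecR -nmE normc_ge_Re. Qed.

Lemma Im_le_nm z : `|complex.Im z| <= nm z.
Proof.
have -> : complex.Im z = - complex.Re (z * 'i%C) by rewrite ReiNIm opprK.
by rewrite normrN (le_trans (Re_le_nm _)) // nmM complexiE nmi mulr1.
Qed.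

Lemma nm_ReIm z : nm z <= `|complex.Re z| + `|complex.Im z|.
Proof.
rewrite {1}[z]complexE (le_trans (nmD _ _)) // nmM !nmR complexiE nmi mul1r //.
Qed.

End Modulus.

(** * Polynomials on a polydisc *)

Section PolyNorm.
Variables (R : realType) (n : nat).
Local Notation C := (Cplx R).
Local Notation MP := (mpoly n C).
Implicit Types (p q : MP) (m : multinom n) (r : R) (t : 'rV[C]_n).

Definition small (r : R) (t : 'rV[C]_n) := forall i, nm (t 0 i) <= r.

Definition ev p t : C := meval (t 0) p.

(** Weighted l^1 norm of the coefficients: it is submultiplicative and bounds the
    polynomial on the polydisc of radius r. *)
Definition nrm r p : R := \sum_(m <- msupp p) nm (mcoeff m p) * r ^+ mdeg m.

Lemma nrmE r p (s : seq (multinom n)) : uniq s -> {subset msupp p <= s} ->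
  nrm r p = \sum_(m <- s) nm (mcoeff m p) * r ^+ mdeg m.
Proof.
move=> us sub; rewrite [RHS](bigID (mem (msupp p))) /= [X in _ + X]big1 ?addr0.
  rewrite -big_filter; apply: perm_big; apply: uniq_perm.
  - exact: msupp_uniq.
  - exact: filter_uniq.
  move=> m; rewrite mem_filter /= andb_idr //; exact: sub.
by move=> m hm; rewrite (memN_msupp_eq0 hm) nm0 mul0r.
Qed.

Lemma nrm_ge0 r p : 0 <= r -> 0 <= nrm r p.
Proof.
by move=> r0; apply: sumr_ge0 => m _; rewrite mulr_ge0 ?nm_ge0 ?exprn_ge0.
Qed.

Lemma nrm0 r : nrm r 0 = 0.
Proof. by rewrite /nrm msupp0 big_nil. Qed.

Lemma nrmD r p q : 0 <= r -> nrm r (p + q) <= nrm r p + nrm r q.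
Proof.
move=> r0; set s := undup (msupp p ++ msupp q).
have us : uniq s by exact: undup_uniq.
rewrite !(@nrmE _ _ s) //; last 3 first.
- by move=> m hm; rewrite mem_undup mem_cat hm orbT.
- by move=> m hm; rewrite mem_undup mem_cat hm.
- by move=> m hm; rewrite mem_undup; exact: msuppD_le hm.
rewrite -big_split /=; apply: ler_sum => m _.
by rewrite mcoeffD -mulrDl ler_wpM2r ?exprn_ge0 ?nmD.
Qed.

Lemma nrmN r p : nrm r (- p) = nrm r p.
Proof.
rewrite /nrm (perm_big _ (msuppN p)) /=.
by apply: eq_bigr => m _; rewrite mcoeffN nmN.
Qed.

Lemma nrm_sum r I (s : seq I) (P : pred I) (F : I -> MP) : 0 <= r ->
  nrm r (\sum_(i <- s | P i) F i) <= \sum_(i <- s | P i) nrm r (F i).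
Proof.
move=> r0; elim/big_rec2: _ => [|i a b _ h]; first by rewrite nrm0.
by apply: le_trans (nrmD _ _ _) _ => //; rewrite lerD2l.
Qed.

Lemma nrmCX r c m : nrm r (c *: mpolyX C m) = nm c * r ^+ mdeg m.
Proof.
rewrite (@nrmE r _ [:: m]) // ?big_seq1 ?mcoeffZ ?mcoeffX ?eqxx ?mulr1 //.
by move=> x /msuppZ_le; rewrite msuppX.
Qed.

Lemma nrmX r m : nrm r (mpolyX C m) = r ^+ mdeg m.
Proof. by rewrite -[mpolyX C m]scale1r nrmCX nm1 mul1r. Qed.

Lemma nrmC r c : nrm r (mpolyC n c) = nm c.
Proof. by rewrite -[mpolyC n c]mulr1 mul_mpolyC -mpolyX0 nrmCX mdeg0 mulr1. Qed.

Lemma nrmZ r c p : 0 <= r -> nrm r (c *: p) <= nm c * nrm r p.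
Proof.
move=> r0; rewrite (@nrmE r _ (msupp p)) ?msupp_uniq //; last exact: msuppZ_le.
rewrite /nrm mulr_sumr; apply: ler_sum => m _.
by rewrite mcoeffZ nmM mulrA.
Qed.

Lemma nrmM r p q : 0 <= r -> nrm r (p * q) <= nrm r p * nrm r q.
Proof.
move=> r0; rewrite mpolyME (le_trans (nrm_sum _ _ _ _)) //.
rewrite big_allpairs /= mulr_suml; apply: ler_sum => m _.
rewrite mulr_sumr; apply: ler_sum => m' _.
by rewrite nrmCX nmM mdegD exprD mulrACA.
Qed.

Lemma nrm_exp r p k : 0 <= r -> nrm r (p ^+ k) <= nrm r p ^+ k.
Proof.
move=> r0; elim: k => [|k IH]; first by rewrite !expr0 -mpolyC1 nrmC nm1.
rewrite !exprS (le_trans (nrmM _ _ _)) // ler_wpM2l ?nrm_ge0 //.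
Qed.

Lemma nrm_prod r I (s : seq I) (P : pred I) (F : I -> MP) : 0 <= r ->
  nrm r (\prod_(i <- s | P i) F i) <= \prod_(i <- s | P i) nrm r (F i).
Proof.
move=> r0; elim/big_rec2: _ => [|i a b _ h]; first by rewrite -mpolyC1 nrmC nm1.
apply: le_trans (nrmM _ _ r0) _; by rewrite ler_wpM2l ?nrm_ge0.
Qed.

Lemma nrm_le r r' p : 0 <= r -> r <= r' -> nrm r p <= nrm r' p.
Proof.
move=> r0 rr; apply: ler_sum => m _.
rewrite ler_wpM2l ?nm_ge0 // lerXn2r // nnegrE //; exact: le_trans rr.
Qed.

Lemma ev_le r p t : 0 <= r -> small r t -> nm (ev p t) <= nrm r p.
Proof.
move=> r0 st; rewrite /ev mevalE (le_trans (nm_sum _ _ _)) //.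
apply: ler_sum => m _; rewrite nmM ler_wpM2l ?nm_ge0 // nm_prod mdegE.
rewrite -prodrXr; apply: ler_prod => i _.
by rewrite nm_ge0 nmX lerXn2r ?nnegrE ?nm_ge0 ?st.
Qed.

(** All monomials have total degree at least k. *)
Definition ord k p := forall m, (mdeg m < k)%N -> mcoeff m p = 0.

(** A monomial of degree d is multiplied by e^d when the radius is multiplied by e. *)
Lemma ord_nrm k r (e : R) p : 0 <= r -> 0 <= e <= 1 -> ord k p ->
  nrm (e * r) p <= e ^+ k * nrm r p.
Proof.
move=> r0 /andP[e0 e1] op; rewrite /nrm mulr_sumr; apply: ler_sum => m _.
have [mk|km] := ltnP (mdeg m) k; first by rewrite op // nm0 !mul0r mulr0.
rewrite exprMn mulrCA ler_wpM2r ?mulr_ge0 ?nm_ge0 ?exprn_ge0 //.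
by rewrite ler_wiXn2l.
Qed.

Lemma ordD k p q : ord k p -> ord k q -> ord k (p + q).
Proof. by move=> hp hq m mk; rewrite mcoeffD hp // hq // addr0. Qed.

Lemma ord_zero k : ord k 0.
Proof. by move=> m _; rewrite mcoeff0. Qed.

Lemma ordZ k c p : ord k p -> ord k (c *: p).
Proof. by move=> hp m mk; rewrite mcoeffZ hp // mulr0. Qed.

Lemma ord_sum k I (s : seq I) (P : pred I) (F : I -> MP) :
  (forall i, P i -> ord k (F i)) -> ord k (\sum_(i <- s | P i) F i).
Proof. by move=> h; apply: big_ind => //; [exact: ord_zero | exact: ordD]. Qed.

Lemma ordW j k p : (j <= k)%N -> ord k p -> ord j p.
Proof. by move=> jk hp m mj; apply: hp; exact: leq_trans mj jk. Qed.

Lemma ordM j k p q : ord j p -> ord k q -> ord (j + k) (p * q).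
Proof.
move=> hp hq m mjk; rewrite mcoeffM big1 // => -[a b] /= /eqP hm.
have [aj|ja] := ltnP (mdeg a) j; first by rewrite hp // mul0r.
have hd := congr1 mdeg hm; rewrite mdegD in hd.
rewrite hq ?mulr0 // -(ltn_add2l j); apply: leq_ltn_trans mjk.
by apply: leq_trans (eq_leq (esym hd)); rewrite leq_add2r.
Qed.

Lemma ord0p p : ord 0 p. Proof. by []. Qed.

Lemma ordX k p : ord 1 p -> ord k (p ^+ k).
Proof.
by move=> hp; elim: k => [|k IH]; [exact: ord0p | rewrite exprS; exact: (@ordM 1 k)].
Qed.

Lemma ordMr k p q : ord k p -> ord k (p * q).
Proof. by move=> h; rewrite -[k]addn0; apply: ordM => //; exact: ord0p. Qed.

Lemma ordMl k p q : ord k q -> ord k (p * q).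
Proof. by rewrite mulrC; exact: ordMr. Qed.

Lemma ord_mono m : ord (mdeg m) (mpolyX C m).
Proof. by move=> m'; rewrite mcoeffX; case: eqP => // ->; rewrite ltnn. Qed.

End PolyNorm.

Section Truncation.
Variables (R : realType) (n : nat).
Local Notation C := (Cplx R).
Local Notation MP := (mpoly n C).
Implicit Types (p q : MP) (m : multinom n) (r : R) (t : 'rV[C]_n).
Implicit Types c : power_series R n.

(** The coefficients of a power series are indexed by finite functions, those of a
    polynomial by multinomials; this map and the next one translate exponents. *)
Definition ff m : {ffun 'I_n -> nat} := [ffun i => m i].
Definition mkm (E : 'I_n -> nat) : multinom n := Multinom [tuple E i | i < n].

Lemma mkmE E i : mkm E i = E i.
Proof. exact: mnmE. Qed.

Lemma ff_mkm E : ff (mkm E) = [ffun i => E i].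
Proof. by apply/ffunP=> i; rewrite !ffunE mkmE. Qed.

Lemma mkm_ff m : mkm (ff m) = m.
Proof. by apply/mnmP=> i; rewrite mkmE ffunE. Qed.

Lemma ff_mkmK (a : {ffun 'I_n -> nat}) : ff (mkm a) = a.
Proof. by apply/ffunP=> i; rewrite ffunE mkmE. Qed.

Lemma mdeg_mkm (a : {ffun 'I_n -> nat}) : mdeg (mkm a) = mdegree a.
Proof. by rewrite mdegE; apply: eq_bigr => i _; rewrite mkmE. Qed.

(** The exponents are bounded one by one, as in the partial sums that define the value
    of a power series. *)
Definition trunc k c : MP :=
  \sum_(a : {ffun 'I_n -> 'I_k}) c [ffun i => nat_of_ord (a i)] *: mpolyX C (mkm (fun i => nat_of_ord (a i))).

Lemma coef_trunc k c m :
  mcoeff m (trunc k c) = if [forall i, (m i < k)%N] then c (ff m) else 0.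
Proof.
rewrite /trunc raddf_sum /=; case: forallP => [h|h].
  pose a0 : {ffun 'I_n -> 'I_k} := [ffun i => Ordinal (h i)].
  have ma0 : mkm (fun i => nat_of_ord (a0 i)) = m by apply/mnmP => i; rewrite mkmE ffunE.
  rewrite (bigD1 a0) //= big1 ?addr0 => [|a ne].
    rewrite mcoeffZ mcoeffX ma0 eqxx mulr1; congr c.
    by apply/ffunP => i; rewrite !ffunE.
  rewrite mcoeffZ mcoeffX; case: eqP => [e|]; last by rewrite mulr0.
  case/negP: ne; apply/eqP/ffunP => i; apply: val_inj.
  by rewrite /= ffunE /= -e mkmE.
rewrite big1 // => a _; rewrite mcoeffZ mcoeffX; case: eqP => [e|]; last by rewrite mulr0.
by case: h => i; rewrite -e mkmE.
Qed.

Lemma coef_trunc_lt k c m : (mdeg m < k)%N -> mcoeff m (trunc k c) = c (ff m).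
Proof.
move=> h; rewrite coef_trunc; case: forallP => // -[] i.
apply: leq_ltn_trans h; rewrite mdegE (bigD1 i) //=; exact: leq_addr.
Qed.

Lemma ev_trunc k c t : ev (trunc k c) t = ps_partial c t k.
Proof.
rewrite /ev /trunc raddf_sum /=; apply: eq_bigr => a _.
rewrite mevalZ mevalX; congr (_ * _); apply: eq_bigr => i _; by rewrite mkmE.
Qed.

Lemma nrm_trunc k c r :
  nrm r (trunc k c) = \sum_(a : {ffun 'I_n -> 'I_k})
     nm (c [ffun i => nat_of_ord (a i)]) * \prod_i r ^+ a i.
Proof.
rewrite (@nrmE _ _ r _ [seq mkm (fun i => nat_of_ord (a i)) | a : {ffun 'I_n -> 'I_k}]).
- rewrite big_map big_enum /=; apply: eq_bigr => a _; rewrite coef_trunc.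
  case: forallP => [_|[] i]; last by rewrite mkmE.
  rewrite ff_mkm mdegE prodrXr; congr (_ * _ ^+ _).
  by apply: eq_bigr => i _; rewrite mkmE.
- rewrite map_inj_uniq ?enum_uniq // => a b e.
  by apply/ffunP => i; apply: val_inj; rewrite /= -(mkmE (fun i => nat_of_ord (a i))) e mkmE.
move=> m; rewrite mcoeff_msupp coef_trunc; case: forallP => [h _|]; last by rewrite eqxx.
apply/mapP; exists [ffun i => Ordinal (h i)]; first by rewrite mem_enum.
by apply/mnmP => i; rewrite mkmE ffunE.
Qed.

(** Absolute convergence on the polydisc of radius r, in terms of truncations. *)
Definition bnd c r (B : R) := forall k, nrm r (trunc k c) <= B.

Lemma bnd_ge0 c r B : 0 <= r -> bnd c r B -> 0 <= B.
Proof. by move=> r0 /(_ 0%N); apply: le_trans; exact: nrm_ge0. Qed.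

Lemma ps_convergentP c : ps_convergent c <-> exists r B, 0 < r /\ bnd c r B.
Proof.
have key (r : R) k : ps_partial (fun a => `|c a|) (const_mx ((r%:C)%C : C)) k
    = ((nrm r (trunc k c))%:C)%C.
  rewrite nrm_trunc rmorph_sum /=; apply: eq_bigr => a _.
  rewrite rmorphM rmorph_prod /= -nmE; congr (_ * _); apply: eq_bigr => i _.
  by rewrite mxE rmorphXn.
split=> [[r r0 [B hB]]|[r [B [r0 hB]]]].
  have rr : r = ((complex.Re r)%:C)%C by rewrite RRe_real // ger0_real // ltW.
  exists (complex.Re r), (complex.Re B); split; first by rewrite -ltcR -rr.
  by move=> k; move: (hB k); rewrite rr key lecE => /andP[].
exists ((r%:C)%C : C); first by rewrite ltcR.
by exists ((B%:C)%C : C) => k; rewrite key lecR.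
Qed.

End Truncation.

(** * Power series as limits of their truncations *)

Section GeometricLimits.
Variable R : realType.
Local Notation C := (Cplx R).

Lemma geom_small (A e : R) : 0 < e ->
  exists N, forall M, (N <= M)%N -> A / 2 ^+ M <= e.
Proof.
move=> e0; have A0 : 0 <= `|A| / e by rewrite divr_ge0 // ltW.
exists (Num.bound (`|A| / e)) => M hM.
have h1 : `|A| / e <= 2 ^+ M.
  apply: le_trans (ltW (archi_boundP A0)) _; apply: (@le_trans _ _ M%:R).
    by rewrite ler_nat.
  by rewrite -natrX ler_nat ltnW // ltn_expl.
rewrite ler_pdivrMr ?exprn_gt0 //; apply: le_trans (ler_norm A) _.
by rewrite mulrC -ler_pdivrMr.
Qed.

Lemma le_geom (a b A : R) : (forall N, a <= b + A / 2 ^+ N) -> a <= b.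
Proof.
move=> h; rewrite leNgt; apply/negP => ba.
have [|N hN] := @geom_small A ((a - b) / 2); first by rewrite divr_gt0 ?subr_gt0.
have := h N; have := hN _ (leqnn N); lra.
Qed.

Lemma nm_geom0 (z : C) A : (forall N, nm z <= A / 2 ^+ N) -> z = 0.
Proof.
by move=> h; apply: nm_le0; apply: (@le_geom _ _ A) => N; rewrite add0r.
Qed.

Lemma real_lim_geom (x : nat -> R) A :
    (forall N M, (N <= M)%N -> `|x N - x M| <= A / 2 ^+ N) ->
  exists l, forall N, `|x N - l| <= A / 2 ^+ N.
Proof.
move=> h; pose S := [set x M - A / 2 ^+ M | M in setT].
have ub N M : x M - A / 2 ^+ M <= x N + A / 2 ^+ N.
  have A0 : 0 <= A.
    by have := h 0%N 0%N isT; rewrite subrr normr0 expr0 divr1.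
  have pos k : 0 <= A / 2 ^+ k by rewrite divr_ge0 ?exprn_ge0.
  have [NM|/ltnW MN] := leqP N M.
    by have := h _ _ NM; have := pos M; rewrite ler_norml => ? /andP[]; lra.
  by have := h _ _ MN; have := pos N; rewrite ler_norml => ? /andP[]; lra.
exists (sup S) => N; rewrite ler_norml.
have h1 : x N - A / 2 ^+ N <= sup S.
  apply: ub_le_sup; last by exists N.
  by exists (x 0%N + A / 2 ^+ 0) => _ [M _ <-].
have h2 : sup S <= x N + A / 2 ^+ N.
  by apply: ge_sup; [exists (x 0%N - A / 2 ^+ 0); exists 0%N | move=> _ [M _ <-]].
by apply/andP; split; lra.
Qed.

(** Limits are always recognized by a geometric rate of convergence, which is what the
    truncations of a power series provide inside the polydisc. *)
Lemma lim_geom_near (z : nat -> C) l A N0 :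
  (forall N, (N0 <= N)%N -> nm (z N - l) <= A / 2 ^+ N) -> limn z = l.
Proof.
move=> h; apply: cvg_lim; first exact: norm_hausdorff.
apply/cvgrPdist_le => e e0; have ee : e = ((complex.Re e)%:C)%C.
  by rewrite RRe_real // gtr0_real.
have [|N hN] := @geom_small A (complex.Re e); first by rewrite -ltcR -ee.
exists (maxn N N0) => // M /=; rewrite geq_max => /andP[NM N0M].
rewrite distrC nmE ee lecR.
exact: le_trans (h M N0M) (hN M NM).
Qed.

Lemma lim_geom_eq (z : nat -> C) l A :
  (forall N, nm (z N - l) <= A / 2 ^+ N) -> limn z = l.
Proof. by move=> h; apply: (@lim_geom_near z l A 0) => N _; exact: h. Qed.

Lemma lim_geom (z : nat -> C) A :
    (forall N M, (N <= M)%N -> nm (z N - z M) <= A / 2 ^+ N) ->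
  forall N, nm (z N - limn z) <= (2 * A) / 2 ^+ N.
Proof.
move=> h.
have [|x hx] := @real_lim_geom (fun N => complex.Re (z N)) A.
  by move=> N M NM; apply: le_trans (h N M NM); rewrite -raddfB; exact: Re_le_nm.
have [|y hy] := @real_lim_geom (fun N => complex.Im (z N)) A.
  by move=> N M NM; apply: le_trans (h N M NM); rewrite -raddfB; exact: Im_le_nm.
have key N : nm (z N - Complex x y) <= (2 * A) / 2 ^+ N.
  apply: le_trans (nm_ReIm _) _; rewrite !raddfB /=.
  by have := hx N; have := hy N; lra.
by rewrite (lim_geom_eq key).
Qed.

End GeometricLimits.

Section Evaluation.
Variables (R : realType) (n : nat).
Local Notation C := (Cplx R).
Local Notation MP := (mpoly n C).
Implicit Types (p q : MP) (m : multinom n) (r : R) (t : 'rV[C]_n).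
Implicit Types c d : power_series R n.

Lemma nrm_le_coef r p q : 0 <= r ->
  (forall m, nm (mcoeff m p) <= nm (mcoeff m q)) -> nrm r p <= nrm r q.
Proof.
move=> r0 h; have us : uniq (undup (msupp p ++ msupp q)) by exact: undup_uniq.
rewrite (nrmE r us) => [|m hm]; last by rewrite mem_undup mem_cat hm.
rewrite (nrmE r us) => [|m hm]; last by rewrite mem_undup mem_cat hm orbT.
by apply: ler_sum => m _; rewrite ler_wpM2r ?exprn_ge0.
Qed.

Lemma evB p q t : ev (p - q) t = ev p t - ev q t.
Proof. exact: mevalB. Qed.

(** Halving the radius gains a factor 2^-k on the monomials of degree at least k. *)
Lemma ev_ord p r t k : 0 <= r -> small (r / 2) t -> ord k p ->
  nm (ev p t) <= nrm r p / 2 ^+ k.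
Proof.
move=> r0 st op; have r20 : 0 <= r / 2 by rewrite divr_ge0.
apply: le_trans (ev_le p r20 st) _.
by rewrite mulrC (mulrC _ _^-1) -exprVn; apply: ord_nrm => //; apply/andP; lra.
Qed.

Lemma ord_trunc k K c : (k <= K)%N -> ord k (trunc K c - trunc k c).
Proof.
move=> kK m mk; rewrite mcoeffB !coef_trunc_lt ?subrr //; exact: leq_trans kK.
Qed.

Lemma bnd_le c r r' B : 0 <= r -> r <= r' -> bnd c r' B -> bnd c r B.
Proof. by move=> r0 rr h k; apply: le_trans (nrm_le _ r0 rr) (h k). Qed.

Lemma ps_partial_eval c r B t k : 0 <= r -> bnd c r B -> small (r / 2) t ->
  nm (ps_partial c t k - ps_eval c t) <= 4 * B / 2 ^+ k.
Proof.
move=> r0 hB st; have -> : 4 * B = 2 * (2 * B) by lra.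
apply: lim_geom => N M NM; rewrite -!ev_trunc -nmN opprB -evB.
apply: le_trans (ev_ord r0 st (ord_trunc c NM)) _.
rewrite ler_wpM2r ?invr_ge0 ?exprn_ge0 //; apply: le_trans (nrmD _ _ r0) _.
by rewrite nrmN; have := hB N; have := hB M; lra.
Qed.

(** A power series may be replaced by any bounded sequence of polynomials with the right
    low-degree coefficients: sums, products, composites and derivatives of series are
    all obtained from the same operations on truncations. *)
Lemma polylim c (p : nat -> MP) r B : 0 <= r -> (forall k, nrm r (p k) <= B) ->
    (forall k m, (mdeg m < k)%N -> mcoeff m (p k) = c (ff m)) ->
  bnd c r B /\ forall t, small (r / 2) t ->
    forall k, nm (ev (p k) t - ps_eval c t) <= 6 * B / 2 ^+ k.
Proof.
move=> r0 hB hc; have bc : bnd c r B.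
  move=> k; apply: le_trans (hB (n * k).+1); apply: nrm_le_coef => // m.
  rewrite coef_trunc; case: forallP => h; last by rewrite nm0 nm_ge0.
  rewrite hc // ltnS mdegE -[n in (n * k)%N]card_ord -sum_nat_const.
  by apply: leq_sum => i _; exact: ltnW.
split=> // t st k.
have -> : ev (p k) t - ps_eval c t
    = ev (p k - trunc k c) t + (ps_partial c t k - ps_eval c t).
  by rewrite evB ev_trunc; ring.
apply: le_trans (nmD _ _) _.
have o : ord k (p k - trunc k c).
  by move=> m mk; rewrite mcoeffB hc // coef_trunc_lt // subrr.
have h1 := ev_ord r0 st o; have h2 := ps_partial_eval k r0 bc st.
have h3 : nrm r (p k - trunc k c) / 2 ^+ k <= 2 * B / 2 ^+ k.
  rewrite ler_wpM2r ?invr_ge0 ?exprn_ge0 //; apply: le_trans (nrmD _ _ r0) _.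
  by rewrite nrmN; have := hB k; have := bc k; lra.
have -> : 6 * B / 2 ^+ k = 2 * B / 2 ^+ k + 4 * B / 2 ^+ k by lra.
by apply: lerD => //; exact: le_trans h1 h3.
Qed.

(** A bounded sequence of polynomials whose coefficients are eventually constant, degree
    by degree, has a power series as its limit. *)
Lemma polylim_stable (p : nat -> MP) r B : 0 <= r ->
    (forall k, nrm r (p k) <= B) -> (forall k, ord k (p k.+1 - p k)) ->
  exists c, [/\ forall k m, (mdeg m < k)%N -> mcoeff m (p k) = c (ff m),
    bnd c r B & forall t, small (r / 2) t ->
    forall k, nm (ev (p k) t - ps_eval c t) <= 6 * B / 2 ^+ k].
Proof.
move=> r0 hB hs; pose c a := mcoeff (mkm a) (p (mdeg (mkm a)).+1); exists c.
have hc k m : (mdeg m < k)%N -> mcoeff m (p k) = c (ff m).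
  rewrite /c mkm_ff; elim: k => // k IH; rewrite ltnS leq_eqVlt => /orP[/eqP ->//|mk].
  by rewrite -IH //; apply/eqP; rewrite -subr_eq0 -mcoeffB hs.
by have [h1 h2] := polylim (c := c) r0 hB hc; split.
Qed.

End Evaluation.

(** * Taylor estimates for polynomials *)

Section TaylorNumbers.
Variables (R : realType) (rho eta delta : R).
Local Notation C := (Cplx R).
Hypotheses (rho0 : 0 <= rho) (eta0 : 0 <= eta) (delta0 : 0 < delta).

(** Taylor bounds at orders 1, 2 and 3 between the values a at x and a' at x + h, with
    first and second differentials d1 and d2; b is the norm of the polynomial at radius
    rho + delta. This shape is stable under the operations that build polynomials. *)
Definition tay (a a' d1 d2 : C) (b : R) := [/\ 0 <= b,
  nm a <= b /\ nm a' <= b,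
  nm (a' - a) <= (eta / delta) * b,
  nm (a' - a - d1) <= (eta / delta) ^+ 2 * b &
  nm (a' - a - d1 - 2^-1 * d2) <= (eta / delta) ^+ 3 * b].

Lemma tayD a a' d1 d2 b x x' e1 e2 y :
  tay a a' d1 d2 b -> tay x x' e1 e2 y ->
  tay (a + x) (a' + x') (d1 + e1) (d2 + e2) (b + y).
Proof.
case=> p0 [p1 p1'] p2 p3 p4 [q0 [q1 q1'] q2 q3 q4].
have key (u v : C) (c c' k : R) : nm u <= k * c -> nm v <= k * c' ->
    nm (u + v) <= k * (c + c').
  by move=> ? ?; apply: le_trans (nmD _ _) _; rewrite mulrDr lerD.
split; first exact: addr_ge0.
- by split; apply: le_trans (nmD _ _) (lerD _ _).
- by have := key _ _ _ _ _ p2 q2; congr (nm _ <= _); ring.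
- by have := key _ _ _ _ _ p3 q3; congr (nm _ <= _); ring.
- by have := key _ _ _ _ _ p4 q4; congr (nm _ <= _); ring.
Qed.

Lemma tayZ c a a' d1 d2 b :
  tay a a' d1 d2 b -> tay (c * a) (c * a') (c * d1) (c * d2) (nm c * b).
Proof.
case=> p0 [p1 p1'] p2 p3 p4.
have key (u : C) (e k : R) : nm u <= k * e -> nm (c * u) <= k * (nm c * e).
  by move=> ?; rewrite nmM mulrCA ler_wpM2l ?nm_ge0.
split; first by rewrite mulr_ge0 ?nm_ge0.
- by split; rewrite nmM ler_wpM2l ?nm_ge0.
- by have := key _ _ _ p2; congr (nm _ <= _); ring.
- by have := key _ _ _ p3; congr (nm _ <= _); ring.
- by have := key _ _ _ p4; congr (nm _ <= _); ring.
Qed.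

(** Multiplication by a coordinate, whose differential is h and whose second
    differential is zero: the norm grows by rho + delta. *)
Lemma tayX x h a a' d1 d2 b : nm x <= rho -> nm (x + h) <= rho -> nm h <= eta ->
  tay a a' d1 d2 b ->
  tay (x * a) ((x + h) * a') (h * a + x * d1) (h * d1 + h * d1 + x * d2)
    ((rho + delta) * b).
Proof.
move=> hb hb' hh [p0 [p1 p1'] p2 p3 p4].
have ed : 0 <= eta / delta by rewrite divr_ge0 // ltW.
have d0 := ltW delta0.
have ee : eta = (eta / delta) * delta by rewrite divfK // gt_eqF.
have key (u v : C) (k : R) : 0 <= k -> nm u <= (eta / delta) * k * b ->
    nm v <= k * b ->
    nm (x * u + h * v) <= (eta / delta) * k * ((rho + delta) * b).
  move=> k0 hu hv; apply: le_trans (nmD _ _) _; rewrite !nmM.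
  have h1 := ler_pM (nm_ge0 _) (nm_ge0 _) hb hu.
  have h2 := ler_pM (nm_ge0 _) (nm_ge0 _) hh hv.
  apply: le_trans (lerD h1 h2) _; rewrite [X in _ + X * _]ee le_eqVlt.
  by apply/orP; left; apply/eqP; ring.
split; first by rewrite mulr_ge0 // addr_ge0.
- have bb : rho * b <= (rho + delta) * b by rewrite ler_wpM2r // lerDl.
  by split; rewrite nmM; apply: le_trans bb; apply: ler_pM; rewrite ?nm_ge0.
- rewrite -[eta / delta]mulr1.
  have := key (a' - a) a' 1 ler01; rewrite mulr1 mul1r => /(_ p2 p1').
  by congr (nm _ <= _); ring.
- have := key _ _ _ ed p3 p2.
  by rewrite -expr2; congr (nm _ <= _); ring.
- have := key _ _ ((eta / delta) ^+ 2) (exprn_ge0 _ ed) p4 p3.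
  by rewrite -exprS; congr (nm _ <= _); field.
Qed.

Lemma tay1 : tay 1 1 0 0 1.
Proof.
have ed : 0 <= eta / delta by rewrite divr_ge0 // ltW.
by split=> //; rewrite ?mulr0 ?subrr ?subr0 ?nm0 ?nm1 ?mulr1 // exprn_ge0.
Qed.

End TaylorNumbers.

Section PolyTaylor.
Variables (R : realType) (n : nat).
Local Notation C := (Cplx R).
Local Notation MP := (mpoly n C).
Implicit Types (p q : MP) (m : multinom n).
Variables (x h : 'rV[C]_n) (rho eta delta : R).
Hypotheses (rho0 : 0 <= rho) (eta0 : 0 <= eta) (delta0 : 0 < delta).
Hypotheses (xs : small rho x) (xhs : small rho (x + h)) (hs : small eta h).

Definition D1 p : C := \sum_j h 0 j * ev (mderiv j p) x.
Definition D2 p : C := \sum_j \sum_l h 0 j * h 0 l * ev (mderiv l (mderiv j p)) x.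

Let evD (t : 'rV[C]_n) p q : ev (p + q) t = ev p t + ev q t.
Proof. exact: mevalD. Qed.
Let evM (t : 'rV[C]_n) p q : ev (p * q) t = ev p t * ev q t.
Proof. exact: mevalM. Qed.
Let ev0 (t : 'rV[C]_n) : ev 0 t = 0.
Proof. exact: meval0. Qed.
Let ev1 (t : 'rV[C]_n) : ev 1 t = 1.
Proof. exact: meval1. Qed.
Let evXU (t : 'rV[C]_n) i : ev (mpolyX C (mnm1 i)) t = t 0 i.
Proof. exact: mevalXU. Qed.
Let evZ (t : 'rV[C]_n) c p : ev (c *: p) t = c * ev p t.
Proof. exact: mevalZ. Qed.

Let D1D p q : D1 (p + q) = D1 p + D1 q.
Proof. by rewrite -big_split; apply: eq_bigr => j _; rewrite mderivD evD mulrDr. Qed.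

Let D2D p q : D2 (p + q) = D2 p + D2 q.
Proof.
rewrite -big_split; apply: eq_bigr => j _; rewrite -big_split.
by apply: eq_bigr => l _; rewrite !mderivD evD mulrDr.
Qed.

Let D1Z c p : D1 (c *: p) = c * D1 p.
Proof. by rewrite mulr_sumr; apply: eq_bigr => j _; rewrite mderivZ evZ mulrCA. Qed.

Let D2Z c p : D2 (c *: p) = c * D2 p.
Proof.
rewrite mulr_sumr; apply: eq_bigr => j _; rewrite mulr_sumr.
by apply: eq_bigr => l _; rewrite !mderivZ evZ mulrCA.
Qed.

Let D1M p q : D1 (p * q) = D1 p * ev q x + ev p x * D1 q.
Proof.
rewrite /D1 mulr_suml mulr_sumr -big_split; apply: eq_bigr => j _ /=.
by rewrite mderivM evD 2!evM mulrDr mulrA mulrCA.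
Qed.

Let ev2 (a b c d e f p q : MP) : ev (a * q + b * c + (d * e + p * f)) x =
  ev a x * ev q x + ev b x * ev c x + ev d x * ev e x + ev p x * ev f x.
Proof. by rewrite evD (evD _ (a * q)) (evD _ (d * e)) 4!evM addrA. Qed.

Let alg (k a b c d : C) : k * (a + b + c + d) = k * a + (k * b + k * c) + k * d.
Proof. by rewrite !mulrDr addrA. Qed.

Let D2M p q :
  D2 (p * q) = D2 p * ev q x + (D1 p * D1 q + D1 p * D1 q) + ev p x * D2 q.
Proof.
pose s1 := \sum_j \sum_l h 0 j * h 0 l * (ev (mderiv j p) x * ev (mderiv l q) x).
pose s2 := \sum_j \sum_l h 0 j * h 0 l * (ev (mderiv l p) x * ev (mderiv j q) x).
have e1 : s1 = D1 p * D1 q.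
  rewrite /D1 mulr_suml; apply: eq_bigr => j _; rewrite mulr_sumr.
  by apply: eq_bigr => l _; rewrite mulrACA.
have e2 : s2 = D1 p * D1 q.
  rewrite -e1 /s2 exchange_big /=; apply: eq_bigr => j _; apply: eq_bigr => l _.
  by rewrite (mulrC (h 0 j)).
have e3 : \sum_j \sum_l h 0 j * h 0 l * (ev (mderiv l (mderiv j p)) x * ev q x)
    = D2 p * ev q x.
  rewrite /D2 mulr_suml; apply: eq_bigr => j _; rewrite mulr_suml.
  by apply: eq_bigr => l _; rewrite mulrA.
have e4 : \sum_j \sum_l h 0 j * h 0 l * (ev p x * ev (mderiv l (mderiv j q)) x)
    = ev p x * D2 q.
  rewrite /D2 mulr_sumr; apply: eq_bigr => j _; rewrite mulr_sumr.
  by apply: eq_bigr => l _; rewrite mulrCA.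
rewrite -e3 -e4 -{1}e1 -e2 /s1 /s2 -!big_split; apply: eq_bigr => j _ /=.
rewrite -!big_split; apply: eq_bigr => l _ /=.
rewrite mderivM mderivD !mderivM ev2; exact: alg.
Qed.

Let subUU i : mnm_sub (mnm1 i) (mnm1 i) = mnm0 :> multinom n.
Proof. by apply/mnmP => j; rewrite mnmBE subnn mnm0E. Qed.

Let D1X i : D1 (mpolyX C (mnm1 i)) = h 0 i.
Proof.
rewrite /D1 (bigD1 i) //= big1 ?addr0 => [|j ji].
  by rewrite mderivX mnm1E eqxx scale1r subUU mpolyX0 ev1 mulr1.
by rewrite mderivX mnm1E eq_sym (negPf ji) scale0r ev0 mulr0.
Qed.

Let D2X i : D2 (mpolyX C (mnm1 i)) = 0.
Proof.
apply: big1 => j _; apply: big1 => l _.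
rewrite mderivX mderivZ mnm1E; case: eqP => [->|_]; last by rewrite scale0r ev0 mulr0.
by rewrite subUU mpolyX0 -mpolyC1 mderivC scaler0 ev0 mulr0.
Qed.

Definition taylor p (b : R) :=
  tay eta delta (ev p x) (ev p (x + h)) (D1 p) (D2 p) b.

Let taylorD p q b b' : taylor p b -> taylor q b' -> taylor (p + q) (b + b').
Proof. by rewrite /taylor 2!evD D1D D2D; exact: tayD. Qed.

Let taylorZ c p b : taylor p b -> taylor (c *: p) (nm c * b).
Proof. by rewrite /taylor 2!evZ D1Z D2Z; exact: tayZ. Qed.

Let taylorXU i p b : taylor p b ->
  taylor (mpolyX C (mnm1 i) * p) ((rho + delta) * b).
Proof.
move=> hp; rewrite /taylor 2!evM D1M D2M D1X D2X !evXU [(x + h) 0 i]mxE mul0r add0r.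
by apply: tayX => //; have := xhs i; rewrite mxE.
Qed.

Let taylor1 : taylor 1 1.
Proof.
have d1 : D1 1 = 0 by rewrite /D1 big1 // => j _; rewrite -mpolyC1 mderivC ev0 mulr0.
have d2 : D2 1 = 0.
  apply: big1 => j _; apply: big1 => l _.
  by rewrite -mpolyC1 mderivC mderiv0 ev0 mulr0.
by rewrite /taylor d1 d2 !ev1; apply: tay1.
Qed.

Let split_mono m i : (0 < m i)%N -> m = mnm_add (mnm1 i) (mnm_sub m (mnm1 i)).
Proof.
move=> mi; apply/mnmP => j; rewrite mnmDE mnmBE mnm1E; case: eqP => [<-|_] /=.
  by rewrite subnKC.
by rewrite subn0.
Qed.

Let taylor_mono m : taylor (mpolyX C m) ((rho + delta) ^+ mdeg m).
Proof.
move: {2}(mdeg m) (erefl (mdeg m)) => k; elim: k m => [|k IH] m hm.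
  move/eqP: hm; rewrite mdeg_eq0 => /eqP ->; rewrite mpolyX0 mdeg0 expr0.
  exact: taylor1.
have [i mi] : exists i, (0 < m i)%N.
  apply/existsP; rewrite -[[exists _, _]]negbK negb_exists; apply/negP => /forallP h0.
  move: hm; rewrite mdegE big1 // => i _; apply/eqP; by rewrite -leqn0 leqNgt h0.
have em := split_mono mi; have hk : mdeg (mnm_sub m (mnm1 i)) = k.
  by move: hm; rewrite {1}em mdegD mdeg1 => -[].
by rewrite em mpolyXD mdegD mdeg1 exprS; apply: taylorXU; apply: IH.
Qed.

(** Polynomials are linear combinations of products of coordinates, so that the three
    Taylor bounds hold with a constant that depends on the norm alone; they therefore
    pass to the limit. *)
Lemma taylorP p : taylor p (nrm (rho + delta) p).
Proof.
have t0 : taylor 0 0 by have := taylorZ 0 taylor1; rewrite scale0r nm0 mul0r.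
rewrite {1}[p]mpolyE /nrm; elim/big_rec2: _ => // m b q _ hq.
by apply: taylorD => //; apply: taylorZ; exact: taylor_mono.
Qed.

End PolyTaylor.

(** * Germs of convergent power series *)

Section Germs.
Variable R : realType.
Local Notation C := (Cplx R).

Lemma nearP n (p : 'rV[C]_n) (P : 'rV[C]_n -> Prop) :
  (\forall q \near p, P q) <->
  exists r : R, 0 < r /\ forall h, small r h -> P (p + h).
Proof.
split.
  case/nbhs_ballP => e e0 he; have ee : e = ((complex.Re e)%:C)%C.
    by rewrite RRe_real // gtr0_real.
  have r0 : 0 < complex.Re e by rewrite -ltcR -ee.
  exists (complex.Re e / 2); split; first by rewrite divr_gt0.
  move=> h hh; apply: he; split=> // i j.
  rewrite -ball_normE /= (ord1 i) mxE opprD addrA subrr sub0r normrN nmE ee ltcR.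
  by apply: le_lt_trans (hh j) _; rewrite ltr_pdivrMr // ltr_pMr // ltr1n.
case=> r [r0 hr]; apply/nbhs_ballP; exists ((r%:C)%C : C); first by rewrite /= ltcR.
move=> q [_ hq]; have -> : q = p + (q - p) by rewrite addrC subrK.
apply: hr => i; have := hq 0 i; rewrite -ball_normE /= distrC nmE ltcR !mxE.
exact: ltW.
Qed.

Lemma near0P n (P : 'rV[C]_n -> Prop) :
  (\forall t \near (0 : 'rV[C]_n), P t) <->
  exists r : R, 0 < r /\ forall t, small r t -> P t.
Proof.
rewrite nearP; split=> -[r [r0 h]]; exists r; split=> // t st.
  by rewrite -[t]add0r; exact: h.
by rewrite add0r; exact: h.
Qed.

Lemma near_shift n (p : 'rV[C]_n) (P : 'rV[C]_n -> Prop) :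
  (\forall q \near p, P q) <-> (\forall h \near (0 : 'rV[C]_n), P (p + h)).
Proof. by rewrite near0P nearP. Qed.

Lemma small_le n (r s : R) (t : 'rV[C]_n) : r <= s -> small r t -> small s t.
Proof. by move=> rs st i; apply: le_trans (st i) rs. Qed.

Lemma small0 n (r : R) : 0 <= r -> small r (0 : 'rV[C]_n).
Proof. by move=> r0 i; rewrite mxE nm0. Qed.

Definition rep n (c : power_series R n) (f : 'rV[C]_n -> C) :=
  ps_convergent c /\ \forall t \near (0 : 'rV[C]_n), f t = ps_eval c t.

(** Germs at the origin of holomorphic functions. *)
Definition an n (f : 'rV[C]_n -> C) := exists c, rep c f.

Lemma repP n (c : power_series R n) f : rep c f ->
  exists r B, [/\ 0 < r, bnd c r B & forall t, small (r / 2) t -> f t = ps_eval c t].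
Proof.
case=> /ps_convergentP [r [B [r0 hB]]] /near0P [s [s0 hs]].
exists (Order.min r s), B; have m0 : 0 < Order.min r s by rewrite lt_min r0.
split=> //; first by apply: bnd_le hB; [exact: ltW | rewrite ge_min lexx].
move=> t st; apply: hs; apply: small_le st; apply: (@le_trans _ _ (Order.min r s)).
  by rewrite ler_pdivrMr // ler_peMr ?ltW // ltr1n.
by rewrite ge_min lexx orbT.
Qed.

Lemma repI n (c : power_series R n) f r B : 0 < r -> bnd c r B ->
  (forall t, small (r / 2) t -> f t = ps_eval c t) -> rep c f.
Proof.
move=> r0 hB h; split; first by apply/ps_convergentP; exists r, B.
by apply/near0P; exists (r / 2); rewrite divr_gt0.
Qed.

Lemma rep_eq n (c : power_series R n) f g :
  (\forall t \near (0 : 'rV[C]_n), f t = g t) -> rep c f -> rep c g.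
Proof.
move=> h [cc hf]; split=> //; apply: filterS2 h hf => t e1 e2.
by rewrite -e1.
Qed.

Lemma an_eq n (f g : 'rV[C]_n -> C) :
  (\forall t \near (0 : 'rV[C]_n), f t = g t) -> an f -> an g.
Proof. by move=> h [c hc]; exists c; exact: rep_eq hc. Qed.

Lemma an_ext n (f g : 'rV[C]_n -> C) : f =1 g -> an f -> an g.
Proof. by move=> h; apply: an_eq; apply: (filterS (P := setT)) (filterT) => t _; exact: h. Qed.

(** Existence of the limit series, in the form used to prove that a function is analytic:
    f has to be approximated at a geometric rate. *)
Lemma rep_lim n (p : nat -> mpoly n C) f r B A : 0 < r ->
    (forall k, nrm r (p k) <= B) -> (forall k, ord k (p k.+1 - p k)) ->
    (forall t, small (r / 2) t -> forall k, nm (ev (p k) t - f t) <= A / 2 ^+ k) ->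
  exists2 c, rep c f & forall k m, (mdeg m < k)%N -> mcoeff m (p k) = c (ff m).
Proof.
move=> r0 hB hs hf; have [c [h1 h2 h3]] := polylim_stable (ltW r0) hB hs.
exists c => //; apply: repI r0 h2 _ => t st; apply/eqP; rewrite -subr_eq0; apply/eqP.
apply: (@nm_geom0 _ _ (A + 6 * B)) => N.
have := hf t st N; have := h3 t st N; rewrite (nmC _ (f t)) => ha hb.
have -> : f t - ps_eval c t = (f t - ev (p N) t) + (ev (p N) t - ps_eval c t).
  by rewrite addrA subrK.
by apply: le_trans (nmD _ _) _; rewrite mulrDl; apply: lerD.
Qed.

Lemma rep_trunc n (c : power_series R n) f : rep c f -> exists r B,
  [/\ 0 < r, bnd c r B &
   forall t, small (r / 2) t -> forall k, nm (ev (trunc k c) t - f t) <= 4 * B / 2 ^+ k].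
Proof.
move=> /repP [r [B [r0 hB hf]]]; exists r, B; split=> // t st k.
by rewrite hf // ev_trunc; apply: ps_partial_eval st => //; exact: ltW.
Qed.

Lemma ev_at0 n (p : mpoly n C) : ev p 0 = mcoeff (mnm0 (n := n)) p.
Proof.
pose q := p - mpolyC n (mcoeff (mnm0 (n := n)) p).
have q1 : ord 1 q.
  move=> m; rewrite ltnS leqn0 mdeg_eq0 => /eqP ->.
  by rewrite mcoeffB mcoeffC eqxx mulr1 subrr.
have h : nm (ev q 0) <= 0.
  have r0 : 0 <= 0 :> R by exact: lexx.
  have h1 := ev_le q r0 (small0 r0).
  have := @ord_nrm _ _ 1 0 0 q r0 _ q1; rewrite lexx ler01 => /(_ isT).
  by rewrite mul0r expr1 mul0r; exact: le_trans h1.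
have -> : p = q + mpolyC n (mcoeff (mnm0 (n := n)) p) by rewrite subrK.
rewrite /ev mevalD mevalC -/(ev _ _) (nm_le0 h) add0r.
by rewrite subrK.
Qed.

Lemma rep_at0 n (c : power_series R n) f : rep c f -> f 0 = c [ffun => 0%N].
Proof.
move=> /rep_trunc [r [B [r0 hB hf]]].
apply/esym/eqP; rewrite -subr_eq0; apply/eqP; apply: (@nm_geom0 _ _ (2 * B)) => N.
have := hf 0 (small0 (ltW (divr_gt0 r0 (ltr0Sn _ 1)))) N.+1.
rewrite ev_at0 coef_trunc_lt ?mdeg0 // (_ : ff _ = [ffun=> 0%N]); last first.
  by apply/ffunP => i; rewrite !ffunE mnm0E.
move=> h; apply: le_trans h _; rewrite exprS invfM mulrA ler_wpM2r //.
by lra.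
Qed.

End Germs.

(** * Algebra and composition of germs *)

Section PolyComposition.
Variables (R : realType) (m n : nat).
Local Notation C := (Cplx R).
Implicit Types (T S : m.-tuple (mpoly n C)) (p : mpoly m C).

Lemma nrm_comp r rho T p : 0 <= r -> (forall i, nrm r (tnth T i) <= rho) ->
  nrm r (comp_mpoly T p) <= nrm rho p.
Proof.
move=> r0 hT; rewrite comp_mpolyE (le_trans (nrm_sum _ _ _ r0)) //.
apply: ler_sum => a _; apply: le_trans (nrmZ _ _ r0) _.
rewrite ler_wpM2l ?nm_ge0 // mdegE -prodrXr (le_trans (nrm_prod _ _ _ r0)) //.
apply: ler_prod => i _; rewrite nrm_ge0 //= (le_trans (nrm_exp _ _ r0)) //.
by rewrite lerXn2r // nnegrE ?nrm_ge0 // (le_trans _ (hT i)) // nrm_ge0.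
Qed.

Lemma ord_prod_exp T (a : multinom m) : (forall i, ord 1 (tnth T i)) ->
  ord (mdeg a) (\prod_(i < m) tnth T i ^+ a i).
Proof.
move=> hT; rewrite mdegE.
elim/big_rec2: _ => [|i k q _ h]; first exact: ord0p.
by apply: ordM => //; exact: ordX.
Qed.

(** Substituting polynomials without constant term does not lower degrees. *)
Lemma ord_comp k T p : (forall i, ord 1 (tnth T i)) -> ord k p ->
  ord k (comp_mpoly T p).
Proof.
move=> hT hp; rewrite comp_mpolyE big_seq; apply: ord_sum => a.
rewrite mcoeff_msupp => ha; apply: ordZ;apply: (ordW _ (ord_prod_exp hT)).
by rewrite leqNgt; apply: contra ha => /hp ->.
Qed.

Lemma ord_comp_diff k T S p : (forall i, ord k (tnth T i - tnth S i)) ->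
  ord k (comp_mpoly T p - comp_mpoly S p).
Proof.
move=> h; rewrite !comp_mpolyE -sumrB; apply: ord_sum => a _.
rewrite -scalerBr; apply: ordZ.
have hM (u u' v v' : mpoly n C) : ord k (u - u') -> ord k (v - v') ->
    ord k (u * v - u' * v').
  move=> hu hv; have -> : u * v - u' * v' = (u - u') * v + u' * (v - v').
    by rewrite mulrBl mulrBr addrA subrK.
  by apply: ordD; [exact: ordMr | exact: ordMl].
elim/big_rec2: _ => [|i u v _ hr]; first by rewrite subrr; exact: ord_zero.
apply: (hM) => //; elim: (a i) => [|d IH]; first by rewrite subrr; exact: ord_zero.
by rewrite !exprS; apply: hM.
Qed.

Lemma ev_comp T p (t : 'rV[C]_n) :
  ev (comp_mpoly T p) t = ev p (\row_i ev (tnth T i) t).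
Proof. by rewrite /ev comp_mpoly_meval; apply: meval_eq => i; rewrite mxE. Qed.

End PolyComposition.

Section GermClosure.
Variable R : realType.
Local Notation C := (Cplx R).

Lemma common_radius (I : finType) (r : I -> R) : (forall i, 0 < r i) ->
  exists2 s, 0 < s & forall i, s <= r i.
Proof.
move=> h; suff [s s0 hs] : exists2 s, 0 < s & forall i, i \in enum I -> s <= r i.
  by exists s => // i; apply: hs; rewrite mem_enum.
elim: (enum I) => [|i l [s s0 IH]]; first by exists 1.
exists (Order.min (r i) s); first by rewrite lt_min h.
move=> j; rewrite inE => /orP[/eqP ->|jl]; first by rewrite ge_min lexx.
by rewrite ge_min (IH j jl) orbT.
Qed.

Lemma rep_trunc_le n (c : power_series R n) f : rep c f -> exists r B, 0 < r /\
  forall s, 0 < s -> s <= r -> [/\ bnd c s B &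
   forall t, small (s / 2) t -> forall k, nm (ev (trunc k c) t - f t) <= 4 * B / 2 ^+ k].
Proof.
move=> /rep_trunc [r [B [r0 hB hf]]]; exists r, B; split=> // s s0 sr.
split; first by apply: bnd_le hB => //; exact: ltW.
by move=> t st k; apply: hf; apply: small_le st; rewrite ler_wpM2r.
Qed.

Lemma an_const n (a : C) : an (fun _ : 'rV[C]_n => a).
Proof.
have [|||c hc _] := @rep_lim R n (fun => mpolyC n a) (fun => a) 1 (nm a) 0 ltr01.
- by move=> k; rewrite nrmC.
- by move=> k; rewrite subrr; exact: ord_zero.
- by move=> t _ k; rewrite /ev mevalC subrr nm0 mul0r.
by exists c.
Qed.

Lemma an_coord n (i : 'I_n) : an (fun t : 'rV[C]_n => t 0 i).
Proof.
have [|||c hc _] := @rep_lim R n (fun => mpolyX C (mnm1 i)) (fun t => t 0 i) 1 1 0 ltr01.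
- by move=> k; rewrite nrmX expr1n.
- by move=> k; rewrite subrr; exact: ord_zero.
- by move=> t _ k; rewrite /ev mevalXU subrr nm0 mul0r.
by exists c.
Qed.

Lemma rep_add n (c d : power_series R n) f g :
  rep c f -> rep d g -> rep (fun a => c a + d a) (fun t => f t + g t).
Proof.
move=> /rep_trunc_le [r [B [r0 hf]]] /rep_trunc_le [s [B' [s0 hg]]].
have m0 : 0 < Order.min r s by rewrite lt_min r0.
have [|cB hf'] := hf _ m0; first by rewrite ge_min lexx.
have [|dB hg'] := hg _ m0; first by rewrite ge_min lexx orbT.
have [|||e he hc] := @rep_lim R n (fun k => trunc k c + trunc k d)
   (fun t => f t + g t) _ (B + B') (4 * B + 4 * B') m0.
- by move=> k; apply: le_trans (nrmD _ _ (ltW m0)) _; apply: lerD.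
- move=> k; rewrite opprD addrACA; apply: ordD; exact: ord_trunc.
- move=> t st k; rewrite /ev mevalD opprD addrACA mulrDl.
  by apply: le_trans (nmD _ _) _; apply: lerD; [exact: hf' | exact: hg'].
suff <- : e = (fun a => c a + d a) by [].
apply/funext => a; have := hc _ _ (ltnSn (mdeg (mkm a))).
by rewrite mcoeffD !coef_trunc_lt // ff_mkmK.
Qed.

Lemma an_add n (f g : 'rV[C]_n -> C) : an f -> an g -> an (fun t => f t + g t).
Proof. by move=> [c hc] [d hd]; eexists; exact: rep_add hc hd. Qed.

Lemma an_mul n (f g : 'rV[C]_n -> C) : an f -> an g -> an (fun t => f t * g t).
Proof.
move=> [c /rep_trunc_le [r [B [r0 hf]]]] [d /rep_trunc_le [s [B' [s0 hg]]]].
have m0 : 0 < Order.min r s by rewrite lt_min r0.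
have [|cB hf'] := hf _ m0; first by rewrite ge_min lexx.
have [|dB hg'] := hg _ m0; first by rewrite ge_min lexx orbT.
have [|||e he _] := @rep_lim R n (fun k => trunc k c * trunc k d)
   (fun t => f t * g t) _ (B * B') (B * (4 * B') + 4 * B * (5 * B')) m0.
- move=> k; apply: le_trans (nrmM _ _ (ltW m0)) _.
  by apply: ler_pM => //; apply: nrm_ge0; exact: ltW.
- move=> k; set a := trunc _ c; set b := trunc _ d.
  have -> : a * b - trunc k c * trunc k d = (a - trunc k c) * b + trunc k c * (b - trunc k d).
    by rewrite mulrBl mulrBr addrA subrK.
  by apply: ordD; [apply: ordMr | apply: ordMl]; exact: ord_trunc.
- move=> t st k; rewrite /ev mevalM -/(ev _ _) -/(ev _ _).
  have h1 := hf' t st k; have h2 := hg' t st k.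
  have B0 := bnd_ge0 (ltW m0) cB; have B'0 := bnd_ge0 (ltW m0) dB.
  have h3 : nm (ev (trunc k c) t) <= B.
    apply: le_trans (cB k); apply: ev_le; first exact: ltW.
    by apply: small_le st; have := ltW m0; lra.
  have h4 : nm (g t) <= 5 * B'.
    have := hg' t st 0%N; rewrite expr0 divr1 => h4.
    have -> : g t = ev (trunc 0 d) t - (ev (trunc 0 d) t - g t) by rewrite subKr.
    apply: le_trans (nmB _ _) _; have : nm (ev (trunc 0 d) t) <= B'; last by lra.
    apply: le_trans (dB 0%N); apply: ev_le; first exact: ltW.
    by apply: small_le st; have := ltW m0; lra.
  have key (a b a' b' : C) (x y z w u : R) : nm a <= x -> nm (b - b') <= y * u ->
      nm b' <= z -> nm (a - a') <= w * u -> nm (a * b - a' * b') <= (x * y + w * z) * u.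
    move=> k1 k2 k3 k4; have -> : a * b - a' * b' = a * (b - b') + (a - a') * b'.
      by rewrite mulrBl mulrBr addrA subrK.
    apply: le_trans (nmD _ _) _; rewrite !nmM mulrDl; apply: lerD.
      by rewrite -mulrA; apply: ler_pM; rewrite ?nm_ge0.
    by rewrite mulrAC; apply: ler_pM; rewrite ?nm_ge0.
  exact: key h3 h2 h4 h1.
by exists e.
Qed.

Lemma an_opp n (f : 'rV[C]_n -> C) : an f -> an (fun t => - f t).
Proof.
move=> h; apply: (an_ext (f := fun t => (-1) * f t)) => [t|]; first by rewrite mulN1r.
by apply: an_mul => //; exact: an_const.
Qed.

Lemma an_sub n (f g : 'rV[C]_n -> C) : an f -> an g -> an (fun t => f t - g t).
Proof. by move=> hf hg; apply: an_add => //; exact: an_opp. Qed.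

Lemma an_sum n (I : Type) (s : seq I) (P : pred I) (F : I -> 'rV[C]_n -> C) :
  (forall i, an (F i)) -> an (fun t => \sum_(i <- s | P i) F i t).
Proof.
move=> h; elim: s => [|i s IH].
  by apply: (an_ext (f := fun => 0)) => [t|]; [rewrite big_nil | exact: an_const].
apply: (an_ext (f := fun t => (if P i then F i t else 0) + \sum_(i <- s | P i) F i t)).
  by move=> t; rewrite big_cons; case: (P i); rewrite ?add0r.
by apply: an_add => //; case: (P i) => //; exact: an_const.
Qed.

(** The composites of the truncations are bounded by nrm_comp on a polydisc so small that
    the inner series stay in the polydisc of f, and they are stationary degree by degree. *)
Lemma an_comp m n (f : 'rV[C]_m -> C) (g : 'I_m -> 'rV[C]_n -> C) :
  an f -> (forall i, an (g i)) -> (forall i, g i 0 = 0) ->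
  an (fun t => f (\row_i g i t)).
Proof.
move=> [c /rep_trunc [rf [Bf [rf0 hBf hf]]]] hg g0.
have /choice [d hd] : forall i, exists di, rep di (g i) by [].
have /choice [rB hrB] : forall i, exists rB : R * R, 0 < rB.1 /\
    forall s, 0 < s -> s <= rB.1 -> [/\ bnd (d i) s rB.2 &
    forall t, small (s / 2) t -> forall k,
      nm (ev (trunc k (d i)) t - g i t) <= 4 * rB.2 / 2 ^+ k].
  by move=> i; have [r [B h]] := rep_trunc_le (hd i); exists (r, B).
have [r0 r00 hr0] := @common_radius _ (fun i => (rB i).1) (fun i => (hrB i).1).
have B0 i : 0 <= (rB i).2.
  by have [h _] := (hrB i).2 _ r00 (hr0 i); apply: bnd_ge0 h; exact: ltW.
pose B := 1 + \sum_i (rB i).2.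
have hB i : (rB i).2 <= B.
  by rewrite /B (bigD1 i) //= addrCA lerDl addr_ge0 // sumr_ge0.
have B1 : 1 <= B by rewrite lerDl sumr_ge0.
pose rho := rf / 4; have rho0 : 0 < rho by rewrite divr_gt0.
pose e := Order.min 1 (rho / B).
have e0 : 0 < e by rewrite lt_min ltr01 divr_gt0 //; lra.
have e1 : e <= 1 by rewrite ge_min lexx.
have eB : e * B <= rho.
  by rewrite -ler_pdivlMr ?ge_min ?lexx ?orbT //; lra.
pose r := e * r0; have r_gt0 : 0 < r by rewrite mulr_gt0.
have rr0 : r <= r0 by rewrite ler_piMl // ltW.
have d1 i k : ord 1 (trunc k (d i)).
  move=> a; rewrite ltnS leqn0 mdeg_eq0 => /eqP ->.
  rewrite coef_trunc; case: ifP => // _; rewrite -(g0 i) (rep_at0 (hd i)).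
  by congr (d i _); apply/ffunP => j; rewrite !ffunE mnm0E.
have nd i k : nrm r (trunc k (d i)) <= rho.
  apply: le_trans eB; have := @ord_nrm _ _ 1 r0 e _ (ltW r00) _ (d1 i k).
  rewrite (ltW e0) e1 => /(_ isT) h; apply: le_trans h _; rewrite expr1 ler_wpM2l ?(ltW e0) //.
  by apply: le_trans (hB i); have [h _] := (hrB i).2 _ r00 (hr0 i); exact: h.
pose T k := [tuple trunc k (d i) | i < m].
have tT k i : tnth (T k) i = trunc k (d i) by rewrite tnth_mktuple.
have [|||ee hee _] := @rep_lim R n (fun k => comp_mpoly (T k) (trunc k c))
   (fun t => f (\row_i g i t)) r Bf (4 * B / rho * Bf + 4 * Bf) r_gt0.
- move=> k; apply: le_trans (@nrm_comp _ _ _ r rho _ _ (ltW r_gt0) _) _.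
    by move=> i; rewrite tT.
  apply: le_trans (hBf k); apply: nrm_le; first exact: ltW.
  by rewrite /rho; have := ltW rf0; lra.
- move=> k; have -> : comp_mpoly (T k.+1) (trunc k.+1 c) - comp_mpoly (T k) (trunc k c)
     = comp_mpoly (T k.+1) (trunc k.+1 c - trunc k c)
       + (comp_mpoly (T k.+1) (trunc k c) - comp_mpoly (T k) (trunc k c)).
    by rewrite comp_mpolyB addrA subrK.
  apply: ordD.
    by apply: ord_comp => [i|]; [rewrite tT; exact: d1 | exact: ord_trunc].
  by apply: ord_comp_diff => i; rewrite !tT; exact: ord_trunc.
- move=> t st k; rewrite ev_comp.
  set G := \row_i g i t; set Gk := \row_i _.
  have st' : small (r0 / 2) t by apply: small_le st; rewrite ler_wpM2r.
  have dG i : nm ((Gk - G) 0 i) <= 4 * B / 2 ^+ k.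
    have [_ h] := (hrB i).2 _ r00 (hr0 i).
    rewrite /Gk /G !mxE tT; apply: le_trans (h t st' k) _.
    by rewrite ler_wpM2r ?invr_ge0 ?exprn_ge0 // ler_wpM2l.
  have sGk : small rho Gk.
    move=> i; rewrite mxE tT; apply: le_trans (nd i k); apply: ev_le; first exact: ltW.
    by apply: small_le st; have := ltW r_gt0; lra.
  have sG : small rho G.
    move=> i; rewrite mxE.
    have bi : bnd (d i) r rho by move=> N; exact: nd.
    apply: (@le_geom _ _ _ (4 * rho)) => N.
    have [_ h] := (hrB i).2 _ r_gt0 (le_trans rr0 (hr0 i)).
    apply: (@le_geom _ _ _ (4 * (rB i).2)) => M; have h1 := h t st M.
    have -> : g i t = ev (trunc M (d i)) t - (ev (trunc M (d i)) t - g i t) by rewrite subKr.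
    apply: le_trans (nmB _ _) _; apply: lerD => //.
    apply: (@le_trans _ _ rho); last by rewrite lerDl divr_ge0 ?exprn_ge0 // mulr_ge0 // ltW.
    apply: le_trans (nd i M); apply: ev_le; first exact: ltW.
    by apply: small_le st; have := ltW r_gt0; lra.
  have eta0 : 0 <= 4 * B / 2 ^+ k by rewrite divr_ge0 ?exprn_ge0 // mulr_ge0 //; lra.
  have eG : G + (Gk - G) = Gk by rewrite addrC subrK.
  have sGk' : small rho (G + (Gk - G)) by rewrite eG.
  have [_ _ + _ _] := taylorP (ltW rho0) eta0 rho0 sG sGk' dG (trunc k c).
  rewrite eG => h1.
  have h2 : nm (ev (trunc k c) G - f G) <= 4 * Bf / 2 ^+ k.
    apply: hf; apply: small_le sG; rewrite /rho; have := ltW rf0; lra.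
  have -> : ev (trunc k c) Gk - f G
     = (ev (trunc k c) Gk - ev (trunc k c) G) + (ev (trunc k c) G - f G).
    by rewrite addrA subrK.
  apply: le_trans (nmD _ _) _; rewrite mulrDl; apply: lerD => //.
  apply: le_trans h1 _.
  have h3 : nrm (rho + rho) (trunc k c) <= Bf.
    apply: le_trans (hBf k); apply: nrm_le; rewrite /rho; have := ltW rf0; lra.
  have -> : 4 * B / rho * Bf / 2 ^+ k = 4 * B / 2 ^+ k / rho * Bf by ring.
  by rewrite ler_wpM2l // divr_ge0 // ltW.
by exists ee.
Qed.

End GermClosure.

(** * Derivatives of germs *)

Section SeriesDerivative.
Variables (R : realType) (n : nat).
Local Notation C := (Cplx R).
Implicit Types (c d : power_series R n) (p : mpoly n C) (r : R) (x h t : 'rV[C]_n).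

(** The coefficients of the j-th partial derivative. *)
Definition dps (j : 'I_n) c : power_series R n :=
  fun a => c [ffun i => (a i + (i == j))%N] *+ (a j).+1.

(** Cauchy estimate, from d <= 2^(d-1). *)
Lemma nrm_mderiv r j p : 0 < r -> nrm (r / 2) (mderiv j p) <= r^-1 * nrm r p.
Proof.
move=> r0; have r20 : 0 <= r / 2 by rewrite divr_ge0 // ltW.
rewrite {1}[p]mpolyE raddf_sum /= (le_trans (nrm_sum _ _ _ r20)) //.
rewrite [X in _ <= _ * X]/nrm mulr_sumr; apply: ler_sum => m _.
rewrite mderivZ mderivX scalerA; rewrite nrmCX nmM nmn -mulrA [X in _ <= X]mulrCA ler_wpM2l ?nm_ge0 //.
have [->|mj] := posnP (m j).
  by rewrite mul0r mulr_ge0 ?invr_ge0 ?exprn_ge0 // ltW.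
have hd : mdeg m = (mdeg (mnm_sub m (mnm1 j))).+1.
  rewrite -add1n -[1%N](mdeg1 j) -mdegD; congr mdeg; apply/mnmP => i.
  rewrite mnmDE mnmBE mnm1E; case: eqP => [<-|_] /=; first by rewrite subnKC.
  by rewrite subn0.
have hm : (m j <= mdeg m)%N by rewrite mdegE (bigD1 j) //= leq_addr.
rewrite hd exprS mulrA mulVf ?gt_eqF // mul1r; set k := mdeg _.
rewrite exprMn exprVn mulrCA ger_pMr ?exprn_gt0 // ler_pdivrMr ?exprn_gt0 // mul1r.
rewrite -natrX ler_nat; apply: leq_trans hm _; rewrite hd -/k.
by rewrite ltn_expl.
Qed.

Lemma dps_lim c j (p : nat -> mpoly n C) :
  (forall k m, (mdeg m < k)%N -> mcoeff m (p k) = c (ff m)) ->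
  forall k m, (mdeg m < k)%N -> mcoeff m (mderiv j (p k.+1)) = dps j c (ff m).
Proof.
move=> hp k m mk; rewrite mcoeff_mderiv hp ?mdegD ?mdeg1 ?addn1 //.
rewrite /dps ffunE; congr (c _ *+ _); apply/ffunP => i.
by rewrite !ffunE mnmDE mnm1E eq_sym.
Qed.

Lemma bnd_dps c r B j : 0 < r -> bnd c r B -> bnd (dps j c) (r / 2) (r^-1 * B).
Proof.
move=> r0 hB; have r20 : 0 <= r / 2 by rewrite divr_ge0 // ltW.
have [||//] := @polylim _ _ (dps j c) (fun k => mderiv j (trunc k.+1 c))
  (r / 2) (r^-1 * B) r20.
  move=> k; apply: le_trans (nrm_mderiv _ _ r0) _.
  by rewrite ler_wpM2l ?invr_ge0 ?(ltW r0).
by apply: (@dps_lim c j (fun k => trunc k c)) => k m; exact: coef_trunc_lt.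
Qed.

Lemma dps_eval c r B (j : 'I_n) (p : nat -> mpoly n C) t k : 0 < r ->
    (forall k, nrm r (p k) <= B) ->
    (forall k m, (mdeg m < k)%N -> mcoeff m (p k) = c (ff m)) ->
    small (r / 2 / 2) t ->
  nm (ev (mderiv j (p k.+1)) t - ps_eval (dps j c) t) <= 6 * (r^-1 * B) / 2 ^+ k.
Proof.
move=> r0 hB hp st; have r20 : 0 <= r / 2 by rewrite divr_ge0 // ltW.
have [|| _ /(_ t st k)//] := @polylim _ _ (dps j c) (fun k => mderiv j (p k.+1))
  (r / 2) (r^-1 * B) r20.
  move=> l; apply: le_trans (nrm_mderiv _ _ r0) _.
  by rewrite ler_wpM2l ?invr_ge0 ?(ltW r0).
exact: dps_lim.
Qed.

Lemma nm_lim (u : nat -> C) (l : C) (b A : R) :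
  (forall k, nm (u k) <= b) -> (forall k, nm (u k - l) <= A / 2 ^+ k) -> nm l <= b.
Proof.
move=> hu hl; apply: (@le_geom _ _ _ A) => k.
have -> : l = u k - (u k - l) by rewrite subKr.
by apply: le_trans (nmB _ _) _; apply: lerD.
Qed.

(** Limit of the Taylor bounds for the truncations: they only involve norms, and the
    derivatives of the truncations converge to the derived series. *)
Lemma series_taylor c r B x h eta : 0 < r -> bnd c r B -> small (r / 16) x ->
  0 <= eta <= r / 16 -> small eta h ->
  [/\ nm (ps_eval c (x + h) - ps_eval c x) <= (eta / (r / 8)) * B,
   nm (ps_eval c (x + h) - ps_eval c x - \sum_j h 0 j * ps_eval (dps j c) x)
     <= (eta / (r / 8)) ^+ 2 * B &
   nm (ps_eval c (x + h) - ps_eval c x - \sum_j h 0 j * ps_eval (dps j c) x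
       - 2^-1 * \sum_j \sum_l h 0 j * h 0 l * ps_eval (dps l (dps j c)) x)
     <= (eta / (r / 8)) ^+ 3 * B].
Proof.
move=> r0 hB sx /andP[eta0 etar] sh.
have r80 : 0 < r / 8 by rewrite divr_gt0.
have sx8 : small (r / 8) x by apply: small_le sx; have := ltW r0; lra.
have sxh8 : small (r / 8) (x + h).
  move=> i; rewrite mxE; apply: le_trans (nmD _ _) _.
  by have := sx i; have := sh i; lra.
(* r / 8 is the value of rho and of delta in the polynomial bounds *)
have wide (y : 'rV[C]_n) : small (r / 8) y -> small (r / 2) y.
  by move=> sy; apply: small_le sy; have := ltW r0; lra.
(* each derivative costs one degree, hence the truncation two degrees higher *)
pose p k := trunc k.+2 c.
have hp k m : (mdeg m < k)%N -> mcoeff m (p k) = c (ff m).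
  by move=> mk; apply: coef_trunc_lt; apply: ltn_trans mk _; rewrite ltnW.
have hp1 k m : (mdeg m < k)%N -> mcoeff m (trunc k.+1 c) = c (ff m).
  by move=> mk; apply: coef_trunc_lt; exact: ltnW.
have pB k : nrm r (p k) <= B by exact: hB.
have B0 := bnd_ge0 (ltW r0) hB.
have e0 (y : 'rV[C]_n) k : small (r / 8) y -> nm (ev (p k) y - ps_eval c y) <= 6 * B / 2 ^+ k.
  move=> sy; have [_ h0] := polylim (c := c) (ltW r0) pB hp.
  by apply: h0; exact: wide.
have e1 j k : nm (ev (mderiv j (p k)) x - ps_eval (dps j c) x) <= 6 * (r^-1 * B) / 2 ^+ k.
  by apply: (@dps_eval c r B j (fun k => trunc k.+1 c)) => //; apply: small_le sx8;
     have := ltW r0; lra.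
have e2 j l k : nm (ev (mderiv l (mderiv j (p k))) x - ps_eval (dps l (dps j c)) x)
     <= 6 * ((r / 2)^-1 * (r^-1 * B)) / 2 ^+ k.
  apply: (@dps_eval (dps j c) (r / 2) (r^-1 * B) l (fun k => mderiv j (trunc k.+1 c))).
  - by rewrite divr_gt0.
  - move=> i; apply: le_trans (nrm_mderiv _ _ r0) _.
    by rewrite ler_wpM2l ?invr_ge0 ?(ltW r0).
  - by apply: (@dps_lim c j (fun k => trunc k c)) => i m; exact: coef_trunc_lt.
  - by apply: small_le sx8; have := ltW r0; lra.
have pB4 k : nrm (r / 8 + r / 8) (p k) <= B.
  by apply: le_trans (pB k); apply: nrm_le; have := ltW r0; lra.
have ed : 0 <= eta / (r / 8) by rewrite divr_ge0 // ltW.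
have T k := taylorP (ltW r80) eta0 r80 sx8 sxh8 sh (p k).
pose A0 := 12 * B.
have f0 k : nm (ev (p k) (x + h) - ev (p k) x - (ps_eval c (x + h) - ps_eval c x)) <= A0 / 2 ^+ k.
  have -> : ev (p k) (x + h) - ev (p k) x - (ps_eval c (x + h) - ps_eval c x)
    = (ev (p k) (x + h) - ps_eval c (x + h)) - (ev (p k) x - ps_eval c x).
    by rewrite !opprB addrACA [RHS]addrACA; congr (_ + _); rewrite addrC.
  apply: le_trans (nmB _ _) _; have := e0 _ k sxh8; have := e0 _ k sx8.
  by rewrite /A0; lra.
pose A1 := \sum_(j < n) eta * (6 * (r^-1 * B)).
have f1 k : nm (D1 x h (p k) - \sum_j h 0 j * ps_eval (dps j c) x) <= A1 / 2 ^+ k.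
  rewrite /D1 -sumrB; apply: le_trans (nm_sum _ _ _) _; rewrite /A1 mulr_suml.
  apply: ler_sum => j _; rewrite -mulrBr nmM -mulrA.
  by apply: ler_pM; rewrite ?nm_ge0.
pose A2 := \sum_(j < n) \sum_(l < n) eta * eta * (6 * ((r / 2)^-1 * (r^-1 * B))).
have f2 k : nm (D2 x h (p k) - \sum_j \sum_l h 0 j * h 0 l * ps_eval (dps l (dps j c)) x)
    <= A2 / 2 ^+ k.
  rewrite /D2 -sumrB; apply: le_trans (nm_sum _ _ _) _; rewrite /A2 mulr_suml.
  apply: ler_sum => j _; rewrite -sumrB; apply: le_trans (nm_sum _ _ _) _.
  rewrite mulr_suml; apply: ler_sum => l _; rewrite -mulrBr nmM -mulrA nmM.
  by apply: ler_pM; rewrite ?mulr_ge0 ?nm_ge0 // ler_pM ?nm_ge0.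
set S1 := \sum_j _ in f1 *; set S2 := \sum_j _ in f2 *; set F := _ - ps_eval c x in f0 *.
have sub2 (a b a' b' : C) (u v w : R) : nm (a - a') <= u / w -> nm (b - b') <= v / w ->
    nm (a - b - (a' - b')) <= (u + v) / w.
  move=> ha hb; have -> : a - b - (a' - b') = (a - a') - (b - b').
    by rewrite !opprB addrACA [RHS]addrACA; congr (_ + _); rewrite addrC.
  by apply: le_trans (nmB _ _) _; rewrite mulrDl lerD.
split.
- apply: (@nm_lim (fun k => ev (p k) (x + h) - ev (p k) x) _ _ A0) => // k.
  have [_ _ + _ _] := T k => hT; apply: le_trans hT _; rewrite ler_wpM2l //.
- apply: (@nm_lim (fun k => ev (p k) (x + h) - ev (p k) x - D1 x h (p k)) _ _ (A0 + A1)) => k.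
    have [_ _ _ + _] := T k => hT; apply: le_trans hT _; rewrite ler_wpM2l // exprn_ge0 //.
  exact: sub2.
apply: (@nm_lim (fun k => ev (p k) (x + h) - ev (p k) x - D1 x h (p k) - 2^-1 * D2 x h (p k))
   _ _ (A0 + A1 + A2)) => k.
  have [_ _ _ _ +] := T k => hT; apply: le_trans hT _; rewrite ler_wpM2l // exprn_ge0 //.
apply: (sub2); first exact: sub2.
rewrite -mulrBr nmM; apply: le_trans (f2 k); rewrite ler_piMl ?nm_ge0 //.
by rewrite nmV nmn invf_le1 ?ler1n.
Qed.

End SeriesDerivative.

Section PartialDerivatives.
Variable R : realType.
Local Notation C := (Cplx R).

(** A limit along the steps 2^-N: it is a total function, and agrees with the partial
    derivative of any function that has a first-order expansion at x. *)
Definition pd n (j : 'I_n) (f : 'rV[C]_n -> C) (x : 'rV[C]_n) : C :=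
  limn (fun N => (f (x + 2 ^- N *: delta_mx 0 j) - f x) * 2 ^+ N).

(** First-order expansion at x with a quadratic remainder, which every analytic germ has. *)
Definition fderiv n (f : 'rV[C]_n -> C) (x : 'rV[C]_n) (g : 'I_n -> C) :=
  exists r B : R, 0 < r /\ forall eta h, 0 <= eta <= r -> small eta h ->
    nm (f (x + h) - f x - \sum_j h 0 j * g j) <= B * eta ^+ 2.

Lemma fderiv_pd n (f : 'rV[C]_n -> C) x g j : fderiv f x g -> pd j f x = g j.
Proof.
case=> r [B [r0 hf]]; have [N0 hN0] := geom_small 1 r0.
apply: (@lim_geom_near _ _ _ B N0) => N hN.
have e0 : 0 <= 1 / 2 ^+ N :> R by rewrite divr_ge0 ?exprn_ge0.
have nm2 : nm (2 ^- N : C) = 1 / 2 ^+ N by rewrite div1r nmV nmX nmn.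
have := hf (1 / 2 ^+ N) (2 ^- N *: delta_mx 0 j : 'rV[C]_n).
rewrite e0 hN0 // => /(_ isT).
have sm : small (1 / 2 ^+ N) (2 ^- N *: delta_mx 0 j : 'rV[C]_n).
  move=> i; rewrite !mxE nmM nm2 eqxx /=; case: eqP => _; first by rewrite nm1 mulr1.
  by rewrite nm0 mulr0.
move=> /(_ sm); rewrite (bigD1 j) //= big1 ?addr0 => [|i ij]; last first.
  by rewrite !mxE (negPf ij) andbF mulr0 mul0r.
rewrite !mxE !eqxx mulr1; set D := f _ - _ => h.
have p2 : (2 ^+ N : C) != 0 by rewrite expf_neq0 // pnatr_eq0.
have -> : D * 2 ^+ N - g j = (D - 2 ^- N * g j) * 2 ^+ N.
  by rewrite [RHS]mulrBl [X in _ = _ - X]mulrAC mulVf // mul1r.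
rewrite nmM nmX nmn; have p0 : 0 < 2 ^+ N :> R by rewrite exprn_gt0.
rewrite -ler_pdivlMr //; apply: le_trans h _.
by rewrite div1r expr2 mulrA.
Qed.

Lemma near_near n (P : 'rV[C]_n -> Prop) :
  (\forall t \near (0 : 'rV[C]_n), P t) ->
  \forall t \near (0 : 'rV[C]_n), \forall q \near t, P q.
Proof.
move=> /near0P [r [r0 hr]]; apply/near0P; exists (r / 2); split; first by rewrite divr_gt0.
move=> t st; apply/nearP; exists (r / 2); split; first by rewrite divr_gt0.
move=> h sh; apply: hr => i; rewrite mxE; apply: le_trans (nmD _ _) _.
by have := st i; have := sh i; lra.
Qed.

Lemma rep_taylor n (c : power_series R n) f : rep c f ->
  exists r B : R, 0 < r /\ forall x, small r x ->
  forall eta h, 0 <= eta <= r -> small eta h ->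
  [/\ nm (f (x + h) - f x) <= B * eta,
   nm (f (x + h) - f x - \sum_j h 0 j * ps_eval (dps j c) x) <= B * eta ^+ 2 &
   nm (f (x + h) - f x - \sum_j h 0 j * ps_eval (dps j c) x
       - 2^-1 * \sum_j \sum_l h 0 j * h 0 l * ps_eval (dps l (dps j c)) x)
     <= B * eta ^+ 3].
Proof.
move=> /repP [r [B [r0 hB hf]]]; pose k := (r / 8)^-1.
have B0 := bnd_ge0 (ltW r0) hB.
have k0 : 0 <= k by rewrite invr_ge0 divr_ge0 // ltW.
exists (r / 16), (B * (1 + k) ^+ 3); split; first by rewrite divr_gt0.
move=> x sx eta h he sh; have [h1 h2 h3] := series_taylor r0 hB sx he sh.
have kk i : (i <= 3)%N -> k ^+ i <= (1 + k) ^+ 3.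
  move=> i3; apply: le_trans (_ : (1 + k) ^+ i <= _).
    by rewrite lerXn2r // ?nnegrE ?addr_ge0 // lerDr.
  by rewrite ler_weXn2l // lerDl.
have [eta0 _] := andP he.
have key i : (i <= 3)%N -> (eta / (r / 8)) ^+ i * B <= B * (1 + k) ^+ 3 * eta ^+ i.
  move=> i3; rewrite exprMn mulrC -mulrA ler_wpM2l // mulrC ler_wpM2r ?exprn_ge0 //.
  exact: kk.
have ex : f x = ps_eval c x.
  by apply: hf; apply: small_le sx; have := ltW r0; lra.
have exh : f (x + h) = ps_eval c (x + h).
  apply: hf => i; rewrite mxE; apply: le_trans (nmD _ _) _.
  by have := sx i; have := sh i; have /andP[_] := he; have := ltW r0; lra.
rewrite ex exh; split.
- by apply: le_trans h1 _; have := key 1%N isT; rewrite !expr1.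
- by apply: le_trans h2 _; exact: key.
- by apply: le_trans h3 _; exact: key.
Qed.

Lemma rep_fderiv n (c : power_series R n) f : rep c f ->
  \forall x \near (0 : 'rV[C]_n), fderiv f x (fun j => ps_eval (dps j c) x).
Proof.
move=> /rep_taylor [r [B [r0 h]]]; apply/near0P; exists r; split=> // x sx.
exists r, B; split=> // eta t he st.
by have [_ h2 _] := h x sx eta t he st.
Qed.

Lemma rep_pd n (c : power_series R n) f j : rep c f -> rep (dps j c) (pd j f).
Proof.
move=> hc; split.
  case: hc => /ps_convergentP [r [B [r0 hB]]] _; apply/ps_convergentP.
  exists (r / 2), (r^-1 * B); split; first by rewrite divr_gt0.
  exact: bnd_dps.
by apply: filterS (rep_fderiv hc) => x /fderiv_pd ->.
Qed.

Lemma an_pd n (f : 'rV[C]_n -> C) j : an f -> an (pd j f).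
Proof. by case=> c hc; exists (dps j c); exact: rep_pd. Qed.

Lemma an_fderiv n (f : 'rV[C]_n -> C) : an f ->
  \forall x \near (0 : 'rV[C]_n), fderiv f x (fun j => pd j f x).
Proof.
case=> c hc; apply: filterS (rep_fderiv hc) => x hx.
suff -> : (fun j => pd j f x) = (fun j => ps_eval (dps j c) x) by [].
by apply/funext => j; exact: fderiv_pd hx.
Qed.

Lemma an_taylor n (f : 'rV[C]_n -> C) : an f ->
  exists r B : R, 0 < r /\ forall x, small r x ->
  forall eta h, 0 <= eta <= r -> small eta h ->
  [/\ nm (f (x + h) - f x) <= B * eta,
   nm (f (x + h) - f x - \sum_j h 0 j * pd j f x) <= B * eta ^+ 2 &
   nm (f (x + h) - f x - \sum_j h 0 j * pd j f x
       - 2^-1 * \sum_j \sum_l h 0 j * h 0 l * pd l (pd j f) x) <= B * eta ^+ 3].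
Proof.
case=> c hc; have [r [B [r0 h]]] := rep_taylor hc.
have h1 : \forall x \near (0 : 'rV[C]_n), forall j, pd j f x = ps_eval (dps j c) x.
  by apply: filterS (rep_fderiv hc) => x hx j; exact: fderiv_pd hx.
have h2 j : \forall x \near (0 : 'rV[C]_n), forall l,
    pd l (pd j f) x = ps_eval (dps l (dps j c)) x.
  by apply: filterS (rep_fderiv (rep_pd j hc)) => x hx l; exact: fderiv_pd hx.
have h3 : \forall x \near (0 : 'rV[C]_n), forall j l,
    pd l (pd j f) x = ps_eval (dps l (dps j c)) x.
  by apply: (filter_forall (f := fun j x => forall l,
    pd l (pd j f) x = ps_eval (dps l (dps j c)) x)) h2.
have [s [s0 hs]] := (near0P _).1 (filterI h1 h3).
exists (Order.min r s), B; split=> [|x sx eta t]; first by rewrite lt_min r0.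
rewrite le_min => /andP[e0 /andP[er _]] st.
have sxr : small r x by apply: small_le sx; rewrite ge_min lexx.
have sxs : small s x by apply: small_le sx; rewrite ge_min lexx orbT.
have [e1 e3] := hs x sxs.
have := h x sxr eta t; rewrite e0 er => /(_ isT st).
have -> : \sum_j t 0 j * pd j f x = \sum_j t 0 j * ps_eval (dps j c) x.
  by apply: eq_bigr => j _; rewrite e1.
suff -> : \sum_j \sum_l t 0 j * t 0 l * pd l (pd j f) x
    = \sum_j \sum_l t 0 j * t 0 l * ps_eval (dps l (dps j c)) x by [].
by apply: eq_bigr => j _; apply: eq_bigr => l _; rewrite e3.
Qed.

Lemma an_continuous n (f : 'rV[C]_n -> C) : an f -> forall e : R, 0 < e ->
  \forall x \near (0 : 'rV[C]_n), nm (f x - f 0) <= e.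
Proof.
move=> /an_taylor [r [B [r0 h]]] e e0; apply/near0P.
pose d := Order.min r (e / (1 + `|B|)).
have d0 : 0 < d by rewrite lt_min r0 divr_gt0 // ltr_pwDl.
exists d; split=> // x sx.
have := h 0 (small0 (ltW r0)) d x; rewrite (ltW d0) ge_min lexx => /(_ isT sx) [h1 _ _].
rewrite add0r in h1; apply: le_trans h1 _.
have hd : d <= e / (1 + `|B|) by rewrite ge_min lexx orbT.
have b1 : 0 < 1 + `|B| by rewrite ltr_pwDl.
rewrite ler_pdivlMr // in hd; apply: le_trans hd; rewrite mulrC ler_wpM2l ?(ltW d0) //.
by apply: le_trans (ler_norm B) _; rewrite lerDr.
Qed.

(** Induction on the degree: the constant terms are the values at the origin, and the
    other coefficients are coefficients of the derivatives. *)
Lemma rep_inj n (c d : power_series R n) f : rep c f -> rep d f -> c = d.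
Proof.
move=> hc hd; apply/funext => a; move: {2}(mdegree a) (erefl (mdegree a)) => k.
elim: k c d f hc hd a => [|k IH] c d f hc hd a ha.
  have -> : a = [ffun=> 0%N].
    apply/ffunP => i; rewrite ffunE; apply/eqP; rewrite -leqn0 -ha.
    by rewrite /mdegree (bigD1 i) //= leq_addr.
  by rewrite -(rep_at0 hc) -(rep_at0 hd).
have [j aj] : exists j, (0 < a j)%N.
  apply/existsP; rewrite -[[exists _, _]]negbK negb_exists; apply/negP => /forallP h0.
  move: ha; rewrite /mdegree big1 // => i _; apply/eqP; by rewrite -leqn0 leqNgt h0.
pose b : {ffun 'I_n -> nat} := [ffun i => (a i - (i == j))%N].
have hb : [ffun i => (b i + (i == j))%N] = a.
  apply/ffunP => i; rewrite !ffunE; case: eqP => [->|_]; first by rewrite subnK.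
  by rewrite subn0 addn0.
have db : mdegree b = k.
  move: ha; rewrite -hb /mdegree (eq_bigr (fun i => b i + (i == j))%N) => [|i _]; last first.
    by rewrite ffunE.
  have s1 : (\sum_(i < n) (i == j) = 1)%N.
    by rewrite (bigD1 j) //= eqxx big1 // => i /negPf ->.
  by rewrite big_split /= s1 addn1 => -[].
have := IH _ _ _ (rep_pd j hc) (rep_pd j hd) b db.
rewrite /dps hb => e; apply: (@mulIf C ((b j).+1)%:R); first by rewrite pnatr_eq0.
by rewrite !mulr_natr.
Qed.

Lemma pd_comm0 n (f : 'rV[C]_n -> C) j l : an f ->
  \forall x \near (0 : 'rV[C]_n), pd l (pd j f) x = pd j (pd l f) x.
Proof.
case=> c hc.
have [_ h1] := rep_pd l (rep_pd j hc); have [_ h2] := rep_pd j (rep_pd l hc).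
apply: filterS2 h1 h2 => x -> ->; congr (ps_eval _ x); apply/funext => a.
rewrite /dps -!mulrnA; congr (c _ *+ _).
  by apply/ffunP => i; rewrite !ffunE addnAC.
by rewrite !ffunE; case: eqP => [->|] ; rewrite ?eqxx //= => /eqP ne;
   rewrite eq_sym (negPf ne) !addn0 mulnC.
Qed.

End PartialDerivatives.

(** * Solving v = h (t, v) *)

Section ImplicitPolynomials.
Variables (R : realType) (n : nat).
Local Notation C := (Cplx R).
Implicit Types (S : mpoly n C) (p : mpoly (n + 1) C) (a : multinom (n + 1)).
Local Notation last := (rshift n (ord0 : 'I_1)).

(** Substitution of S for the last variable. *)
Definition graph_tuple S : (n + 1).-tuple (mpoly n C) :=
  [tuple match fintype.split i with inl j => mpolyX C (mnm1 j) | inr _ => S end | i < n + 1].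

Lemma graph_tupleL S j : tnth (graph_tuple S) (lshift 1 j) = mpolyX C (mnm1 j).
Proof. by rewrite tnth_mktuple (unsplitK (inl j)). Qed.

Lemma graph_tupleR S : tnth (graph_tuple S) last = S.
Proof. by rewrite tnth_mktuple (unsplitK (inr ord0)). Qed.

Lemma ev_graph S p (t : 'rV[C]_n) :
  ev (comp_mpoly (graph_tuple S) p) t = ev p (row_mx t (const_mx (ev S t))).
Proof.
rewrite ev_comp; congr (ev p _); apply/rowP => i; rewrite mxE tnth_mktuple mxE.
by case: (fintype.split i) => j; rewrite ?mxE // /ev mevalXU.
Qed.

Lemma prod_graph S a : \prod_(i < n + 1) tnth (graph_tuple S) i ^+ a i =
  (\prod_(j < n) mpolyX C (mnm1 j) ^+ a (lshift 1 j)) * S ^+ a last.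
Proof.
rewrite big_split_ord big_ord1 graph_tupleR; congr (_ * _).
by apply: eq_bigr => j _; rewrite graph_tupleL.
Qed.

Lemma mdeg_split a : mdeg a = ((\sum_(j < n) a (lshift 1 j)) + a last)%N.
Proof. by rewrite mdegE big_split_ord big_ord1. Qed.

Lemma mdeg_last a : (0 < a last)%N -> (mdeg a <= 1)%N -> a = mnm1 last.
Proof.
move=> a0 a1; have e : mdeg a == 1%N.
  by rewrite eqn_leq a1 mdeg_split (leq_trans a0) ?leq_addl.
have /mdeg1P [i /eqP ai] := e; move: a0; rewrite ai mnm1E.
by case: eqP => [->|].
Qed.

(** Without the monomial v alone, every monomial with a factor v has another factor that
    vanishes at the origin: one degree is gained at each iteration. *)
Lemma ord_graph_gain S S' p k : ord 1 S -> ord 1 S' -> ord k (S - S') ->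
    mcoeff (mnm1 last) p = 0 ->
  ord k.+1 (comp_mpoly (graph_tuple S) p - comp_mpoly (graph_tuple S') p).
Proof.
move=> oS oS' od p1; rewrite !comp_mpolyE -sumrB big_seq; apply: ord_sum => a.
rewrite mcoeff_msupp => ap; rewrite -scalerBr; apply: ordZ.
rewrite !prod_graph -mulrBr.
have [->|a0] := posnP (a last); first by rewrite !expr0 subrr mulr0; exact: ord_zero.
have oX (j : 'I_n) : ord 1 (mpolyX C (mnm1 j) : mpoly n C).
  by have := @ord_mono R n (mnm1 j); rewrite mdeg1.
have oP : ord (\sum_(j < n) a (lshift 1 j))
    (\prod_(j < n) mpolyX C (mnm1 j) ^+ a (lshift 1 j) : mpoly n C).
  elim/big_rec2: _ => [|i d q _ h]; first exact: ord0p.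
  by apply: ordM => //; exact: ordX.
have dvd : ord (k + (a last).-1) (S ^+ a last - S' ^+ a last).
  rewrite -(prednK a0) subrXX; apply: ordM => //=; apply: ord_sum => i _.
  have hi : (((a last).-1.+1.-1 - i) + i = (a last).-1)%N.
    by rewrite /= subnK // -ltnS ltn_ord.
  by rewrite -[X in ord X _]hi; apply: ordM; exact: ordX.
apply: (ordW _ (ordM oP dvd)).
have : (1 < mdeg a)%N.
  rewrite ltnNge; apply/negP => a1.
  by move: ap; rewrite (mdeg_last a0 a1) p1 eqxx.
by rewrite mdeg_split; case: (a last) a0 => // b _; rewrite addnS ltnS /= => h;
   rewrite addnCA -addn1 leq_add2l.
Qed.

(** The monomials of p have a factor t or at least two factors: on a small polydisc the
    substitution therefore shrinks the norm by e. *)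
Lemma nrm_graph_gain r delta r0 e S p : 0 < r -> r <= delta -> delta <= r0 ->
    r <= e * r0 -> delta ^+ 2 <= e * r0 ^+ 2 -> nrm r S <= delta ->
    mcoeff (mnm0 (n := n + 1)) p = 0 -> mcoeff (mnm1 last) p = 0 ->
  nrm r (comp_mpoly (graph_tuple S) p) <= e * nrm r0 p.
Proof.
move=> rp rd dr0 h1 h2 hS p0 p1; have rge := ltW rp.
have d0 : 0 < delta by exact: lt_le_trans rd.
have r00 : 0 < r0 by exact: lt_le_trans dr0.
have e0 : 0 <= e by rewrite -(pmulr_lge0 _ r00); exact: le_trans h1.
rewrite comp_mpolyE (le_trans (nrm_sum _ _ _ rge)) // /nrm mulr_sumr.
rewrite big_seq [X in _ <= X]big_seq; apply: ler_sum => a.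
rewrite mcoeff_msupp => ap; apply: le_trans (nrmZ _ _ rge) _.
rewrite mulrCA ler_wpM2l ?nm_ge0 // prod_graph.
apply: le_trans (nrmM _ _ rge) _.
have k1 : nrm r (\prod_(j < n) mpolyX C (mnm1 j) ^+ a (lshift 1 j) : mpoly n C)
    <= r ^+ (\sum_(j < n) a (lshift 1 j)).
  rewrite (le_trans (nrm_prod _ _ _ rge)) // -prodrXr; apply: ler_prod => j _.
  rewrite nrm_ge0 //=; apply: le_trans (nrm_exp _ _ rge) _.
  by rewrite nrmX mdeg1 expr1.
have k2 : nrm r (S ^+ a last) <= delta ^+ a last.
  apply: le_trans (nrm_exp _ _ rge) _.
  by rewrite lerXn2r ?nnegrE ?nrm_ge0 // ltW.
apply: le_trans (ler_pM (nrm_ge0 _ rge) (nrm_ge0 _ rge) k1 k2) _.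
rewrite mdeg_split; set b := (\sum_(j < n) _)%N.
have hb : (0 < b + a last)%N.
  rewrite lt0n; apply/negP => /eqP h; move: ap.
  have /eqP : mdeg a = 0%N by rewrite mdeg_split.
  by rewrite mdeg_eq0 => /eqP ->; rewrite p0 eqxx.
have [al0|al0] := posnP (a last).
  rewrite al0 expr0 mulr1 addn0; move: hb; rewrite al0 addn0; case: b {k1} => // b _.
  rewrite !exprS mulrA; apply: ler_pM => //; first by rewrite exprn_ge0.
  by rewrite lerXn2r ?nnegrE // ?(ltW r00) // (le_trans rd).
have hb2 : (1 < b + a last)%N.
  rewrite ltnNge; apply/negP => a1; move: ap.
  by rewrite (mdeg_last al0) ?mdeg_split // p1 eqxx.
apply: (@le_trans _ _ (delta ^+ (b + a last))).
  rewrite exprD ler_wpM2r ?exprn_ge0 ?(ltW d0) //.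
  by rewrite lerXn2r ?nnegrE // ltW.
rewrite -(subnK hb2); set q := (_ - 2)%N; rewrite !exprD [X in _ <= X]mulrCA.
apply: ler_pM => //; rewrite ?exprn_ge0 ?(ltW d0) //.
by rewrite lerXn2r ?nnegrE // ltW.
Qed.

End ImplicitPolynomials.

Section ImplicitFunction.
Variable R : realType.
Local Notation C := (Cplx R).

(** The point (t, v), for a distinguished last variable v. *)
Definition app1 n (t : 'rV[C]_n) (v : C) : 'rV[C]_(n + 1) := row_mx t (const_mx v).
Notation last n := (rshift n (ord0 : 'I_1)).

Lemma small_app1 n r (t : 'rV[C]_n) v : small r t -> nm v <= r -> small r (app1 t v).
Proof.
by move=> st sv i; rewrite /app1 mxE; case: fintype.split => j; rewrite ?mxE.
Qed.

Lemma app1_last n (t : 'rV[C]_n) v : app1 t v 0 (last n) = v.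
Proof. by rewrite /app1 row_mxEr mxE. Qed.

Lemma app1_0 n : app1 (0 : 'rV[C]_n) 0 = 0.
Proof. by apply/rowP => i; rewrite !mxE; case: fintype.split => j; rewrite mxE. Qed.

(** The iterates S_(k+1) = h_(k+1) (t, S_k) of the truncations h_k are stationary degree
    by degree and uniformly bounded, since h has no constant term and no term linear in
    v alone. *)
Lemma an_fixpoint n (h : 'rV[C]_(n + 1) -> C) : an h -> h 0 = 0 ->
    pd (last n) h 0 = 0 ->
  exists s, [/\ an s, s 0 = 0 &
    \forall t \near (0 : 'rV[C]_n), s t = h (app1 t (s t))].
Proof.
move=> [c hc] h0 dh0.
have c0 k : mcoeff (mnm0 (n := n + 1)) (trunc k c) = 0.
  rewrite coef_trunc; case: ifP => // _; rewrite -h0 (rep_at0 hc).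
  by congr (c _); apply/ffunP => j; rewrite !ffunE mnm0E.
have c1 k : mcoeff (mnm1 (last n)) (trunc k c) = 0.
  rewrite coef_trunc; case: ifP => // _.
  rewrite -dh0 (rep_at0 (rep_pd _ hc)) /dps ffunE mulr1n.
  by congr (c _); apply/ffunP => j; rewrite !ffunE mnm1E add0n eq_sym.
have [r0 [H [r00 hH hh]]] := rep_trunc hc.
have H0 := bnd_ge0 (ltW r00) hH.
have H1 : 0 < H + 1 by lra.
(* delta bounds the iterates: a substitution gains the factor e, with e H <= delta, and
   delta^2 <= e r0^2 controls the monomials of degree 2 *)
pose delta := Order.min (r0 / 4) (r0 ^+ 2 / (H + 1)).
have d0 : 0 < delta by rewrite lt_min !divr_gt0 ?exprn_gt0.
pose e := delta / (H + 1).
have e0 : 0 < e by rewrite divr_gt0.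
pose r := Order.min delta (e * r0).
have rp : 0 < r by rewrite lt_min d0 mulr_gt0.
have dr : delta <= r0 / 4 by rewrite ge_min lexx.
have dr0 : delta <= r0 by have := ltW r00; lra.
have rd : r <= delta by rewrite ge_min lexx.
have h1 : r <= e * r0 by rewrite ge_min lexx orbT.
have h2 : delta ^+ 2 <= e * r0 ^+ 2.
  have hd : delta <= r0 ^+ 2 / (H + 1) by rewrite ge_min lexx orbT.
  by rewrite /e [X in X <= _]expr2 -mulrA ler_pM2l // mulrC.
have eH : e * H <= delta.
  by rewrite /e -mulrA mulrC ler_piMl ?(ltW d0) // mulrC ler_pdivrMr //; lra.
pose S := fix S k := if k is k'.+1 then comp_mpoly (graph_tuple (S k')) (trunc k'.+1 c)
  else (0 : mpoly n C).
have SS k : S k.+1 = comp_mpoly (graph_tuple (S k)) (trunc k.+1 c) by [].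
have nS k : nrm r (S k) <= delta.
  elim: k => [|k IH]; first by rewrite nrm0 ltW.
  rewrite SS; apply: le_trans (nrm_graph_gain rp rd dr0 h1 h2 IH (c0 _) (c1 _)) _.
  by apply: le_trans eH; rewrite ler_wpM2l // ltW.
have o1 (T : mpoly n C) k : ord 1 T -> ord 1 (comp_mpoly (graph_tuple T) (trunc k c)).
  move=> oT; apply: ord_comp => [i|].
    rewrite tnth_mktuple; case: fintype.split => // j.
    by have := @ord_mono R n (mnm1 j); rewrite mdeg1.
  by move=> a; rewrite ltnS leqn0 mdeg_eq0 => /eqP ->.
have oS k : ord 1 (S k).
  by elim: k => [|k IH]; [exact: ord_zero | rewrite SS; exact: o1].
have stat k : ord k (S k.+1 - S k).
  elim: k => [|k IH]; first exact: ord0p.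
  have -> : S k.+2 - S k.+1 = comp_mpoly (graph_tuple (S k.+1)) (trunc k.+2 c - trunc k.+1 c)
      + (comp_mpoly (graph_tuple (S k.+1)) (trunc k.+1 c)
         - comp_mpoly (graph_tuple (S k)) (trunc k.+1 c)).
    by rewrite comp_mpolyB !SS addrA subrK.
  apply: ordD; last exact: ord_graph_gain.
  apply: ord_comp => [i|]; last exact: ord_trunc.
  rewrite tnth_mktuple; case: fintype.split => // j.
  by have := @ord_mono R n (mnm1 j); rewrite mdeg1.
have [d [hd bd Sd]] := polylim_stable (ltW rp) nS stat.
pose s t := ps_eval d t.
have rs : rep d s by apply: repI rp bd _.
exists s; split; first by exists d.
  rewrite (rep_at0 rs) -(oS 1%N (mnm0 (n := n))) ?mdeg0 //.
  rewrite (hd 1%N) ?mdeg0 //; congr (d _); apply/ffunP => j; by rewrite !ffunE mnm0E.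
apply/near0P; exists (r / 2); split=> [|t st]; first by rewrite divr_gt0.
have str : small delta t.
  by apply: small_le st; have := ltW rp; lra.
have evS k : nm (ev (S k) t) <= delta.
  apply: le_trans (nS k); apply: ev_le; first exact: ltW.
  by apply: small_le st; have := ltW rp; lra.
have ns : nm (s t) <= delta.
  by apply: (@nm_lim R (fun k => ev (S k) t) _ _ (6 * delta)) => // k; exact: Sd.
have sx : small delta (app1 t (s t)) by exact: small_app1.
apply/eqP; rewrite -subr_eq0; apply/eqP.
(* three errors: s t against the iterate k + 1, the truncation of h at y against its value
   at x, and the truncation against h *)
apply: (@nm_geom0 _ _ (6 * delta + 6 * H + 4 * H)) => k.
pose x := app1 t (s t); pose y := app1 t (ev (S k) t).
have hyx : small (6 * delta / 2 ^+ k) (y - x).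
  move=> i; rewrite /y /x /app1 !mxE; case: fintype.split => j; rewrite ?mxE ?subrr ?nm0.
    by rewrite divr_ge0 ?exprn_ge0 // mulr_ge0 // ltW.
  exact: Sd.
have exy : x + (y - x) = y by rewrite addrC subrK.
have sxy : small delta (x + (y - x)) by rewrite exy; apply: small_app1.
have eta0 : 0 <= 6 * delta / 2 ^+ k by rewrite divr_ge0 ?exprn_ge0 // mulr_ge0 // ltW.
have [_ _ + _ _] := taylorP (ltW d0) eta0 d0 sx sxy hyx (trunc k.+1 c).
rewrite exy => k1.
have k2 : nm (ev (trunc k.+1 c) x - h x) <= 4 * H / 2 ^+ k.
  apply: le_trans (hh x _ k.+1) _; first by apply: small_le sx; have := ltW r00; lra.
  rewrite ler_wpM2l ?mulr_ge0 // lef_pV2 ?posrE ?exprn_gt0 // exprS.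
  by rewrite ler_peMl ?exprn_ge0 // ler1n.
have k3 := Sd t st k.+1.
have k4 : nm (s t - ev (S k.+1) t) <= 6 * delta / 2 ^+ k.
  rewrite nmC; apply: le_trans k3 _.
  rewrite ler_wpM2l ?mulr_ge0 ?(ltW d0) // lef_pV2 ?posrE ?exprn_gt0 // exprS.
  by rewrite ler_peMl ?exprn_ge0 // ler1n.
have k5 : nm (ev (trunc k.+1 c) y - ev (trunc k.+1 c) x) <= 6 * H / 2 ^+ k.
  apply: le_trans k1 _.
  have h3 : nrm (delta + delta) (trunc k.+1 c) <= H.
    by apply: le_trans (hH k.+1); apply: nrm_le; [have := ltW d0; lra | lra].
  have -> : 6 * delta / 2 ^+ k / delta = 6 / 2 ^+ k.
    by rewrite mulrAC mulfK // gt_eqF.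
  by rewrite [X in _ <= X]mulrAC ler_wpM2l // divr_ge0 ?exprn_ge0.
have -> : s t - h x = (s t - ev (S k.+1) t)
    + (ev (trunc k.+1 c) y - ev (trunc k.+1 c) x) + (ev (trunc k.+1 c) x - h x).
  by rewrite SS ev_graph -/(app1 _ _) -/y !addrA !subrK.
apply: le_trans (nmD _ _) _.
apply: le_trans (lerD (le_trans (nmD _ _) (lerD k4 k5)) k2) _.
by rewrite -!mulrDl.
Qed.

(** The derivative of h in v is small near the origin, which makes v |-> h (t, v) a
    contraction. *)
Lemma fixpoint_unique n (h : 'rV[C]_(n + 1) -> C) : an h ->
    pd (last n) h 0 = 0 ->
  exists rho : R, 0 < rho /\ forall t v w, small rho t -> nm v <= rho -> nm w <= rho ->
    v = h (app1 t v) -> w = h (app1 t w) -> v = w.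
Proof.
move=> ah dh0; have [r [B [r0 hT]]] := an_taylor ah.
have q0 : 0 < 4^-1 :> R by rewrite invr_gt0.
have /near0P [r1 [r10 hc]] := an_continuous (an_pd (last n) ah) q0.
pose b := 1 + `|B|; have b0 : 0 < b by rewrite ltr_pwDl.
pose rho := Order.min (Order.min (r / 2) r1) (8 * b)^-1.
have rho0 : 0 < rho by rewrite !lt_min r10 divr_gt0 // invr_gt0 mulr_gt0.
exists rho; split=> // t v w st sv sw ev ew.
have rho_r : rho <= r / 2 by rewrite !ge_min lexx.
have rho_r1 : rho <= r1 by rewrite !ge_min lexx orbT.
have rho_b : rho * b <= 8^-1.
  have : rho <= (8 * b)^-1 by rewrite !ge_min lexx orbT.
  by rewrite invfM => hb; rewrite -ler_pdivlMr.
have sx : small rho (app1 t w) by exact: small_app1.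
set eta := nm (v - w).
have eta_r : eta <= 2 * rho by apply: le_trans (nmB _ _) _; lra.
have sxr : small r (app1 t w) by apply: small_le sx; have := ltW r0; lra.
have sh : small eta (app1 (0 : 'rV[C]_n) (v - w)).
  by apply: small_app1 => //; apply: small0; exact: nm_ge0.
have := hT _ sxr eta _ _ sh; rewrite nm_ge0 (_ : eta <= r) //; last first.
  by apply: le_trans eta_r _; lra.
move=> /(_ isT) [_ + _].
have -> : app1 t w + app1 0 (v - w) = app1 t v.
  apply/rowP => i; rewrite !mxE; case: fintype.split => j; rewrite ?mxE ?addr0 //.
  by rewrite addrC subrK.
rewrite -ev -ew big_split_ord big_ord1 /= big1 => [|i _]; last first.
  by rewrite /app1 row_mxEl mxE mul0r.
rewrite add0r app1_last => k1.
have k2 := hc _ (small_le rho_r1 sx); rewrite dh0 subr0 in k2.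
have k3 : eta <= B * eta ^+ 2 + eta * 4^-1.
  have e : v - w = (v - w - (v - w) * pd (last n) h (app1 t w))
    + (v - w) * pd (last n) h (app1 t w) by rewrite subrK.
  rewrite {1}/eta {1}e; apply: le_trans (nmD _ _) _; apply: lerD => //.
  by rewrite nmM ler_wpM2l ?nm_ge0.
have k4 : B * eta ^+ 2 <= eta * 4^-1.
  apply: (@le_trans _ _ (b * eta ^+ 2)).
    rewrite ler_wpM2r ?exprn_ge0 ?nm_ge0 //; apply: le_trans (ler_norm B) _.
    by rewrite lerDr.
  rewrite expr2 mulrCA ler_wpM2l ?nm_ge0 //.
  have : b * eta <= b * (2 * rho) by rewrite ler_wpM2l // ltW.
  by have := rho_b; rewrite mulrC; lra.
have eta0 : eta <= 0 by have := nm_ge0 (v - w); rewrite -/eta; lra.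
by apply/eqP; rewrite -subr_eq0; apply/eqP; apply: nm_le0.
Qed.

End ImplicitFunction.

(** * One-variable derivatives and implicit functions *)

Section OneVariable.
Variable R : realType.
Local Notation C := (Cplx R).

(** The derivative at the origin of a function of one complex variable, again with a
    quadratic remainder. *)
Definition cd (f : C -> C) (a : C) := exists r B : R, 0 < r /\
  forall tau, nm tau <= r -> nm (f tau - f 0 - tau * a) <= B * nm tau ^+ 2.

Lemma cd_unique f a b : cd f a -> cd f b -> a = b.
Proof.
case=> r [B [r0 hr]] [s [D [s0 hs]]].
have m0 : 0 < Order.min r s by rewrite lt_min r0.
apply/eqP; rewrite -subr_eq0; apply/eqP; have [N0 hN] := geom_small 1 m0.
pose A := (B + D) / 2 ^+ N0; apply: (@nm_geom0 _ _ A) => N.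
pose tau : C := 2 ^- (N0 + N).
have nt : nm tau = 1 / 2 ^+ (N0 + N) by rewrite nmV nmX nmn div1r.
have tp : 0 < nm tau by rewrite nt divr_gt0 // exprn_gt0.
have : nm tau <= Order.min r s by rewrite nt; apply: hN; rewrite leq_addr.
rewrite le_min => /andP[tr ts]; have h1 := hr _ tr; have h2 := hs _ ts.
rewrite -(ler_pM2l tp) -nmM.
have -> : tau * (a - b) = (f tau - f 0 - tau * b) - (f tau - f 0 - tau * a).
  by rewrite mulrBr; move: (f tau - f 0) (tau * a) (tau * b) => u v w; ring.
apply: le_trans (nmB _ _) _.
have -> : nm tau * (A / 2 ^+ N) = (B + D) * nm tau ^+ 2.
  have -> : A / 2 ^+ N = (B + D) * nm tau.
    by rewrite nt div1r /A -mulrA -invfM -exprD.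
  by rewrite expr2 mulrCA.
by rewrite mulrDl addrC; apply: lerD.
Qed.

Lemma cd_eq f g a : (exists2 r : R, 0 < r & forall tau, nm tau <= r -> f tau = g tau) ->
  cd f a -> cd g a.
Proof.
case=> s s0 e [r [B [r0 hr]]]; exists (Order.min r s), B.
split=> [|tau]; first by rewrite lt_min r0.
rewrite le_min => /andP[tr ts]; rewrite -e // -(e 0) ?nm0 ?(ltW s0) //; exact: hr.
Qed.

Lemma cd_ext f g a : f =1 g -> cd f a -> cd g a.
Proof. by move=> e; apply: cd_eq; exists 1 => // tau _; exact: e. Qed.

Lemma cd_const b : cd (fun=> b) 0.
Proof.
by exists 1, 0; split=> // tau _; rewrite subrr mulr0 subr0 nm0 mul0r.
Qed.

Lemma cd_lin b c : cd (fun tau => b + tau * c) c.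
Proof.
exists 1, 0; split=> // tau _.
by rewrite !mul0r addr0 [b + _]addrC addrK subrr nm0.
Qed.

Lemma cd_id : cd id 1.
Proof. by apply: cd_ext (cd_lin 0 1) => tau; rewrite mulr1 add0r. Qed.

Lemma cd_zero f a : (exists2 r : R, 0 < r & forall tau, nm tau <= r -> f tau = 0) ->
  cd f a -> a = 0.
Proof.
by move=> h hf; apply: cd_unique hf _; apply: cd_eq (cd_const 0); case: h => r r0 e;
   exists r => // tau /e ->.
Qed.

Lemma cd_lip f a : cd f a -> exists r D : R, [/\ 0 < r, 0 <= D &
  forall tau, nm tau <= r -> nm (f tau - f 0) <= D * nm tau].
Proof.
case=> r [B [r0 hr]]; exists r, (`|B| * r + nm a); split=> //.
  by rewrite addr_ge0 ?nm_ge0 // mulr_ge0 // ltW.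
move=> tau tr; rewrite -[f tau - f 0](subrK (tau * a)).
apply: le_trans (nmD _ _) _; rewrite mulrDl nmM [X in _ <= _ + X]mulrC lerD2r.
apply: le_trans (hr _ tr) _; rewrite expr2 mulrA ler_wpM2r ?nm_ge0 //.
apply: (@le_trans _ _ (`|B| * nm tau)).
  by rewrite ler_wpM2r ?nm_ge0 ?ler_norm.
by rewrite ler_wpM2l.
Qed.

Lemma fderiv_le n (f : 'rV[C]_n -> C) x g : fderiv f x g ->
  exists r B : R, [/\ 0 < r, 0 <= B & forall eta h, 0 <= eta <= r -> small eta h ->
    nm (f (x + h) - f x - \sum_j h 0 j * g j) <= B * eta ^+ 2].
Proof.
case=> r [B [r0 hr]]; exists r, `|B|; split=> // eta h he sh.
by apply: le_trans (hr eta h he sh) _; rewrite ler_wpM2r ?ler_norm // exprn_ge0 //; case/andP: he.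
Qed.

Lemma cd_chain n (f : 'rV[C]_n -> C) (G : C -> 'rV[C]_n) g (a : 'I_n -> C) :
  fderiv f (G 0) g -> (forall i, cd (fun tau => G tau 0 i) (a i)) ->
  cd (fun tau => f (G tau)) (\sum_i a i * g i).
Proof.
move=> /fderiv_le [r [B [r0 B0 hr]]] hG.
have /choice [s hs] : forall i, exists s : R * R, [/\ 0 < s.1, 0 <= s.2 &
    forall tau, nm tau <= s.1 -> nm (G tau 0 i - G 0 0 i - tau * a i) <= s.2 * nm tau ^+ 2].
  move=> i; have [r' [B' [r'0 h]]] := hG i; exists (r', `|B'|); split; [by []|exact: normr_ge0|move=> tau ht].
  by apply: le_trans (h _ ht) _; rewrite ler_wpM2r ?ler_norm // exprn_ge0 // nm_ge0.
have /choice [d hd] : forall i, exists d : R * R, [/\ 0 < d.1, 0 <= d.2 &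
    forall tau, nm tau <= d.1 -> nm (G tau 0 i - G 0 0 i) <= d.2 * nm tau].
  by move=> i; have [r' [D h]] := cd_lip (hG i); exists (r', D).
have [s0 s00 hs0] := @common_radius R _ (fun i => (s i).1) (fun i => let: And3 h _ _ := hs i in h).
have [d0 d00 hd0] := @common_radius R _ (fun i => (d i).1) (fun i => let: And3 h _ _ := hd i in h).
pose D := 1 + \sum_i (d i).2.
have d2 i : 0 <= (d i).2 by case: (hd i).
have s2 i : 0 <= (s i).2 by case: (hs i).
have D1 : 1 <= D by rewrite lerDl sumr_ge0.
have dD i : (d i).2 <= D.
  by rewrite /D (bigD1 i) //= addrCA lerDl addr_ge0 // sumr_ge0.
have D0 : 0 < D by lra.
pose m := Order.min (Order.min s0 d0) (r / D).
exists m, (B * D ^+ 2 + \sum_i (s i).2 * nm (g i)).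
split; first by rewrite !lt_min s00 d00 divr_gt0.
move=> tau; rewrite !le_min -andbA => /and3P[ts td tr].
rewrite ler_pdivlMr // in tr.
have sm : small (D * nm tau) (G tau - G 0).
  move=> i; rewrite !mxE; have [_ _ h] := hd i.
  apply: le_trans (h _ (le_trans td (hd0 i))) _.
  by rewrite ler_wpM2r ?nm_ge0.
have := hr (D * nm tau) (G tau - G 0); rewrite mulr_ge0 ?nm_ge0 ?(ltW D0) //= mulrC tr.
move=> /(_ isT); rewrite mulrC => /(_ sm); rewrite (addrC (G 0)) subrK => h1.
have h2 : nm (\sum_j (G tau - G 0) 0 j * g j - tau * \sum_i a i * g i)
    <= (\sum_i (s i).2 * nm (g i)) * nm tau ^+ 2.
  rewrite mulr_sumr -sumrB mulr_suml; apply: le_trans (nm_sum _ _ _) _.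
  apply: ler_sum => i _; rewrite !mxE mulrA -mulrBl nmM mulrAC ler_wpM2r ?nm_ge0 //.
  by have [_ _ h] := hs i; apply: h; exact: le_trans ts (hs0 i).
have -> : f (G tau) - f (G 0) - tau * (\sum_i a i * g i)
  = (f (G tau) - f (G 0) - \sum_j (G tau - G 0) 0 j * g j)
    + (\sum_j (G tau - G 0) 0 j * g j - tau * \sum_i a i * g i) by rewrite addrA subrK.
apply: le_trans (nmD _ _) _; rewrite mulrDl; apply: lerD => //.
by apply: le_trans h1 _; rewrite exprMn mulrA.
Qed.

Lemma cd_fderiv n (f : 'rV[C]_n -> C) x g j : fderiv f x g ->
  cd (fun tau => f (x + tau *: delta_mx 0 j)) (g j).
Proof.
move=> hf; have hx : x + (0 : C) *: delta_mx 0 j = x by rewrite scale0r addr0.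
have := @cd_chain n f (fun tau => x + tau *: delta_mx 0 j) g (fun i => (i == j)%:R).
rewrite hx => /(_ hf); rewrite (bigD1 j) //= eqxx mul1r big1 ?addr0 => [|i /negPf ->].
  apply=> i; apply: cd_ext (cd_lin (x 0 i) _) => tau.
  by rewrite !mxE eqxx.
by rewrite mul0r.
Qed.

Lemma fderiv_mul_cd f h a b : cd f a -> cd h b ->
  cd (fun tau => f tau * h tau) (a * h 0 + f 0 * b).
Proof.
move=> hf hh.
have [r1 [B1 [r10 h1]]] := hf; have [r2 [B2 [r20 h2]]] := hh.
have [r3 [D1 [r30 D10 h3]]] := cd_lip hf; have [r4 [D2 [r40 D20 h4]]] := cd_lip hh.
pose m := Order.min (Order.min r1 r2) (Order.min r3 r4).
exists m, (`|B1| * nm (h 0) + nm (f 0) * `|B2| + D1 * D2).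
split; first by rewrite !lt_min r10 r20 r30.
move=> tau; rewrite !le_min => /andP[/andP[t1 t2] /andP[t3 t4]].
have -> : f tau * h tau - f 0 * h 0 - tau * (a * h 0 + f 0 * b)
  = (f tau - f 0 - tau * a) * h 0 + f 0 * (h tau - h 0 - tau * b)
    + (f tau - f 0) * (h tau - h 0).
  move: (f tau) (h tau) (f 0) (h 0) => ? ? ? ?; ring.
apply: le_trans (nmD _ _) _; rewrite [X in _ <= X]mulrDl; apply: lerD; last first.
  rewrite nmM expr2 mulrACA; apply: ler_pM; rewrite ?nm_ge0 ?h3 ?h4 //.
apply: le_trans (nmD _ _) _; rewrite [X in _ <= X]mulrDl !nmM; apply: lerD.
  rewrite mulrAC ler_wpM2r ?nm_ge0 //; apply: le_trans (h1 _ t1) _.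
  by rewrite ler_wpM2r ?ler_norm // exprn_ge0 // nm_ge0.
rewrite -mulrA ler_wpM2l ?nm_ge0 //; apply: le_trans (h2 _ t2) _.
by rewrite ler_wpM2r ?ler_norm // exprn_ge0 // nm_ge0.
Qed.

Lemma cd_add f h a b : cd f a -> cd h b -> cd (fun tau => f tau + h tau) (a + b).
Proof.
move=> [r1 [B1 [r10 h1]]] [r2 [B2 [r20 h2]]].
exists (Order.min r1 r2), (B1 + B2); split; first by rewrite lt_min r10.
move=> tau; rewrite le_min => /andP[t1 t2].
have -> : f tau + h tau - (f 0 + h 0) - tau * (a + b)
  = (f tau - f 0 - tau * a) + (h tau - h 0 - tau * b).
  move: (f tau) (h tau) (f 0) (h 0) => ? ? ? ?; ring.
by apply: le_trans (nmD _ _) _; rewrite [X in _ <= X]mulrDl; apply: lerD; [exact: h1|exact: h2].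
Qed.

Lemma cd_scale f a k : cd f a -> cd (fun tau => k * f tau) (k * a).
Proof.
move=> h; have := fderiv_mul_cd (cd_const k) h; by rewrite mul0r add0r.
Qed.

Lemma cd_conj f a : cd f a -> cd (fun tau => (f tau^*)^*) a^*.
Proof.
case=> r [B [r0 h]]; exists r, B; split=> // tau tr.
have := h tau^*; rewrite nmJ => /(_ tr) ht; apply: le_trans ht.
rewrite -nmJ !rmorphB rmorphM /= !conjCK rmorph0.
by [].
Qed.

End OneVariable.

Section GermComposition.
Variable R : realType.
Local Notation C := (Cplx R).

Lemma an_compose m n (f : 'rV[C]_m -> C) (G : 'rV[C]_n -> 'rV[C]_m) :
  an f -> (forall i, an (fun t => G t 0 i)) -> G 0 = 0 -> an (fun t => f (G t)).
Proof.
move=> hf hG G0; apply: (an_ext (f := fun t => f (\row_i G t 0 i))).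
  by move=> t; congr f; apply/rowP => i; rewrite mxE.
by apply: an_comp => // i; rewrite G0 mxE.
Qed.

Lemma near_compose m n (G : 'rV[C]_n -> 'rV[C]_m) (P : 'rV[C]_m -> Prop) :
  (forall i, an (fun t => G t 0 i)) -> G 0 = 0 ->
  (\forall x \near (0 : 'rV[C]_m), P x) -> \forall t \near (0 : 'rV[C]_n), P (G t).
Proof.
move=> hG G0 /near0P [r [r0 hP]].
have h : \forall t \near (0 : 'rV[C]_n), forall i, nm (G t 0 i - G 0 0 i) <= r.
  have hi i : \forall t \near (0 : 'rV[C]_n), nm (G t 0 i - G 0 0 i) <= r.
    by have := an_continuous (hG i) r0.
  exact: (filter_forall (f := fun i t => nm (G t 0 i - G 0 0 i) <= r)) hi.
by apply: filterS h => t ht; apply: hP => i; have := ht i; rewrite G0 mxE subr0.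
Qed.

Lemma conjmx_small n r (t : 'rV[C]_n) : small r t -> small r (conjmx t).
Proof. by move=> st i; rewrite mxE nmJ. Qed.

Lemma conjmxK m n (A : 'M[C]_(m, n)) : conjmx (conjmx A) = A.
Proof. by apply/matrixP => i j; rewrite !mxE conjCK. Qed.

Lemma conjmx0 m n : conjmx (0 : 'M[C]_(m, n)) = 0.
Proof. by apply/matrixP => i j; rewrite !mxE rmorph0. Qed.

Lemma near_conj n (P : 'rV[C]_n -> Prop) :
  (\forall t \near (0 : 'rV[C]_n), P t) -> \forall t \near (0 : 'rV[C]_n), P (conjmx t).
Proof.
move=> /near0P [r [r0 h]]; apply/near0P; exists r; split=> // t st.
by apply: h; exact: conjmx_small.
Qed.

(** The holomorphic germ with conjugate coefficients. *)
Definition cbar n (f : 'rV[C]_n -> C) t : C := (f (conjmx t))^*.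

Lemma cbar0 n (f : 'rV[C]_n -> C) : f 0 = 0 -> cbar f 0 = 0.
Proof. by rewrite /cbar conjmx0 => ->; rewrite rmorph0. Qed.

Lemma rep_cbar n (c : power_series R n) f : rep c f -> rep (fun a => (c a)^*) (cbar f).
Proof.
move=> /rep_trunc [r [B [r0 hB hf]]].
have ct k m : mcoeff m (trunc k (fun a => (c a)^*)) = (mcoeff m (trunc k c))^*.
  by rewrite !coef_trunc; case: ifP => // _; rewrite rmorph0.
have ee k t : ev (trunc k (fun a => (c a)^*)) t = (ev (trunc k c) (conjmx t))^*.
  rewrite !ev_trunc rmorph_sum; apply: eq_bigr => a _; rewrite rmorphM rmorph_prod.
  by congr (_ * _); apply: eq_bigr => i _; rewrite rmorphXn /= mxE conjCK.
have bb : bnd (fun a => (c a)^*) r B.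
  move=> k; apply: le_trans (hB k); apply: nrm_le_coef; first exact: ltW.
  by move=> m; rewrite ct nmJ.
apply: (repI r0 bb) => t st; apply/eqP; rewrite -subr_eq0; apply/eqP.
apply: (@nm_geom0 _ _ (4 * B + 4 * B)) => k.
have h1 := hf _ (conjmx_small st) k.
have h2 := ps_partial_eval k (ltW r0) bb st; rewrite -ev_trunc ee in h2.
have -> : cbar f t - ps_eval (fun a => (c a)^*) t
  = ((ev (trunc k c) (conjmx t))^* - ps_eval (fun a => (c a)^*) t)
    - (ev (trunc k c) (conjmx t) - f (conjmx t))^*.
  rewrite rmorphB /cbar /=; move: (ev _ _)^* (ps_eval _ _) (f _)^* => u v w; ring.
by apply: le_trans (nmB _ _) _; rewrite mulrDl nmJ; apply: lerD.
Qed.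

Lemma an_cbar n (f : 'rV[C]_n -> C) : an f -> an (cbar f).
Proof. by case=> c hc; eexists; exact: rep_cbar hc. Qed.

Local Notation last n := (rshift n (ord0 : 'I_1)).

Lemma app1E n (t : 'rV[C]_n) v i : app1 t v 0 i =
  if fintype.split i is inl j then t 0 j else v.
Proof. by rewrite /app1 mxE; case: fintype.split => j; rewrite ?mxE. Qed.

Lemma an_app1 m n (f : 'rV[C]_m -> 'rV[C]_n) g : (forall i, an (fun t => f t 0 i)) ->
  an g -> forall i, an (fun t => app1 (f t) (g t) 0 i).
Proof.
move=> hf hg i; apply: (an_ext (f := fun t => if fintype.split i is inl j then f t 0 j else g t)).
  by move=> t; rewrite app1E.
by case: (fintype.split i).
Qed.

(** Newton normalization: F (t, v) = 0 is the fixed-point equation of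
    h (t, v) = v - F (t, v) / a, which has no term linear in v alone. *)
Lemma an_implicit n (F : 'rV[C]_(n + 1) -> C) a : an F -> F 0 = 0 ->
    cd (fun v => F (app1 0 v)) a -> a != 0 ->
  exists s, [/\ an s, s 0 = 0, \forall t \near (0 : 'rV[C]_n), F (app1 t (s t)) = 0 &
    exists rho : R, 0 < rho /\
      forall t v, small rho t -> nm v <= rho -> F (app1 t v) = 0 -> v = s t].
Proof.
move=> aF F0 dF a0; pose h (x : 'rV[C]_(n + 1)) : C := x 0 (last n) - a^-1 * F x.
have ah : an h.
  by apply: an_sub; [exact: an_coord | apply: an_mul => //; exact: an_const].
have h0 : h 0 = 0 by rewrite /h F0 mulr0 subr0 mxE.
have dh : pd (last n) h 0 = 0.
  have [r0 [r00 hc]] := (near0P _).1 (an_fderiv ah).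
  have h1 := cd_fderiv (last n) (hc 0 (small0 (ltW r00))).
  apply: cd_unique h1 _.
  apply: (@cd_ext _ (fun tau => tau + - a^-1 * F (app1 0 tau))).
    move=> tau; rewrite /h add0r; have -> : tau *: delta_mx 0 (last n) = app1 (0 : 'rV[C]_n) tau.
      apply/rowP => i; rewrite app1E !mxE /=; case: fintype.splitP => j hj; rewrite ?mxE.
        rewrite (_ : i == last n = false) ?mulr0 //; apply/eqP => e.
        by move: hj; rewrite e /= addn0 => h2; have := ltn_ord j; rewrite -h2 ltnn.
      rewrite (_ : i == last n) ?mulr1 //; apply/eqP/ord_inj; rewrite hj /= (ord1 j).
      by [].
    by rewrite app1_last mulNr.
  have := cd_add (cd_id R) (cd_scale (- a^-1) dF).
  by rewrite mulNr mulVf // subrr.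
have [s [as_ s0 hs]] := an_fixpoint ah h0 dh.
have eqF (x : 'rV[C]_(n + 1)) : (x 0 (last n) = h x) <-> F x = 0.
  rewrite /h; split=> [e|->]; last by rewrite mulr0 subr0.
  have : a^-1 * F x = 0 by rewrite -[RHS](subrr (x 0 (last n))) {2}e subKr.
  by move/eqP; rewrite mulf_eq0 invr_eq0 (negPf a0) => /eqP.
have fs : \forall t \near (0 : 'rV[C]_n), F (app1 t (s t)) = 0.
  by apply: filterS hs => t e; apply/eqF; rewrite app1_last.
exists s; split=> //; have [rho [rho0 hu]] := fixpoint_unique ah dh.
have h1 : \forall t \near (0 : 'rV[C]_n), nm (s t - s 0) <= rho by exact: an_continuous.
have [r1 [r10 h2]] := (near0P _).1 (filterI hs h1).
exists (Order.min rho r1); split=> [|t v st]; first by rewrite lt_min rho0.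
rewrite le_min => /andP[vr vr1] /eqF; rewrite app1_last => ev.
have sr : small r1 t by apply: small_le st; rewrite ge_min lexx orbT.
have [e1] := h2 _ sr; rewrite /= s0 subr0 => e2.
apply: (hu t) => //; by apply: small_le st; rewrite ge_min lexx.
Qed.

End GermComposition.

(** * Vanishing order and coefficients *)

Section VanishingOrder.
Variable R : realType.
Local Notation C := (Cplx R).

Definition bigO n k (f : 'rV[C]_n -> C) := exists r B : R, [/\ 0 < r, 0 <= B &
  forall eta t, 0 <= eta <= r -> small eta t -> nm (f t) <= B * eta ^+ k].

Lemma bigO_eq n k (f g : 'rV[C]_n -> C) :
  (\forall t \near (0 : 'rV[C]_n), f t = g t) -> bigO k f -> bigO k g.
Proof.
move=> /near0P [s [s0 e]] [r [B [r0 B0 h]]]; exists (Order.min r s), B.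
split=> // [|eta t /andP[e0]]; first by rewrite lt_min r0.
rewrite le_min => /andP[er es] st; rewrite -e; last exact: small_le st.
by apply: h => //; rewrite e0.
Qed.

Lemma bigO_ext n k (f g : 'rV[C]_n -> C) : f =1 g -> bigO k f -> bigO k g.
Proof. by move=> e; apply: bigO_eq; apply: (filterS (P := setT)) (filterT) => t _; exact: e. Qed.

Lemma bigO_zero n k (f : 'rV[C]_n -> C) :
  (\forall t \near (0 : 'rV[C]_n), f t = 0) -> bigO k f.
Proof.
move=> h; apply: (@bigO_eq _ _ (fun=> 0)); first by apply: filterS h => t ->.
by exists 1, 0; split=> // eta t _ _; rewrite nm0 mul0r.
Qed.

Lemma bigO_add n k (f g : 'rV[C]_n -> C) :
  bigO k f -> bigO k g -> bigO k (fun t => f t + g t).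
Proof.
move=> [r [B [r0 B0 h]]] [r' [B' [r'0 B'0 h']]]; exists (Order.min r r'), (B + B').
split; rewrite ?lt_min ?r0 ?addr_ge0 // => eta t /andP[e0].
rewrite le_min => /andP[er es] st; apply: le_trans (nmD _ _) _.
by rewrite mulrDl; apply: lerD; [apply: h | apply: h'] => //; rewrite e0.
Qed.

Lemma bigO_mul n k l (f g : 'rV[C]_n -> C) :
  bigO k f -> bigO l g -> bigO (k + l) (fun t => f t * g t).
Proof.
move=> [r [B [r0 B0 h]]] [r' [B' [r'0 B'0 h']]]; exists (Order.min r r'), (B * B').
split; rewrite ?lt_min ?r0 ?mulr_ge0 // => eta t /andP[e0].
rewrite le_min => /andP[er es] st; rewrite nmM exprD mulrACA.
by apply: ler_pM; rewrite ?nm_ge0 //; [apply: h | apply: h'] => //; rewrite e0.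
Qed.

Lemma bigO_const n (b : C) : bigO 0 (fun _ : 'rV[C]_n => b).
Proof.
by exists 1, (nm b); split; rewrite ?nm_ge0 // => eta t _ _; rewrite expr0 mulr1.
Qed.

Lemma bigO_scale n k (b : C) (f : 'rV[C]_n -> C) : bigO k f -> bigO k (fun t => b * f t).
Proof. exact: bigO_mul (bigO_const n b). Qed.

Lemma bigO_opp n k (f : 'rV[C]_n -> C) : bigO k f -> bigO k (fun t => - f t).
Proof. by move/(bigO_scale (-1)); apply: bigO_ext => t; rewrite mulN1r. Qed.

Lemma bigO_sub n k (f g : 'rV[C]_n -> C) :
  bigO k f -> bigO k g -> bigO k (fun t => f t - g t).
Proof. by move=> hf hg; apply: bigO_add => //; exact: bigO_opp. Qed.

Lemma bigO_sum n k (I : Type) (s : seq I) (P : pred I) (F : I -> 'rV[C]_n -> C) :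
  (forall i, P i -> bigO k (F i)) -> bigO k (fun t => \sum_(i <- s | P i) F i t).
Proof.
move=> h; elim: s => [|i s IH].
  by apply: bigO_zero; apply: (filterS (P := setT)) (filterT) => t _; rewrite big_nil.
apply: (bigO_ext (f := fun t => (if P i then F i t else 0) + \sum_(i <- s | P i) F i t)).
  by move=> t; rewrite big_cons; case: (P i); rewrite ?add0r.
apply: bigO_add => //; case hi: (P i); first exact: h.
by apply: bigO_zero; apply: (filterS (P := setT)) (filterT).
Qed.

Lemma bigOW n j k (f : 'rV[C]_n -> C) : (j <= k)%N -> bigO k f -> bigO j f.
Proof.
move=> jk [r [B [r0 B0 h]]]; exists (Order.min r 1), B; split; rewrite ?lt_min ?r0 ?ltr01 //.
move=> eta t /andP[e0]; rewrite le_min => /andP[er e1] st.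
have he : 0 <= eta <= r by rewrite e0.
apply: le_trans (h _ _ he st) _.
by rewrite ler_wpM2l // ler_wiXn2l.
Qed.

Lemma bigO_coord n i : bigO 1 (fun t : 'rV[C]_n => t 0 i).
Proof. by exists 1, 1; split=> // eta t _ st; rewrite mul1r expr1; exact: st. Qed.

Lemma bigO1 n (f : 'rV[C]_n -> C) : an f -> f 0 = 0 -> bigO 1 f.
Proof.
move=> af f0; have [r [B [r0 h]]] := an_taylor af.
exists r, `|B|; split=> // eta t he st.
have [h1 _ _] := h 0 (small0 (ltW r0)) eta t he st; rewrite add0r f0 subr0 in h1.
apply: le_trans h1 _; rewrite expr1 ler_wpM2r ?ler_norm //; by case/andP: he.
Qed.

Lemma bigO2 n (f : 'rV[C]_n -> C) : an f -> f 0 = 0 ->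
  bigO 2 (fun t => f t - \sum_j t 0 j * pd j f 0).
Proof.
move=> af f0; have [r [B [r0 h]]] := an_taylor af.
exists r, `|B|; split=> // eta t he st.
have [_ h1 _] := h 0 (small0 (ltW r0)) eta t he st; rewrite add0r f0 subr0 in h1.
apply: le_trans h1 _; rewrite ler_wpM2r ?ler_norm // exprn_ge0 //; by case/andP: he.
Qed.

Lemma bigO3 n (f : 'rV[C]_n -> C) : an f -> f 0 = 0 ->
  bigO 3 (fun t => f t - \sum_j t 0 j * pd j f 0
                   - 2^-1 * \sum_j \sum_l t 0 j * t 0 l * pd l (pd j f) 0).
Proof.
move=> af f0; have [r [B [r0 h]]] := an_taylor af.
exists r, `|B|; split=> // eta t he st.
have [_ _ h1] := h 0 (small0 (ltW r0)) eta t he st; rewrite add0r f0 subr0 in h1.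
apply: le_trans h1 _; rewrite ler_wpM2r ?ler_norm // exprn_ge0 //; by case/andP: he.
Qed.

Lemma bigO_comp m n k (f : 'rV[C]_m -> C) (G : 'rV[C]_n -> 'rV[C]_m) :
  bigO k f -> (forall i, bigO 1 (fun t => G t 0 i)) -> bigO k (fun t => f (G t)).
Proof.
move=> [r [B [r0 B0 h]]] hG.
have /choice [s hs] : forall i, exists s : R * R, [/\ 0 < s.1, 0 <= s.2 &
    forall eta t, 0 <= eta <= s.1 -> small eta t -> nm (G t 0 i) <= s.2 * eta].
  move=> i; have [r' [B' [r'0 B'0 h']]] := hG i; exists (r', B'); split; [by []|by []|move=> eta t he st].
  by have := h' eta t he st; rewrite expr1.
have [s0 s00 hs0] := @common_radius R _ (fun i => (s i).1) (fun i => let: And3 h _ _ := hs i in h).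
have s2 i : 0 <= (s i).2 by case: (hs i).
pose D := 1 + \sum_i (s i).2.
have D1 : 1 <= D by rewrite lerDl sumr_ge0.
have dD i : (s i).2 <= D.
  by rewrite /D (bigD1 i) //= addrCA lerDl addr_ge0 // sumr_ge0.
have D0 : 0 < D by lra.
exists (Order.min s0 (r / D)), (B * D ^+ k).
split; rewrite ?lt_min ?s00 ?divr_gt0 ?mulr_ge0 ?exprn_ge0 ?(ltW D0) //.
move=> eta t /andP[e0]; rewrite le_min => /andP[es er] st.
rewrite ler_pdivlMr // in er.
have hD : 0 <= D * eta <= r by rewrite mulr_ge0 ?(ltW D0) //= mulrC.
rewrite -mulrA -exprMn; apply: h hD _ => i; have [_ _ hi] := hs i.
have he : 0 <= eta <= (s i).1 by rewrite e0 /=; exact: le_trans es (hs0 i).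
by apply: le_trans (hi eta t he st) _; rewrite ler_wpM2r.
Qed.

Lemma rep_bigO n k (c : power_series R n) f : rep c f ->
  (forall a, (mdegree a < k)%N -> c a = 0) -> bigO k f.
Proof.
move=> /rep_trunc [r [B [r0 hB hf]]] hc; have B0 := bnd_ge0 (ltW r0) hB.
exists (r / 2), (r^-1 ^+ k * B); split; rewrite ?divr_gt0 ?mulr_ge0 ?exprn_ge0 ?invr_ge0 ?(ltW r0) //.
move=> eta t /andP[e0 er] st.
have st2 : small (r / 2) t by exact: small_le st.
apply: (@nm_lim R (fun N => ev (trunc N c) t) _ _ (4 * B)) => N; last exact: hf.
have o : ord k (trunc N c).
  move=> m mk; rewrite coef_trunc; case: ifP => // _; apply: hc.
  by rewrite -mdeg_mkm mkm_ff.
apply: le_trans (ev_le _ e0 st) _.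
have e1 : 0 <= eta / r <= 1.
  rewrite divr_ge0 ?(ltW r0) //= ler_pdivrMr // mul1r.
  by apply: le_trans er _; have := ltW r0; lra.
have := ord_nrm (ltW r0) e1 o; rewrite divfK ?gt_eqF // => h; apply: le_trans h _.
rewrite exprMn (mulrC (eta ^+ k)) [X in _ <= X]mulrAC.
by rewrite ler_wpM2l ?mulr_ge0 ?exprn_ge0 ?invr_ge0 ?(ltW r0) //; exact: hB.
Qed.

Lemma bnd_mask n (c : power_series R n) (b : {ffun 'I_n -> nat} -> bool) r B :
  0 <= r -> bnd c r B -> bnd (fun a => if b a then c a else 0) r B.
Proof.
move=> r0 h k; apply: le_trans (h k); apply: nrm_le_coef => // m.
by rewrite !coef_trunc; case: ifP => // _; case: ifP; rewrite // nm0 nm_ge0.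
Qed.

Lemma rep_mask n (c : power_series R n) (b : {ffun 'I_n -> nat} -> bool) :
  ps_convergent c -> rep (fun a => if b a then c a else 0)
    (ps_eval (fun a => if b a then c a else 0)).
Proof.
move=> /ps_convergentP [r [B [r0 hB]]].
by apply: (repI r0 (bnd_mask b (ltW r0) hB)).
Qed.

Lemma ps_partial_homog n k (c : power_series R n) (l : C) t N :
  ps_partial (fun a => if mdegree a == k then c a else 0) (l *: t) N
  = l ^+ k * ps_partial (fun a => if mdegree a == k then c a else 0) t N.
Proof.
rewrite mulr_sumr; apply: eq_bigr => a _; case: eqP => [<-|_]; last by rewrite !mul0r mulr0.
rewrite mulrCA; congr (_ * _); rewrite /mdegree -prodrXr -big_split.
by apply: eq_bigr => i _; rewrite mxE exprMn ffunE.
Qed.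

Lemma rep_zero n : rep (fun=> 0) (fun _ : 'rV[C]_n => 0 : C).
Proof.
have b0 : bnd (fun _ : {ffun 'I_n -> nat} => 0 : C) 1 0.
  by move=> k; rewrite nrm_trunc big1 // => a _; rewrite nm0 mul0r.
apply: (repI ltr01 b0) => t _; apply/esym; apply: (@lim_geom_eq _ _ _ 0) => N.
by rewrite /ps_partial big1 ?subrr ?nm0 ?mul0r // => a _; rewrite mul0r.
Qed.

(** By induction the terms of degree less than k vanish; the homogeneous part of degree k
    is then O (|t|^(k+1)), and it vanishes by scaling t to 0. *)
Lemma bigO_coef n k (c : power_series R n) f : rep c f -> bigO k f ->
  forall a, (mdegree a < k)%N -> c a = 0.
Proof.
move=> hc; elim: k => // k IH hO a; rewrite ltnS leq_eqVlt => /orP[/eqP ak|]; last first.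
  by apply: IH; apply: bigOW hO.
have low := IH (bigOW (leqnSn k) hO).
pose lo a := if mdegree a == k then c a else 0.
pose hi a := if mdegree a != k then c a else 0.
have rlo : rep lo (ps_eval lo) by apply: rep_mask; case: hc.
have rhi : rep hi (ps_eval hi) by apply: rep_mask; case: hc.
have Ohi : bigO k.+1 (ps_eval hi).
  apply: rep_bigO rhi _ => b; rewrite ltnS leq_eqVlt /hi => /orP[->//|bk].
  by rewrite low // if_same.
have Olo : bigO k.+1 (ps_eval lo).
  apply: bigO_eq (bigO_sub hO Ohi).
  have rs := rep_add rlo rhi.
  have cs : (fun a => lo a + hi a) = c.
    by apply/funext => b; rewrite /lo /hi; case: eqP; rewrite /= ?addr0 ?add0r.
  rewrite cs in rs; case: hc => _ h1; case: rs => _ h2.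
  by apply: filterS2 h1 h2 => t -> <-; rewrite addrK.
have [r1 [B1 [r10 hB1]]] := repP rlo; move=> _.
have [r2 [B2 [r20 B20 h2]]] := Olo.
have z : \forall t \near (0 : 'rV[C]_n), ps_eval lo t = 0.
  apply/near0P; exists (Order.min (r1 / 2) r2).
  split=> [|t]; first by rewrite lt_min divr_gt0.
  set eta := Order.min _ _ => st.
  have e0 : 0 <= eta by rewrite le_min (ltW r20) divr_ge0 // ltW.
  have e1 : eta <= r1 / 2 by rewrite ge_min lexx.
  have e2 : eta <= r2 by rewrite ge_min lexx orbT.
  (* by homogeneity 2^(-kN) |lo t| = |lo (2^-N t)| = O (2^(-(k+1)N)) *)
  apply: (@nm_geom0 _ _ (B2 * eta ^+ k.+1)) => N.
  pose l : C := 2 ^- N.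
  have nl : nm l = 2 ^- N by rewrite nmV nmX nmn.
  have l1 : 2 ^- N <= 1 :> R by rewrite invf_le1 ?exprn_gt0 // exprn_ege1 // ler1n.
  have l0 : 0 < 2 ^- N :> R by rewrite invr_gt0 exprn_gt0.
  have sl : small (2 ^- N * eta) (l *: t).
    by move=> i; rewrite mxE nmM nl ler_wpM2l // ltW.
  have el : ps_eval lo (l *: t) = l ^+ k * ps_eval lo t.
    apply/eqP; rewrite -subr_eq0; apply/eqP; apply: (@nm_geom0 _ _ (4 * B1 + 4 * B1)) => M.
    have s1 : small (r1 / 2) t by apply: small_le st.
    have s2 : small (r1 / 2) (l *: t).
      by apply: small_le sl; apply: le_trans e1; rewrite ler_piMl.
    have a1 := ps_partial_eval M (ltW r10) hB1 s1.
    have a2 := ps_partial_eval M (ltW r10) hB1 s2.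
    rewrite ps_partial_homog in a2.
    have -> : ps_eval lo (l *: t) - l ^+ k * ps_eval lo t
      = l ^+ k * (ps_partial lo t M - ps_eval lo t)
        - (l ^+ k * ps_partial lo t M - ps_eval lo (l *: t)).
      move: (ps_eval lo _) (ps_eval lo _) (ps_partial _ _ _) (l ^+ k) => u v w x; ring.
    apply: le_trans (nmB _ _) _; rewrite mulrDl; apply: lerD => //.
    rewrite nmM; apply: le_trans a1; rewrite ler_piMl ?nm_ge0 // nmX nl.
    by rewrite exprn_ile1 // ltW.
  have e3 : 0 <= 2 ^- N * eta <= r2.
    by rewrite mulr_ge0 ?(ltW l0) //=; apply: le_trans e2; rewrite ler_piMl.
  have := h2 _ _ e3 sl; rewrite el nmM nmX nl exprMn => h.
  rewrite -(ler_pM2l (exprn_gt0 k l0)); apply: le_trans h _.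
  rewrite (exprS (2 ^- N)) le_eqVlt; apply/orP; left; apply/eqP.
  move: (2 ^- N) (eta ^+ k.+1) => q e; ring.
have [conv _] := rlo.
have r0 : rep lo (fun=> 0) by split=> //; apply: filterS z => t ->.
by have := congr1 (fun d => d a) (rep_inj r0 (rep_zero n)); rewrite /lo ak eqxx.
Qed.

Lemma rep_restrict n (I : {pred 'I_n}) (c : power_series R n) f : rep c f ->
  rep (fun a : {ffun 'I_n -> nat} =>
         if [forall i, (i \notin I) ==> (a i == 0%N)] then c a else 0)
      (fun t => f (\row_i (if i \in I then t 0 i else 0))).
Proof.
move=> /repP [r [B [r0 hB hf]]]; apply: (repI r0 (bnd_mask _ (ltW r0) hB)) => t st.
rewrite hf; last first.
  move=> i; rewrite mxE; case: ifP => _; first exact: st.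
  by rewrite nm0 divr_ge0 // ltW.
congr (limn _); apply/funext => N; apply: eq_bigr => a _.
case: ifP => [/forallP h|/negbT].
  congr (_ * _); apply: eq_bigr => i _; rewrite mxE; case: ifP => // iI.
  by have := h i; rewrite iI ffunE /= => /eqP ->; rewrite !expr0.
rewrite negb_forall => /existsP [j]; rewrite negb_imply ffunE => /andP[jI aj].
by rewrite mul0r (bigD1 j) //= mxE (negPf jI) expr0n (negPf aj) mul0r mulr0.
Qed.

(** The coefficients of f that only involve the variables in I are seen on the
    coordinate subspace of these variables. *)
Lemma bigO_coef_restrict n k (I : {pred 'I_n}) (c : power_series R n) f : rep c f ->
  bigO k (fun t => f (\row_i (if i \in I then t 0 i else 0))) ->
  forall a : {ffun 'I_n -> nat}, (forall i, i \notin I -> a i = 0%N) ->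
    (mdegree a < k)%N -> c a = 0.
Proof.
move=> hc hO a ha ak; have := bigO_coef (rep_restrict I hc) hO ak.
by case: ifP => // /negbT; rewrite negb_forall => /existsP [j];
   rewrite negb_imply => /andP[/ha ->].
Qed.

End VanishingOrder.

(** * Vector-valued germs and velocities *)

Section VectorGerms.
Variable R : realType.
Local Notation C := (Cplx R).
Local Notation last n := (rshift n (ord0 : 'I_1)).

Lemma conj_app1 n (t : 'rV[C]_n) v : conjmx (app1 t v) = app1 (conjmx t) v^*.
Proof. by apply/rowP => i; rewrite !mxE; case: fintype.split => j; rewrite !mxE. Qed.

Lemma lsub_app1 n (t : 'rV[C]_n) v : lsubmx (app1 t v) = t.
Proof. exact: row_mxKl. Qed.

Lemma app1_eta n (t : 'rV[C]_(n + 1)) : app1 (lsubmx t) (t 0 (last n)) = t.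
Proof.
rewrite -[RHS]hsubmxK /app1; congr (row_mx _ _); apply/rowP => i.
by rewrite (ord1 i) !mxE.
Qed.

Lemma conj_lsub m n (t : 'rV[C]_(m + n)) : lsubmx (conjmx t) = conjmx (lsubmx t).
Proof. by apply/rowP => i; rewrite !mxE. Qed.

Lemma conj_rsub m n (t : 'rV[C]_(m + n)) : rsubmx (conjmx t) = conjmx (rsubmx t).
Proof. by apply/rowP => i; rewrite !mxE. Qed.

Lemma conj_row m n (x : 'rV[C]_m) (y : 'rV[C]_n) :
  conjmx (row_mx x y) = row_mx (conjmx x) (conjmx y).
Proof. by apply/rowP => i; rewrite !mxE; case: fintype.split => j; rewrite !mxE. Qed.

(** Vector-valued germs. *)
Definition van m n (f : 'rV[C]_n -> 'rV[C]_m) := forall i, an (fun t => f t 0 i).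

Lemma van_const m n (b : 'rV[C]_m) : van (fun _ : 'rV[C]_n => b).
Proof. by move=> i; exact: an_const. Qed.

Lemma van_id n : van (fun t : 'rV[C]_n => t).
Proof. by move=> i; exact: an_coord. Qed.

Lemma van_app1 m n (f : 'rV[C]_n -> 'rV[C]_m) g :
  van f -> an g -> van (fun t => app1 (f t) (g t)).
Proof. by move=> hf hg i; exact: an_app1. Qed.

Lemma van_row m k n (f : 'rV[C]_n -> 'rV[C]_m) (g : 'rV[C]_n -> 'rV[C]_k) :
  van f -> van g -> van (fun t => row_mx (f t) (g t)).
Proof.
move=> hf hg i; apply: (an_ext (f := fun t => match fintype.split i with
  inl j => f t 0 j | inr j => g t 0 j end)); last by case: fintype.split.
by move=> t; rewrite mxE.
Qed.

Lemma van_lsub m k n (f : 'rV[C]_n -> 'rV[C]_(m + k)) : van f -> van (fun t => lsubmx (f t)).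
Proof. by move=> hf i; apply: an_ext (hf (lshift k i)) => t; rewrite mxE. Qed.

Lemma van_rsub m k n (f : 'rV[C]_n -> 'rV[C]_(m + k)) : van f -> van (fun t => rsubmx (f t)).
Proof. by move=> hf i; apply: an_ext (hf (rshift m i)) => t; rewrite mxE. Qed.

Lemma an_last m n (f : 'rV[C]_n -> 'rV[C]_(m + 1)) : van f -> an (fun t => f t 0 (last m)).
Proof. by move=> hf; exact: hf. Qed.

Lemma van_scalar n g : an g -> van (fun t : 'rV[C]_n => const_mx (g t) : 'rV[C]_1).
Proof. by move=> hg i; apply: an_ext hg => t; rewrite mxE. Qed.

Lemma van_conj m n (f : 'rV[C]_n -> 'rV[C]_m) :
  van f -> van (fun t => conjmx (f (conjmx t))).
Proof. by move=> hf i; apply: an_ext (an_cbar (hf i)) => t; rewrite mxE. Qed.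

(** Velocity at 0 of a curve. *)
Definition vcd m (f : C -> 'rV[C]_m) (a : 'rV[C]_m) := forall i, cd (fun tau => f tau 0 i) (a 0 i).

Lemma vcd_const m (b : 'rV[C]_m) : vcd (fun=> b) 0.
Proof. by move=> i; rewrite mxE; exact: cd_const. Qed.

Lemma vcd_lin m (b e : 'rV[C]_m) : vcd (fun tau => b + tau *: e) e.
Proof. by move=> i; apply: cd_ext (cd_lin (b 0 i) _) => tau; rewrite !mxE. Qed.

Lemma vcd_scale m (e : 'rV[C]_m) : vcd (fun tau => tau *: e) e.
Proof. by move=> i; apply: cd_ext (cd_lin 0 _) => tau; rewrite !mxE add0r. Qed.

Lemma vcd_row m k (f : C -> 'rV[C]_m) (g : C -> 'rV[C]_k) a b :
  vcd f a -> vcd g b -> vcd (fun tau => row_mx (f tau) (g tau)) (row_mx a b).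
Proof.
move=> hf hg i; rewrite mxE.
apply: (cd_ext (f := fun tau => match fintype.split i with
  inl j => f tau 0 j | inr j => g tau 0 j end)); last by case: fintype.split.
by move=> tau; rewrite mxE.
Qed.

Lemma vcd_scalar f a : cd f a -> vcd (fun tau => const_mx (f tau) : 'rV[C]_1) (const_mx a).
Proof. by move=> h i; rewrite mxE; apply: cd_ext h => tau; rewrite mxE. Qed.

Lemma vcd_app1 m (f : C -> 'rV[C]_m) g a b :
  vcd f a -> cd g b -> vcd (fun tau => app1 (f tau) (g tau)) (app1 a b).
Proof. by move=> hf hg; apply: vcd_row => //; exact: vcd_scalar. Qed.

Definition dot m (a : 'rV[C]_m) (g : 'I_m -> C) := \sum_i a 0 i * g i.

Lemma dot_row m k (a : 'rV[C]_m) (b : 'rV[C]_k) g :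
  dot (row_mx a b) g = dot a (fun i => g (lshift k i)) + dot b (fun i => g (rshift m i)).
Proof.
rewrite /dot big_split_ord; congr (_ + _); apply: eq_bigr => i _.
  by rewrite row_mxEl.
by rewrite row_mxEr.
Qed.

Lemma dot_app1 m (a : 'rV[C]_m) b g :
  dot (app1 a b) g = dot a (fun i => g (lshift 1 i)) + b * g (last m).
Proof. by rewrite dot_row; congr (_ + _); rewrite /dot big_ord1 mxE. Qed.

Lemma dot0 m (g : 'I_m -> C) : dot 0 g = 0.
Proof. by rewrite /dot big1 // => i _; rewrite mxE mul0r. Qed.

Lemma dot_delta m j (g : 'I_m -> C) : dot (delta_mx 0 j) g = g j.
Proof.
rewrite /dot (bigD1 j) //= mxE !eqxx mul1r big1 ?addr0 // => i ij.
by rewrite mxE (negPf ij) andbF mul0r.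
Qed.

Lemma dotZ m (k : C) (a : 'rV[C]_m) g : dot (k *: a) g = k * dot a g.
Proof. by rewrite /dot mulr_sumr; apply: eq_bigr => i _; rewrite mxE mulrA. Qed.

Lemma dot_const (b : C) g : dot (const_mx b : 'rV[C]_1) g = b * g 0.
Proof. by rewrite /dot big_ord1 mxE. Qed.

Lemma cd_comp n (f : 'rV[C]_n -> C) (G : C -> 'rV[C]_n) x g a :
  fderiv f x g -> G 0 = x -> vcd G a -> cd (fun tau => f (G tau)) (dot a g).
Proof. by move=> hf G0 hG; apply: cd_chain => //; rewrite G0. Qed.

Lemma an_fderiv0 n (f : 'rV[C]_n -> C) : an f -> fderiv f 0 (fun j => pd j f 0).
Proof.
by move=> /an_fderiv /near0P [r [r0 h]]; apply: h; apply: small0; exact: ltW.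
Qed.

Lemma cd_pd n (f : 'rV[C]_n -> C) (e : 'rV[C]_n) : an f ->
  cd (fun tau => f (tau *: e)) (dot e (fun j => pd j f 0)).
Proof.
by move=> af; apply: (cd_comp (an_fderiv0 af)) (vcd_scale e); rewrite scale0r.
Qed.

Lemma near_curve n (P : 'rV[C]_n -> Prop) (G : C -> 'rV[C]_n) a :
  (\forall t \near (0 : 'rV[C]_n), P t) -> vcd G a -> G 0 = 0 ->
  exists2 r : R, 0 < r & forall tau, nm tau <= r -> P (G tau).
Proof.
move=> /near0P [r [r0 hP]] hG G0.
have /choice [s hs] : forall i, exists s : R * R, [/\ 0 < s.1, 0 <= s.2 &
    forall tau, nm tau <= s.1 -> nm (G tau 0 i - G 0 0 i) <= s.2 * nm tau].
  by move=> i; have [r' [D h]] := cd_lip (hG i); exists (r', D).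
have [s0 s00 hs0] := @common_radius R _ (fun i => (s i).1) (fun i => let: And3 h _ _ := hs i in h).
have s2 i : 0 <= (s i).2 by case: (hs i).
pose D := 1 + \sum_i (s i).2.
have D1 : 1 <= D by rewrite lerDl sumr_ge0.
have dD i : (s i).2 <= D.
  by rewrite /D (bigD1 i) //= addrCA lerDl addr_ge0 // sumr_ge0.
have D0 : 0 < D by lra.
exists (Order.min s0 (r / D)); first by rewrite lt_min s00 divr_gt0.
move=> tau; rewrite le_min => /andP[ts tr]; rewrite ler_pdivlMr // in tr.
apply: hP => i; have [_ _ h] := hs i.
have := h _ (le_trans ts (hs0 i)); rewrite G0 mxE subr0 => h1.
apply: le_trans h1 _; apply: le_trans tr; rewrite mulrC ler_wpM2l ?nm_ge0 //.
Qed.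

End VectorGerms.

(** * Segre varieties along a transversal curve *)

Section NormalCoordinates.
Variable R : realType.
Local Notation C := (Cplx R).
Local Notation last n := (rshift n (ord0 : 'I_1)).
Local Notation lz j := (lshift (2 + 1) (lshift 1 j)).
Local Notation lw := (lshift (2 + 1) (last 2)).
Local Notation rz j := (rshift (2 + 1) (lshift 1 j)).
Local Notation rw := (rshift (2 + 1) (last 2)).

(** The antiholomorphic involution (x, y) |-> (conj y, conj x), whose fixed points are the
    pairs (x, conj x). *)
Definition cswap m (X : 'rV[C]_(m + m)) : 'rV[C]_(m + m) :=
  row_mx (conjmx (rsubmx X)) (conjmx (lsubmx X)).

Lemma cswap_row m (x y : 'rV[C]_m) : cswap (row_mx x y) = row_mx (conjmx y) (conjmx x).
Proof. by rewrite /cswap row_mxKl row_mxKr. Qed.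

Lemma row00 m n : row_mx (0 : 'rV[C]_m) (0 : 'rV[C]_n) = 0.
Proof. exact: row_mx0. Qed.

Lemma half_i : 'i / 2 * ('i - - 'i) = -1 :> C.
Proof.
have : 'i * 'i = -1 :> C by rewrite -expr2 sqrCi.
move: 'i => u hu; have -> : u / 2 * (u - - u) = u * u by field.
exact: hu.
Qed.

Lemma const_mx0 m : const_mx 0 = 0 :> 'rV[C]_m.
Proof. by apply/rowP => i; rewrite !mxE. Qed.

Lemma scalar_eta (t : 'rV[C]_1) : const_mx (t 0 0) = t.
Proof. by apply/rowP => i; rewrite mxE (ord1 i). Qed.

Variable P : 'rV[C]_((2 + 1) + (2 + 1)) -> C.
Hypothesis aP : an P.
Hypothesis hP : \forall X \near (0 : 'rV[C]_((2 + 1) + (2 + 1))), P (cswap X) = (P X)^*.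
Hypothesis P0 : P 0 = 0.
Hypothesis pz : forall j, pd (lz j) P 0 = 0.
Hypothesis pw : pd lw P 0 = 'i / 2.
Hypothesis qz : forall j, pd (rz j) P 0 = 0.
Hypothesis qw : pd rw P 0 = - ('i / 2).

Lemma dotP a b a' b' :
  dot (row_mx (app1 a b) (app1 a' b')) (fun i => pd i P 0) = 'i / 2 * (b - b').
Proof.
have da : dot a (fun j => pd (lz j) P 0) = 0.
  by apply: big1 => j _; rewrite pz mulr0.
have db : dot a' (fun j => pd (rz j) P 0) = 0.
  by apply: big1 => j _; rewrite qz mulr0.
rewrite dot_row 2!dot_app1 da db pw qw; move: ('i / 2) => k; ring.
Qed.

(** The differential of P at the origin is (dx_3 - dy_3) i/2: only the velocities of the
    third coordinates matter. *)
Lemma cdP (z zeta : C -> 'rV[C]_2) (v om : C -> C) a b a' b' :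
  z 0 = 0 -> v 0 = 0 -> zeta 0 = 0 -> om 0 = 0 ->
  vcd z a -> cd v b -> vcd zeta a' -> cd om b' ->
  cd (fun tau => P (row_mx (app1 (z tau) (v tau)) (app1 (zeta tau) (om tau))))
     ('i / 2 * (b - b')).
Proof.
move=> z0 v0 y0 o0 hz hv hy ho; rewrite -(dotP a b a' b').
apply: (cd_comp (an_fderiv0 aP)); first by rewrite z0 v0 y0 o0 !app1_0 row00.
by apply: vcd_row; apply: vcd_app1.
Qed.

(** A holomorphic curve (0, gam s) which lies in the hypersurface for real s: with
    gam s = s + i g s, the implicit function g is real because both g and its conjugate
    solve the same equation. *)
Lemma straight_curve : exists gam : 'rV[C]_1 -> C, [/\ an gam, gam 0 = 0,
  cd (fun tau => gam (const_mx tau)) 1 &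
  \forall t \near (0 : 'rV[C]_1),
    P (row_mx (app1 0 (gam t)) (app1 0 (cbar gam t))) = 0].
Proof.
pose F (t : 'rV[C]_(1 + 1)) := P (row_mx
  (app1 0 (t 0 (lshift 1 0) + 'i * t 0 (last 1)))
  (app1 0 (t 0 (lshift 1 0) - 'i * t 0 (last 1)))).
have FE t v : F (app1 t v) = P (row_mx (app1 0 (t 0 0 + 'i * v)) (app1 0 (t 0 0 - 'i * v))).
  by rewrite /F app1_last /app1 row_mxEl.
have aF : an F.
  apply: (an_compose aP); last first.
    by rewrite !mxE mulr0 subr0 addr0 !app1_0 row00.
  have ai : an (fun t : 'rV[C]_(1 + 1) => 'i * t 0 (last 1)).
    by apply: an_mul; [exact: an_const | exact: an_coord].
  apply: van_row; apply: van_app1; try exact: van_const.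
    by apply: an_add => //; exact: an_coord.
  by apply: an_sub => //; exact: an_coord.
have F0 : F 0 = 0 by rewrite -app1_0 FE !mxE mulr0 subr0 addr0 !app1_0 row00.
have dF : cd (fun v => F (app1 0 v)) (-1).
  rewrite -half_i; apply: (cd_ext (f := fun v => P (row_mx (app1 0 ('i * v)) (app1 0 (- 'i * v))))).
    by move=> v; rewrite FE mxE add0r sub0r mulNr.
  apply: (cdP (z := fun=> 0) (zeta := fun=> 0)); rewrite ?mulr0 //; try exact: vcd_const.
    by have := cd_scale 'i (cd_id R); rewrite mulr1.
  by have := cd_scale (- 'i) (cd_id R); rewrite mulr1.
have [|g [ag g0 hg [rho [rho0 ug]]]] := an_implicit aF F0 dF.
  by rewrite oppr_eq0 oner_eq0.
(* the conjugate of g solves the same equation, since P is hermitian *)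
have greal : \forall t \near (0 : 'rV[C]_1), cbar g t = g t.
  have h1 : \forall t \near (0 : 'rV[C]_1), nm (cbar g t - cbar g 0) <= rho.
    by have := an_continuous (an_cbar ag) rho0.
  have h2 : \forall t \near (0 : 'rV[C]_1), F (app1 (conjmx t) (g (conjmx t))) = 0.
    exact: near_conj hg.
  have h3 : \forall t \near (0 : 'rV[C]_1), small rho t.
    by apply/near0P; exists rho.
  have h4 : \forall t \near (0 : 'rV[C]_1), P (cswap (row_mx
      (app1 0 (conjmx t 0 0 + 'i * g (conjmx t))) (app1 0 (conjmx t 0 0 - 'i * g (conjmx t)))))
     = (P (row_mx
      (app1 0 (conjmx t 0 0 + 'i * g (conjmx t))) (app1 0 (conjmx t 0 0 - 'i * g (conjmx t)))))^*.
    apply: (near_conj (P := fun t => P (cswap (row_mx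
      (app1 0 (t 0 0 + 'i * g t)) (app1 0 (t 0 0 - 'i * g t))))
     = (P (row_mx (app1 0 (t 0 0 + 'i * g t)) (app1 0 (t 0 0 - 'i * g t))))^*)).
    apply: (near_compose (P := fun X => P (cswap X) = (P X)^*)) hP.
      apply: van_row; apply: van_app1; try exact: van_const.
        by apply: an_add; [exact: an_coord | apply: an_mul => //; exact: an_const].
      by apply: an_sub; [exact: an_coord | apply: an_mul => //; exact: an_const].
    by rewrite mxE g0 mulr0 subr0 addr0 !app1_0 row00.
  apply: filterS2 (filterI h1 h2) (filterI h3 h4) => t [k1 k2] [k3 k4].
  apply: ug => //; first by rewrite (cbar0 g0) subr0 in k1.
  move: k4; rewrite -FE k2 rmorph0 cswap_row !conj_app1 conjmx0 mxE !(rmorphB, rmorphD, rmorphM).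
  rewrite /= conjCi conjCK FE /cbar !mulNr opprK => <-.
  by congr (P (row_mx _ _)); congr app1.
(* the derivative of the equation at the origin is - g' (0) *)
have g'0 : cd (fun tau => g (const_mx tau)) 0.
  have h0 := cd_pd (const_mx 1 : 'rV[C]_1) ag; set a := dot _ _ in h0.
  have h : cd (fun tau => g (const_mx tau)) a.
    by apply: cd_ext h0 => tau; congr g; apply/rowP => i; rewrite !mxE mulr1.
  suff <- : a = 0 by [].
  have k : cd (fun tau => F (app1 (const_mx tau) (g (const_mx tau)))) ('i / 2 * ((1 + 'i * a) - (1 - 'i * a))).
    apply: (cd_ext (f := fun tau => P (row_mx (app1 0 (tau + 'i * g (const_mx tau)))
        (app1 0 (tau + - 'i * g (const_mx tau)))))).
      by move=> tau; rewrite FE mxE mulNr.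
    apply: (cdP (z := fun=> 0) (zeta := fun=> 0)); rewrite ?const_mx0 ?g0 ?mulr0 ?addr0 //;
      try exact: vcd_const.
      by apply: cd_add; [exact: cd_id | exact: cd_scale].
    by rewrite -mulNr; apply: cd_add; [exact: cd_id | exact: cd_scale].
  have z : exists2 r : R, 0 < r & forall tau, nm tau <= r -> F (app1 (const_mx tau) (g (const_mx tau))) = 0.
    have [r [r0 hr]] := (near0P _).1 hg; exists r => // tau ht.
    by apply: hr => i; rewrite mxE.
  have := cd_zero z k; have := half_i; move: 'i => u hu e.
  have : u / 2 * (u - - u) * a = 0 by rewrite -e; field.
  by rewrite hu mulN1r => /eqP; rewrite oppr_eq0 => /eqP.
exists (fun t : 'rV[C]_1 => t 0 0 + 'i * g t); split.
- by apply: an_add; [exact: an_coord | apply: an_mul => //; exact: an_const].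
- by rewrite mxE g0 mulr0 addr0.
- apply: (cd_ext (f := fun tau => tau + 'i * g (const_mx tau))); first by move=> tau; rewrite mxE.
  by rewrite -[X in cd _ X]addr0 -[X in cd _ (_ + X)](mulr0 'i); apply: cd_add; [exact: cd_id | exact: cd_scale].
apply: filterS2 greal hg => t e; rewrite FE => h.
rewrite -[RHS]h; congr (P (row_mx _ (app1 _ _))).
rewrite -e /cbar rmorphD rmorphM /= conjCi mxE conjCK mulNr //.
Qed.

Variable gam : 'rV[C]_1 -> C.
Hypothesis ag : an gam.
Hypothesis g0 : gam 0 = 0.
Hypothesis dg : cd (fun tau => gam (const_mx tau)) 1.
Hypothesis Pg : \forall t \near (0 : 'rV[C]_1),
    P (row_mx (app1 0 (gam t)) (app1 0 (cbar gam t))) = 0.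

Local Notation gb s := (cbar gam (const_mx s)).

Lemma gb0 : gb 0 = 0.
Proof. by rewrite const_mx0 cbar0. Qed.

Lemma dgb f a : cd f a -> f 0 = 0 -> cd (fun tau => gb (f tau)) a.
Proof.
move=> hf f0; have ac := an_cbar ag.
have h : cd (fun tau => gb (f tau)) (dot (const_mx a : 'rV[C]_1) (fun j => pd j (cbar gam) 0)).
  by apply: (cd_comp (an_fderiv0 ac)); [rewrite f0 const_mx0 | exact: vcd_scalar].
rewrite dot_const in h; suff e : pd 0 (cbar gam) 0 = 1 by rewrite e mulr1 in h.
have := cd_conj dg; rewrite rmorph1 => h1; apply: cd_unique _ h1.
have := cd_pd (const_mx 1 : 'rV[C]_1) ac; rewrite dot_const mul1r; apply: cd_ext => tau.
by rewrite /cbar; congr ((gam _)^*); apply/rowP => i; rewrite !mxE mulr1.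
Qed.

Lemma van_gb n (f : 'rV[C]_n -> C) : an f -> f 0 = 0 -> an (fun t => gb (f t)).
Proof.
move=> af f0; apply: (an_compose (an_cbar ag)); first exact: van_scalar.
by rewrite f0 const_mx0.
Qed.

(** The Segre variety of parameter s is the set of the x with P (x, (0, cbar gam s)) = 0.
    These varieties foliate a neighborhood of the origin, and w maps a point to the
    parameter of the leaf through it. This w is the new third coordinate. *)
Lemma segre_function : exists w : 'rV[C]_(2 + 1) -> C, [/\ an w, w 0 = 0,
  forall e : 'rV[C]_2, forall b, cd (fun tau => w (tau *: app1 e b)) b,
  \forall x \near (0 : 'rV[C]_(2 + 1)), P (row_mx x (app1 0 (gb (w x)))) = 0 &
  exists rho : R, 0 < rho /\ forall x s, small rho x -> nm s <= rho ->
    P (row_mx x (app1 0 (gb s))) = 0 -> s = w x].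
Proof.
pose F (t : 'rV[C]_(2 + 1 + 1)) := P (row_mx (lsubmx t) (app1 0 (gb (t 0 (last (2 + 1)))))).
have FE x s : F (app1 x s) = P (row_mx x (app1 0 (gb s))).
  by rewrite /F app1_last lsub_app1.
have aF : an F.
  apply: (an_compose aP); last first.
    by rewrite mxE gb0 app1_0 linear0 row00.
  apply: van_row; first by apply: van_lsub; exact: van_id.
  apply: van_app1; first exact: van_const.
  by apply: van_gb; [exact: an_coord | rewrite mxE].
have F0 : F 0 = 0 by rewrite -app1_0 FE gb0 app1_0 row00.
have dF : cd (fun v => F (app1 0 v)) (- ('i / 2)).
  have -> : - ('i / 2) = 'i / 2 * (0 - 1) :> C by rewrite sub0r mulrN1.
  apply: (cd_ext (f := fun v => P (row_mx (app1 0 0) (app1 0 (gb v))))).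
    by move=> v; rewrite FE app1_0.
  apply: (cdP (z := fun=> 0) (v := fun=> 0) (zeta := fun=> 0)); rewrite ?gb0 //;
    try exact: vcd_const; try exact: cd_const.
  by apply: dgb => //; exact: cd_id.
have i2 : - ('i / 2) != 0 :> C by rewrite oppr_eq0 mulf_neq0 ?neq0Ci // invr_eq0 pnatr_eq0.
have [w [aw w0 hw [rho [rho0 uw]]]] := an_implicit aF F0 dF i2.
exists w; split=> //.
- move=> e b.
  have h := cd_pd (app1 e b) aw; set a := dot _ _ in h.
  suff eab : a = b by rewrite eab in h.
  have k : cd (fun tau => F (app1 (tau *: app1 e b) (w (tau *: app1 e b)))) ('i / 2 * (b - a)).
    apply: (cd_ext (f := fun tau => P (row_mx (app1 (tau *: e) (tau * b))
       (app1 0 (gb (w (tau *: app1 e b))))))).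
      move=> tau; rewrite FE; congr (P (row_mx _ _)).
      by apply/rowP => i; rewrite !mxE; case: fintype.split => j; rewrite !mxE.
    apply: (cdP (zeta := fun=> 0)); rewrite ?scale0r ?mul0r ?w0 ?gb0 //; try exact: vcd_const.
    - exact: vcd_scale.
    - by apply: cd_ext (cd_lin 0 b) => tau; rewrite add0r.
    - by apply: dgb => //; rewrite scale0r.
  have z : exists2 r : R, 0 < r & forall tau, nm tau <= r ->
      F (app1 (tau *: app1 e b) (w (tau *: app1 e b))) = 0.
    by apply: near_curve hw (vcd_scale _) _; rewrite scale0r.
  have := cd_zero z k => /eqP; rewrite mulf_eq0 subr_eq0.
  by rewrite -[_ == 0]oppr_eq0 (negPf i2) eq_sym => /eqP.
- by apply: filterS hw => x; rewrite FE.
by exists rho; split=> // x s sx ss; rewrite -FE; exact: uw.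
Qed.

(** The inverse of the change of coordinates: W (z, s) is the third coordinate of the
    point over z on the Segre variety of parameter s. *)
Lemma segre_parametrization : exists W : 'rV[C]_(2 + 1) -> C, [/\ an W, W 0 = 0,
  forall e : 'rV[C]_2, forall b, cd (fun tau => W (tau *: app1 e b)) b,
  \forall p \near (0 : 'rV[C]_(2 + 1)),
    P (row_mx (app1 (lsubmx p) (W p)) (app1 0 (gb (p 0 (last 2))))) = 0 &
  exists rho : R, 0 < rho /\ forall z s v, small rho z -> nm s <= rho -> nm v <= rho ->
    P (row_mx (app1 z v) (app1 0 (gb s))) = 0 -> v = W (app1 z s)].
Proof.
pose F (t : 'rV[C]_(2 + 1 + 1)) := P (row_mx
  (app1 (lsubmx (lsubmx t)) (t 0 (last (2 + 1)))) (app1 0 (gb (lsubmx t 0 (last 2))))).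
have FE p v : F (app1 p v) = P (row_mx (app1 (lsubmx p) v) (app1 0 (gb (p 0 (last 2))))).
  by rewrite /F app1_last lsub_app1.
have aF : an F.
  apply: (an_compose aP); last first.
    by rewrite !linear0 !mxE gb0 !app1_0 row00.
  apply: van_row; apply: van_app1.
  - by apply: van_lsub; apply: van_lsub; exact: van_id.
  - exact: an_coord.
  - exact: van_const.
  - apply: van_gb; last by rewrite linear0 mxE.
    by apply: an_last; apply: van_lsub; exact: van_id.
have F0 : F 0 = 0.
  by rewrite -(app1_0 R (2 + 1)) FE linear0 mxE gb0 !app1_0 row00.
have dF : cd (fun v => F (app1 0 v)) ('i / 2).
  have -> : 'i / 2 = 'i / 2 * (1 - 0) :> C by rewrite subr0 mulr1.
  apply: (cd_ext (f := fun v => P (row_mx (app1 0 v) (app1 0 0)))).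
    by move=> v; rewrite FE linear0 mxE gb0.
  apply: (cdP (z := fun=> 0) (v := id) (zeta := fun=> 0) (om := fun=> 0)) => //;
    try exact: vcd_const; [exact: cd_id | exact: cd_const].
have i2 : 'i / 2 != 0 :> C by rewrite mulf_neq0 ?neq0Ci // invr_eq0 pnatr_eq0.
have [W [aW W0 hW [rho [rho0 uW]]]] := an_implicit aF F0 dF i2.
exists W; split=> //.
- move=> e b; have h := cd_pd (app1 e b) aW; set a := dot _ _ in h.
  suff eab : a = b by rewrite eab in h.
  have k : cd (fun tau => F (app1 (tau *: app1 e b) (W (tau *: app1 e b)))) ('i / 2 * (a - b)).
    apply: (cd_ext (f := fun tau => P (row_mx (app1 (tau *: e) (W (tau *: app1 e b)))
       (app1 0 (gb (tau * b)))))).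
      move=> tau; rewrite FE.
      have -> : lsubmx (tau *: app1 e b) = tau *: e by rewrite linearZ /= lsub_app1.
      by have -> : (tau *: app1 e b) 0 (last 2) = tau * b by rewrite mxE app1_last.
    apply: (cdP (zeta := fun=> 0)); rewrite ?scale0r ?mul0r ?W0 ?gb0 //; try exact: vcd_const.
    - exact: vcd_scale.
    - apply: dgb; last by rewrite mul0r.
      by apply: cd_ext (cd_lin 0 b) => tau; rewrite add0r.
  have z : exists2 r : R, 0 < r & forall tau, nm tau <= r ->
      F (app1 (tau *: app1 e b) (W (tau *: app1 e b))) = 0.
    by apply: near_curve hW (vcd_scale _) _; rewrite scale0r.
  have := cd_zero z k => /eqP; rewrite mulf_eq0 subr_eq0 (negPf i2) /=.
  by move/eqP.
- by apply: filterS hW => x; rewrite FE.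
exists rho; split=> // z s v sz ss sv; have := uW (app1 z s) v (small_app1 sz ss) sv.
by rewrite FE lsub_app1 app1_last.
Qed.

End NormalCoordinates.

(** * The graphing function *)

Section GraphingFunction.
Variable R : realType.
Local Notation C := (Cplx R).
Local Notation last n := (rshift n (ord0 : 'I_1)).
Local Notation lz j := (lshift (2 + 1) (lshift 1 j)).
Local Notation lw := (lshift (2 + 1) (last 2)).
Local Notation rz j := (rshift (2 + 1) (lshift 1 j)).
Local Notation rw := (rshift (2 + 1) (last 2)).

(** The points (z, zeta, u), where zeta stands for the conjugate of z. *)
Definition pt3 (z zeta : 'rV[C]_2) (u : C) : 'rV[C]_(2 + 2 + 1) := app1 (row_mx z zeta) u.
Definition zz (t : 'rV[C]_(2 + 2 + 1)) : 'rV[C]_2 := lsubmx (lsubmx t).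
Definition ze (t : 'rV[C]_(2 + 2 + 1)) : 'rV[C]_2 := rsubmx (lsubmx t).
Definition uu (t : 'rV[C]_(2 + 2 + 1)) : C := t 0 (last (2 + 2)).
Definition hswap t := pt3 (conjmx (ze t)) (conjmx (zz t)) (uu t)^*.

Lemma zz_pt z y u : zz (pt3 z y u) = z.
Proof. by rewrite /zz /pt3 lsub_app1 row_mxKl. Qed.
Lemma ze_pt z y u : ze (pt3 z y u) = y.
Proof. by rewrite /ze /pt3 lsub_app1 row_mxKr. Qed.
Lemma uu_pt z y u : uu (pt3 z y u) = u.
Proof. by rewrite /uu /pt3 app1_last. Qed.
Lemma pt_eta t : pt3 (zz t) (ze t) (uu t) = t.
Proof. by rewrite /pt3 /zz /ze /uu hsubmxK app1_eta. Qed.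
Lemma pt0 : pt3 0 0 0 = 0.
Proof. by rewrite /pt3 row00 app1_0. Qed.
Lemma zz0 : zz 0 = 0. Proof. by rewrite -pt0 zz_pt. Qed.
Lemma ze0 : ze 0 = 0. Proof. by rewrite -pt0 ze_pt. Qed.
Lemma uu0 : uu 0 = 0. Proof. by rewrite -pt0 uu_pt. Qed.
Lemma hswap_pt z y u : hswap (pt3 z y u) = pt3 (conjmx y) (conjmx z) u^*.
Proof. by rewrite /hswap zz_pt ze_pt uu_pt. Qed.

Lemma van_zz : van zz. Proof. by apply: van_lsub; apply: van_lsub; exact: van_id. Qed.
Lemma van_ze : van ze. Proof. by apply: van_rsub; apply: van_lsub; exact: van_id. Qed.
Lemma an_uu : an uu. Proof. exact: an_coord. Qed.
Lemma van_pt n (z y : 'rV[C]_n -> 'rV[C]_2) u :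
  van z -> van y -> an u -> van (fun t => pt3 (z t) (y t) (u t)).
Proof. by move=> hz hy hu; apply: van_app1 => //; exact: van_row. Qed.

Lemma small_row m n r (x : 'rV[C]_m) (y : 'rV[C]_n) :
  small r x -> small r y -> small r (row_mx x y).
Proof. by move=> sx sy i; rewrite mxE; case: fintype.split. Qed.

Lemma small_pt r z y u : small r z -> small r y -> nm u <= r -> small r (pt3 z y u).
Proof. by move=> sz sy su; apply: small_app1 => //; exact: small_row. Qed.

Lemma small_lsub m n r (t : 'rV[C]_(m + n)) : small r t -> small r (lsubmx t).
Proof. by move=> st i; rewrite mxE. Qed.

Lemma small_rsub m n r (t : 'rV[C]_(m + n)) : small r t -> small r (rsubmx t).
Proof. by move=> st i; rewrite mxE. Qed.

Lemma near_small n r : 0 < r -> \forall t \near (0 : 'rV[C]_n), small r t.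
Proof. by move=> r0; apply/near0P; exists r. Qed.

Lemma nm_ReC (s : C) : nm ('Re s) <= nm s.
Proof. by rewrite -complexRe nmR Re_le_nm. Qed.

Lemma nm_ImC (s : C) : nm ('Im s) <= nm s.
Proof. by rewrite -complexIm nmR Im_le_nm. Qed.

Variable P : 'rV[C]_((2 + 1) + (2 + 1)) -> C.
Hypothesis aP : an P.
Hypothesis hP : \forall X \near (0 : 'rV[C]_((2 + 1) + (2 + 1))), P (cswap X) = (P X)^*.
Hypothesis P0 : P 0 = 0.
Hypothesis pz : forall j, pd (lz j) P 0 = 0.
Hypothesis pw : pd lw P 0 = 'i / 2.
Hypothesis qz : forall j, pd (rz j) P 0 = 0.
Hypothesis qw : pd rw P 0 = - ('i / 2).
Variable gam : 'rV[C]_1 -> C.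
Hypothesis ag : an gam.
Hypothesis g0 : gam 0 = 0.
Hypothesis Pg : \forall t \near (0 : 'rV[C]_1),
    P (row_mx (app1 0 (gam t)) (app1 0 (cbar gam t))) = 0.
Local Notation gb s := (cbar gam (const_mx s)).
Variable w : 'rV[C]_(2 + 1) -> C.
Hypothesis aw : an w.
Hypothesis w0 : w 0 = 0.
Hypothesis hw : \forall x \near (0 : 'rV[C]_(2 + 1)), P (row_mx x (app1 0 (gb (w x)))) = 0.
Variable W : 'rV[C]_(2 + 1) -> C.
Hypothesis aW : an W.
Hypothesis W0 : W 0 = 0.
Hypothesis dW : forall e : 'rV[C]_2, forall b, cd (fun tau => W (tau *: app1 e b)) b.
Hypothesis hW : \forall p \near (0 : 'rV[C]_(2 + 1)),
    P (row_mx (app1 (lsubmx p) (W p)) (app1 0 (gb (p 0 (last 2))))) = 0.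
Variable rW : R.
Hypothesis rW0 : 0 < rW.
Hypothesis uW : forall z s v, small rW z -> nm s <= rW -> nm v <= rW ->
    P (row_mx (app1 z v) (app1 0 (gb s))) = 0 -> v = W (app1 z s).

(** The curve is W (0, s): its points lie on their own Segre varieties. *)
Lemma W_gam : \forall t \near (0 : 'rV[C]_1), W (app1 0 ((t : 'rV[C]_1) 0 0)) = gam t.
Proof.
have h : \forall t \near (0 : 'rV[C]_1), nm (gam t - gam 0) <= rW.
  by have := an_continuous ag rW0.
apply: filterS2 Pg (filterI h (near_small 1 rW0)) => t e [k st].
apply/esym; apply: uW => //; last by rewrite scalar_eta.
  by apply: small0; exact: ltW.
by rewrite g0 subr0 in k.
Qed.

Lemma W_w : \forall x \near (0 : 'rV[C]_(2 + 1)), W (app1 (lsubmx x) (w x)) = x 0 (last 2).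
Proof.
have h : \forall x \near (0 : 'rV[C]_(2 + 1)), nm (w x - w 0) <= rW.
  by have := an_continuous aw rW0.
apply: filterS2 hw (filterI h (near_small (2 + 1) rW0)) => x e [k sx].
apply/esym; apply: uW => //; last by rewrite app1_eta.
  exact: small_lsub.
by rewrite w0 subr0 in k.
Qed.

Lemma dotW e b : dot (app1 e b) (fun j => pd j W 0) = b.
Proof. by apply: cd_unique (dW e b); exact: cd_pd. Qed.

Lemma dWb (e : 'rV[C]_2) b : cd (fun tau => cbar W (tau *: app1 e b)) b.
Proof.
have h := cd_conj (dW (conjmx e) b^*); rewrite conjCK in h.
apply: cd_ext h => tau; rewrite /cbar; congr ((W _)^*).
by apply/rowP => i; rewrite !mxE rmorphM; case: fintype.split => j; rewrite !mxE.
Qed.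

Lemma dotWb e b : dot (app1 e b) (fun j => pd j (cbar W) 0) = b.
Proof. exact: cd_unique (cd_pd (app1 e b) (an_cbar aW)) (dWb e b). Qed.

(** The point of the complexified space whose new coordinates are (z, u + i v) and
    (zeta, u - i v). *)
Definition Xm z zeta u v : 'rV[C]_((2 + 1) + (2 + 1)) :=
  row_mx (app1 z (W (app1 z (u + 'i * v)))) (app1 zeta (cbar W (app1 zeta (u - 'i * v)))).

Lemma cswap_Xm z zeta u v : cswap (Xm z zeta u v) = Xm (conjmx zeta) (conjmx z) u^* v^*.
Proof.
rewrite /Xm cswap_row !conj_app1 /cbar conjCK !conj_app1 conjmxK.
by rewrite !(rmorphB, rmorphD, rmorphM) /= conjCi !conjCK !mulNr !opprK.
Qed.

Lemma Xm0 : Xm 0 0 0 0 = 0.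
Proof. by rewrite /Xm mulr0 subr0 addr0 !app1_0 W0 cbar0 // !app1_0 row00. Qed.

Lemma van_Xm n (z zeta : 'rV[C]_n -> 'rV[C]_2) u v : van z -> van zeta -> an u -> an v ->
  z 0 = 0 -> zeta 0 = 0 -> u 0 = 0 -> v 0 = 0 ->
  van (fun t => Xm (z t) (zeta t) (u t) (v t)).
Proof.
move=> hz hy hu hv z0 y0 u0 v0.
have iv : an (fun t => 'i * v t) by apply: an_mul => //; exact: an_const.
apply: van_row; apply: van_app1 => //.
  apply: (an_compose aW); last by rewrite z0 u0 v0 mulr0 addr0 app1_0.
  by apply: van_app1 => //; exact: an_add.
apply: (an_compose (an_cbar aW)); last by rewrite y0 u0 v0 mulr0 subr0 app1_0.
by apply: van_app1 => //; exact: an_sub.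
Qed.

(** The equation of the hypersurface in the new coordinates, with v as last variable. *)
Definition F4 (t : 'rV[C]_(2 + 2 + 1 + 1)) :=
  P (Xm (zz (lsubmx t)) (ze (lsubmx t)) (uu (lsubmx t)) (t 0 (last (2 + 2 + 1)))).

Lemma F4E t v : F4 (app1 t v) = P (Xm (zz t) (ze t) (uu t) v).
Proof. by rewrite /F4 app1_last lsub_app1. Qed.

Lemma an_F4 : an F4.
Proof.
apply: (an_compose aP); last by rewrite linear0 zz0 ze0 uu0 mxE Xm0.
have hl : van (fun t : 'rV[C]_(2 + 2 + 1 + 1) => lsubmx t) by apply: van_lsub; exact: van_id.
apply: van_Xm; rewrite ?linear0 ?zz0 ?ze0 ?uu0 ?mxE //.
- by apply: van_lsub; apply: van_lsub.
- by apply: van_rsub; apply: van_lsub.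
- exact: an_last.
- exact: an_coord.
Qed.

(** The implicit function theorem gives v = phi (z, conj z, u). For zeta = 0 and v = 0 the
    equation says that (z, W (z, u)) lies on the Segre variety of parameter u, which is
    true: hence phi (z, 0, u) = 0, and the other normality condition follows by
    conjugation. *)
Lemma graphing_function : exists phi : 'rV[C]_(2 + 2 + 1) -> C, [/\ an phi,
  \forall q \near (0 : 'rV[C]_(2 + 1)), P (row_mx q (conjmx q)) = 0 <->
    'Im (w q) = phi (pt3 (lsubmx q) (conjmx (lsubmx q)) ('Re (w q))),
  \forall t \near (0 : 'rV[C]_(2 + 2 + 1)), phi (hswap t) = (phi t)^*,
  \forall t \near (0 : 'rV[C]_(2 + 2 + 1)),
    phi (pt3 0 (ze t) (uu t)) = 0 /\ phi (pt3 (zz t) 0 (uu t)) = 0 &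
  \forall t \near (0 : 'rV[C]_(2 + 2 + 1)), P (Xm (zz t) (ze t) (uu t) (phi t)) = 0].
Proof.
have F0 : F4 0 = 0 by rewrite -app1_0 F4E zz0 ze0 uu0 Xm0.
have dF : cd (fun v => F4 (app1 0 v)) (-1).
  rewrite -half_i; apply: (cd_ext (f := fun v => P (row_mx (app1 0 (W (v *: app1 0 'i)))
      (app1 0 (cbar W (v *: app1 0 (- 'i))))))).
    move=> v; rewrite F4E zz0 ze0 uu0 /Xm add0r sub0r.
    have e (k : C) : v *: app1 (0 : 'rV[C]_2) k = app1 0 (v * k).
      by apply/rowP => i; rewrite !mxE; case: fintype.split => j; rewrite !mxE ?mulr0.
    by rewrite !e mulrN (mulrC v).
  apply: (cdP aP pz pw qz qw (z := fun=> 0) (zeta := fun=> 0));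
    rewrite ?scale0r ?cbar0 //; try exact: vcd_const.
  exact: dWb.
have [|phi [ap p0 hphi [rho [rho0 up]]]] := an_implicit an_F4 F0 dF.
  by rewrite oppr_eq0 oner_eq0.
have hphi' : \forall t \near (0 : 'rV[C]_(2 + 2 + 1)), P (Xm (zz t) (ze t) (uu t) (phi t)) = 0.
  by apply: filterS hphi => t; rewrite F4E.
have herm : \forall t \near (0 : 'rV[C]_(2 + 2 + 1)), phi (hswap t) = (phi t)^*.
  have k1 : \forall t \near (0 : 'rV[C]_(2 + 2 + 1)), P (cswap (Xm (zz t) (ze t) (uu t) (phi t)))
      = (P (Xm (zz t) (ze t) (uu t) (phi t)))^*.
    apply: (near_compose (P := fun X => P (cswap X) = (P X)^*)) hP.
      by apply: van_Xm; rewrite ?zz0 ?ze0 ?uu0 //; [exact: van_zz|exact: van_ze|exact: an_uu].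
    by rewrite zz0 ze0 uu0 p0 Xm0.
  have k2 : \forall t \near (0 : 'rV[C]_(2 + 2 + 1)), nm (phi t - phi 0) <= rho.
    by have := an_continuous ap rho0.
  apply: filterS2 (filterI k1 hphi') (filterI k2 (near_small _ rho0)) => t [e1 e2] [e3 st].
  apply/esym; apply: up.
  - rewrite /hswap; apply: small_pt; rewrite ?nmJ; last exact: st.
      by apply: conjmx_small; apply: small_rsub; exact: small_lsub.
    by apply: conjmx_small; apply: small_lsub; exact: small_lsub.
  - by rewrite nmJ; rewrite p0 subr0 in e3.
  by rewrite F4E /hswap zz_pt ze_pt uu_pt -cswap_Xm e1 e2 rmorph0.
have norm1 : \forall t \near (0 : 'rV[C]_(2 + 2 + 1)), phi (pt3 (zz t) 0 (uu t)) = 0.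
  have k1 : \forall t \near (0 : 'rV[C]_(2 + 2 + 1)), W (app1 0 ((const_mx (uu t)^* : 'rV[C]_1) 0 0))
      = gam (const_mx (uu t)^*).
    have := near_compose (P := fun t : 'rV[C]_1 => W (app1 0 (conjmx t 0 0)) = gam (conjmx t))
      (G := fun t => const_mx (uu t) : 'rV[C]_1) (van_scalar an_uu) _ (near_conj W_gam).
    rewrite uu0 const_mx0 => /(_ erefl); apply: filterS => t.
    suff -> : conjmx (const_mx (uu t) : 'rV[C]_1) = const_mx (uu t)^* by [].
    by apply/rowP => i; rewrite !mxE.
  have k2 : \forall t \near (0 : 'rV[C]_(2 + 2 + 1)),
      P (row_mx (app1 (zz t) (W (app1 (zz t) (uu t)))) (app1 0 (gb (uu t)))) = 0.
    have := near_compose (P := fun p : 'rV[C]_(2 + 1) => P (row_mx (app1 (lsubmx p) (W p))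
      (app1 0 (gb (p 0 (last 2))))) = 0) (G := fun t => app1 (zz t) (uu t))
      (van_app1 van_zz an_uu) _ hW.
    rewrite uu0 zz0 app1_0 => /(_ erefl); apply: filterS => t.
    by rewrite lsub_app1 app1_last.
  apply: filterS2 (filterI k1 k2) (near_small _ rho0) => t [e1 e2] st.
  apply/esym; apply: up; rewrite ?nm0 ?(ltW rho0) //.
    apply: small_pt; [by apply: small_lsub; exact: small_lsub | | exact: st].
    by apply: small0; exact: ltW.
  rewrite F4E zz_pt ze_pt uu_pt /Xm mulr0 subr0 addr0 -[RHS]e2.
  congr (P (row_mx _ (app1 _ _))); rewrite /cbar conj_app1 conjmx0.
  rewrite mxE in e1; rewrite e1; congr ((gam _)^*).
  by apply/rowP => i; rewrite !mxE.
exists phi; split=> //.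
- have k2 : \forall q \near (0 : 'rV[C]_(2 + 1)), nm (w q - w 0) <= rho.
    by have := an_continuous aw rho0.
  have [r3 [r30 h3]] := (near0P _).1 hphi'.
  have k3 : \forall q \near (0 : 'rV[C]_(2 + 1)), nm (w q - w 0) <= r3.
    by have := an_continuous aw r30.
  apply: filterS2 (filterI W_w (near_small _ r30))
    (filterI k2 (filterI k3 (near_small _ rho0))) => q [eW sq3] [e2 [e3 sq]].
  rewrite w0 subr0 in e2; rewrite w0 subr0 in e3.
  set t := pt3 _ _ _.
  have st (r : R) : small r q -> nm (w q) <= r -> small r t.
    move=> sr wr; apply: small_pt; first exact: small_lsub.
      by apply: conjmx_small; exact: small_lsub.
    by apply: le_trans (nm_ReC _) wr.
  have X v : v \is Num.real -> 'Im (w q) = v -> row_mx q (conjmx q) = Xm (zz t) (ze t) (uu t) v.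
    move=> vr ev; rewrite /t zz_pt ze_pt uu_pt /Xm -ev.
    have s1 : 'Re (w q) + 'i * 'Im (w q) = w q by rewrite -Crect.
    have s2 : 'Re (w q) - 'i * 'Im (w q) = (w q)^*.
      by rewrite [in RHS](Crect (w q)) conjC_rect ?Creal_Re ?Creal_Im.
    rewrite s1 s2 /cbar conj_app1 conjmxK conjCK eW.
    by rewrite -conj_app1 app1_eta.
  have Xi : row_mx q (conjmx q) = Xm (zz t) (ze t) (uu t) ('Im (w q)).
    by apply: X => //; exact: Creal_Im.
  split=> [e|e].
    apply: up; [exact: st | exact: le_trans (nm_ImC _) e2 |].
    by rewrite F4E -Xi.
  by rewrite Xi e; apply: h3; exact: st.
have k1 : \forall t \near (0 : 'rV[C]_(2 + 2 + 1)), phi (pt3 (ze t) 0 (uu t)) = 0.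
  have := near_compose (P := fun t => phi (pt3 (zz t) 0 (uu t)) = 0)
    (G := fun t => pt3 (ze t) (zz t) (uu t)) (van_pt van_ze van_zz an_uu) _ norm1.
  rewrite zz0 ze0 uu0 pt0 => /(_ erefl); apply: filterS => t.
  by rewrite zz_pt uu_pt.
have k2 : \forall t \near (0 : 'rV[C]_(2 + 2 + 1)),
    phi (hswap (pt3 0 (ze t) (uu t))) = (phi (pt3 0 (ze t) (uu t)))^*.
  apply: (near_compose (P := fun t => phi (hswap t) = (phi t)^*)) herm.
    by apply: van_pt; [exact: van_const | exact: van_ze | exact: an_uu].
  by rewrite ze0 uu0 pt0.
apply: filterS2 norm1 (filterI k2 (near_conj k1)) => t e1 [e2 e3]; split=> //.
apply: (can_inj (@conjCK _)); rewrite rmorph0 -e2 hswap_pt conjmx0 -[RHS]e3.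
congr (phi (pt3 _ _ _)); last by rewrite /uu mxE.
by rewrite /ze conj_lsub conj_rsub.
Qed.

End GraphingFunction.

(** * Jets of the graphing function *)

Section GraphJets.
Variable R : realType.
Local Notation C := (Cplx R).
Local Notation last n := (rshift n (ord0 : 'I_1)).
Local Notation lz j := (lshift (2 + 1) (lshift 1 j)).
Local Notation lw := (lshift (2 + 1) (last 2)).
Local Notation rz j := (rshift (2 + 1) (lshift 1 j)).
Local Notation rw := (rshift (2 + 1) (last 2)).
Local Notation i0 := (0 : 'I_2).
Local Notation i1 := (1 : 'I_2).

Variable P : 'rV[C]_((2 + 1) + (2 + 1)) -> C.
Hypothesis aP : an P.
Hypothesis hP : \forall X \near (0 : 'rV[C]_((2 + 1) + (2 + 1))), P (cswap X) = (P X)^*.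
Hypothesis P0 : P 0 = 0.
Hypothesis pz : forall j, pd (lz j) P 0 = 0.
Hypothesis pw : pd lw P 0 = 'i / 2.
Hypothesis qw : pd rw P 0 = - ('i / 2).
Variable gam : 'rV[C]_1 -> C.
Hypothesis g0 : gam 0 = 0.
Local Notation gb s := (cbar gam (const_mx s)).
Variable W : 'rV[C]_(2 + 1) -> C.
Hypothesis aW : an W.
Hypothesis W0 : W 0 = 0.
Hypothesis dW : forall e : 'rV[C]_2, forall b, cd (fun tau => W (tau *: app1 e b)) b.
Hypothesis hW : \forall p \near (0 : 'rV[C]_(2 + 1)),
    P (row_mx (app1 (lsubmx p) (W p)) (app1 0 (gb (p 0 (last 2))))) = 0.
Variable phi : 'rV[C]_(2 + 2 + 1) -> C.
Hypothesis ap : an phi.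
Hypothesis phi0 : \forall t \near (0 : 'rV[C]_(2 + 2 + 1)), phi (pt3 0 (ze t) (uu t)) = 0.
Hypothesis hphi : \forall t \near (0 : 'rV[C]_(2 + 2 + 1)),
   P (Xm W (zz t) (ze t) (uu t) (phi t)) = 0.

(** The Segre variety of the origin, in the conjugate variables, is the graph of om over
    the zeta-plane; Yc parametrizes it. *)
Definition om zeta := cbar W (app1 zeta 0).
Definition Yc (zeta : 'rV[C]_2) : 'rV[C]_((2 + 1) + (2 + 1)) := row_mx 0 (app1 zeta (om zeta)).
(** The part of phi linear in z_j at u = 0, as a function of zeta. *)
Definition phij (j : 'I_2) (zeta : 'rV[C]_2) := pd (lshift 1 (lshift 2 j)) phi (pt3 0 zeta 0).
(** The derivative of the equation of the hypersurface in the direction of v. *)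
Definition Dd zeta := 'i * (pd lw P (Yc zeta)
   - pd rw P (Yc zeta) * pd (last 2) (cbar W) (app1 zeta 0)).

Lemma van_emb : van (fun zeta : 'rV[C]_2 => app1 zeta (0 : C)).
Proof. by apply: van_app1; [exact: van_id | exact: an_const]. Qed.

Lemma an_om : an om.
Proof. by apply: (an_compose (an_cbar aW)); [exact: van_emb | rewrite app1_0]. Qed.

Lemma om0 : om 0 = 0.
Proof. by rewrite /om app1_0 cbar0. Qed.

Lemma pd_om j : pd j om 0 = 0.
Proof.
have h := cd_pd (delta_mx 0 j) an_om; rewrite dot_delta in h.
apply: cd_unique h _; apply: cd_ext (dWb dW (delta_mx 0 j) 0) => tau; rewrite /om.
by congr (cbar W _); apply/rowP => i; rewrite !mxE; case: fintype.split => k; rewrite !mxE ?mulr0.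
Qed.

Lemma bigO_om : bigO 2 om.
Proof.
have := bigO2 an_om om0; apply: bigO_ext => z; rewrite big1 ?subr0 // => j _.
by rewrite pd_om mulr0.
Qed.

Lemma van_Yc : van Yc.
Proof.
apply: van_row; first exact: van_const.
by apply: van_app1; [exact: van_id | exact: an_om].
Qed.

Lemma Yc0 : Yc 0 = 0.
Proof. by rewrite /Yc om0 app1_0 row00. Qed.

Lemma bigO_Yc i : bigO 1 (fun z => Yc z 0 i).
Proof. by apply: bigO1; [exact: van_Yc | rewrite Yc0 mxE]. Qed.

(** The origin and the points of its Segre variety satisfy the complexified equation. *)
Lemma P_Yc : \forall z \near (0 : 'rV[C]_2), P (Yc z) = 0.
Proof.
have h : \forall z \near (0 : 'rV[C]_2), P (row_mx (app1 z (W (app1 z 0))) 0) = 0.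
  have := near_compose (P := fun p : 'rV[C]_(2 + 1) => P (row_mx (app1 (lsubmx p) (W p))
    (app1 0 (gb (p 0 (last 2))))) = 0) van_emb (app1_0 _ _) hW.
  by apply: filterS => z; rewrite lsub_app1 app1_last const_mx0 cbar0 // app1_0.
have k : \forall z \near (0 : 'rV[C]_2), P (cswap (row_mx (app1 z (W (app1 z 0))) 0))
   = (P (row_mx (app1 z (W (app1 z 0))) 0))^*.
  apply: (near_compose (P := fun X => P (cswap X) = (P X)^*)) hP; last first.
    by rewrite app1_0 W0 app1_0 row00.
  apply: van_row; last exact: van_const.
  apply: van_app1; first exact: van_id.
  by apply: (an_compose aW); [exact: van_emb | exact: app1_0].
apply: filterS2 (near_conj h) (near_conj k) => z e1 e2.
rewrite e1 rmorph0 in e2; rewrite -[RHS]e2; congr P.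
by rewrite cswap_row conjmx0 conj_app1 conjmxK /Yc /om /cbar conj_app1 rmorph0.
Qed.

(** Implicit differentiation of the equation of the graph in the direction z_j, at the
    points (0, zeta, 0), where phi vanishes and W (0, 0) = 0. *)
Lemma phij_eq j : \forall z \near (0 : 'rV[C]_2), pd (lz j) P (Yc z) + phij j z * Dd z = 0.
Proof.
have vT : van (fun z : 'rV[C]_2 => pt3 0 z 0).
  by apply: van_pt; [exact: van_const | exact: van_id | exact: an_const].
have n1 : \forall z \near (0 : 'rV[C]_2), fderiv phi (pt3 0 z 0) (fun j => pd j phi (pt3 0 z 0)).
  by have := near_compose (P := fun t => fderiv phi t (fun j => pd j phi t)) vT (pt0 R) (an_fderiv ap).
have n2 : \forall z \near (0 : 'rV[C]_2), fderiv (cbar W) (app1 z 0) (fun j => pd j (cbar W) (app1 z 0)).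
  by have := near_compose (P := fun t => fderiv (cbar W) t (fun j => pd j (cbar W) t)) van_emb
    (app1_0 _ _) (an_fderiv (an_cbar aW)).
have n3 : \forall z \near (0 : 'rV[C]_2), fderiv P (Yc z) (fun j => pd j P (Yc z)).
  by have := near_compose (P := fun t => fderiv P t (fun j => pd j P t)) van_Yc Yc0 (an_fderiv aP).
have n4 : \forall z \near (0 : 'rV[C]_2), phi (pt3 0 z 0) = 0.
  have := near_compose (P := fun t => phi (pt3 0 (ze t) (uu t)) = 0) vT (pt0 R) phi0.
  by apply: filterS => z; rewrite ze_pt uu_pt.
have [r [r0 hr]] := (near0P _).1 hphi.
apply: filterS2 (filterI n1 n2) (filterI n3 (filterI n4 (near_small _ r0))) =>
  z [f1 f2] [f3 [e4 sz]].
pose T tau := pt3 (tau *: delta_mx 0 j) z 0.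
have T0 : T 0 = pt3 0 z 0 by rewrite /T scale0r.
have vcT : vcd T (pt3 (delta_mx 0 j) 0 0).
  apply: vcd_app1; last exact: cd_const.
  by apply: vcd_row; [exact: vcd_scale | exact: vcd_const].
have h1 : cd (fun tau => phi (T tau)) (phij j z).
  have := cd_comp f1 T0 vcT.
  by rewrite dot_app1 dot_row dot_delta dot0 mul0r !addr0.
have h2 : cd (fun tau => W (app1 (tau *: delta_mx 0 j) (0 + 'i * phi (T tau)))) ('i * phij j z).
  rewrite -[X in cd _ X](dotW aW dW (delta_mx 0 j)).
  apply: (cd_comp (an_fderiv0 aW)).
    by rewrite scale0r T0 e4 mulr0 addr0 app1_0.
  apply: vcd_app1; first exact: vcd_scale.
  by rewrite -[X in cd _ X]add0r; apply: cd_add; [exact: cd_const | exact: cd_scale].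
have h3 : cd (fun tau => cbar W (app1 z (0 - 'i * phi (T tau))))
    (- 'i * phij j z * pd (last 2) (cbar W) (app1 z 0)).
  have -> : - 'i * phij j z * pd (last 2) (cbar W) (app1 z 0)
     = dot (app1 0 (- 'i * phij j z)) (fun j => pd j (cbar W) (app1 z 0)).
    by rewrite dot_app1 dot0 add0r.
  apply: (cd_comp f2); first by rewrite T0 e4 mulr0 subr0.
  apply: vcd_app1; first exact: vcd_const.
  rewrite -[X in cd _ X]add0r; apply: cd_add; first exact: cd_const.
  by apply: cd_ext (cd_scale (- 'i) h1) => tau; rewrite mulNr.
have h4 := cd_comp f3 _ (vcd_row (vcd_app1 (vcd_scale (delta_mx 0 j)) h2)
  (vcd_app1 (vcd_const z) h3)).
have e : row_mx (app1 ((0 : C) *: delta_mx 0 j) (W (app1 ((0 : C) *: delta_mx 0 j) (0 + 'i * phi (T 0)))))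
    (app1 z (cbar W (app1 z (0 - 'i * phi (T 0))))) = Yc z.
  by rewrite scale0r T0 e4 mulr0 addr0 subr0 app1_0 W0 app1_0.
have hz := cd_zero _ (h4 e).
rewrite dot_row !dot_app1 dot_delta dot0 add0r in hz.
rewrite /Dd -[RHS]hz; last first.
  exists r => // tau ht; have := hr (T tau).
  rewrite /T zz_pt ze_pt uu_pt; apply; apply: small_pt => //; last by rewrite nm0 ltW.
  move=> i; rewrite !mxE nmM; case: (_ == _) => /=; rewrite ?nm1 ?nm0 ?mulr1 ?mulr0 ?(ltW r0) //.
  by case: eqP; rewrite ?nm1 ?nm0 ?mulr1 ?mulr0 ?(ltW r0).
lazy beta; set a := pd (lz j) P _; set b := pd lw P _; set c := pd rw P _.
set d := pd _ (cbar W) _; move: a b c d (phij j z) => a b c d f.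
by rewrite mulrBr; move: 'i => u; ring.
Qed.

Lemma an_phij j : an (phij j).
Proof.
apply: (an_compose (an_pd _ ap)); last exact: pt0.
by apply: van_pt; [exact: van_const | exact: van_id | exact: an_const].
Qed.

Lemma an_Dd : an Dd.
Proof.
apply: an_mul; first exact: an_const.
apply: an_sub; first exact: (an_compose (an_pd _ aP) van_Yc Yc0).
apply: an_mul; first exact: (an_compose (an_pd _ aP) van_Yc Yc0).
by apply: (an_compose (an_pd _ (an_cbar aW)) van_emb); rewrite app1_0.
Qed.

Lemma Dd0 : Dd 0 = -1.
Proof.
rewrite /Dd Yc0 app1_0 pw qw.
have -> : pd (last 2) (cbar W) 0 = 1.
  by have := dotWb aW dW 0 1; rewrite dot_app1 dot0 add0r mul1r.
rewrite mulr1 -(@half_i R); by move: 'i => u; field.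
Qed.

Lemma phij0 j : phij j 0 = 0.
Proof.
have [r [r0 h]] := (near0P _).1 (phij_eq j).
have := h 0 (small0 (ltW r0)); rewrite Yc0 pz add0r Dd0 mulrN1 => /eqP.
by rewrite oppr_eq0 => /eqP.
Qed.

Lemma bigO_phij j : bigO 1 (phij j).
Proof. by apply: bigO1; [exact: an_phij | exact: phij0]. Qed.

Lemma bigO_Dd : bigO 1 (fun z => 1 + Dd z).
Proof.
apply: bigO1; last by rewrite Dd0 subrr.
by apply: an_add; [exact: an_const | exact: an_Dd].
Qed.

(** Form of phij_eq suited to estimates: 1 + Dd vanishes at the origin, so that the term
    with this factor gains one order. *)
Lemma phij_split j : \forall z \near (0 : 'rV[C]_2),
  pd (lz j) P (Yc z) + phij j z * (1 + Dd z) = phij j z.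
Proof.
apply: filterS (phij_eq j) => z h.
by rewrite mulrDr mulr1 addrCA h addr0.
Qed.

Lemma dotD m (a : 'rV[C]_m) f g k :
  dot a (fun i => f i + k * g i) = dot a f + k * dot a g.
Proof.
by rewrite /dot mulr_sumr -big_split; apply: eq_bigr => i _; rewrite /= mulrDr mulrCA.
Qed.

Lemma dot2 (a : 'rV[C]_2) g : dot a g = a 0 0 * g 0 + a 0 1 * g 1.
Proof.
rewrite /dot big_ord_recl big_ord1; congr (_ + a 0 _ * g _); by apply/val_inj.
Qed.

Lemma dot_first (z : 'rV[C]_2) (h : 'I_2 -> 'I_2 -> C) :
  (forall a b, h a b = ((a == i0) && (b == i0))%:R) ->
  dot z (fun a => dot z (fun b => h a b)) = z 0 i0 * z 0 i0.
Proof.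
move=> hh; have h0 : dot z (fun b => h i0 b) = z 0 i0.
  by rewrite dot2 !hh eqxx /= mulr1 mulr0 addr0.
have h1 : dot z (fun b => h i1 b) = 0 by rewrite dot2 !hh /= !mulr0 addr0.
by rewrite dot2 h0 h1 mulr0 addr0.
Qed.

Lemma bigO_dot (g : 'I_2 -> C) : bigO 1 (fun z : 'rV[C]_2 => dot z g).
Proof.
apply: bigO_sum => i _; have h := bigO_scale (g i) (bigO_coord R i).
by apply: bigO_ext h => z; rewrite mulrC.
Qed.

(** The first-order expansion of the derivative of P in z_1 on the Segre variety, whose
    third coordinate om is O(2). *)
Lemma phi1_jet : (forall a, pd (rz a) (pd (lz i0) P) 0 = (a == i0)%:R) ->
  bigO 2 (fun z => phij i0 z - z 0 i0).
Proof.
move=> hl; have aq := an_pd (lz i0) aP.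
have h1 := bigO_comp (bigO2 aq (pz i0)) bigO_Yc.
have h2 : bigO 2 (fun z => phij i0 z * (1 + Dd z)).
  exact: (@bigO_mul R 2 1 1 _ _ (bigO_phij i0) bigO_Dd).
pose k := pd rw (pd (lz i0) P) 0.
have h3 := bigO_add (bigO_add h1 h2) (bigO_scale k bigO_om).
apply: bigO_eq h3; apply: filterS (phij_split i0) => z e.
rewrite -[in RHS]e; set S := \sum_j _.
have -> : S = z 0 i0 + om z * k.
  have -> : S = dot (Yc z) (fun j => pd j (pd (lz i0) P) 0) by [].
  rewrite /Yc dot_row dot0 add0r dot_app1; congr (_ + _).
  by rewrite dot2 !hl eqxx mulr1 mulr0 addr0.
move: (pd _ P _) (phij _ _ * _) (z 0 i0) (om z) => a b c d; ring.
Qed.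

(** As P vanishes on the Segre variety, the derivative of P in z_2 may be corrected by
    kappa P, which kills its linear part; the quadratic part remains. *)
Lemma phi2_jet (kappa : C) (e := fun X => pd (lz i1) P X + kappa * P X) :
  (forall i, pd (rshift (2 + 1) i) e 0 = 0) ->
  (forall a b : 'I_2, pd (rz b) (pd (rz a) e) 0 = ((a == i0) && (b == i0))%:R) ->
  bigO 3 (fun z => phij i1 z - 2^-1 * (z 0 i0 * z 0 i0)).
Proof.
move=> e1 e2; have ae : an e.
  apply: an_add; first exact: an_pd.
  by apply: an_mul => //; exact: an_const.
have e0 : e 0 = 0 by rewrite /e pz P0 mulr0 addr0.
have h1 := bigO_comp (bigO3 ae e0) bigO_Yc.
pose h i l := pd l (pd i e) 0.
pose B z := dot z (fun a => h (rz a) rw) + dot z (fun b => h rw (rz b)) + om z * h rw rw.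
have hB : bigO 3 (fun z => om z * B z).
  apply: (@bigO_mul R 2 2 1) bigO_om _.
  apply: bigO_add; first by apply: bigO_add; exact: bigO_dot.
  apply: bigO_ext (bigO_scale (h rw rw) (bigOW (leqnSn 1) bigO_om)) => z.
  by rewrite mulrC.
have eY : bigO 3 (fun z => e (Yc z) - 2^-1 * (z 0 i0 * z 0 i0)).
  apply: bigO_ext (bigO_add h1 (bigO_scale 2^-1 hB)) => z.
  have -> : \sum_j Yc z 0 j * pd j e 0 = 0.
    rewrite -/(dot (Yc z) (fun j => pd j e 0)) /Yc dot_row dot0 add0r.
    by apply: big1 => i _; rewrite e1 mulr0.
  have -> : \sum_j \sum_l Yc z 0 j * Yc z 0 l * pd l (pd j e) 0
      = z 0 i0 * z 0 i0 + om z * B z.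
    transitivity (dot (Yc z) (fun i => dot (Yc z) (fun l => h i l))).
      by apply: eq_bigr => i _; rewrite mulr_sumr; apply: eq_bigr => l _; rewrite mulrA.
    have eq1 i : dot (Yc z) (fun l => h i l) = dot z (fun b => h i (rz b)) + om z * h i rw.
      by rewrite /Yc dot_row dot0 add0r dot_app1.
    rewrite {1}/Yc dot_row dot0 add0r dot_app1.
    have -> : dot z (fun a => dot (Yc z) (fun l => h (rz a) l))
       = z 0 i0 * z 0 i0 + om z * dot z (fun a => h (rz a) rw).
      rewrite (_ : (fun a => _) = fun a => dot z (fun b => h (rz a) (rz b)) + om z * h (rz a) rw);
        last by apply/funext => a; rewrite eq1.
      rewrite dotD; congr (_ + _).
      exact: (@dot_first z (fun a b => h (rz a) (rz b)) e2).
    by rewrite eq1 /B -addrA -mulrDr addrA.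
  by rewrite subr0 mulrDr opprD addrA subrK.
have hp2 : bigO 2 (phij i1).
  have q1 : bigO 2 (fun z => e (Yc z)).
    have q3 : bigO 2 (fun z : 'rV[C]_2 => 2^-1 * (z 0 i0 * z 0 i0)).
      by apply: bigO_scale; apply: (@bigO_mul R 2 1 1); exact: bigO_coord.
    apply: bigO_ext (bigO_add (bigOW (leqnSn 2) eY) q3) => z.
    by rewrite subrK.
  have q2 : bigO 2 (fun z => phij i1 z * (1 + Dd z)).
    exact: (@bigO_mul R 2 1 1 _ _ (bigO_phij i1) bigO_Dd).
  apply: bigO_eq (bigO_add q1 q2).
  apply: filterS2 (phij_split i1) P_Yc => z h2 h3.
  by rewrite /e h3 mulr0 addr0.
have h2 : bigO 3 (fun z => phij i1 z * (1 + Dd z)).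
  exact: (@bigO_mul R 2 2 1 _ _ hp2 bigO_Dd).
apply: bigO_eq (bigO_add eY h2).
apply: filterS2 (phij_split i1) P_Yc => z h3 h4.
by rewrite /e h4 mulr0 addr0 addrAC h3.
Qed.

End GraphJets.

(** * Straightening the first coordinate *)

Section Straighten.
Variable R : realType.
Local Notation C := (Cplx R).
Local Notation last n := (rshift n (ord0 : 'I_1)).
Local Notation i0 := (0 : 'I_2).
Local Notation i1 := (1 : 'I_2).
Local Notation zi j := (lshift 1 (lshift 2 j)).

Definition mk2 (a b : C) : 'rV[C]_2 := \row_j (if j == i0 then a else b).

Lemma mk2_eta (z : 'rV[C]_2) : mk2 (z 0 i0) (z 0 i1) = z.
Proof.
apply/rowP => j; rewrite mxE; case: eqP => [->//|h]; congr (z 0 _).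
by apply/val_inj; move: h; case: j => -[|[|//]] hj // h; case: h; apply/val_inj.
Qed.

Lemma mk2_0 : mk2 0 0 = 0.
Proof. by apply/rowP => j; rewrite !mxE if_same. Qed.

Lemma mk2_0E a b : mk2 a b 0 i0 = a. Proof. by rewrite mxE. Qed.
Lemma mk2_1E a b : mk2 a b 0 i1 = b. Proof. by rewrite mxE. Qed.

Lemma conj_mk2 a b : conjmx (mk2 a b) = mk2 a^* b^*.
Proof. by apply/rowP => j; rewrite !mxE; case: ifP. Qed.

Lemma small_mk2 r a b : nm a <= r -> nm b <= r -> small r (mk2 a b).
Proof. by move=> ha hb i; rewrite mxE; case: ifP. Qed.

Lemma van_mk2 n (f g : 'rV[C]_n -> C) : an f -> an g -> van (fun t => mk2 (f t) (g t)).
Proof.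
move=> af ag i; apply: (an_ext (f := fun t => if i == i0 then f t else g t)).
  by move=> t; rewrite mxE.
by case: (i == i0).
Qed.

Lemma vcd_mk2 f g a b : cd f a -> cd g b -> vcd (fun tau => mk2 (f tau) (g tau)) (mk2 a b).
Proof.
move=> hf hg i; rewrite mxE.
apply: (cd_ext (f := fun tau => if i == i0 then f tau else g tau)).
  by move=> t; rewrite mxE.
by case: (i == i0).
Qed.

Variable phi : 'rV[C]_(2 + 2 + 1) -> C.
Hypothesis ap : an phi.
Hypothesis herm : \forall t \near (0 : 'rV[C]_(2 + 2 + 1)), phi (hswap t) = (phi t)^*.
Hypothesis norm : \forall t \near (0 : 'rV[C]_(2 + 2 + 1)),
    phi (pt3 0 (ze t) (uu t)) = 0 /\ phi (pt3 (zz t) 0 (uu t)) = 0.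
Hypothesis jet0 : bigO 2 (fun z => phij phi i0 z - z 0 i0).
Hypothesis jet1 : bigO 3 (fun z => phij phi i1 z - 2^-1 * (z 0 i0 * z 0 i0)).

Lemma fderiv_bigO n (f : 'rV[C]_n -> C) (a : 'I_n -> C) :
  f 0 = 0 -> bigO 2 (fun z => f z - dot z a) -> fderiv f 0 a.
Proof.
move=> f0 [r [B [r0 B0 h]]]; exists r, B; split=> // eta z he sz.
by rewrite add0r f0 subr0; exact: h.
Qed.

Let f1 := cbar (phij phi i0).

Lemma phij00 : phij phi i0 0 = 0.
Proof.
have [r [B [r0 B0 h]]] := jet0; apply: nm_le0.
have := h 0 0; rewrite lexx (ltW r0) => /(_ isT (small0 (lexx 0))).
by rewrite mxE subr0 expr0n /= mulr0.
Qed.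

Lemma f1_0 : f1 0 = 0.
Proof. by rewrite /f1 cbar0 // phij00. Qed.

Lemma an_f1 : an f1.
Proof. by apply: an_cbar; exact: an_phij. Qed.

Lemma bigO_cbar n k (f : 'rV[C]_n -> C) : bigO k f -> bigO k (cbar f).
Proof.
move=> [r [B [r0 B0 h]]]; exists r, B; split=> // eta t he st.
by rewrite /cbar nmJ; apply: h => //; exact: conjmx_small.
Qed.

Lemma f1_jet : bigO 2 (fun z => f1 z - z 0 i0).
Proof.
apply: bigO_ext (bigO_cbar jet0) => z.
by rewrite /f1 /cbar rmorphB /= [(conjmx z) _ _]mxE conjCK.
Qed.

Lemma fderiv_f1 : fderiv f1 0 (fun j => (j == i0)%:R).
Proof.
apply: fderiv_bigO; first exact: f1_0.
by apply: bigO_ext f1_jet => z; rewrite dot2 eqxx mulr1 mulr0 addr0.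
Qed.

Lemma cd_f1 a b f g : cd f a -> cd g b -> f 0 = 0 -> g 0 = 0 ->
  cd (fun tau => f1 (mk2 (f tau) (g tau))) a.
Proof.
move=> hf hg f0 g0; have := cd_comp fderiv_f1 (_ : mk2 (f 0) (g 0) = 0) (vcd_mk2 hf hg).
rewrite f0 g0 mk2_0 dot2 mk2_0E mk2_1E eqxx mulr1 mulr0 addr0; exact.
Qed.

(** The map (f1 z, z_2) is tangent to the identity at the origin, so that it can be
    inverted by solving for the first coordinate alone. *)
Lemma straighten : exists g1 : 'rV[C]_2 -> C, [/\ an g1, g1 0 = 0,
  forall e : 'rV[C]_2, cd (fun tau => g1 (tau *: e)) (e 0 i0),
  \forall z \near (0 : 'rV[C]_2), f1 (mk2 (g1 z) (z 0 i1)) = z 0 i0 &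
  \forall z \near (0 : 'rV[C]_2), g1 (mk2 (f1 z) (z 0 i1)) = z 0 i0].
Proof.
pose F (t : 'rV[C]_(2 + 1)) := f1 (mk2 (t 0 (last 2)) (lsubmx t 0 i1)) - lsubmx t 0 i0.
have FE z v : F (app1 z v) = f1 (mk2 v (z 0 i1)) - z 0 i0.
  by rewrite /F app1_last lsub_app1.
have vl : van (fun t : 'rV[C]_(2 + 1) => lsubmx t) by apply: van_lsub; exact: van_id.
have aF : an F.
  apply: an_sub; last exact: vl.
  apply: (an_compose an_f1); last by rewrite linear0 !mxE mk2_0.
  by apply: van_mk2; [exact: an_coord | exact: vl].
have F0 : F 0 = 0 by rewrite -app1_0 FE !mxE mk2_0 f1_0 subr0.
have dF : cd (fun v => F (app1 0 v)) 1.
  apply: (cd_ext (f := fun v => f1 (mk2 v 0))).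
    by move=> v; rewrite FE !mxE subr0.
  exact: (cd_f1 (cd_id R) (cd_const 0)).
have [g1 [ag g0 hg [rho [rho0 ug]]]] := an_implicit aF F0 dF (oner_neq0 _).
have hg' : \forall z \near (0 : 'rV[C]_2), f1 (mk2 (g1 z) (z 0 i1)) = z 0 i0.
  by apply: filterS hg => z; rewrite FE => /eqP; rewrite subr_eq0 => /eqP.
exists g1; split=> //.
- move=> e; have h := cd_pd e ag; set a := dot _ _ in h.
  suff ea : a = e 0 i0 by rewrite ea in h.
  have lin j : cd (fun tau => (tau *: e) 0 j) (e 0 j) by exact: vcd_scale.
  have k : cd (fun tau => f1 (mk2 (g1 (tau *: e)) ((tau *: e) 0 i1))) a.
    by apply: (cd_f1 h (lin i1)); rewrite scale0r ?mxE.
  apply: cd_unique k _; apply: cd_eq (lin i0).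
  have [r r0 hr] := near_curve hg' (vcd_scale e) (scale0r e).
  by exists r => // tau /hr ->.
have h : \forall z \near (0 : 'rV[C]_2), nm (f1 z - f1 0) <= rho.
  by have := an_continuous an_f1 rho0.
apply: filterS2 h (near_small _ rho0) => z; rewrite f1_0 subr0 => h1 sz.
apply/esym; apply: ug.
- by apply: small_mk2 => //; exact: sz.
- exact: sz.
by rewrite FE mk2_0E mk2_1E mk2_eta subrr.
Qed.

Definition f1v (z : 'rV[C]_2) := mk2 (f1 z) (z 0 i1).

(** With z_1 replaced by f1 z, the part of phi linear in z_1 becomes zeta_1 exactly, since
    f1 is by definition the conjugate of that part. As the change is tangent to the
    identity, it preserves the 2-jet of the part linear in z_2. *)
Lemma straightened_graph : exists psi : 'rV[C]_(2 + 2 + 1) -> C, [/\ an psi,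
  \forall t \near (0 : 'rV[C]_(2 + 2 + 1)), psi (hswap t) = (psi t)^*,
  \forall t \near (0 : 'rV[C]_(2 + 2 + 1)),
    psi (pt3 0 (ze t) (uu t)) = 0 /\ psi (pt3 (zz t) 0 (uu t)) = 0,
  (\forall z \near (0 : 'rV[C]_2), phij psi i0 z = z 0 i0) /\
    bigO 3 (fun z => phij psi i1 z - 2^-1 * (z 0 i0 * z 0 i0)) &
  exists r : R, 0 < r /\ forall z u, small r z -> nm u <= r ->
    phi (pt3 z (conjmx z) u) = psi (pt3 (f1v z) (conjmx (f1v z)) u)].
Proof.
have [g1 [ag g0 dg hg hgf]] := straighten.
pose gv (z : 'rV[C]_2) := mk2 (g1 z) (z 0 i1).
pose gb z := conjmx (gv (conjmx z)).
have gv0 : gv 0 = 0 by rewrite /gv g0 mxE mk2_0.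
have gb0 : gb 0 = 0 by rewrite /gb conjmx0 gv0 conjmx0.
have vgv : van gv by apply: van_mk2 => //; exact: an_coord.
have vgb : van gb by exact: van_conj.
have vzg : van (fun t => gv (zz t)).
  by move=> i; apply: (an_compose (vgv i)); [exact: van_zz | exact: zz0].
have veg : van (fun t => gb (ze t)).
  by move=> i; apply: (an_compose (vgb i)); [exact: van_ze | exact: ze0].
pose G t := pt3 (gv (zz t)) (gb (ze t)) (uu t).
have vG : van G by apply: van_pt => //; exact: an_uu.
have G0 : G 0 = 0 by rewrite /G zz0 ze0 uu0 gv0 gb0 pt0.
pose psi t := phi (G t).
have apsi : an psi by exact: an_compose.
have jet j : \forall z \near (0 : 'rV[C]_2), phij psi j z = phij phi j (gb z).
  have vT : van (fun z : 'rV[C]_2 => pt3 0 z 0).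
    by apply: van_pt; [exact: van_const | exact: van_id | exact: an_const].
  have vT' : van (fun z : 'rV[C]_2 => pt3 0 (gb z) 0).
    by apply: van_pt; [exact: van_const | exact: vgb | exact: an_const].
  have n1 : \forall z \near (0 : 'rV[C]_2), fderiv psi (pt3 0 z 0) (fun j => pd j psi (pt3 0 z 0)).
    by have := near_compose (P := fun t => fderiv psi t (fun j => pd j psi t)) vT (pt0 R) (an_fderiv apsi).
  have n2 : \forall z \near (0 : 'rV[C]_2), fderiv phi (pt3 0 (gb z) 0) (fun j => pd j phi (pt3 0 (gb z) 0)).
    have := near_compose (P := fun t => fderiv phi t (fun j => pd j phi t)) vT' _ (an_fderiv ap).
    by rewrite gb0 pt0 => /(_ erefl).
  apply: filterS2 n1 n2 => z d1 d2.
  have h1 : cd (fun tau => psi (pt3 (tau *: delta_mx 0 j) z 0)) (phij psi j z).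
    have := cd_comp d1 _ (vcd_app1 (vcd_row (vcd_scale (delta_mx 0 j)) (vcd_const z)) (cd_const 0)).
    rewrite scale0r => /(_ erefl).
    by rewrite dot_app1 dot_row dot_delta dot0 mul0r !addr0.
  have vc : vcd (fun tau => gv (tau *: delta_mx 0 j)) (delta_mx 0 j).
    rewrite -[X in vcd _ X]mk2_eta; apply: vcd_mk2; first exact: dg.
    by have := vcd_scale (delta_mx 0 j : 'rV[C]_2) i1.
  apply: cd_unique h1 _.
  have := cd_comp d2 _ (vcd_app1 (vcd_row vc (vcd_const (gb z))) (cd_const 0)).
  rewrite scale0r gv0 => /(_ erefl).
  rewrite dot_app1 dot_row dot_delta dot0 mul0r !addr0.
  by apply: cd_ext => tau; rewrite /psi /G zz_pt ze_pt uu_pt.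
have gb_jet : bigO 2 (fun z => gb z 0 i0 - z 0 i0).
  have h : bigO 2 (fun z => g1 z - z 0 i0).
    apply: bigO_ext (bigO2 ag g0) => z; congr (_ - _).
    have pg j : pd j g1 0 = (j == i0)%:R.
      have := cd_pd (delta_mx 0 j) ag; rewrite dot_delta => h1.
      by apply: cd_unique h1 _; have := dg (delta_mx 0 j); rewrite mxE eqxx eq_sym.
    by rewrite -/(dot z _) dot2 !pg eqxx mulr1 mulr0 addr0.
  apply: bigO_ext (bigO_cbar h) => z; rewrite /gb /gv conj_mk2 mk2_0E /cbar.
  by rewrite rmorphB /= [(conjmx z) _ _]mxE conjCK.
exists psi; split=> //.
- have := near_compose (P := fun t => phi (hswap t) = (phi t)^*) vG G0 herm.
  apply: filterS => t <-; rewrite /psi; congr phi.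
  by rewrite /G hswap_pt /hswap zz_pt ze_pt uu_pt /gb !conjmxK.
- have := near_compose (P := fun t => phi (pt3 0 (ze t) (uu t)) = 0 /\ phi (pt3 (zz t) 0 (uu t)) = 0) vG G0 norm.
  apply: filterS => t; rewrite /psi /G !zz_pt !ze_pt !uu_pt.
  by rewrite gv0 gb0.
- split.
    apply: filterS2 (jet i0) (near_conj hg) => z -> h.
    have -> : phij phi i0 (gb z) = (f1 (gv (conjmx z)))^*.
      by rewrite /f1 /cbar conjCK /gb.
    by rewrite h mxE conjCK.
  (* g^2 - z_1^2 = (g - z_1) (g + z_1) is O(3) *)
  have k1 : bigO 3 (fun z => phij phi i1 (gb z) - 2^-1 * (gb z 0 i0 * gb z 0 i0)).
    by apply: (bigO_comp jet1) => i; apply: bigO1; [exact: vgb | rewrite gb0 mxE].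
  have k2 : bigO 3 (fun z => (gb z 0 i0 - z 0 i0) * (gb z 0 i0 + z 0 i0)).
    apply: (@bigO_mul R 2 2 1) gb_jet _; apply: bigO_add; last exact: bigO_coord.
    by apply: bigO1; [exact: vgb | rewrite gb0 mxE].
  apply: bigO_eq (bigO_add k1 (bigO_scale 2^-1 k2)).
  apply: filterS (jet i1) => z ->; move: (phij _ _ _) (gb z 0 i0) (z 0 i0) => a b c.
  ring.
have [r [r0 hr]] := (near0P _).1 hgf; exists r; split=> // z u sz su.
have e y : small r y -> gv (f1v y) = y.
  by move=> sy; rewrite /gv /f1v mk2_1E (hr y sy) mk2_eta.
rewrite /psi /G zz_pt ze_pt uu_pt /gb conjmxK e //.
Qed.

End Straighten.

(** * Extraction of the remainders *)

Section NormalForm.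
Variable R : realType.
Local Notation C := (Cplx R).
Local Notation last n := (rshift n (ord0 : 'I_1)).
Local Notation i0 := (0 : 'I_2).
Local Notation i1 := (1 : 'I_2).

(** Vanishing of a germ on a coordinate subspace, read on its coefficients. *)
Lemma vanish_restrict n (I : {pred 'I_n}) (c : power_series R n) f : rep c f ->
  (\forall t \near (0 : 'rV[C]_n), f (\row_i (if i \in I then 0 else (t : 'rV[C]_n) 0 i)) = 0) ->
  ps_vanish_at I c.
Proof.
move=> hc hz a ha.
apply: (@bigO_coef_restrict _ _ (mdegree a).+1 [pred i | i \notin I] c f hc) => //.
  apply: bigO_zero; apply: filterS hz => t e; rewrite -[RHS]e; congr f.
  by apply/rowP => i; rewrite !mxE inE; case: (i \in I).
by move=> i; rewrite inE negbK; exact: ha.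
Qed.

Lemma row_maskL (t : 'rV[C]_(2 + 2)) :
  \row_i (if i \in [pred i : 'I_(2 + 2) | (i < 2)%N] then 0 else t 0 i) = row_mx 0 (rsubmx t).
Proof.
apply/rowP => i; rewrite !mxE inE; case: fintype.splitP => j hj.
  by rewrite /= mxE.
by rewrite /= mxE; congr (t 0 _); exact/val_inj.
Qed.

Lemma row_maskR (t : 'rV[C]_(2 + 2)) :
  \row_i (if i \in [pred i : 'I_(2 + 2) | (2 <= i < 4)%N] then 0 else t 0 i)
  = row_mx (lsubmx t) 0.
Proof.
apply/rowP => i; rewrite !mxE inE; case: fintype.splitP => j hj.
  by rewrite leqNgt hj ltn_ord /= mxE; congr (t 0 _); exact/val_inj.
have -> : (2 <= i < 4)%N by rewrite hj leq_addr /= ltn_add2l.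
by rewrite mxE.
Qed.

Lemma pt_maskL (t : 'rV[C]_(2 + 2 + 1)) :
  \row_i (if i \in [pred i : 'I_(2 + 2 + 1) | (i < 2)%N] then 0 else t 0 i)
  = pt3 0 (ze t) (uu t).
Proof.
apply/rowP => i; rewrite mxE inE app1E; case: fintype.splitP => j hj.
  rewrite -row_maskL mxE inE hj /=; case: ifP => // _.
  by rewrite mxE; congr (t 0 _); exact/val_inj.
have -> : (i < 2)%N = false by rewrite hj.
by rewrite /uu; congr (t 0 _); apply/val_inj; rewrite /= hj (ord1 j).
Qed.

Lemma pt_maskR (t : 'rV[C]_(2 + 2 + 1)) :
  \row_i (if i \in [pred i : 'I_(2 + 2 + 1) | (2 <= i < 4)%N] then 0 else t 0 i)
  = pt3 (zz t) 0 (uu t).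
Proof.
apply/rowP => i; rewrite mxE inE app1E; case: fintype.splitP => j hj.
  rewrite -row_maskR mxE inE hj ltn_ord !andbT; case: (1 < j)%N => //.
  by rewrite [in RHS]mxE; congr (t 0 _); exact/val_inj.
rewrite andbF.
by rewrite /uu; congr (t 0 _); apply/val_inj; rewrite /= hj (ord1 j).
Qed.

Definition cubic (z y : 'rV[C]_2) : C :=
  z 0 i0 * y 0 i0 + 2^-1 * (z 0 i0 * z 0 i0 * y 0 i1) + 2^-1 * (z 0 i1 * y 0 i0 * y 0 i0).

Variable psi : 'rV[C]_(2 + 2 + 1) -> C.
Hypothesis ap : an psi.
Hypothesis herm : \forall t \near (0 : 'rV[C]_(2 + 2 + 1)), psi (hswap t) = (psi t)^*.
Hypothesis norm : \forall t \near (0 : 'rV[C]_(2 + 2 + 1)),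
    psi (pt3 0 (ze t) (uu t)) = 0 /\ psi (pt3 (zz t) 0 (uu t)) = 0.
Hypothesis jet0 : \forall z \near (0 : 'rV[C]_2), phij psi i0 z = z 0 i0.
Hypothesis jet1 : bigO 3 (fun z => phij psi i1 z - 2^-1 * (z 0 i0 * z 0 i0)).

Let r1 (x : 'rV[C]_(2 + 2)) := psi (app1 x 0) - cubic (lsubmx x) (rsubmx x).
Let r2 t := psi t - psi (app1 (lsubmx t) 0).

Lemma an_cubic : an (fun x : 'rV[C]_(2 + 2) => cubic (lsubmx x) (rsubmx x)).
Proof.
have vl : van (fun x : 'rV[C]_(2 + 2) => lsubmx x) by apply: van_lsub; exact: van_id.
have vr : van (fun x : 'rV[C]_(2 + 2) => rsubmx x) by apply: van_rsub; exact: van_id.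
apply: an_add; [apply: an_add; [apply: an_mul|] |]; try exact: vl; try exact: vr.
  apply: an_mul; first exact: an_const.
  apply: an_mul; last exact: vr.
  by apply: an_mul; exact: vl.
apply: an_mul; first exact: an_const.
apply: an_mul; last exact: vr.
by apply: an_mul; [exact: vl | exact: vr].
Qed.

Lemma van_x0 : van (fun x : 'rV[C]_(2 + 2) => app1 x (0 : C)).
Proof. by apply: van_app1; [exact: van_id | exact: an_const]. Qed.

Lemma an_r1 : an r1.
Proof.
apply: an_sub; last exact: an_cubic.
by apply: (an_compose ap van_x0); rewrite app1_0.
Qed.

Lemma an_r2 : an r2.
Proof.
apply: an_sub => //; apply: (an_compose ap); last by rewrite linear0 app1_0.
by apply: van_app1; [apply: van_lsub; exact: van_id | exact: an_const].
Qed.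

Lemma near_x0 (Q : 'rV[C]_(2 + 2 + 1) -> Prop) :
  (\forall t \near (0 : 'rV[C]_(2 + 2 + 1)), Q t) ->
  \forall x \near (0 : 'rV[C]_(2 + 2)), Q (app1 x 0).
Proof. by move=> h; apply: near_compose van_x0 _ h; rewrite app1_0. Qed.

Lemma r1_norm : \forall x \near (0 : 'rV[C]_(2 + 2)),
  r1 (row_mx 0 (rsubmx x)) = 0 /\ r1 (row_mx (lsubmx x) 0) = 0.
Proof.
apply: filterS (near_x0 norm) => x.
rewrite /ze /zz /uu lsub_app1 app1_last /pt3 /r1 !row_mxKl !row_mxKr => -[-> ->].
by rewrite /cubic !mxE !(mulr0, mul0r) !addr0 subrr.
Qed.

Lemma r2_norm : \forall t \near (0 : 'rV[C]_(2 + 2 + 1)),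
  r2 (pt3 0 (ze t) (uu t)) = 0 /\ r2 (pt3 (zz t) 0 (uu t)) = 0.
Proof.
have h : \forall t \near (0 : 'rV[C]_(2 + 2 + 1)),
    psi (pt3 0 (ze t) 0) = 0 /\ psi (pt3 (zz t) 0 0) = 0.
  have := near_compose (P := fun t => psi (pt3 0 (ze t) (uu t)) = 0 /\ psi (pt3 (zz t) 0 (uu t)) = 0)
    (G := fun t => pt3 (zz t) (ze t) 0) _ _ norm.
  rewrite zz0 ze0 pt0 => /(_ (van_pt (van_zz R) (van_ze R) (an_const _ _)) erefl).
  by apply: filterS => t; rewrite zz_pt ze_pt uu_pt.
apply: filterS2 norm h => t [a b] [c d]; rewrite /r2 {2 4}/pt3 !lsub_app1 a b.
by rewrite -!/(pt3 _ _ _) c d subrr.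
Qed.

(** The derivatives in z of the cubic part at z = 0 are zeta_1 and zeta_1^2 / 2. *)
Lemma r1_dz j : \forall y \near (0 : 'rV[C]_2),
  pd (lshift 2 j) r1 (row_mx 0 y) = phij psi j y -
    ((j == i0)%:R * y 0 i0 + 2^-1 * ((j == i1)%:R * (y 0 i0 * y 0 i0))).
Proof.
have vy : van (fun y : 'rV[C]_2 => row_mx (0 : 'rV[C]_2) y).
  by apply: van_row; [exact: van_const | exact: van_id].
have vy3 : van (fun y : 'rV[C]_2 => pt3 0 y 0).
  by apply: van_pt; [exact: van_const | exact: van_id | exact: an_const].
have n1 : \forall y \near (0 : 'rV[C]_2), fderiv r1 (row_mx 0 y) (fun j => pd j r1 (row_mx 0 y)).
  by have := near_compose (P := fun t => fderiv r1 t (fun j => pd j r1 t)) vy (row00 _ _ _)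
    (an_fderiv an_r1).
have n2 : \forall y \near (0 : 'rV[C]_2), fderiv psi (pt3 0 y 0) (fun j => pd j psi (pt3 0 y 0)).
  by have := near_compose (P := fun t => fderiv psi t (fun j => pd j psi t)) vy3 (pt0 R)
    (an_fderiv ap).
apply: filterS2 n1 n2 => y d1 d2.
have h1 := cd_comp d1 _ (vcd_row (vcd_scale (delta_mx 0 j : 'rV[C]_2)) (vcd_const y)).
rewrite scale0r in h1; have {}h1 := h1 erefl; rewrite dot_row dot_delta dot0 addr0 in h1.
have h2 := cd_comp d2 _ (vcd_app1 (vcd_row (vcd_scale (delta_mx 0 j : 'rV[C]_2)) (vcd_const y)) (cd_const 0)).
rewrite scale0r in h2; have {}h2 := h2 erefl.
rewrite dot_app1 dot_row dot_delta dot0 mul0r !addr0 in h2.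
apply: cd_unique h1 _.
have lin k : cd (fun tau => (tau *: (delta_mx 0 j : 'rV[C]_2)) 0 k) ((delta_mx 0 j : 'rV[C]_2) 0 k).
  exact: vcd_scale.
have lin0 : cd (fun tau => (tau *: (delta_mx 0 j : 'rV[C]_2)) 0 i0) (j == i0)%:R.
  by have := lin i0; rewrite mxE eqxx eq_sym.
have lin1 : cd (fun tau => (tau *: (delta_mx 0 j : 'rV[C]_2)) 0 i1) (j == i1)%:R.
  by have := lin i1; rewrite mxE eqxx eq_sym.
have q : cd (fun tau => cubic (tau *: delta_mx 0 j) y)
    ((j == i0)%:R * y 0 i0 + 2^-1 * ((j == i1)%:R * (y 0 i0 * y 0 i0))).
  have mc (f : C -> C) a k : cd f a -> cd (fun tau => f tau * k) (a * k).
    by move=> h; have := fderiv_mul_cd h (cd_const k); rewrite mulr0 addr0.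
  have := cd_add (cd_add (mc _ _ (y 0 i0) lin0)
    (cd_scale 2^-1 (mc _ _ (y 0 i1) (fderiv_mul_cd lin0 lin0))))
    (cd_scale 2^-1 (mc _ _ (y 0 i0) (mc _ _ (y 0 i0) lin1))).
  rewrite scale0r (_ : (0 : 'rV[C]_2) 0 i0 = 0) ?mxE // mulr0 mul0r addr0 mul0r mulr0 addr0.
  by rewrite !mulrA.
apply: (cd_ext (f := fun tau => psi (app1 (row_mx (tau *: delta_mx 0 j) y) 0)
    + -1 * cubic (tau *: delta_mx 0 j) y)).
  by move=> tau; rewrite /r1 row_mxKl row_mxKr mulN1r.
by have := cd_add h2 (cd_scale (-1) q); rewrite [X in cd _ (_ + X)]mulN1r.
Qed.

Lemma bigO_r1_dz j : bigO 3 (fun y => pd (lshift 2 j) r1 (row_mx 0 y)).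
Proof.
have [->|j1] : j = i0 \/ j = i1.
  by case: j => -[|[|//]] hj; [left | right]; exact/val_inj.
  apply: bigO_zero; apply: filterS2 (r1_dz i0) jet0 => y -> ->.
  by rewrite eqxx mul1r /= mul0r mulr0 addr0 subrr.
rewrite j1; apply: bigO_eq jet1; apply: filterS (r1_dz i1) => y ->.
by rewrite eqxx mul1r /= mul0r add0r.
Qed.

Lemma r1_herm : \forall x \near (0 : 'rV[C]_(2 + 2)),
  r1 (row_mx (conjmx (rsubmx x)) (conjmx (lsubmx x))) = (r1 x)^*.
Proof.
apply: filterS (near_x0 herm) => x.
rewrite /hswap /pt3 /ze /zz /uu lsub_app1 app1_last rmorph0 => e; rewrite /r1 rmorphB /= -e.
congr (_ - _); rewrite row_mxKl row_mxKr /cubic !mxE !(rmorphD, rmorphM) /= fmorphV rmorph_nat.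
move: (x _ _)^* (x _ _)^* (x _ _)^* (x _ _)^* => a b c d; ring.
Qed.

Lemma r1_dzb j : \forall z \near (0 : 'rV[C]_2),
  pd (rshift 2 j) r1 (row_mx z 0) = (pd (lshift 2 j) r1 (row_mx 0 (conjmx z)))^*.
Proof.
have vy : van (fun y : 'rV[C]_2 => row_mx (0 : 'rV[C]_2) y).
  by apply: van_row; [exact: van_const | exact: van_id].
have vz : van (fun z : 'rV[C]_2 => row_mx z (0 : 'rV[C]_2)).
  by apply: van_row; [exact: van_id | exact: van_const].
have n1 : \forall y \near (0 : 'rV[C]_2), fderiv r1 (row_mx 0 y) (fun j => pd j r1 (row_mx 0 y)).
  by have := near_compose (P := fun t => fderiv r1 t (fun j => pd j r1 t)) vy (row00 _ _ _)
    (an_fderiv an_r1).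
have n2 : \forall z \near (0 : 'rV[C]_2), fderiv r1 (row_mx z 0) (fun j => pd j r1 (row_mx z 0)).
  by have := near_compose (P := fun t => fderiv r1 t (fun j => pd j r1 t)) vz (row00 _ _ _)
    (an_fderiv an_r1).
have [r [r0 hr]] := (near0P _).1 r1_herm.
apply: filterS2 (near_conj n1) (filterI n2 (near_small _ r0)) => z d1 [d2 sz].
have h1 := cd_comp d1 _ (vcd_row (vcd_scale (delta_mx 0 j : 'rV[C]_2)) (vcd_const (conjmx z))).
rewrite scale0r in h1; have {}h1 := h1 erefl; rewrite dot_row dot_delta dot0 addr0 in h1.
have h2 := cd_comp d2 _ (vcd_row (vcd_const z) (vcd_scale (delta_mx 0 j : 'rV[C]_2))).
rewrite scale0r in h2; have {}h2 := h2 erefl; rewrite dot_row dot_delta dot0 add0r in h2.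
apply: cd_unique h2 _; apply: cd_eq (cd_conj h1); exists r => // tau ht.
have := hr (row_mx z (tau *: delta_mx 0 j)); rewrite row_mxKl row_mxKr => e.
apply: (can_inj (@conjCK _)); rewrite conjCK -e; last first.
  apply: small_row => // i; rewrite !mxE nmM.
  by case: (_ && _); rewrite ?nm1 ?nm0 ?mulr1 ?mulr0 ?(ltW r0).
congr (r1 (row_mx _ _)); apply/rowP => i; rewrite !mxE rmorphM.
by rewrite rmorph_nat.
Qed.

Lemma bigO_r1_dzb j : bigO 3 (fun z => pd (rshift 2 j) r1 (row_mx z 0)).
Proof.
apply: bigO_eq (bigO_cbar (bigO_r1_dz j)).
by apply: filterS (r1_dzb j) => z ->.
Qed.

(** Up to a nonzero factor, such a coefficient is a coefficient of the restriction of the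
    i-th derivative to the coordinates in I. *)
Lemma coef_by_derivative n (c : power_series R n) f (i : 'I_n) (I : {pred 'I_n}) k :
  rep c f -> bigO k (fun t => pd i f (\row_j (if j \in I then t 0 j else 0))) ->
  forall a : {ffun 'I_n -> nat}, (0 < a i)%N -> (mdegree a <= k)%N ->
    (forall j, j \notin I -> a j = (j == i)) -> c a = 0.
Proof.
move=> hc hO a ai ak aI.
pose b : {ffun 'I_n -> nat} := [ffun l => (a l - (l == i))%N].
have hb : [ffun l => (b l + (l == i))%N] = a.
  apply/ffunP => l; rewrite !ffunE; case: eqP => [->|_]; first by rewrite subnK.
  by rewrite subn0 addn0.
have db : (mdegree b < k)%N.
  have e : mdegree a = (mdegree b + 1)%N.
    have s1 : (\sum_(l < n) (l == i) = 1)%N.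
      by rewrite (bigD1 i) // eqxx big1 // => l /negPf ->.
    rewrite -s1 /mdegree -big_split; apply: eq_bigr => l _.
    by rewrite -[in LHS]hb ffunE.
  by rewrite addn1 in e; rewrite -e.
have := bigO_coef_restrict (rep_pd i hc) hO _ db.
rewrite /dps hb => h; have /eqP : c a *+ (b i).+1 = 0.
  by apply: h => j jI; rewrite ffunE (aI _ jI) subnn.
by rewrite -mulr_natr mulf_eq0 pnatr_eq0 orbF => /eqP.
Qed.

(** A monomial of degree at most 3 without pure z or zeta part has degree 1 in z or in
    zeta; its coefficient is therefore one of the known first derivatives along zeta = 0
    or z = 0. The difference psi (z, zeta, u) - psi (z, zeta, 0) is divisible by u, and
    its quotient has no pure monomials either, which forces degree 2. *)
Lemma normal_form : exists (R1 : power_series R (2 + 2)) (R2 Q : power_series R (2 + 2 + 1)),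
  [/\ bigO_order 4 R1,
      bigO_order 2 Q /\ R2 = ps_mulvar (rshift (2 + 2) ord0) Q,
      remainder_normalized R1 /\ remainder_normalized R2 &
  exists r : R, 0 < r /\ forall z u, small r z -> nm u <= r ->
    psi (pt3 z (conjmx z) u) = normal_rhs R1 R2 z u].
Proof.
have [R1 hR1] := an_r1; have [R2 hR2] := an_r2.
have van1 : remainder_normalized R1.
  split; apply: (vanish_restrict hR1).
    by apply: filterS r1_norm => x [e _]; rewrite row_maskL.
  by apply: filterS r1_norm => x [_ e]; rewrite row_maskR.
have van2 : remainder_normalized R2.
  split; apply: (vanish_restrict hR2).
    by apply: filterS r2_norm => x [e _]; rewrite pt_maskL.
  by apply: filterS r2_norm => x [_ e]; rewrite pt_maskR.
pose u5 : 'I_(2 + 2 + 1) := rshift (2 + 2) ord0.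
pose Q : power_series R (2 + 2 + 1) := fun b => R2 [ffun j => (b j + (j == u5))%N].
have R2Q : R2 = ps_mulvar u5 Q.
  apply/funext => a; rewrite /ps_mulvar; case: eqP => [au|/eqP au].
    have vu : ps_vanish_at [pred i | i == u5] R2.
      apply: (vanish_restrict hR2); apply: (filterS (P := setT)) (filterT) => t _.
      have -> : \row_i (if i \in [pred i | i == u5] then 0 else t 0 i) = pt3 (zz t) (ze t) 0.
        apply/rowP => i; rewrite mxE inE app1E; case: fintype.splitP => j hj.
          have -> : (i == u5) = false.
            by apply/eqP => e; move: (ltn_ord j); rewrite -hj e /= addn0 ltnn.
          by rewrite -[t in LHS]pt_eta app1E (_ : i = lshift 1 j) ?(unsplitK (inl j)) //; exact/val_inj.
        have -> // : i == u5 by apply/eqP/val_inj; rewrite /= hj (ord1 j).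
      by rewrite /r2 {2}/pt3 lsub_app1 -/(pt3 _ _ _) subrr.
    by apply: vu => i; rewrite inE => /eqP ->.
  congr R2; apply/ffunP => i; rewrite !ffunE; case: eqP => [->|_].
    by rewrite subnK // lt0n.
  by rewrite subn0 addn0.
have cQ : ps_convergent Q.
  case: hR2 => /ps_convergentP [r [B [r0 hB]]] _; apply/ps_convergentP.
  exists (r / 2), (r^-1 * B); split=> [|k]; first by rewrite divr_gt0.
  apply: le_trans (bnd_dps u5 r0 hB k); apply: nrm_le_coef.
    by rewrite divr_ge0 // ltW.
  move=> m; rewrite !coef_trunc; case: ifP => // _.
  rewrite /dps -mulr_natr nmM nmn ler_peMr ?nm_ge0 // ler1n //.
exists R1, R2, Q; split=> //.
- split; first by case: hR1.
  (* A and B are the degrees in z and in zeta *)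
  move=> a a4; pose A := (a (lshift 2 i0) + a (lshift 2 i1))%N.
  pose B := (a (rshift 2 i0) + a (rshift 2 i1))%N.
  have two (F : 'I_2 -> nat) : (\sum_(i < 2) F i = F i0 + F i1)%N.
    by rewrite big_ord_recl big_ord1; congr (_ + F _)%N; exact/val_inj.
  have dAB : mdegree a = (A + B)%N by rewrite /mdegree big_split_ord /= !two.
  have two2 (j : 'I_2) : j = i0 \/ j = i1.
    by case: j => -[|[|//]] hj; [left | right]; exact/val_inj.
  have small_lr (i : 'I_(2 + 2)) : (i < 2)%N -> exists j, i = lshift 2 j.
    by move=> h; exists (Ordinal h); exact/val_inj.
  have big_lr (i : 'I_(2 + 2)) : (2 <= i)%N -> exists j, i = rshift 2 j.
    move=> h; have h2 : (i - 2 < 2)%N by rewrite ltn_subLR // ltn_ord.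
    by exists (Ordinal h2); apply/val_inj; rewrite /= subnKC.
  case: (posnP A) => [A0|A0].
    apply: van1.1 => i; rewrite inE => /small_lr [j ->].
    have /eqP := A0; rewrite addn_eq0 => /andP[/eqP h0 /eqP h1].
    by case: (two2 j) => ->.
  case: (posnP B) => [B0|B0].
    apply: van1.2 => i; rewrite inE => /andP[/big_lr [j ->] _].
    have /eqP := B0; rewrite addn_eq0 => /andP[/eqP h0 /eqP h1].
    by case: (two2 j) => ->.
  have k3 : (mdegree a <= 3)%N by [].
  have pick1 (g : 'I_2 -> nat) : (g i0 + g i1 = 1)%N ->
      exists j, (0 < g j)%N /\ forall l, g l = (l == j).
    case e0 : (g i0) => [|[|//]]; case e1 : (g i1) => [|[|//]] // _.
      by exists i1; rewrite e1; split=> // l; case: (two2 l) => ->; rewrite ?e0 ?e1.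
    by exists i0; rewrite e0; split=> // l; case: (two2 l) => ->; rewrite ?e0 ?e1.
  have [A1|A1] : (A = 1 \/ B = 1)%N.
    move: a4 A0 B0; rewrite dAB; case: (A) => [|[|A']] // ; first by left.
    case: (B) => [|[|B']] //; first by right.
    by rewrite !addSn !addnS.
    have [j [aj al]] := pick1 (fun j => a (lshift 2 j)) A1.
    apply: (@coef_by_derivative _ R1 r1 (lshift 2 j) [pred i : 'I_(2 + 2) | (2 <= i)%N] 3 hR1) => //.
      have := @bigO_comp R 2 (2 + 2) 3 _ (fun x : 'rV[C]_(2 + 2) => rsubmx x) (bigO_r1_dz j).
      move=> h; apply: bigO_ext (h _) => [t|i]; last first.
        by apply: bigO_ext (bigO_coord R (rshift 2 i)) => t; rewrite mxE.
      rewrite -row_maskL; congr (pd _ r1 _); apply/rowP => i; rewrite !mxE !inE.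
      by case: (ltnP i 2).
    move=> i; rewrite inE -ltnNge => /small_lr [l ->]; rewrite al.
    by congr nat_of_bool; apply/eqP/eqP => [->//|/lshift_inj].
  have [j [aj al]] := pick1 (fun j => a (rshift 2 j)) A1.
  apply: (@coef_by_derivative _ R1 r1 (rshift 2 j) [pred i : 'I_(2 + 2) | (i < 2)%N] 3 hR1) => //.
    have := @bigO_comp R 2 (2 + 2) 3 _ (fun x : 'rV[C]_(2 + 2) => lsubmx x) (bigO_r1_dzb j).
    move=> h; apply: bigO_ext (h _) => [t|i]; last first.
      by apply: bigO_ext (bigO_coord R (lshift 2 i)) => t; rewrite mxE.
    rewrite -row_maskR; congr (pd _ r1 _); apply/rowP => i; rewrite !mxE !inE.
    by rewrite (ltn_ord i : (i < 4)%N) andbT; case: (ltnP i 2).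
  move=> i; rewrite inE -leqNgt => /big_lr [l ->]; rewrite al.
  by congr nat_of_bool; apply/eqP/eqP => [->//|/rshift_inj].
- split=> //; split=> // b b2.
  rewrite /Q; set a := [ffun _ => _].
  have au : a u5 = (b u5).+1 by rewrite ffunE eqxx [LHS]addn1.
  have ab i : i != u5 -> a i = b i by move=> /negPf h; rewrite ffunE h [LHS]addn0.
  pose A := (b (lshift 1 (lshift 2 i0)) + b (lshift 1 (lshift 2 i1)))%N.
  pose B := (b (lshift 1 (rshift 2 i0)) + b (lshift 1 (rshift 2 i1)))%N.
  have two (F : 'I_2 -> nat) : (\sum_(i < 2) F i = F i0 + F i1)%N.
    by rewrite big_ord_recl big_ord1; congr (_ + F _)%N; exact/val_inj.
  have two2 (j : 'I_2) : j = i0 \/ j = i1.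
    by case: j => -[|[|//]] hj; [left | right]; exact/val_inj.
  have dAB : mdegree b = (A + B + b u5)%N.
    by rewrite /mdegree big_split_ord /= big_ord1 big_split_ord /= !two.
  have nu (i : 'I_(2 + 2 + 1)) : (i < 4)%N -> i != u5.
    by move=> h; apply/eqP => e; move: h; rewrite e.
  case: (posnP A) => [A0|A0].
    apply: van2.1 => i; rewrite inE => hi.
    have -> : i = lshift 1 (lshift 2 (Ordinal hi)) by exact/val_inj.
    rewrite ab ?nu //=; last by apply: leq_trans hi _.
    have /eqP := A0; rewrite addn_eq0 => /andP[/eqP h0 /eqP h1].
    by case: (two2 (Ordinal hi)) => ->.
  apply: van2.2 => i; rewrite inE => /andP[h2 h4].
  have h3 : (i - 2 < 2)%N by rewrite ltn_subLR.
  have -> : i = lshift 1 (rshift 2 (Ordinal h3)) by apply/val_inj; rewrite /= subnKC.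
  have B0 : B = 0%N.
    move: b2; rewrite dAB; case: (A) A0 => // A' _; case: (B) => // B'.
    by rewrite !addSn !addnS.
  rewrite ab; last by apply: nu; rewrite /= subnKC.
  have /eqP := B0; rewrite addn_eq0 => /andP[/eqP h0 /eqP h1].
  by case: (two2 (Ordinal h3)) => ->.
have [_ /near0P [s1 [s10 e1]]] := hR1; have [_ /near0P [s2 [s20 e2]]] := hR2.
exists (Order.min s1 s2); split=> [|z u sz]; first by rewrite lt_min s10.
rewrite le_min => /andP[us1 us2].
have z1 : small s1 z by apply: small_le sz; rewrite ge_min lexx.
have z2 : small s2 z by apply: small_le sz; rewrite ge_min lexx orbT.
have k1 := e1 (row_mx z (conjmx z)) (small_row z1 (conjmx_small z1)).
have k2 := e2 (pt3 z (conjmx z) u) (small_pt z2 (conjmx_small z2) us2).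
rewrite /normal_rhs -k1 -[ps_eval R2 _]k2 /r1 /r2 row_mxKl row_mxKr /cubic !mxE.
rewrite [lsubmx _]lsub_app1.
move: (psi _) (psi _) (z 0 i0) (z 0 i1) => a b c d.
ring.
Qed.

End NormalForm.

(** * Complexification of real analytic functions *)

Section RealGerms.
Variable R : realType.
Local Notation C := (Cplx R).

Lemma derive1_quadratic (f : R -> R) a r B : 0 < r ->
  (forall t, `|t| <= r -> `|f t - f 0 - t * a| <= B * t ^+ 2) -> derive1 f 0 = a.
Proof.
move=> r0 h; apply/cvg_lim => //; apply/cvgrPdist_le => e e0.
have d0 : 0 < Order.min r (e / (1 + `|B|)).
  by rewrite lt_min r0 divr_gt0 // ltr_pwDl.
near=> t.
have t0 : t != 0 by near: t; exact: nbhs_dnbhs_neq.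
have ts : `|t| <= Order.min r (e / (1 + `|B|)) by near: t; exact: dnbhs0_le.
move: ts; rewrite le_min => /andP[tr te].
have -> : a - t^-1 *: (f (t + 0) - f 0) = - t^-1 * (f t - f 0 - t * a).
  by rewrite addr0 /GRing.scale /=; field.
rewrite normrM normrN normfV ler_pdivrMl ?normr_gt0 //; apply: le_trans (h t tr) _.
rewrite -real_normK ?num_real // expr2 mulrCA ler_pM2l ?normr_gt0 // mulrC.
move: te; rewrite ler_pdivlMr ?ltr_pwDl // => te; apply: le_trans te.
by rewrite ler_wpM2l ?normr_ge0 // (le_trans (ler_norm B)) // lerDr.
Unshelve. all: by end_near.
Qed.

Lemma dir_deriv_quadratic (f : C3 R -> C) q v a r B : 0 < r ->
  (forall t : R, `|t| <= r -> nm (f (q + (t%:C)%C *: v) - f q - (t%:C)%C * a) <= B * t ^+ 2) ->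
  dir_deriv f q v = a.
Proof.
move=> r0 h; rewrite /dir_deriv; have e0 : q + ((0 : R)%:C)%C *: v = q.
  by rewrite rmorph0 scale0r addr0.
have re x y (t : R) : complex.Re (x - y - (t%:C)%C * a)
    = complex.Re x - complex.Re y - t * complex.Re a.
  by case: x y (a) => [x1 x2] [y1 y2] [a1 a2] /=; ring.
have im x y (t : R) : complex.Im (x - y - (t%:C)%C * a)
    = complex.Im x - complex.Im y - t * complex.Im a.
  by case: x y (a) => [x1 x2] [y1 y2] [a1 a2] /=; ring.
rewrite (@derive1_quadratic _ (complex.Re a) r B) //; last first.
  by move=> t tr; rewrite e0 -re; apply: le_trans (Re_le_nm _) (h t tr).
rewrite (@derive1_quadratic _ (complex.Im a) r B) //; last first.
  by move=> t tr; rewrite e0 -im; apply: le_trans (Im_le_nm _) (h t tr).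
by case: (a).
Qed.

(** The real differential of f at q is h |-> g . (h, conj h). *)
Definition rderiv (f : C3 R -> C) q (g : 'I_(3 + 3) -> C) :=
  exists r B : R, 0 < r /\ forall eta h, 0 <= eta <= r -> small eta h ->
    nm (f (q + h) - f q - dot (row_mx h (conjmx h)) g) <= B * eta ^+ 2.

Lemma conjmxZ m n k (A : 'M[C]_(m, n)) : conjmx (k *: A) = k^* *: conjmx A.
Proof. by apply/matrixP => i j; rewrite !mxE rmorphM. Qed.

Lemma rderiv_dir f q g v : rderiv f q g -> small 1 v ->
  dir_deriv f q v = dot (row_mx v (conjmx v)) g.
Proof.
case=> r [B [r0 h]] v1; apply: (dir_deriv_quadratic (B := B) r0) => t tr.
have := h `|t| ((t%:C)%C *: v); rewrite normr_ge0 tr => /(_ isT) h1.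
rewrite -real_normK ?num_real //; apply: le_trans (h1 _).
  rewrite le_eqVlt; apply/orP; left; apply/eqP; congr nm; congr (_ - _).
  rewrite conjmxZ (_ : ((t%:C)%C)^* = (t%:C)%C); last by rewrite conj_Creal // complex_real.
  by rewrite -scale_row_mx dotZ.
by move=> i; rewrite mxE nmM nmR ler_piMr.
Qed.

Lemma conj_delta m n (i : 'I_m) (j : 'I_n) : conjmx (delta_mx i j) = delta_mx i j :> 'M[C]_(m, n).
Proof. by apply/matrixP => k l; rewrite !mxE rmorph_nat. Qed.

(** Evaluate the differential on e_j and on i e_j. *)
Lemma rderiv_gradient f q g : rderiv f q g -> gradient f q = \col_j g j.
Proof.
move=> hf; have s1 j : small 1 (delta_mx 0 j : C3 R).
  by move=> i; rewrite mxE nmn; case: (_ && _).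
have si j : small 1 ('i *: delta_mx 0 j : C3 R).
  by move=> i; rewrite mxE nmM nmi mul1r; exact: s1.
have e1 j : dir_deriv f q (delta_mx 0 j) = g (lshift 3 j) + g (rshift 3 j).
  by rewrite (rderiv_dir hf (s1 j)) conj_delta dot_row !dot_delta.
have ei j : dir_deriv f q ('i *: delta_mx 0 j) = 'i * (g (lshift 3 j) - g (rshift 3 j)).
  rewrite (rderiv_dir hf (si j)) conjmxZ conj_delta dot_row !dotZ !dot_delta conjCi.
  by rewrite mulNr mulrBr.
have i2 : 'i * 'i = -1 :> C by rewrite -expr2 sqrCi.
apply/colP => j; rewrite !mxE; case: fintype.splitP => k hk; rewrite mxE.
  have -> : j = lshift 3 k by exact/val_inj.
  rewrite /d_z e1 ei mulrA i2.
  by move: (g _) (g _) => a b; field.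
have -> : j = rshift 3 k by exact/val_inj.
rewrite /d_zbar e1 ei mulrA i2.
by move: (g _) (g _) => a b; field.
Qed.

(** P is the complexification of f at p, a germ at the origin in the variables q - p and
    conj (q - p). *)
Definition germ (p : C3 R) (f : C3 R -> C) (P : 'rV[C]_(3 + 3) -> C) :=
  an P /\ \forall h \near (0 : C3 R), f (p + h) = P (row_mx h (conjmx h)).

Lemma near_diag (Q : 'rV[C]_(3 + 3) -> Prop) : (\forall t \near (0 : 'rV[C]_(3 + 3)), Q t) ->
  \forall h \near (0 : C3 R), Q (row_mx h (conjmx h)).
Proof.
move=> /near0P [r [r0 h]]; apply/near0P; exists r; split=> // t st.
by apply: h; apply: small_row => //; exact: conjmx_small.
Qed.

Lemma near_all n (Q : 'rV[C]_n -> Prop) : (forall t, Q t) -> \forall t \near (0 : 'rV[C]_n), Q t.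
Proof. by move=> h; apply/near0P; exists 1; split. Qed.

Lemma germP p f : real_analytic_at p f <-> exists P, germ p f P.
Proof.
split=> [[c cc hf]|[P [[c [cc hc]] hf]]].
  exists (ps_eval c); split; first by exists c; split=> //; apply: near_all => t.
  by apply: filterS ((near_shift _ _).1 hf) => h; rewrite [p + h]addrC addrK [h + p]addrC.
exists c => //; apply/near_shift; apply: filterS2 hf (near_diag hc) => h -> ->.
by rewrite [p + h]addrC addrK.
Qed.

Lemma germ_at p f P : germ p f P -> f p = P 0.
Proof.
case=> _ /near0P [r [r0 h]]; have := h 0 (small0 (ltW r0)).
by rewrite addr0 conjmx0 row_mx0.
Qed.

Lemma germ_rderiv p f P : germ p f P -> \forall h \near (0 : C3 R),
  rderiv f (p + h) (fun j => pd j P (row_mx h (conjmx h))).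
Proof.
case=> aP hf; apply: filterS2 (near_diag (an_fderiv aP)) (near_near hf) => h.
case=> r [B [r0 hP]] /nearP [s [s0 hs]]; exists (Order.min r s), B.
split=> [|eta k /andP[e0]]; first by rewrite lt_min r0.
rewrite le_min => /andP[er es] sk.
rewrite -[p + h + k]addrA hs; last exact: small_le es sk.
have -> : f (p + h) = P (row_mx h (conjmx h)).
  by rewrite -[h in LHS]addr0 hs ?addr0 //; apply: small0; exact: ltW.
have -> : row_mx (h + k) (conjmx (h + k)) = row_mx h (conjmx h) + row_mx k (conjmx k).
  rewrite add_row_mx; congr row_mx.
  by apply/matrixP => i j; rewrite !mxE rmorphD.
apply: hP; first by rewrite e0.
by apply: small_row => //; exact: conjmx_small.
Qed.

Lemma germ_gradient p f P : germ p f P -> gradient f p = \col_j pd j P 0.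
Proof.
move=> /germ_rderiv /near0P [r [r0 h]]; have := h 0 (small0 (ltW r0)).
by rewrite addr0 conjmx0 row_mx0 => /rderiv_gradient.
Qed.

(** The Wirtinger derivatives of f are the partial derivatives of its complexification, at
    all the points near p. *)
Lemma germ_pd p f P j : germ p f P -> germ p (fun q => gradient f q j 0) (pd j P).
Proof.
move=> hf; split; first by case: hf => /an_pd.
by apply: filterS (germ_rderiv hf) => h /rderiv_gradient ->; rewrite mxE.
Qed.

Lemma germ_const p a : germ p (fun=> a) (fun=> a).
Proof. by split; [exact: an_const | apply: near_all]. Qed.

Lemma germ_add p f g P Q : germ p f P -> germ p g Q ->
  germ p (fun q => f q + g q) (fun t => P t + Q t).
Proof.
move=> [aP hf] [aQ hg]; split; first exact: an_add.
by apply: filterS2 hf hg => h -> ->.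
Qed.

Lemma germ_mul p f g P Q : germ p f P -> germ p g Q ->
  germ p (fun q => f q * g q) (fun t => P t * Q t).
Proof.
move=> [aP hf] [aQ hg]; split; first exact: an_mul.
by apply: filterS2 hf hg => h -> ->.
Qed.

Lemma germ_sub p f g P Q : germ p f P -> germ p g Q ->
  germ p (fun q => f q - g q) (fun t => P t - Q t).
Proof.
move=> [aP hf] [aQ hg]; split; first exact: an_sub.
by apply: filterS2 hf hg => h -> ->.
Qed.

Lemma germ_sum p (I : Type) (s : seq I) (A : pred I) F P : (forall i, germ p (F i) (P i)) ->
  germ p (fun q => \sum_(i <- s | A i) F i q) (fun t => \sum_(i <- s | A i) P i t).
Proof.
move=> h; split; first by apply: an_sum => i; case: (h i).
elim: s => [|i s IH]; first by apply: near_all => t; rewrite !big_nil.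
apply: filterS2 (h i).2 IH => t e1 e2; rewrite !big_cons.
by case: (A i); rewrite ?e1 e2.
Qed.

(** The complexification of the conjugate function. *)
Definition hconj (P : 'rV[C]_(3 + 3) -> C) X := (P (cswap X))^*.

Lemma small_cswap m r (X : 'rV[C]_(m + m)) : small r X -> small r (cswap X).
Proof.
move=> h; apply: small_row; apply: conjmx_small.
  exact: (small_rsub h).
exact: (small_lsub h).
Qed.

Lemma an_hconj P : an P -> an (hconj P).
Proof.
move=> aP; have := an_compose (G := fun X : 'rV[C]_(3 + 3) => row_mx (rsubmx X) (lsubmx X))
  (an_cbar aP).
move=> h; apply: (an_ext (f := fun X => cbar P (row_mx (rsubmx X) (lsubmx X)))); last first.
  apply: h; last by rewrite !linear0 row_mx0.
  by apply: van_row; [apply: van_rsub | apply: van_lsub]; exact: van_id.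
by move=> X; rewrite /cbar /hconj conj_row.
Qed.

Lemma germ_conj p f P : germ p f P -> germ p (fun q => (f q)^*) (hconj P).
Proof.
move=> [aP hf]; split; first exact: an_hconj.
by apply: filterS hf => h ->; rewrite /hconj cswap_row conjmxK.
Qed.

(** The derivative of P at the origin along v. *)
Definition Dv (v : 'rV[C]_(3 + 3)) (P : 'rV[C]_(3 + 3) -> C) := dot v (fun j => pd j P 0).

Lemma germ_vderiv (X : vfield R) p f P : germ p f P -> vderiv X f p = Dv (X p) P.
Proof.
move=> h; rewrite /vderiv (germ_gradient h) mxE; apply: eq_bigr => j _.
by rewrite mxE.
Qed.

Lemma Dv_cd v P a : an P -> cd (fun tau => P (tau *: v)) a -> Dv v P = a.
Proof. by move=> aP; apply: cd_unique; exact: cd_pd. Qed.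

Lemma Dv_mul v P Q : an P -> an Q ->
  Dv v (fun t => P t * Q t) = Dv v P * Q 0 + P 0 * Dv v Q.
Proof.
move=> aP aQ; apply: Dv_cd; first exact: an_mul.
have := fderiv_mul_cd (cd_pd v aP) (cd_pd v aQ); rewrite scale0r; exact.
Qed.

Lemma Dv_add v P Q : an P -> an Q -> Dv v (fun t => P t + Q t) = Dv v P + Dv v Q.
Proof.
by move=> aP aQ; apply: Dv_cd; [exact: an_add | exact: cd_add (cd_pd v aP) (cd_pd v aQ)].
Qed.

Lemma Dv_const v a : Dv v (fun=> a) = 0.
Proof. by apply: Dv_cd; [exact: an_const | exact: cd_const]. Qed.

Lemma Dv_sub v P Q : an P -> an Q -> Dv v (fun t => P t - Q t) = Dv v P - Dv v Q.
Proof.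
move=> aP aQ; have -> : (fun t => P t - Q t) = (fun t => P t + (-1) * Q t).
  by apply/funext => t; rewrite mulN1r.
rewrite Dv_add // ?Dv_mul ?Dv_const ?mul0r ?add0r ?mulN1r //; try exact: an_const.
by apply: an_mul => //; exact: an_const.
Qed.

Lemma Dv_sum v (I : Type) (s : seq I) (A : pred I) P : (forall i, an (P i)) ->
  Dv v (fun t => \sum_(i <- s | A i) P i t) = \sum_(i <- s | A i) Dv v (P i).
Proof.
move=> h; elim: s => [|i s IH].
  by rewrite big_nil -[RHS](Dv_const v 0); congr Dv; apply/funext => t; rewrite big_nil.
rewrite big_cons; have e : (fun t => \sum_(j <- i :: s | A j) P j t) =
    if A i then (fun t => P i t + \sum_(j <- s | A j) P j t)
    else (fun t => \sum_(j <- s | A j) P j t).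
  by apply/funext => t; rewrite big_cons; case: (A i).
by rewrite e; case: (A i); rewrite // Dv_add ?IH //; exact: an_sum.
Qed.

Lemma Dv_hconj v P : an P -> Dv v (hconj P) = (Dv (tconj v) P)^*.
Proof.
move=> aP; apply: Dv_cd; first exact: an_hconj.
apply: cd_ext (cd_conj (cd_pd (tconj v) aP)) => tau; rewrite /hconj; congr ((P _)^*).
rewrite /tconj /cswap scale_row_mx; congr row_mx; rewrite -conjmxZ; congr conjmx.
  by apply/rowP => i; rewrite !mxE.
by apply/rowP => i; rewrite !mxE.
Qed.

End RealGerms.

(** * Curves in real hypersurfaces *)

Section TangentVectors.
Variable R : realType.
Local Notation C := (Cplx R).

Lemma small_ex n (v : 'rV[C]_n) : exists m : R, 1 <= m /\ small m v.
Proof.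
exists (1 + \sum_i nm (v 0 i)); split; first by rewrite lerDl sumr_ge0 // => i _; exact: nm_ge0.
move=> i; rewrite (bigD1 i) //= addrCA lerDl addr_ge0 ?ler01 //.
by apply: sumr_ge0 => j _; exact: nm_ge0.
Qed.

(** A real tangent vector k, seen in the complexified tangent space. *)
Definition rv n (k : 'rV[C]_n) := row_mx k (conjmx k).

Lemma rvD n (k l : 'rV[C]_n) : rv (k + l) = rv k + rv l.
Proof.
rewrite /rv add_row_mx; congr row_mx.
by apply/matrixP => i j; rewrite !mxE rmorphD.
Qed.

Lemma rvZ n (t : R) (k : 'rV[C]_n) : rv ((t%:C)%C *: k) = (t%:C)%C *: rv k.
Proof.
by rewrite /rv scale_row_mx conjmxZ conj_Creal // complex_real.
Qed.

Lemma small_rv n r (k : 'rV[C]_n) : small r k -> small r (rv k).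
Proof. by move=> h; apply: small_row => //; exact: conjmx_small. Qed.

Lemma small_lin n (t s m e : R) (h w : 'rV[C]_n) : small m h -> small m w -> 0 <= m ->
  `|t| <= e -> `|s| <= e -> small (2 * e * m) ((t%:C)%C *: h + (s%:C)%C *: w).
Proof.
move=> sh sw m0 te se i; rewrite !mxE; apply: le_trans (nmD _ _) _.
rewrite !nmM !nmR mulrAC mulrDl mul1r mulrDl; apply: lerD.
  by rewrite mulrC; apply: ler_pM; rewrite ?nm_ge0.
by rewrite mulrC; apply: ler_pM; rewrite ?nm_ge0.
Qed.

Lemma dotDl m (a b : 'rV[C]_m) g : dot (a + b) g = dot a g + dot b g.
Proof. by rewrite /dot -big_split; apply: eq_bigr => i _; rewrite mxE mulrDl. Qed.

Lemma quad_small (K t : R) : 0 <= K -> 0 <= t -> t <= (1 + K)^-1 -> K * t ^+ 2 <= t.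
Proof.
move=> K0 t0 tK; rewrite expr2 mulrA -[leRHS]mul1r ler_wpM2r //.
have : (1 + K) * t <= 1 by rewrite -ler_pdivlMl ?mulr1 ?ltr_pwDl.
by apply: le_trans; rewrite ler_wpM2r // lerDr.
Qed.

(** Correct t h along the transversal direction w: P is real there, of size O(t^2) at t h,
    and changes sign for a correction between -K t^2 and K t^2. The intermediate value
    theorem gives a zero. *)
Lemma curve_in_zero_locus P (h w : C3 R) (d : R) : an P -> P 0 = 0 ->
  Dv (rv h) P = 0 -> Dv (rv w) P = (d%:C)%C -> 0 < d ->
  exists K r : R, [/\ 0 < r, 0 <= K & forall t, 0 <= t <= r -> exists s : R,
    `|s| <= K * t ^+ 2 /\ complex.Re (P (rv ((t%:C)%C *: h + (s%:C)%C *: w))) = 0].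
Proof.
move=> /an_taylor [r [B [r0 hT]]] P0 dh dw d0.
have [m1 [m11 sh]] := small_ex h; have [m2 [m21 sw]] := small_ex w.
pose m := Order.max m1 m2; have m0 : 0 < m by rewrite lt_max (lt_le_trans ltr01 m11).
have {}sh : small m h by apply: small_le sh; rewrite le_max lexx.
have {}sw : small m w by apply: small_le sw; rewrite le_max lexx orbT.
(* |P - s d| <= b t^2 as long as |s| <= t, so that the sign of P is that of s when
   |s| = K t^2 *)
pose b := `|B| * (2 * m) ^+ 2; have b0 : 0 <= b by rewrite mulr_ge0 ?sqr_ge0.
pose K := b / d; have K0 : 0 <= K by rewrite divr_ge0 // ltW.
pose r' := Order.min (r / (2 * m)) (1 + K)^-1.
exists K, r'; split=> //; first by rewrite lt_min divr_gt0 ?invr_gt0 ?ltr_pwDl // mulr_gt0.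
move=> t /andP[t0]; rewrite le_min => /andP[tr tK].
have Kt : K * t ^+ 2 <= t.
  exact: quad_small.
pose q (s : R) := (t%:C)%C *: h + (s%:C)%C *: w.
pose g s := complex.Re (P (rv (q s))).
have sq s : `|s| <= K * t ^+ 2 -> small (2 * t * m) (rv (q s)).
  move=> st; apply: small_rv; apply: small_lin => //; first exact: ltW.
    by rewrite ger0_norm.
  exact: le_trans st Kt.
have tm : 0 <= 2 * t * m <= r.
  by rewrite mulr_ge0 ?mulr_ge0 ?(ltW m0) //= mulrAC mulrC -ler_pdivlMr // mulr_gt0.
have reB (x y : C) : complex.Re x - complex.Re y = complex.Re (x - y).
  by case: x y => [x1 x2] [y1 y2].
have gq s : `|s| <= K * t ^+ 2 -> `|g s - s * d| <= b * t ^+ 2.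
  move=> /sq sk; have [_ h2 _] := hT 0 (small0 (ltW r0)) _ _ tm sk.
  have e : \sum_j rv (q s) 0 j * pd j P 0 = ((s * d)%:C)%C.
    rewrite -/(dot (rv (q s)) (fun j => pd j P 0)) rvD dotDl !rvZ !dotZ.
    by rewrite -!/(Dv _ P) dh dw mulr0 add0r rmorphM.
  rewrite add0r P0 subr0 e in h2.
  have -> : g s - s * d = complex.Re (P (rv (q s)) - ((s * d)%:C)%C).
    by rewrite /g; case: (P _).
  apply: le_trans (Re_le_nm _) (le_trans h2 _).
  have -> : b * t ^+ 2 = `|B| * (2 * t * m) ^+ 2 by rewrite /b -mulrA -exprMn [2 * m * t]mulrAC.
  by rewrite ler_wpM2r ?sqr_ge0 // ler_norm.
have Kt0 : 0 <= K * t ^+ 2 by rewrite mulr_ge0 ?sqr_ge0.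
have dK : K * t ^+ 2 * d = b * t ^+ 2 by rewrite mulrAC divfK // gt_eqF.
have [|||s si gs] := @IVT R g (- (K * t ^+ 2)) (K * t ^+ 2) 0.
- by rewrite (le_trans _ Kt0) // oppr_le0.
- apply: continuous_in_subspaceT => s; rewrite inE /= in_itv /= -ler_norml => /sq ss.
  apply/cvgrPdist_le => e e0.
  near=> s'.
  have h1 : `|s' - s| * m <= r.
    rewrite -ler_pdivlMr // distrC; near: s'.
    by apply: cvgr_dist_le => //; rewrite divr_gt0.
  have h2 : `|s' - s| * m * `|B| <= e.
    have : `|s' - s| <= e / (m * (1 + `|B|)).
      rewrite distrC; near: s'; apply: cvgr_dist_le => //.
      by rewrite divr_gt0 // mulr_gt0 // ltr_pwDl.
    rewrite ler_pdivlMr; last by rewrite mulr_gt0 // ltr_pwDl.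
    move=> h2; apply: le_trans h2; rewrite mulrA ler_wpM2l ?lerDr //.
    by rewrite mulr_ge0 // ltW.
  have ee : 0 <= `|s' - s| * m <= r by rewrite h1 andbT mulr_ge0 // ltW.
  have sd : small (`|s' - s| * m) (rv (((s' - s)%:C)%C *: w)).
    by apply: small_rv => i; rewrite mxE nmM nmR ler_wpM2l.
  have sr : small r (rv (q s)) by apply: small_le ss; case/andP: tm.
  have [h3 _ _] := hT _ sr _ _ ee sd.
  rewrite distrC; have e1 : g s' - g s = complex.Re (P (rv (q s) + rv (((s' - s)%:C)%C *: w)) - P (rv (q s))).
    have eq : q s' = q s + ((s' - s)%:C)%C *: w.
      rewrite /q rmorphB scalerBl; move: (_ *: h) (_ *: w) (_ *: w) => x y z.
      by rewrite -addrA; congr (_ + _); rewrite addrC subrK.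
    have <- : rv (q s') = rv (q s) + rv (((s' - s)%:C)%C *: w) by rewrite eq rvD.
    exact: reB.
  rewrite e1; apply: le_trans (Re_le_nm _) (le_trans h3 (le_trans _ h2)).
  by rewrite mulrC ler_wpM2l ?ler_norm //; case/andP: ee.
- have h1 : g (K * t ^+ 2) >= 0.
    have := gq (K * t ^+ 2); rewrite ger0_norm // lexx dK => /(_ isT).
    by rewrite ler_norml => /andP[k _]; move: k; rewrite lerBrDr addrC subrr.
  have h2 : g (- (K * t ^+ 2)) <= 0.
    have := gq (- (K * t ^+ 2)); rewrite normrN ger0_norm // lexx mulNr dK => /(_ isT).
    by rewrite ler_norml opprK => /andP[_ k]; move: k; rewrite -lerBrDr subrr.
  have mm (x y : R) : x <= 0 -> 0 <= y -> Num.min x y <= 0 <= Num.max x y.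
    by move=> x0 y0; rewrite ge_min x0 le_max y0 orbT.
  exact: mm h2 h1.
exists s; split=> //; move: si; rewrite in_itv /= => si.
by rewrite ler_norml.
Unshelve. all: by end_near.
Qed.

(** The curve has velocity h, as its correction is O(t^2). *)
Lemma derivative_along_curve P (h w : C3 R) (K r : R) : an P -> P 0 = 0 -> 0 < r -> 0 <= K ->
  (forall t : R, 0 <= t <= r -> exists s : R,
    `|s| <= K * t ^+ 2 /\ P (rv ((t%:C)%C *: h + (s%:C)%C *: w)) = 0) ->
  Dv (rv h) P = 0.
Proof.
move=> /an_taylor [rT [B [rT0 hT]]] P0 r0 K0 hc.
have [m1 [m11 sh]] := small_ex h; have [m2 [m21 sw]] := small_ex w.
pose m := Order.max m1 m2; have m0 : 0 < m by rewrite lt_max (lt_le_trans ltr01 m11).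
have {}sh : small m h by apply: small_le sh; rewrite le_max lexx.
have {}sw : small m w by apply: small_le sw; rewrite le_max lexx orbT.
pose A := `|B| * (2 * m) ^+ 2 + K * nm (Dv (rv w) P).
have A0 : 0 <= A by rewrite addr_ge0 // mulr_ge0 ?nm_ge0 ?sqr_ge0.
pose r' := Order.min r (Order.min (rT / (2 * m)) (1 + K)^-1).
have r'0 : 0 < r' by rewrite !lt_min r0 divr_gt0 ?invr_gt0 ?ltr_pwDl // mulr_gt0.
have key t : 0 < t -> t <= r' -> nm (Dv (rv h) P) <= A * t.
  move=> t0; rewrite !le_min => /and3P[tr tT tK].
  have [|s [st Ps]] := hc t; first by rewrite (ltW t0).
  have Kt : K * t ^+ 2 <= t.
    exact: quad_small (ltW t0) tK.
  have sq : small (2 * t * m) (rv ((t%:C)%C *: h + (s%:C)%C *: w)).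
    apply: small_rv; apply: small_lin => //; first exact: ltW.
      by rewrite gtr0_norm.
    exact: le_trans st Kt.
  have tm : 0 <= 2 * t * m <= rT.
    by rewrite mulr_ge0 ?mulr_ge0 ?(ltW m0) ?(ltW t0) //= mulrAC mulrC -ler_pdivlMr // mulr_gt0.
  have [_ h2 _] := hT 0 (small0 (ltW rT0)) _ _ tm sq.
  rewrite add0r Ps P0 subr0 sub0r nmN -/(dot _ (fun j => pd j P 0)) rvD dotDl !rvZ !dotZ in h2.
  rewrite -!/(Dv _ P) in h2.
  move: h2; set x := Dv (rv h) P; set y := Dv (rv w) P => h2.
  have h3 : t * nm x <= B * (2 * t * m) ^+ 2 + K * t ^+ 2 * nm y.
    have -> : t * nm x = nm ((t%:C)%C * x + (s%:C)%C * y - (s%:C)%C * y).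
      by rewrite addrK nmM nmR gtr0_norm.
    apply: le_trans (nmB _ _) (lerD h2 _).
    by rewrite nmM nmR ler_wpM2r ?nm_ge0.
  have h4 : B * (2 * t * m) ^+ 2 <= `|B| * (2 * m) ^+ 2 * t ^+ 2.
    have -> : `|B| * (2 * m) ^+ 2 * t ^+ 2 = `|B| * (2 * t * m) ^+ 2.
      by rewrite -mulrA -exprMn [2 * m * t]mulrAC.
    by rewrite ler_wpM2r ?sqr_ge0 // ler_norm.
  rewrite -(ler_pM2l t0) (le_trans h3) // /A.
  have -> : t * (((`|B| * (2 * m) ^+ 2) + K * nm y) * t)
    = `|B| * (2 * m) ^+ 2 * t ^+ 2 + K * t ^+ 2 * nm y by ring.
  by rewrite lerD2r.
apply: nm_le0; rewrite leNgt; apply/negP => x0.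
pose t := Order.min r' (nm (Dv (rv h) P) / (2 * (1 + A))).
have t0 : 0 < t by rewrite lt_min r'0 divr_gt0 // mulr_gt0 // ltr_pwDl.
have h1 := key t t0; rewrite ge_min lexx in h1; have {}h1 := h1 isT.
have : t <= nm (Dv (rv h) P) / (2 * (1 + A)) by rewrite ge_min lexx orbT.
rewrite ler_pdivlMr; last by rewrite mulr_gt0 // ltr_pwDl.
have lin (x y z : R) : 0 < x -> 0 <= y -> z <= y -> x * 2 + 2 * y <= z -> False by lra.
move=> h2; apply: lin t0 (mulr_ge0 A0 (ltW t0)) h1 _; apply: le_trans h2.
by rewrite le_eqVlt; apply/orP; left; apply/eqP; ring.
Qed.

End TangentVectors.

(** * Vector fields tangent to a hypersurface *)

Section Hypersurface.
Variable R : realType.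
Local Notation C := (Cplx R).

(** Average a complexification with its conjugate: both restrict to the real function
    rho. *)
Lemma germ_hermitian p (rho : C3 R -> R) : real_analytic_at p (to_C rho) ->
  exists P, germ p (to_C rho) P /\ forall X, P (cswap X) = (P X)^*.
Proof.
move=> /germP [P0 h]; exists (fun t => 2^-1 * (P0 t + hconj P0 t)); split.
  have := germ_mul (germ_const p 2^-1) (germ_add h (germ_conj h)).
  move=> [a e]; split=> //; apply: filterS e => t <-; rewrite /to_C conj_Creal ?complex_real //.
  by move: ((rho _)%:C)%C => x; field.
move=> X; rewrite rmorphM fmorphV rmorph_nat; congr (_ * _).
rewrite rmorphD /hconj /= conjCK addrC; congr (_ + (P0 _)); rewrite /cswap.
by rewrite row_mxKl row_mxKr !conjmxK hsubmxK.
Qed.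

Lemma near_at n (p : 'rV[C]_n) (Q : 'rV[C]_n -> Prop) : (\forall q \near p, Q q) -> Q p.
Proof.
by move=> /nearP [r [r0 h]]; rewrite -[p]addr0; apply: h; apply: small0; exact: ltW.
Qed.

Lemma pd_comm n (P : 'rV[C]_n -> C) i j : an P -> pd i (pd j P) 0 = pd j (pd i P) 0.
Proof. by move=> aP; exact: (near_at (pd_comm0 j i aP)). Qed.

(** The second Wirtinger derivatives of the defining function. *)
Definition hess (rho : C3 R -> R) q (i j : 'I_(3 + 3)) :=
  gradient (fun q' => gradient (to_C rho) q' j 0) q i 0.

(** The Levi form of the defining function, before restriction to the tangent space. *)
Definition cplx_hessian (rho : C3 R -> R) q (a b : C3 R) : C :=
  \sum_j a 0 j * \sum_k b 0 k * hess rho q (rshift 3 k) (lshift 3 j).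

Lemma dot_row0 m k (a : 'rV[C]_m) g :
  dot (row_mx a (0 : 'rV[C]_k)) g = dot a (fun i => g (lshift k i)).
Proof. by rewrite dot_row dot0 addr0. Qed.

Lemma dot_0row m k (a : 'rV[C]_k) g :
  dot (row_mx (0 : 'rV[C]_m) a) g = dot a (fun i => g (rshift m i)).
Proof. by rewrite dot_row dot0 add0r. Qed.

Variables (U : set (C3 R)) (rho : C3 R -> R) (M : set (C3 R)).
Hypothesis hM : hypersurface U rho M.
Variable p : C3 R.
Hypothesis Mp : M p.
Variable P : 'rV[C]_(3 + 3) -> C.
Hypothesis gP : germ p (to_C rho) P.
Hypothesis hP : forall X, P (cswap X) = (P X)^*.

Lemma aP : an P. Proof. by case: gP. Qed.

Lemma in_CTM q v : (v \in CTM rho q) = (v *m gradient (to_C rho) q == 0).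
Proof. by rewrite memv_ker lfunE. Qed.

Lemma CTM_Dv v : (v \in CTM rho p) = (Dv v P == 0).
Proof.
rewrite in_CTM (germ_gradient gP) /Dv /dot.
have e : (v *m \col_j pd j P 0) 0 0 = \sum_j v 0 j * pd j P 0.
  by rewrite mxE; apply: eq_bigr => j _; rewrite mxE.
apply/eqP/eqP => [h|h]; first by rewrite -e h mxE.
by apply/matrixP => i j; rewrite !ord1 e h mxE.
Qed.

Lemma in_T10 q v : (v \in T10 rho q) = (v \in CTM rho q) && (rsubmx v == 0).
Proof. by rewrite memv_cap; congr (_ && _); rewrite memv_ker lfunE. Qed.

Lemma in_T01 q v : (v \in T01 rho q) = (v \in CTM rho q) && (lsubmx v == 0).
Proof. by rewrite memv_cap; congr (_ && _); rewrite memv_ker lfunE. Qed.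

Lemma rho0 : rho p = 0.
Proof. by case: hM Mp => _ _ -> _ []. Qed.

Lemma P00 : P 0 = 0.
Proof. by rewrite -(germ_at gP) /to_C rho0. Qed.

Lemma Dv_tconj v : Dv (tconj v) P = (Dv v P)^*.
Proof.
have e : hconj P = P by apply/funext => X; rewrite /hconj hP conjCK.
by rewrite -{2}e Dv_hconj ?conjCK //; exact: aP.
Qed.

Lemma DvZ v k (Q : 'rV[C]_(3 + 3) -> C) : Dv (k *: v) Q = k * Dv v Q.
Proof. exact: dotZ. Qed.

Lemma DvDl v w (Q : 'rV[C]_(3 + 3) -> C) : Dv (v + w) Q = Dv v Q + Dv w Q.
Proof. exact: dotDl. Qed.

(** The components of the (1,0) and (0,1) parts of the differential of the defining
    function at p. *)
Definition gx j := pd (lshift 3 j) P 0.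
Definition gy j := pd (rshift 3 j) P 0.

Lemma Dv_split v : Dv v P = dot (lsubmx v) gx + dot (rsubmx v) gy.
Proof. by rewrite -{1}(hsubmxK v); exact: dot_row. Qed.

Lemma gyE j : gy j = (gx j)^*.
Proof.
have := Dv_tconj (row_mx (delta_mx 0 j) 0).
have -> : tconj (row_mx (delta_mx 0 j) 0) = row_mx 0 (delta_mx 0 j) :> tvec R.
  by rewrite /tconj row_mxKl row_mxKr conjmx0 conj_delta.
have e1 : Dv (row_mx (delta_mx 0 j) 0) P = gx j by rewrite /Dv dot_row0; exact: dot_delta.
have e2 : Dv (row_mx 0 (delta_mx 0 j)) P = gy j by rewrite /Dv dot_0row; exact: dot_delta.
by rewrite e1 e2.
Qed.

Lemma gx_neq0 : exists j, gx j != 0.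
Proof.
case: hM => _ _ _ /(_ p Mp) h; apply: contrapT => k; case/negP: h.
have k0 j : gx j = 0 by apply/eqP; apply: contra_notT k => h; exists j.
rewrite (germ_gradient gP); apply/eqP/colP => j; rewrite !mxE.
rewrite -(splitK j); case: (fintype.split j) => l /=; first exact: k0.
by have := gyE l; rewrite k0 rmorph0.
Qed.

(** Take for w the conjugate of the (1,0) part of the differential. *)
Lemma transversal : exists w d, Dv (rv w) P = (d%:C)%C /\ 0 < d.
Proof.
pose w : C3 R := \row_j (gx j)^*; pose d := \sum_j nm (gx j) ^+ 2.
have d0 : 0 < d.
  have [j hj] := gx_neq0; rewrite /d (bigD1 j) //= ltr_pwDl ?exprn_gt0 ?nm_gt0 //.
  by apply: sumr_ge0 => i _; rewrite sqr_ge0.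
exists w, (2 * d); split; last by rewrite mulr_gt0.
have e : dot w gx = (d%:C)%C.
  rewrite /dot /d rmorph_sum; apply: eq_bigr => j _.
  by rewrite mxE mulrC -normCK nmE rmorphXn.
have e2 : dot (conjmx w) gy = (d%:C)%C.
  rewrite -[RHS](_ : ((d%:C)%C)^* = _); last by rewrite conj_Creal // complex_real.
  rewrite -e /dot rmorph_sum; apply: eq_bigr => j _.
  by rewrite [conjmx w _ _]mxE rmorphM gyE.
have -> : Dv (rv w) P = dot w gx + dot (conjmx w) gy by exact: dot_row.
by rewrite e e2 [2 * d]mulr_natl mulr2n rmorphD.
Qed.

Lemma real_tangent f Q h : germ p f Q -> (\forall q \near p, M q -> f q = 0) ->
  Dv (rv h) P = 0 -> Dv (rv h) Q = 0.
Proof.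
move=> [aQ gQ] fM hh; have [w [d [dw d0]]] := transversal.
have [K [r [r0 K0 hc]]] := curve_in_zero_locus aP P00 hh dw d0.
have Q0 : Q 0 = 0.
  by rewrite -(germ_at (conj aQ gQ)); exact: (near_at fM).
have Un : \forall q \near p, U q.
  case: hM Mp => oU _ -> _ [Up _]; exact: open_nbhs_nbhs.
have [s [s0 hs]] := (near0P _).1 (filterI (filterI gP.2 gQ)
  (filterI ((near_shift _ _).1 fM) ((near_shift _ _).1 Un))).
have [m1 [m11 sh]] := small_ex h; have [m2 [m21 sw]] := small_ex w.
pose m := Order.max m1 m2; have m0 : 0 < m by rewrite lt_max (lt_le_trans ltr01 m11).
have {}sh : small m h by apply: small_le sh; rewrite le_max lexx.
have {}sw : small m w by apply: small_le sw; rewrite le_max lexx orbT.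
pose r' := Order.min r (Order.min (s / (2 * m)) (1 + K)^-1).
have r'0 : 0 < r' by rewrite !lt_min r0 divr_gt0 ?invr_gt0 ?ltr_pwDl // mulr_gt0.
apply: (@derivative_along_curve _ Q h w K r' aQ Q0 r'0 K0) => t.
rewrite !le_min => /andP[t0 /and3P[tr ts tK]].
have [|a [aK hP0]] := hc t; first by rewrite t0.
exists a; split=> //; set k := _ + _ in hP0 *.
have sk : small s k.
  apply: (small_le (r := 2 * t * m)); first by rewrite mulrAC mulrC -ler_pdivlMr // mulr_gt0.
  apply: small_lin => //; first exact: ltW.
    by rewrite ger0_norm.
  by apply: le_trans aK _; exact: quad_small.
have [[e1 e2] [e3 e4]] := hs k sk.
rewrite -e2; apply: e3; case: hM => _ _ -> _; split=> //=.
by move: hP0; rewrite /rv -e1.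
Qed.

(** A complex tangent vector is a combination v = (h_1 - i h_2) / 2 of two real ones. *)
Lemma tangent f Q v : germ p f Q -> (\forall q \near p, M q -> f q = 0) ->
  v \in CTM rho p -> Dv v Q = 0.
Proof.
move=> gQ fM; rewrite CTM_Dv => /eqP v0.
have e1 : rv (lsubmx v + conjmx (rsubmx v)) = v + tconj v.
  rewrite rvD /tconj -[v in RHS]hsubmxK /rv conjmxK !add_row_mx hsubmxK.
  by congr row_mx; rewrite addrC.
have e2 : rv ('i *: (lsubmx v - conjmx (rsubmx v))) = 'i *: (v - tconj v).
  rewrite /tconj -[v in RHS]hsubmxK /rv conjmxZ conjCi opp_row_mx add_row_mx scale_row_mx.
  rewrite hsubmxK; congr row_mx; rewrite scaleNr -scalerN; congr (_ *: _).
  by apply/rowP => i; rewrite !mxE rmorphB /= conjCK opprB.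
have d1 := real_tangent (h := lsubmx v + conjmx (rsubmx v)) gQ fM.
have d2 := real_tangent (h := 'i *: (lsubmx v - conjmx (rsubmx v))) gQ fM.
have vN Q' : Dv (- tconj v) Q' = - Dv (tconj v) Q' by rewrite -scaleN1r DvZ mulN1r.
rewrite e1 !DvDl Dv_tconj v0 rmorph0 addr0 in d1; have {}d1 := d1 erefl.
rewrite e2 !DvZ !DvDl !vN Dv_tconj v0 rmorph0 subr0 mulr0 in d2; have {}d2 := d2 erefl.
have : 'i * (Dv v Q - Dv (tconj v) Q) + 'i * (Dv v Q + Dv (tconj v) Q) = 0.
  by rewrite d2 d1 mulr0 addr0.
rewrite -mulrDr addrACA addNr addr0 -mulr2n => /eqP.
by rewrite mulf_eq0 (negPf (@neq0Ci _)) mulrn_eq0 /= => /eqP.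
Qed.

Lemma hessE i j : hess rho p i j = pd i (pd j P) 0.
Proof. by rewrite /hess (germ_gradient (germ_pd j gP)) mxE. Qed.

Definition vgerm (X : vfield R) (PX : 'I_(3 + 3) -> 'rV[C]_(3 + 3) -> C) :=
  forall k, germ p (fun q => X q 0 k) (PX k).

Lemma T10_partial q v : v \in T10 rho q ->
  \sum_j v 0 (lshift 3 j) * gradient (to_C rho) q (lshift 3 j) 0 = 0.
Proof.
rewrite in_T10 in_CTM => /andP[/eqP h /eqP r0]; have := congr1 (fun A : 'M[C]_1 => A 0 0) h.
rewrite [LHS]mxE big_split_ord /= [in X in _ + X]big1 ?addr0 => [->|j _]; first by rewrite mxE.
by have := congr1 (fun A : 'M[C]_(1, 3) => A 0 j) r0; rewrite !mxE => ->; rewrite mul0r.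
Qed.

Lemma T01_partial q v : v \in T01 rho q ->
  \sum_j v 0 (rshift 3 j) * gradient (to_C rho) q (rshift 3 j) 0 = 0.
Proof.
rewrite in_T01 in_CTM => /andP[/eqP h /eqP r0]; have := congr1 (fun A : 'M[C]_1 => A 0 0) h.
rewrite [LHS]mxE big_split_ord /= [in X in X + _]big1 ?add0r => [->|j _]; first by rewrite mxE.
by have := congr1 (fun A : 'M[C]_(1, 3) => A 0 j) r0; rewrite !mxE => ->; rewrite mul0r.
Qed.

(** Differentiate along v the relation X rho = 0 on the hypersurface. *)
Lemma partial_derivative X PX v : vgerm X PX -> v \in CTM rho p ->
  (\forall q \near p, M q -> X q \in T10 rho q) ->
  \sum_j (Dv v (PX (lshift 3 j)) * gx j + X p 0 (lshift 3 j) * Dv v (pd (lshift 3 j) P)) = 0.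
Proof.
move=> hX vT XT.
have gg : germ p (fun q => \sum_j X q 0 (lshift 3 j) * gradient (to_C rho) q (lshift 3 j) 0)
    (fun t => \sum_j PX (lshift 3 j) t * pd (lshift 3 j) P t).
  by apply: germ_sum => j; exact: germ_mul (hX _) (germ_pd _ gP).
have z : \forall q \near p, M q ->
    \sum_j X q 0 (lshift 3 j) * gradient (to_C rho) q (lshift 3 j) 0 = 0.
  by apply: filterS XT => q h /h /T10_partial.
have aPX j : an (PX (lshift 3 j)) by case: (hX (lshift 3 j)).
have := tangent gg z vT; rewrite Dv_sum => [e|j]; last by apply: an_mul => //; exact: an_pd aP.
rewrite -[RHS]e; apply: eq_bigr => j _; rewrite Dv_mul //; last exact: an_pd aP.
by rewrite (germ_at (hX _)).
Qed.

Lemma partial_derivative01 Z PZ v : vgerm Z PZ -> v \in CTM rho p ->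
  (\forall q \near p, M q -> Z q \in T01 rho q) ->
  \sum_j (Dv v (PZ (rshift 3 j)) * gy j + Z p 0 (rshift 3 j) * Dv v (pd (rshift 3 j) P)) = 0.
Proof.
move=> hX vT XT.
have gg : germ p (fun q => \sum_j Z q 0 (rshift 3 j) * gradient (to_C rho) q (rshift 3 j) 0)
    (fun t => \sum_j PZ (rshift 3 j) t * pd (rshift 3 j) P t).
  by apply: germ_sum => j; exact: germ_mul (hX _) (germ_pd _ gP).
have z : \forall q \near p, M q ->
    \sum_j Z q 0 (rshift 3 j) * gradient (to_C rho) q (rshift 3 j) 0 = 0.
  by apply: filterS XT => q h /h /T01_partial.
have aPX j : an (PZ (rshift 3 j)) by case: (hX (rshift 3 j)).
have := tangent gg z vT; rewrite Dv_sum => [e|j]; last by apply: an_mul => //; exact: an_pd aP.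
rewrite -[RHS]e; apply: eq_bigr => j _; rewrite Dv_mul //; last exact: an_pd aP.
by rewrite (germ_at (hX _)).
Qed.

Lemma T10_lsub v Q : v \in T10 rho p -> Dv v Q = dot (lsubmx v) (fun j => pd (lshift 3 j) Q 0).
Proof.
rewrite in_T10 => /andP[_ /eqP h].
by rewrite /Dv -[v in LHS]hsubmxK h dot_row dot0 addr0.
Qed.

Lemma T01_rsub v Q : v \in T01 rho p -> Dv v Q = dot (rsubmx v) (fun j => pd (rshift 3 j) Q 0).
Proof.
rewrite in_T01 => /andP[_ /eqP h].
by rewrite /Dv -[v in LHS]hsubmxK h dot_row dot0 add0r.
Qed.

(** On the hypersurface the field Z has no (1,0) part and X no (0,1) part; the bracket
    therefore reduces to the derivatives of the components of one field along the other,
    and the relations X rho = 0 and Z rho = 0, differentiated, turn these into second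
    derivatives of rho. *)
Lemma bracket_formula X Z PX PZ : vgerm X PX -> vgerm Z PZ ->
  (\forall q \near p, M q -> X q \in T10 rho q) ->
  (\forall q \near p, M q -> Z q \in T01 rho q) ->
  let W := lie_bracket X Z p in
  [/\ forall j, lsubmx W 0 j = - Dv (Z p) (PX (lshift 3 j)),
      dot (lsubmx W) gx = cplx_hessian rho p (lsubmx (X p)) (rsubmx (Z p)) &
      W \in CTM rho p].
Proof.
move=> hX hZ XT ZT W.
have Xp : X p \in T10 rho p by exact: (near_at XT).
have Zp : Z p \in T01 rho p by exact: (near_at ZT).
have XC : X p \in CTM rho p by move: Xp; rewrite in_T10 => /andP[].
have ZC : Z p \in CTM rho p by move: Zp; rewrite in_T01 => /andP[].
have WE k : W 0 k = Dv (X p) (PZ k) - Dv (Z p) (PX k).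
  by rewrite mxE (germ_vderiv X (hZ k)) (germ_vderiv Z (hX k)).
have Wl j : lsubmx W 0 j = - Dv (Z p) (PX (lshift 3 j)).
  rewrite mxE WE (tangent (hZ (lshift 3 j)) _ XC) ?sub0r //.
  apply: filterS ZT => q h /h; rewrite in_T01 => /andP[_ /eqP e].
  by have := congr1 (fun A : 'M[C]_(1, 3) => A 0 j) e; rewrite !mxE.
have Wr j : rsubmx W 0 j = Dv (X p) (PZ (rshift 3 j)).
  rewrite mxE WE (tangent (hX (rshift 3 j)) _ ZC) ?subr0 //.
  apply: filterS XT => q h /h; rewrite in_T10 => /andP[_ /eqP e].
  by have := congr1 (fun A : 'M[C]_(1, 3) => A 0 j) e; rewrite !mxE.
have WH : dot (lsubmx W) gx = cplx_hessian rho p (lsubmx (X p)) (rsubmx (Z p)).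
  have := partial_derivative hX ZC XT; rewrite big_split /= => /eqP.
  rewrite addrC addr_eq0 => /eqP e; rewrite /cplx_hessian.
  transitivity (\sum_j X p 0 (lshift 3 j) * Dv (Z p) (pd (lshift 3 j) P)).
    by rewrite e /dot -sumrN; apply: eq_bigr => j _; rewrite Wl mulNr.
  apply: eq_bigr => j _; rewrite [in RHS]mxE; congr (_ * _).
  by rewrite T01_rsub //; apply: eq_bigr => k _; rewrite hessE.
split=> //; rewrite CTM_Dv Dv_split WH.
have := partial_derivative01 hZ XC ZT; rewrite big_split /= => /eqP.
rewrite addrC addr_eq0 => /eqP e.
have -> : dot (rsubmx W) gy = \sum_j Dv (X p) (PZ (rshift 3 j)) * gy j.
  by apply: eq_bigr => j _; rewrite Wr.
rewrite -[X in _ + X]opprK -e subr_eq0 /cplx_hessian; apply/eqP.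
transitivity (\sum_k \sum_j X p 0 (lshift 3 j) * (Z p 0 (rshift 3 k) *
    pd (rshift 3 k) (pd (lshift 3 j) P) 0)).
  rewrite exchange_big; apply: eq_bigr => j _; rewrite mxE mulr_sumr.
  by apply: eq_bigr => k _; rewrite mxE hessE.
apply: eq_bigr => k _.
have -> : Dv (X p) (pd (rshift 3 k) P) =
    \sum_j X p 0 (lshift 3 j) * pd (rshift 3 k) (pd (lshift 3 j) P) 0.
  by rewrite (T10_lsub _ Xp); apply: eq_bigr => j _; rewrite mxE (pd_comm _ _ aP).
by rewrite mulr_sumr; apply: eq_bigr => j _; exact: mulrCA.
Qed.

End Hypersurface.

(** * The Levi form *)

Section LeviForm.
Variable R : realType.
Local Notation C := (Cplx R).
Variables (U : set (C3 R)) (rho : C3 R -> R) (M : set (C3 R)).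
Hypothesis hM : hypersurface U rho M.

Lemma hermitian_germ p : M p ->
  exists P, germ p (to_C rho) P /\ forall X, P (cswap X) = (P X)^*.
Proof.
by case: hM => _ hU -> _ [Up _]; apply: germ_hermitian; exact: hU.
Qed.

Lemma tconjK (v : tvec R) : tconj (tconj v) = v.
Proof. by rewrite /tconj row_mxKl row_mxKr !conjmxK hsubmxK. Qed.

(** The differential of a real function is invariant under conjugation. *)
Lemma tconj_T10 q v : M q -> v \in T10 rho q -> tconj v \in T01 rho q.
Proof.
move=> Mq; have [P [gP hP]] := hermitian_germ Mq.
rewrite in_T10 in_T01 (CTM_Dv gP) (CTM_Dv gP) => /andP[/eqP v0 /eqP r0].
by rewrite (Dv_tconj gP hP) v0 rmorph0 eqxx /= /tconj row_mxKl r0 conjmx0.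
Qed.

(** Exchange of the holomorphic and antiholomorphic indices. *)
Definition flip (k : 'I_(3 + 3)) : 'I_(3 + 3) :=
  match fintype.split k with inl j => rshift 3 j | inr j => lshift 3 j end.

Lemma flip_r j : flip (rshift 3 j) = lshift 3 j.
Proof. by rewrite /flip (unsplitK (inr j)). Qed.

Lemma flip_delta j : tconj (delta_mx 0 j : tvec R) = delta_mx 0 (flip j).
Proof.
rewrite -(splitK j) /flip unsplitK; case: (fintype.split j) => l /=.
  by rewrite delta_mx_lshift delta_mx_rshift /tconj row_mxKl row_mxKr conj_delta conjmx0.
by rewrite delta_mx_lshift delta_mx_rshift /tconj row_mxKl row_mxKr conj_delta conjmx0.
Qed.

Lemma Dv_near v (Q Q' : 'rV[C]_(3 + 3) -> C) : an Q ->
  (\forall X \near (0 : 'rV[C]_(3 + 3)), Q X = Q' X) -> Dv v Q = Dv v Q'.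
Proof.
move=> aQ e; apply/esym/Dv_cd; first exact: an_eq e aQ.
have [r r0 h] := near_curve e (vcd_scale v) (scale0r v).
by apply: cd_eq (cd_pd v aQ); exists r.
Qed.

Lemma pd_hconj i (Q : 'rV[C]_(3 + 3) -> C) : an Q ->
  \forall X \near (0 : 'rV[C]_(3 + 3)), pd i (hconj Q) X = hconj (pd (flip i) Q) X.
Proof.
move=> aQ; have := an_fderiv (an_hconj aQ).
have h : \forall X \near (0 : 'rV[C]_(3 + 3)), fderiv Q (cswap X) (fun j => pd j Q (cswap X)).
  have /near0P [r [r0 h]] := an_fderiv aQ; apply/near0P; exists r; split=> // X sX.
  by apply: h; exact: small_cswap.
move=> h2; apply: filterS2 h h2 => X d1 d2.
apply: cd_unique (cd_fderiv i d2) _; apply: cd_ext (cd_conj (cd_fderiv (flip i) d1)) => tau.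
rewrite /hconj; congr ((Q _)^*); rewrite -flip_delta /tconj /cswap.
rewrite scale_row_mx add_row_mx -!conjmxZ !linearD /=.
by congr row_mx; apply/rowP => k; rewrite !mxE rmorphD.
Qed.

Lemma vgerm_conj p Y (PY : 'I_(3 + 3) -> 'rV[C]_(3 + 3) -> C) : vgerm p Y PY -> vgerm p (vconj Y) (fun k => hconj (PY (flip k))).
Proof.
move=> h k; have := germ_conj (h (flip k)).
suff -> : (fun q => vconj Y q 0 k) = (fun q => (Y q 0 (flip k))^*) by [].
apply/funext => q; rewrite /vconj /tconj /flip mxE.
by case: fintype.split => j; rewrite !mxE.
Qed.

Lemma vgermP p (X : vfield R) : (forall k, real_analytic_at p (fun q => X q 0 k)) -> exists PX, vgerm p X PX.
Proof.
by move=> h; have [PX hX] := choice (fun k => (germP p _).1 (h k)); exists PX.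
Qed.

Lemma section10_at p X : M p -> section10 rho M p X -> X p \in T10 rho p.
Proof. by move=> Mp [_ h]; exact: (near_at h). Qed.

Lemma bracket10 p X Y PX P : M p -> germ p (to_C rho) P -> (forall Z, P (cswap Z) = (P Z)^*) ->
  section10 rho M p X -> section10 rho M p Y -> vgerm p X PX ->
  let W := lie_bracket X (vconj Y) p in
  [/\ forall j, lsubmx W 0 j = - Dv (tconj (Y p)) (PX (lshift 3 j)),
      dot (lsubmx W) (gx P) = cplx_hessian rho p (lsubmx (X p)) (conjmx (lsubmx (Y p))) &
      W \in CTM rho p].
Proof.
move=> Mp gP hP [_ XT] [Ya YT] hX; have [PY hY] := vgermP Ya.
have YT' : \forall q \near p, M q -> vconj Y q \in T01 rho q.
  by apply: filterS YT => q h Mq; apply: tconj_T10 => //; exact: h.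
have [h1 h2 h3] := bracket_formula hM Mp gP hP hX (vgerm_conj hY) XT YT'.
by split=> //; rewrite h2 /vconj /tconj row_mxKr.
Qed.

Variable theta : C3 R -> cotvec R.
Hypothesis hth : contact_form rho M theta.

(** Both forms vanish on T10 + T01, which has codimension one in the tangent space. *)
Lemma theta_partial p P : M p -> germ p (to_C rho) P -> (forall Z, P (cswap Z) = (P Z)^*) ->
  exists mu, mu != 0 /\ forall v, v \in CTM rho p -> theta p v = mu * dot (lsubmx v) (gx P).
Proof.
move=> Mp gP hP; have [_ /subvPn [v0 v0T v0N] ker] := hth Mp.
have key v : v \in CTM rho p -> dot (lsubmx v) (gx P) = 0 -> theta p v = 0.
  move=> vT v0'; have : v \in (T10 rho p + T01 rho p)%VS.
    have e : row_mx (lsubmx v) 0 + row_mx 0 (rsubmx v) = v.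
      by rewrite add_row_mx addr0 add0r hsubmxK.
    rewrite -e; apply: memv_add.
      rewrite in_T10 (CTM_Dv gP) (Dv_split P) row_mxKl row_mxKr v0' dot0 addr0.
      by rewrite !eqxx.
    rewrite in_T01 (CTM_Dv gP) (Dv_split P) row_mxKl row_mxKr dot0 add0r.
    move: vT; rewrite (CTM_Dv gP) (Dv_split P) v0' add0r => ->.
    by rewrite eqxx.
  by rewrite -ker memv_cap => /andP[_]; rewrite memv_ker => /eqP.
have d0 : dot (lsubmx v0) (gx P) != 0.
  by apply: contraNneq v0N => h; rewrite memv_ker (key _ v0T h).
have t0 : theta p v0 != 0 by move: v0N; rewrite memv_ker.
exists (theta p v0 / dot (lsubmx v0) (gx P)); split; first by rewrite mulf_neq0 ?invr_neq0.
move=> v vT; pose c := dot (lsubmx v) (gx P) / dot (lsubmx v0) (gx P).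
have : theta p (v - c *: v0) = 0.
  apply: key; first by rewrite memvB ?memvZ.
  have -> : lsubmx (v - c *: v0) = lsubmx v + (- c) *: lsubmx v0.
    by apply/rowP => i; rewrite !mxE mulNr.
  by rewrite dotDl dotZ mulNr /c divfK // subrr.
rewrite linearB linearZ /= => /eqP; rewrite subr_eq0 => /eqP ->.
have sc (a b : C) : a *: (b : (Cplx R)^o) = b * a by exact: mulrC.
by rewrite sc /c mulrA mulrAC.
Qed.

Lemma cplx_hessianDl q a b c : cplx_hessian rho q (a + b) c = cplx_hessian rho q a c + cplx_hessian rho q b c.
Proof. by rewrite /cplx_hessian -big_split; apply: eq_bigr => j _; rewrite mxE mulrDl. Qed.

Lemma cplx_hessianZl q k a c : cplx_hessian rho q (k *: a) c = k * cplx_hessian rho q a c.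
Proof. by rewrite /cplx_hessian mulr_sumr; apply: eq_bigr => j _; rewrite mxE mulrA. Qed.

Lemma cplx_hessianDr q a b c : cplx_hessian rho q a (b + c) = cplx_hessian rho q a b + cplx_hessian rho q a c.
Proof.
rewrite /cplx_hessian -big_split; apply: eq_bigr => j _ /=; rewrite -mulrDr; congr (_ * _).
by rewrite -big_split; apply: eq_bigr => k _; rewrite mxE mulrDl.
Qed.

Lemma cplx_hessianZr q k a c : cplx_hessian rho q a (k *: c) = k * cplx_hessian rho q a c.
Proof.
rewrite /cplx_hessian mulr_sumr; apply: eq_bigr => j _; rewrite mulrCA; congr (_ * _).
by rewrite mulr_sumr; apply: eq_bigr => l _; rewrite mxE mulrA.
Qed.

Lemma cplx_hessian_conj q a b : M q -> (cplx_hessian rho q a b)^* = cplx_hessian rho q (conjmx b) (conjmx a).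
Proof.
move=> Mq; have [P [gP hP]] := hermitian_germ Mq; have aP := aP gP.
have h j k : (pd (rshift 3 k) (pd (lshift 3 j) P) 0)^* = pd (rshift 3 j) (pd (lshift 3 k) P) 0.
  have hPe : hconj P = P by apply/funext => X; rewrite /hconj hP conjCK.
  have e : \forall X \near (0 : 'rV[C]_(3 + 3)), pd (rshift 3 j) P X = hconj (pd (lshift 3 j) P) X.
    have := pd_hconj (rshift 3 j) aP; rewrite hPe flip_r; exact.
  have e1 : pd (rshift 3 k) (pd (lshift 3 j) P) 0 = Dv (row_mx 0 (delta_mx 0 k)) (pd (lshift 3 j) P).
    by rewrite /Dv dot_0row; apply/esym; exact: dot_delta.
  rewrite e1 -[row_mx _ _]tconjK -(Dv_hconj _ (an_pd _ aP)).
  rewrite -(Dv_near _ (an_pd _ aP) e) /tconj row_mxKl row_mxKr conjmx0 conj_delta.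
  rewrite /Dv dot_row0 -(pd_comm _ _ aP); exact: dot_delta.
rewrite /cplx_hessian rmorph_sum.
transitivity (\sum_j \sum_k (conjmx b) 0 k * ((conjmx a) 0 j * hess rho q (rshift 3 j) (lshift 3 k))).
  apply: eq_bigr => j _; rewrite rmorphM rmorph_sum mulr_sumr; apply: eq_bigr => k _.
  by rewrite rmorphM /= !(hessE gP) h !mxE mulrCA.
by rewrite exchange_big; apply: eq_bigr => j _; rewrite mulr_sumr.
Qed.

(** By theta_partial and bracket10 the Levi form is, up to a factor, the complex Hessian
    of the defining function. *)
Lemma levi_formula p : M p -> exists mu, mu != 0 /\
  forall X Y, section10 rho M p X -> section10 rho M p Y ->
  levi theta X Y p = mu * cplx_hessian rho p (lsubmx (X p)) (conjmx (lsubmx (Y p))).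
Proof.
move=> Mp; have [P [gP hP]] := hermitian_germ Mp.
have [mu [mu0 ht]] := theta_partial Mp gP hP; exists ('i * mu); split.
  by rewrite mulf_neq0 // neq0Ci.
move=> X Y hX hY; have [PX gX] := vgermP hX.1.
have [_ e W] := bracket10 Mp gP hP hX hY gX.
rewrite /levi linearZ /= (ht _ W) e; exact: mulrA.
Qed.

End LeviForm.

(** * The kernel of the Levi form *)

Section Freeman.
Variable R : realType.
Local Notation C := (Cplx R).
Variables (U : set (C3 R)) (rho : C3 R -> R) (M : set (C3 R)).
Hypothesis hM : hypersurface U rho M.
Variable theta : C3 R -> cotvec R.
Hypothesis hth : contact_form rho M theta.
Variable L : 'I_2 -> vfield R.
Hypothesis secL : forall p, M p -> forall j, section10 rho M p (L j).
Hypothesis basL : forall p, M p -> basis_of (T10 rho p) [:: L 0 p; L 1 p].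
Hypothesis frameL : forall p, M p -> basis_of (CTM rho p)
        [:: L 0 p; L 1 p; vconj (L 0) p; vconj (L 1) p;
            lie_bracket (L 0) (vconj (L 0)) p].
Hypothesis rankL : forall p, M p -> \rank (levi_mx theta L p) = 1%N.

(** The Levi matrix in the given frame, normalized by the defining function. *)
Definition levi_coef j k q := cplx_hessian rho q (lsubmx (L j q)) (conjmx (lsubmx (L k q))).

(** Otherwise the contact form would vanish on the five fields of the frame, hence on the
    whole tangent space. *)
Lemma levi_coef00_neq0 q : M q -> levi_coef 0 0 q != 0.
Proof.
move=> Mq; apply/negP => /eqP l0.
have [P [gP hP]] := hermitian_germ hM Mq.
have [mu [mu0 ht]] := theta_partial hth Mq gP hP.
have [PX gX] := vgermP (secL Mq 0).1.
have [_ e W] := bracket10 hM Mq gP hP (secL Mq 0) (secL Mq 0) gX.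
have [_ /negP nle _] := hth Mq; apply: nle.
have z v : v \in CTM rho q -> dot (lsubmx v) (gx P) = 0 -> v \in lker (theta q).
  by move=> vT v0; rewrite memv_ker (ht _ vT) v0 mulr0.
have t10 j : L j q \in lker (theta q).
  have := section10_at Mq (secL Mq j); rewrite in_T10 => /andP[h1 /eqP h2].
  apply: z => //; move: h1; rewrite (CTM_Dv gP) (Dv_split P) h2 dot0 addr0.
  by move/eqP.
have t01 j : vconj (L j) q \in lker (theta q).
  have := tconj_T10 hM Mq (section10_at Mq (secL Mq j)).
  by rewrite in_T01 => /andP[h1 /eqP h2]; apply: z => //; rewrite h2 dot0.
have tb : lie_bracket (L 0) (vconj (L 0)) q \in lker (theta q) by apply: z => //; rewrite e.
rewrite -(span_basis (frameL Mq)); apply/span_subvP; apply/allP.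
by apply/and5P; split; [exact: t10 | exact: t10 | exact: t01 | exact: t01 | rewrite tb].
Qed.

Lemma levi_coef_det q : M q -> levi_coef 0 0 q * levi_coef 1 1 q = levi_coef 1 0 q * levi_coef 0 1 q.
Proof.
move=> Mq; have [mu [mu0 h]] := levi_formula hM hth Mq.
have : levi_mx theta L q \notin unitmx.
  by apply/negP => /mxrank_unit; rewrite rankL.
rewrite unitmxE unitfE negbK (expand_det_row _ 0) big_ord_recl big_ord1.
rewrite /cofactor !det_mx11 !mxE /=.
have -> : lift 0 0 = 1 :> 'I_2 by exact/val_inj.
have -> : lift 1 0 = 0 :> 'I_2 by exact/val_inj.
rewrite !(h _ _ (secL Mq _) (secL Mq _)) -!/(levi_coef _ _ q) /= expr0 mul1r expr1 mulN1r.
move: (levi_coef _ _ _) (levi_coef _ _ _) (levi_coef _ _ _) (levi_coef _ _ _) => a b c d.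
rewrite mulrN subr_eq0 => /eqP e; apply: (mulfI mu0); apply: (mulfI mu0).
transitivity (mu * d * (mu * c)); [ring | rewrite e; ring].
Qed.

Lemma T10_span q v : M q -> v \in T10 rho q -> exists a b, v = a *: L 0 q + b *: L 1 q.
Proof.
move=> Mq; rewrite -(span_basis (basL Mq)) !span_cons span_nil addv0.
by case/memv_addP => x /vlineP [a ->] [y /vlineP [b ->] ->]; exists a, b.
Qed.

(** The last row of the adjugate of the Levi matrix: an analytic field in the kernel, as the
    determinant vanishes. *)
Definition kernel_field : vfield R := fun q => levi_coef 0 0 q *: L 1 q - levi_coef 1 0 q *: L 0 q.

Lemma kernel_field_T10 q : M q -> kernel_field q \in T10 rho q.
Proof. by move=> Mq; rewrite memvB ?memvZ //; apply: (section10_at Mq); exact: secL. Qed.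

Lemma lsub_comb a b (v w : tvec R) :
  lsubmx (a *: v + b *: w) = a *: lsubmx v + b *: lsubmx w.
Proof. by apply/rowP => i; rewrite !mxE. Qed.

Lemma conj_comb n a b (v w : 'rV[C]_n) :
  conjmx (a *: v + b *: w) = a^* *: conjmx v + b^* *: conjmx w.
Proof. by apply/rowP => i; rewrite !mxE rmorphD !rmorphM. Qed.

Lemma kernel_fieldE q : kernel_field q = levi_coef 0 0 q *: L 1 q + (- levi_coef 1 0 q) *: L 0 q.
Proof. by rewrite /kernel_field scaleNr. Qed.

Lemma kernel_field_kernel q v : M q -> v \in T10 rho q ->
  cplx_hessian rho q (lsubmx (kernel_field q)) (conjmx (lsubmx v)) = 0.
Proof.
move=> Mq /(T10_span Mq) [a [b ->]].
rewrite kernel_fieldE !lsub_comb conj_comb cplx_hessianDr !cplx_hessianZr !cplx_hessianDl !cplx_hessianZl -!/(levi_coef _ _ q).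
rewrite (levi_coef_det Mq); move: (levi_coef _ _ _) (levi_coef _ _ _) (levi_coef _ _ _) => x y z; ring.
Qed.

Lemma kernel_field_levi_kernel q : M q -> levi_kernel rho M theta q (kernel_field q).
Proof.
move=> Mq; split; first exact: kernel_field_T10.
move=> X Y hX hY XK; have [mu [_ h]] := levi_formula hM hth Mq.
by rewrite h // XK (kernel_field_kernel Mq (section10_at Mq hY)) mulr0.
Qed.

Lemma near_all_at (p : C3 R) (Q : C3 R -> Prop) : (forall q, Q q) -> \forall q \near p, Q q.
Proof. by move=> h; apply: (near_shift p Q).2; apply: near_all => t; exact: h. Qed.

Lemma germ_levi_coef p j k : M p -> exists Q, germ p (levi_coef j k) Q.
Proof.
move=> Mp; have [PX hX] := vgermP (secL Mp j).1; have [PY hY] := vgermP (secL Mp k).1.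
have [P [gP _]] := hermitian_germ hM Mp.
pose H a b := pd (rshift 3 b) (pd (lshift 3 a) P).
have hH a b : germ p (fun q => hess rho q (rshift 3 b) (lshift 3 a)) (H a b).
  exact: (germ_pd _ (germ_pd _ gP)).
exists (fun t => \sum_a PX (lshift 3 a) t * \sum_b hconj (PY (lshift 3 b)) t * H a b t).
have [aQ hQ] : germ p (fun q => \sum_a L j q 0 (lshift 3 a) * \sum_b (L k q 0 (lshift 3 b))^* *
    hess rho q (rshift 3 b) (lshift 3 a)) (fun t => \sum_a PX (lshift 3 a) t *
    \sum_b hconj (PY (lshift 3 b)) t * H a b t).
  apply: germ_sum => a; apply: germ_mul (hX _) _; apply: germ_sum => b.
  by apply: germ_mul; [exact: germ_conj (hY _) | exact: hH].
split=> //; apply: filterS hQ => t <-; rewrite /levi_coef /cplx_hessian.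
by apply: eq_bigr => a _; rewrite mxE; congr (_ * _); apply: eq_bigr => b _; rewrite !mxE.
Qed.

Lemma kernel_field_section p : M p -> section10 rho M p kernel_field.
Proof.
move=> Mp; split; last by apply: near_all_at => q Mq; exact: kernel_field_T10.
move=> k; apply/germP.
have [PX hX] := vgermP (secL Mp 0).1; have [PY hY] := vgermP (secL Mp 1).1.
have [a ha] := germ_levi_coef 0 0 Mp; have [b hb] := germ_levi_coef 1 0 Mp.
exists (fun t => a t * PY k t - b t * PX k t).
have [c hc] := germ_sub (germ_mul ha (hY k)) (germ_mul hb (hX k)).
by split=> //; apply: filterS hc => t <-; rewrite !mxE.
Qed.

Lemma kernel_field_sectionK p : M p -> sectionK rho M theta p kernel_field.
Proof.
move=> Mp; split; first exact: kernel_field_section.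
by apply: near_all_at => q Mq; exact: kernel_field_levi_kernel.
Qed.

End Freeman.

(** * The third-order jet and the Freeman form *)

Section DirectionalCalculus.
Variable R : realType.
Local Notation C := (Cplx R).

(** The derivative along v, as a function; Dv is its value at the origin. *)
Definition DD n (v : 'rV[C]_n) (Q : 'rV[C]_n -> C) (X : 'rV[C]_n) := dot v (fun j => pd j Q X).

Lemma an_DD n (v : 'rV[C]_n) Q : an Q -> an (DD v Q).
Proof.
by move=> aQ; apply: an_sum => j; apply: an_mul; [exact: an_const | exact: an_pd].
Qed.

Lemma pd_add n i (Q1 Q2 : 'rV[C]_n -> C) : an Q1 -> an Q2 -> \forall X \near (0 : 'rV[C]_n),
  pd i (fun t => Q1 t + Q2 t) X = pd i Q1 X + pd i Q2 X.
Proof.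
move=> a1 a2; apply: filterS2 (an_fderiv (an_add a1 a2)) (filterI (an_fderiv a1) (an_fderiv a2)).
move=> X d [d1 d2]; exact: cd_unique (cd_fderiv i d) (cd_add (cd_fderiv i d1) (cd_fderiv i d2)).
Qed.

Lemma an_scale n k (Q : 'rV[C]_n -> C) : an Q -> an (fun t => k * Q t).
Proof. by move=> aQ; apply: an_mul => //; exact: an_const. Qed.

Lemma pd_scale n i k (Q : 'rV[C]_n -> C) : an Q -> \forall X \near (0 : 'rV[C]_n),
  pd i (fun t => k * Q t) X = k * pd i Q X.
Proof.
move=> aQ; apply: filterS2 (an_fderiv (an_scale k aQ)) (an_fderiv aQ).
move=> X d d1; exact: cd_unique (cd_fderiv i d) (cd_scale k (cd_fderiv i d1)).
Qed.

Lemma pd_lincomb n i (I : Type) (s : seq I) (a : I -> C) (F : I -> 'rV[C]_n -> C) :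
  (forall j, an (F j)) -> \forall X \near (0 : 'rV[C]_n),
    pd i (fun t => \sum_(j <- s) a j * F j t) X = \sum_(j <- s) a j * pd i (F j) X.
Proof.
move=> aF; elim: s => [|j s IH].
  have -> : (fun t => \sum_(j <- [::]) a j * F j t) = (fun=> 0).
    by apply/funext => t; rewrite big_nil.
  apply: filterS (an_fderiv (an_const n 0)) => X d; rewrite big_nil.
  exact: cd_unique (cd_fderiv i d) (cd_const 0).
have e : (fun t => \sum_(k <- j :: s) a k * F k t)
    = (fun t => a j * F j t + \sum_(k <- s) a k * F k t).
  by apply/funext => t; rewrite big_cons.
have h := pd_add i (an_scale (a j) (aF j)) (an_sum s xpredT (fun k => an_scale (a k) (aF k))).
apply: filterS2 h (filterI (pd_scale i (a j) (aF j)) IH) => X h1 [h2 h3].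
by rewrite e h1 h2 h3 big_cons.
Qed.

Lemma dot_delta2 n (x y : C) b c (g : 'I_n -> C) :
  dot (x *: delta_mx 0 b + y *: delta_mx 0 c) g = x * g b + y * g c.
Proof. by rewrite dotDl 2!dotZ 2!dot_delta. Qed.

Lemma Dv_scale v k (Q : 'rV[C]_(3 + 3) -> C) : an Q -> Dv v (fun t => k * Q t) = k * Dv v Q.
Proof. by move=> aQ; rewrite Dv_mul ?Dv_const ?mul0r ?add0r //; exact: an_const. Qed.

End DirectionalCalculus.

Section FreemanJet.
Variable R : realType.
Local Notation C := (Cplx R).
Variables (U : set (C3 R)) (rho : C3 R -> R) (M : set (C3 R)).
Hypothesis hM : hypersurface U rho M.
Variable theta : C3 R -> cotvec R.
Hypothesis hth : contact_form rho M theta.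
Variable L : 'I_2 -> vfield R.
Hypothesis secL : forall p, M p -> forall j, section10 rho M p (L j).
Hypothesis basL : forall p, M p -> basis_of (T10 rho p) [:: L 0 p; L 1 p].
Hypothesis frameL : forall p, M p -> basis_of (CTM rho p)
        [:: L 0 p; L 1 p; vconj (L 0) p; vconj (L 1) p;
            lie_bracket (L 0) (vconj (L 0)) p].
Hypothesis rankL : forall p, M p -> \rank (levi_mx theta L p) = 1%N.
Variable p : C3 R.
Hypothesis Mp : M p.
Hypothesis frp : freeman_nondegenerate rho M theta p.
Variable P : 'rV[C]_(3 + 3) -> C.
Hypothesis gP : germ p (to_C rho) P.
Hypothesis hP : forall X, P (cswap X) = (P X)^*.

Local Notation Kf := (kernel_field rho L).
Local Notation lf := (levi_coef rho L).
Local Notation lsh j := (lshift 3 j).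
Local Notation rsh j := (rshift 3 j).

Lemma gy_ker_T10 q Q b : M q -> germ q (to_C rho) Q -> (forall X, Q (cswap X) = (Q X)^*) ->
  dot b (gy Q) = 0 -> row_mx (conjmx b) 0 \in T10 rho q.
Proof.
move=> Mq gQ hQ b0; rewrite in_T10 (CTM_Dv gQ) row_mxKr eqxx andbT (Dv_split Q).
rewrite row_mxKl row_mxKr dot0 addr0; apply/eqP.
have -> : dot (conjmx b) (gx Q) = (dot b (gy Q))^*.
  rewrite /dot rmorph_sum; apply: eq_bigr => j _.
  by rewrite rmorphM /= (gyE gQ hQ) conjCK [conjmx b _ _]mxE.
by rewrite b0 rmorph0.
Qed.

(** The vectors b are the conjugates of the (1,0) tangent vectors. *)
Lemma kernel_field_annihilates q Q b : M q -> germ q (to_C rho) Q -> (forall X, Q (cswap X) = (Q X)^*) ->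
  dot b (gy Q) = 0 -> cplx_hessian rho q (lsubmx (Kf q)) b = 0.
Proof.
move=> Mq gQ hQ b0.
have := kernel_field_kernel hM hth secL basL rankL Mq (gy_ker_T10 Mq gQ hQ b0).
by rewrite row_mxKl conjmxK.
Qed.

Let k := lsubmx (Kf p).
Let l := lsubmx (L 0 p).

(** The component along d/dzbar_b of the contraction of the complex Hessian with the
    kernel field. *)
Definition eta b q := \sum_j Kf q 0 (lsh j) * hess rho q (rsh b) (lsh j).

Lemma cplx_hessian_eta q b : cplx_hessian rho q (lsubmx (Kf q)) b = \sum_i b 0 i * eta i q.
Proof.
rewrite /cplx_hessian /eta; under [RHS]eq_bigr do rewrite mulr_sumr.
rewrite exchange_big; apply: eq_bigr => j _; rewrite mulr_sumr; apply: eq_bigr => i _.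
by rewrite mxE mulrCA.
Qed.

(** The contraction of the complex Hessian with the kernel field vanishes on the
    (0,1) tangent vectors at every point of the hypersurface, so that it is proportional
    to the (0,1) part of the differential. *)
Lemma eta_proportional q b c : M q ->
  gradient (to_C rho) q (rsh c) 0 * eta b q - gradient (to_C rho) q (rsh b) 0 * eta c q = 0.
Proof.
move=> Mq; have [Q [gQ hQ]] := hermitian_germ hM Mq.
rewrite (germ_gradient gQ) !mxE -/(gy Q c) -/(gy Q b).
pose v : C3 R := gy Q c *: delta_mx 0 b + (- gy Q b) *: delta_mx 0 c.
have v0 : dot v (gy Q) = 0.
  by rewrite /v dot_delta2 mulNr [X in X - _]mulrC subrr.
have := kernel_field_annihilates Mq gQ hQ v0; rewrite cplx_hessian_eta -/(dot v (fun i => eta i q)).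
by rewrite /v dot_delta2 mulNr.
Qed.

Variable PK : 'I_(3 + 3) -> 'rV[C]_(3 + 3) -> C.
Hypothesis gK : vgerm p Kf PK.

Definition Eta b X := \sum_j PK (lsh j) X * pd (rsh b) (pd (lsh j) P) X.

Lemma germ_eta b : germ p (eta b) (Eta b).
Proof.
by apply: germ_sum => j; apply: germ_mul (gK _) _; exact: (germ_pd _ (germ_pd _ gP)).
Qed.

Variable c : 'I_3.
Hypothesis gc : gy P c != 0.

(** The opposite of the factor of proportionality at p. *)
Definition kappa := - eta c p / gy P c.

Lemma eta_at b : eta b p = - kappa * gy P b.
Proof.
have := eta_proportional b c Mp; rewrite (germ_gradient gP) !mxE => /eqP.
rewrite subr_eq0 -/(gy P c) -/(gy P b) => /eqP e.
apply: (mulfI gc); rewrite e /kappa.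
by move: gc (eta c p) (gy P b); move: (gy P c) => g g0 x y; field.
Qed.

(** Differentiation of eta_proportional along the hypersurface. The terms with a factor
    eta a or gy a are contracted to zero. *)
Lemma eta_derivative v a : v \in CTM rho p -> dot a (gy P) = 0 ->
  dot a (fun b => Dv v (Eta b) + kappa * Dv v (pd (rsh b) P)) = 0.
Proof.
move=> vT a0; have aP := aP gP.
have aE b : an (Eta b) by case: (germ_eta b).
have alg (dpc dEb dpb dEc gb g kp : C) :
    0 = (dpc * (- kp * gb) + g * dEb) - (dpb * (- kp * g) + gb * dEc) ->
    g * (dEb + kp * dpb) = gb * (dEc + kp * dpc).
  by move=> e; apply/eqP; rewrite -subr_eq0 [X in _ == X]e; apply/eqP; ring.
have h b : gy P c * (Dv v (Eta b) + kappa * Dv v (pd (rsh b) P)) =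
    gy P b * (Dv v (Eta c) + kappa * Dv v (pd (rsh c) P)).
  have gg := germ_sub (germ_mul (germ_pd (rsh c) gP) (germ_eta b))
    (germ_mul (germ_pd (rsh b) gP) (germ_eta c)).
  have z : \forall q \near p, M q -> gradient (to_C rho) q (rsh c) 0 * eta b q -
      gradient (to_C rho) q (rsh b) 0 * eta c q = 0.
    by apply: near_all_at => q; exact: eta_proportional.
  have a1 := an_pd (rsh c) aP; have a2 := an_pd (rsh b) aP.
  (* products are differentiated by congruence: matching them up to conversion
     would unfold partial derivatives *)
  have := etrans (esym (tangent hM Mp gP hP gg z vT)) (etrans
    (Dv_sub v (an_mul a1 (aE b)) (an_mul a2 (aE c)))
    (congr2 (fun x y => x - y) (Dv_mul v a1 (aE b)) (Dv_mul v a2 (aE c)))).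
  have eE i : Eta i 0 = - kappa * gy P i by rewrite -(germ_at (germ_eta i)) eta_at.
  rewrite (eE b) (eE c) -/(gy P b) -/(gy P c).
  exact: alg.
apply: (mulfI gc); rewrite mulr0 /dot mulr_sumr.
under eq_bigr do rewrite mulrCA h mulrA.
by rewrite -mulr_suml -/(dot a (gy P)) a0 mul0r.
Qed.

(** The derivative of P along the kernel direction, corrected by a multiple of P so that
    its first derivatives in the conjugate variables vanish. *)
Definition Ef X := DD (row_mx k 0) P X + kappa * P X.

Lemma EfE : Ef = (fun X => \sum_j k 0 j * pd (lsh j) P X + kappa * P X).
Proof. by apply/funext => X; rewrite /Ef /DD dot_row0. Qed.

Lemma an_Ef : an Ef.
Proof.
have aP := aP gP.
by rewrite EfE; apply: an_add; [apply: an_sum => j; apply: an_scale; exact: an_pd | exact: an_scale].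
Qed.

Lemma pd_Ef i : \forall X \near (0 : 'rV[C]_(3 + 3)),
  pd i Ef X = \sum_j k 0 j * pd i (pd (lsh j) P) X + kappa * pd i P X.
Proof.
have aP := aP gP; have aj j : an (fun X => k 0 j * pd (lsh j) P X) by apply: an_scale; exact: an_pd.
have h1 := pd_add i (an_sum (index_enum 'I_3) xpredT aj) (an_scale kappa aP).
have h2 := pd_lincomb i (index_enum 'I_3) (fun j => k 0 j) (fun j => an_pd (lsh j) aP).
have h4 := pd_scale i kappa aP.
by apply: filterS2 (filterI h1 h2) h4 => X [e1 e2] e4; rewrite EfE e1 e2 e4.
Qed.

(** The second derivatives of Ef in the conjugate variables are third derivatives of the
    defining function; eta_derivative expresses them by the derivatives of the kernel
    field, that is by the Freeman form. *)
Lemma Ef_second v a : v \in CTM rho p -> dot a (gy P) = 0 ->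
  Dv v (DD (row_mx 0 a) Ef) = - cplx_hessian rho p (\row_j Dv v (PK (lsh j))) a.
Proof.
move=> vT a0; have aP := aP gP; have aPK j : an (PK j) by case: (gK j).
have -> : DD (row_mx 0 a) Ef = (fun X => \sum_b a 0 b * pd (rsh b) Ef X).
  by apply/funext => X; rewrite /DD dot_0row.
rewrite Dv_sum => [|b]; last by apply: an_scale; apply: an_pd; exact: an_Ef.
have e b : Dv v (pd (rsh b) Ef) = \sum_j k 0 j * Dv v (pd (rsh b) (pd (lsh j) P))
     + kappa * Dv v (pd (rsh b) P).
  rewrite (Dv_near v (an_pd _ an_Ef) (pd_Ef (rsh b))).
  have a1 j : an (fun X => k 0 j * pd (rsh b) (pd (lsh j) P) X).
    by apply: an_scale; apply: an_pd; exact: an_pd.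
  rewrite Dv_add; [|exact: an_sum|by apply: an_scale; exact: an_pd].
  rewrite Dv_scale; last exact: an_pd.
  by rewrite Dv_sum //; congr (_ + _); apply: eq_bigr => j _; rewrite Dv_scale //; do 2 apply: an_pd.
have e2 b : Dv v (Eta b) = \sum_j Dv v (PK (lsh j)) * pd (rsh b) (pd (lsh j) P) 0
    + \sum_j k 0 j * Dv v (pd (rsh b) (pd (lsh j) P)).
  rewrite /Eta Dv_sum => [|j]; last by apply: an_mul => //; do 2 apply: an_pd.
  rewrite -big_split; apply: eq_bigr => j _; rewrite Dv_mul //; last by do 2 apply: an_pd.
  congr (_ + _ * _); rewrite -(germ_at (gK (lsh j))) /k; by rewrite [RHS]mxE.
have := eta_derivative vT a0 => h; apply/eqP; rewrite -subr_eq0 -[X in _ == X]h; apply/eqP.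
rewrite opprK /cplx_hessian.
have -> : \sum_j (\row_j0 Dv v (PK (lsh j0))) 0 j * \sum_k0 a 0 k0 * hess rho p (rsh k0) (lsh j)
   = \sum_b a 0 b * \sum_j Dv v (PK (lsh j)) * pd (rsh b) (pd (lsh j) P) 0.
  under [RHS]eq_bigr do rewrite mulr_sumr.
  rewrite exchange_big; apply: eq_bigr => j _; rewrite mulr_sumr; apply: eq_bigr => b _.
  by rewrite mxE (hessE gP) mulrCA.
rewrite /dot -big_split; apply: eq_bigr => b _ /=; rewrite Dv_scale; last by apply: an_pd; exact: an_Ef.
by rewrite e e2 -mulrDr; congr (_ * _); rewrite addrC addrA.
Qed.

Lemma Ef_first b : Dv (row_mx 0 b) Ef = 0.
Proof.
rewrite /Dv dot_0row; apply: big1 => i _.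
rewrite (near_at (pd_Ef (rsh i))) (_ : \sum_j _ = eta i p).
  by rewrite eta_at mulNr addNr mulr0.
by apply: eq_bigr => j _; rewrite (hessE gP) /k [in LHS]mxE.
Qed.

Lemma ker_CTM b : dot b (gy P) = 0 -> row_mx 0 b \in CTM rho p.
Proof.
by move=> b0; rewrite (CTM_Dv gP) (Dv_split P) row_mxKl row_mxKr dot0 add0r b0.
Qed.

(** Differentiate K rho = 0 along a (0,1) vector, which annihilates the contraction of the
    Hessian with K. *)
Lemma kernel_field_derivative_ker v : dot v (gy P) = 0 ->
  dot (\row_j Dv (row_mx 0 v) (PK (lsh j))) (gx P) = 0.
Proof.
move=> v0; have KT : \forall q \near p, M q -> Kf q \in T10 rho q.
  by apply: near_all_at => q; exact: kernel_field_T10.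
have := partial_derivative hM Mp gP hP gK (ker_CTM v0) KT.
rewrite big_split /= => e; have e2 : \sum_j Kf p 0 (lsh j) * Dv (row_mx 0 v) (pd (lsh j) P) = 0.
  rewrite -[RHS](kernel_field_annihilates Mp gP hP v0) /cplx_hessian; apply: eq_bigr => j _.
  rewrite [in RHS]mxE; congr (_ * _); rewrite /Dv dot_0row; apply: eq_bigr => i _.
  by rewrite (hessE gP).
by rewrite e2 addr0 in e; rewrite -[RHS]e; apply: eq_bigr => j _; rewrite mxE.
Qed.

(** By Ef_second and hermitian symmetry this is the conjugate of a value, at a (0,1) tangent
    vector, of the contraction of the Hessian with the kernel vector. *)
Lemma Ef_degenerate b : dot b (gy P) = 0 -> Dv (row_mx 0 b) (DD (row_mx 0 (conjmx k)) Ef) = 0.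
Proof.
move=> b0; have k0 : dot (conjmx k) (gy P) = 0.
  have := kernel_field_T10 secL Mp; rewrite in_T10 (CTM_Dv gP) (Dv_split P) => /andP[/eqP h /eqP r0].
  rewrite r0 dot0 addr0 in h; rewrite -[RHS](rmorph0 Num.conj_op) -[in RHS]h /dot rmorph_sum.
  by apply: eq_bigr => j _; rewrite rmorphM /= (gyE gP hP) [conjmx k _ _]mxE.
rewrite (Ef_second (ker_CTM b0) k0); set w := \row_j _.
have w0 : dot (conjmx w) (gy P) = 0.
  rewrite -[RHS](rmorph0 Num.conj_op) -[in RHS](kernel_field_derivative_ker b0) /dot rmorph_sum.
  by apply: eq_bigr => j _; rewrite rmorphM /= (gyE gP hP) [conjmx w _ _]mxE.
have := cplx_hessian_conj hM k (conjmx w) Mp; rewrite conjmxK => <-.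
by rewrite (kernel_field_annihilates Mp gP hP w0) rmorph0 oppr0.
Qed.

Lemma kernel_field_neq0 : Kf p != 0.
Proof.
have l0 := levi_coef00_neq0 hM hth secL frameL Mp.
apply/negP => /eqP; rewrite /kernel_field => /eqP; rewrite subr_eq0 => /eqP e.
have := basis_free (basL Mp); rewrite free_cons seq1_free span_seq1 => /andP[n1 n2].
have e1 : L 1 p = (lf 0 0 p)^-1 * lf 1 0 p *: L 0 p by rewrite -scalerA -e scalerA mulVf ?scale1r.
have [z|z] := eqVneq ((lf 0 0 p)^-1 * lf 1 0 p) 0.
  by move: n2; rewrite e1 z scale0r eqxx.
case/negP: n1; rewrite e1; apply/vlineP; exists ((lf 0 0 p)^-1 * lf 1 0 p)^-1.
by rewrite scalerA mulVf ?scale1r.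
Qed.

Lemma L0_not_kernel : ~ levi_kernel rho M theta p (L 0 p).
Proof.
case=> _ /(_ _ _ (secL Mp 0) (secL Mp 0) erefl).
have [mu [mu0 h]] := levi_formula hM hth Mp; rewrite h; try exact: secL.
move/eqP; rewrite mulf_eq0 (negPf mu0) /= => e.
by have := levi_coef00_neq0 hM hth secL frameL Mp; rewrite /levi_coef e.
Qed.

Lemma l_ker : dot (conjmx l) (gy P) = 0.
Proof.
have := section10_at Mp (secL Mp 0).
rewrite in_T10 (CTM_Dv gP) (Dv_split P) => /andP[/eqP h /eqP r0].
rewrite r0 dot0 addr0 in h; rewrite -[RHS](rmorph0 Num.conj_op) -[in RHS]h /dot rmorph_sum.
by apply: eq_bigr => j _; rewrite rmorphM /= (gyE gP hP) [conjmx l _ _]mxE.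
Qed.

Lemma tconj_L0 : tconj (L 0 p) = row_mx 0 (conjmx l).
Proof.
have := section10_at Mp (secL Mp 0); rewrite in_T10 => /andP[_ /eqP r0].
by rewrite /tconj r0 conjmx0.
Qed.

(** The value is the Levi form of [K, conj L] against L. If it vanished, the (1,0) part of
    the bracket would be in the kernel of the Levi form, against the nondegeneracy of the
    Freeman form. *)
Lemma Ef_nondegenerate :
  Dv (row_mx 0 (conjmx l)) (DD (row_mx 0 (conjmx l)) Ef) != 0.
Proof.
have sK := kernel_field_section hM secL Mp.
have [W1 W2 W3] := bracket10 hM Mp gP hP sK (secL Mp 0) gK.
set W := lie_bracket _ _ _ in W1 W2 W3.
rewrite (Ef_second (ker_CTM l_ker) l_ker); set w := \row_j _.
have wW : w = - lsubmx W.
  by apply/rowP => j; rewrite [RHS]mxE W1 opprK mxE tconj_L0.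
have -> : - cplx_hessian rho p w (conjmx l) = cplx_hessian rho p (lsubmx W) (conjmx l).
  by rewrite wW -[- lsubmx W]scaleN1r cplx_hessianZl mulN1r opprK.
apply/negP => /eqP H0.
have l0 := levi_coef00_neq0 hM hth secL frameL Mp.
have g0 : dot (lsubmx W) (gx P) = 0.
  by rewrite W2 (kernel_field_kernel hM hth secL basL rankL Mp) //; exact: section10_at (secL Mp 0).
have aT : row_mx (lsubmx W) 0 \in T10 rho p.
  by rewrite in_T10 (CTM_Dv gP) (Dv_split P) row_mxKl row_mxKr g0 dot0 addr0 !eqxx.
have bT : row_mx 0 (rsubmx W) \in T01 rho p.
  rewrite in_T01 (CTM_Dv gP) (Dv_split P) row_mxKl row_mxKr dot0 add0r eqxx andbT.
  by move: W3; rewrite (CTM_Dv gP) (Dv_split P) g0 add0r.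
apply: (frp (kernel_field_sectionK hM hth secL basL rankL Mp) (secL Mp 0) kernel_field_neq0 L0_not_kernel).
exists (row_mx (lsubmx W) 0), (row_mx 0 (rsubmx W)); split; [|exact: bT|]; last first.
  by rewrite add_row_mx addr0 add0r; apply/esym; exact: hsubmxK.
split; first exact: aT.
move=> X Y hX hY Xa; have [mu [_ h]] := levi_formula hM hth Mp.
rewrite h // Xa row_mxKl.
have [a [b e]] := T10_span basL Mp aT.
have [d [f ->]] := T10_span basL Mp (section10_at Mp hY).
have eW : lsubmx W = a *: lsubmx (L 0 p) + b *: lsubmx (L 1 p).
  by rewrite -lsub_comb -e row_mxKl.
have z0 : a * lf 0 0 p + b * lf 1 0 p = 0.
  by rewrite -[RHS]H0 eW cplx_hessianDl !cplx_hessianZl.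
have z1 : a * lf 0 1 p + b * lf 1 1 p = 0.
  apply: (mulfI l0); rewrite mulr0 mulrDr [X in _ + X]mulrCA (levi_coef_det hM hth secL rankL Mp).
  have := congr1 (fun x => lf 0 1 p * x) z0; rewrite mulr0 => e2; rewrite -[RHS]e2.
  by move: (lf 0 0 p) (lf 1 0 p) (lf 0 1 p) => x y z; ring.
rewrite lsub_comb conj_comb cplx_hessianDr !cplx_hessianZr eW !cplx_hessianDl !cplx_hessianZl -!/(levi_coef _ _ _ _ p) z0 z1.
by rewrite !mulr0 addr0 mulr0.
Qed.

End FreemanJet.

(** * Normal coordinates of an adapted germ *)

Section AdaptedGerm.
Variable R : realType.
Local Notation C := (Cplx R).
Local Notation last n := (rshift n (ord0 : 'I_1)).
Local Notation lz j := (lshift (2 + 1) (lshift 1 j)).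
Local Notation lw := (lshift (2 + 1) (last 2)).
Local Notation rz j := (rshift (2 + 1) (lshift 1 j)).
Local Notation rw := (rshift (2 + 1) (last 2)).
Local Notation i0 := (0 : 'I_2).
Local Notation i1 := (1 : 'I_2).

(** All the steps for a germ P in adapted linear coordinates: transversal curve, Segre
    coordinate, graph, straightening of z_1, remainders. *)
Lemma normal_coordinates (P : 'rV[C]_((2 + 1) + (2 + 1)) -> C) (kappa : C)
    (e := fun X => pd (lz i1) P X + kappa * P X) :
  an P -> (\forall X \near (0 : 'rV[C]_((2 + 1) + (2 + 1))), P (cswap X) = (P X)^*) ->
  P 0 = 0 -> (forall j, pd (lz j) P 0 = 0) -> pd lw P 0 = 'i / 2 ->
  (forall j, pd (rz j) P 0 = 0) -> pd rw P 0 = - ('i / 2) ->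
  (forall a, pd (rz a) (pd (lz i0) P) 0 = (a == i0)%:R) ->
  (forall i, pd (rshift (2 + 1) i) e 0 = 0) ->
  (forall a b : 'I_2, pd (rz b) (pd (rz a) e) 0 = ((a == i0) && (b == i0))%:R) ->
  exists (w : 'rV[C]_(2 + 1) -> C) (g : 'rV[C]_2 -> C) (R1 : power_series R (2 + 2))
      (R2 Q : power_series R (2 + 2 + 1)),
  [/\ [/\ an w, w 0 = 0 & forall (a : 'rV[C]_2) b, cd (fun tau => w (tau *: app1 a b)) b],
      [/\ an g, g 0 = 0 & forall a : 'rV[C]_2, cd (fun tau => g (tau *: a)) (a 0 i0)],
      [/\ bigO_order 4 R1, bigO_order 2 Q /\ R2 = ps_mulvar (rshift (2 + 2) ord0) Q &
          remainder_normalized R1 /\ remainder_normalized R2],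
      \forall x \near (0 : 'rV[C]_(2 + 1)),
        normal_rhs R1 R2 (lsubmx x) ('Re (x 0 (last 2))) \is Num.real &
      \forall q \near (0 : 'rV[C]_(2 + 1)), P (row_mx q (conjmx q)) = 0 <->
        'Im (w q) = normal_rhs R1 R2 (mk2 (g (lsubmx q)) (lsubmx q 0 i1)) ('Re (w q))].
Proof.
move=> aP hP P0 pz pw qz qw hl he1 he2.
have [gam [ag g0 dg Pg]] := straight_curve aP hP P0 pz pw qz qw.
have [w [aw w0 dw hw _]] := segre_function aP P0 pz pw qz qw ag g0 dg.
have [W [aW W0 dW hW [rW [rW0 uW]]]] := segre_parametrization aP P0 pz pw qz qw ag g0 dg.
have [phi [ap eqM herm norm hphi]] :=
  graphing_function aP hP P0 pz pw qz qw ag g0 Pg aw w0 hw aW W0 dW hW rW0 uW.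
have phi0 : \forall t \near (0 : 'rV[C]_(2 + 2 + 1)), phi (pt3 0 (ze t) (uu t)) = 0.
  by apply: filterS norm => t [].
have jet0 := phi1_jet aP pz pw qw aW W0 dW ap phi0 hphi hl.
have jet1 := phi2_jet aP hP P0 pz pw qw g0 aW W0 dW hW ap phi0 hphi he1 he2.
have [psi [aps hps nps [j0 j1] [r [r0 hr]]]] := straightened_graph ap herm norm jet0 jet1.
have [R1 [R2 [Q [b1 b2 b3 [s [s0 hs]]]]]] := normal_form aps hps nps j0 j1.
pose g := cbar (phij phi i0).
have ag1 : an g by exact: an_f1.
have g10 : g 0 = 0 by exact: f1_0.
exists w, g, R1, R2, Q; split=> //.
- split=> // a; have := cd_comp (fderiv_f1 jet0) (scale0r a) (vcd_scale a).
  by rewrite dot2 eqxx mulr1 mulr0 addr0.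
- have [h [h0 hh]] := (near0P _).1 hps.
  have m0 : 0 < Order.min s h by rewrite lt_min s0.
  apply: filterS (near_small (2 + 1) m0) => x sx.
  have sz : small (Order.min s h) (lsubmx x) by exact: small_lsub.
  have su : nm ('Re (x 0 (last 2))) <= Order.min s h.
    by apply: le_trans (nm_ReC _) (sx _).
  rewrite -hs; last 2 first.
  - by apply: small_le sz; rewrite ge_min lexx.
  - by apply: le_trans su _; rewrite ge_min lexx.
  rewrite CrealE -hh; last first.
    have sz2 : small h (lsubmx x) by apply: small_le sz; rewrite ge_min lexx orbT.
    apply: small_pt => //; first exact: conjmx_small.
    by apply: le_trans su _; rewrite ge_min lexx orbT.
  rewrite hswap_pt conjmxK (_ : ('Re (x 0 (last 2)))^* = 'Re (x 0 (last 2))) //.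
  by apply: conj_Creal; exact: Creal_Re.
- have m0 : 0 < Order.min r s by rewrite lt_min r0.
  have hg : \forall z \near (0 : 'rV[C]_2), nm (g z - g 0) <= s by exact: an_continuous.
  have hg2 : \forall q \near (0 : 'rV[C]_(2 + 1)), nm (g (lsubmx q) - g 0) <= s.
    have := near_compose (P := fun z => nm (g z - g 0) <= s)
      (van_lsub (van_id R (n := 2 + 1))) (linear0 _) hg; exact.
  have hw2 : \forall q \near (0 : 'rV[C]_(2 + 1)), nm (w q - w 0) <= Order.min r s.
    exact: an_continuous.
  apply: filterS2 (filterI eqM hg2) (filterI hw2 (near_small (2 + 1) m0)).
  move=> q [e1 e2] [e3 sq]; rewrite e1.
  have sz : small (Order.min r s) (lsubmx q) by exact: small_lsub.
  have su : nm ('Re (w q)) <= Order.min r s.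
    by apply: le_trans (nm_ReC _) _; move: e3; rewrite w0 subr0.
  rewrite hr; last 2 first.
  - by apply: small_le sz; rewrite ge_min lexx.
  - by apply: le_trans su _; rewrite ge_min lexx.
  rewrite hs // /f1v -/g; last by apply: le_trans su _; rewrite ge_min lexx orbT.
  apply: small_mk2; first by move: e2; rewrite g10 subr0.
  by apply: (small_le _ sz); rewrite ge_min lexx orbT.
Qed.

End AdaptedGerm.

(** * Adapted linear coordinates *)

Section LinearChange.
Variable R : realType.
Local Notation C := (Cplx R).
Variables (n : nat) (A : 'M[C]_n).

(** The linear change x |-> x A, complexified. *)
Definition lin2 (X : 'rV[C]_(n + n)) : 'rV[C]_(n + n) :=
  row_mx (lsubmx X *m A) (rsubmx X *m conjmx A).

Lemma conjmxM m p q (B : 'M[C]_(m, p)) (D : 'M[C]_(p, q)) :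
  conjmx (B *m D) = conjmx B *m conjmx D.
Proof. exact: map_mxM. Qed.

Lemma lin2_rv q : lin2 (rv q) = rv (q *m A).
Proof. by rewrite /lin2 /rv row_mxKl row_mxKr conjmxM. Qed.

Lemma lin2_cswap X : lin2 (cswap X) = cswap (lin2 X).
Proof. by rewrite /lin2 /cswap !row_mxKl !row_mxKr !conjmxM conjmxK. Qed.

Lemma lin2_0 : lin2 0 = 0.
Proof. by rewrite /lin2 !linear0 !mul0mx row_mx0. Qed.

Lemma lin2_line X Y tau : lin2 (X + tau *: Y) = lin2 X + tau *: lin2 Y.
Proof.
by rewrite /lin2 scale_row_mx add_row_mx !linearD !linearZ /= !mulmxDl !scalemxAl.
Qed.

Lemma van_mulmx m p q (f : 'rV[C]_m -> 'rV[C]_p) (B : 'M[C]_(p, q)) :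
  van f -> van (fun t => f t *m B).
Proof.
move=> hf i; apply: (an_ext (f := fun t => \sum_j f t 0 j * B j i)) => [t|].
  by rewrite mxE.
by apply: an_sum => j; apply: an_mul => //; exact: an_const.
Qed.

Lemma van_lin2 : van lin2.
Proof.
by apply: van_row; apply: van_mulmx; [apply: van_lsub | apply: van_rsub]; exact: van_id.
Qed.

Lemma lin2_delta_l i : lin2 (delta_mx 0 (lshift n i)) = row_mx (row i A) 0.
Proof. by rewrite /lin2 delta_mx_lshift row_mxKl row_mxKr mul0mx rowE. Qed.

Lemma lin2_delta_r i : lin2 (delta_mx 0 (rshift n i)) = row_mx 0 (conjmx (row i A)).
Proof.
rewrite /lin2 delta_mx_rshift row_mxKl row_mxKr mul0mx -rowE; congr row_mx.
by apply/rowP => j; rewrite !mxE.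
Qed.

(** Chain rule for the linear change of variables. *)
Lemma pd_lin2 i c (F Q : 'rV[C]_(n + n) -> C) : an Q ->
  (\forall X \near (0 : 'rV[C]_(n + n)), F X = c * Q (lin2 X)) ->
  \forall X \near (0 : 'rV[C]_(n + n)), pd i F X = c * DD (lin2 (delta_mx 0 i)) Q (lin2 X).
Proof.
move=> aQ e; have aF : an F.
  apply: (an_eq (f := fun X => c * Q (lin2 X))); first by apply: filterS e => X ->.
  by apply: an_scale; exact: an_compose aQ van_lin2 lin2_0.
have h : \forall X \near (0 : 'rV[C]_(n + n)), fderiv Q (lin2 X) (fun j => pd j Q (lin2 X)).
  by have := near_compose (P := fun t => fderiv Q t (fun j => pd j Q t)) van_lin2 lin2_0
    (an_fderiv aQ).
apply: filterS2 (near_near e) (filterI h (an_fderiv aF)) => X eX [d1 d2].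
apply: cd_unique (cd_fderiv i d2) _.
have d3 := cd_comp d1 (_ : lin2 X + 0 *: lin2 (delta_mx 0 i) = lin2 X)
  (vcd_lin (lin2 X) (lin2 (delta_mx 0 i))).
rewrite scale0r addr0 in d3; have {}d3 := cd_scale c (d3 erefl).
apply: cd_eq d3; have [r [r0 hr]] := (nearP _ _).1 eX; exists r => // tau ht.
rewrite hr ?lin2_line // => j; rewrite mxE nmM [delta_mx _ _ _ _]mxE nmn.
by case: (_ && _); rewrite ?mulr1 ?mulr0 // ltW.
Qed.

Lemma DDZ m k v (Q : 'rV[C]_m -> C) X : DD (k *: v) Q X = k * DD v Q X.
Proof. exact: dotZ. Qed.

Lemma DD_comm m u v (Q : 'rV[C]_m -> C) : an Q -> DD u (DD v Q) 0 = DD v (DD u Q) 0.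
Proof.
move=> aQ; have e a i : pd i (DD a Q) 0 = \sum_j a 0 j * pd i (pd j Q) 0.
  exact: (near_at (pd_lincomb i _ (fun j => a 0 j) (fun j => an_pd j aQ))).
rewrite /(DD u) /(DD v) /dot -/(DD v Q) -/(DD u Q).
under eq_bigr do rewrite e mulr_sumr.
under [RHS]eq_bigr do rewrite e mulr_sumr.
rewrite exchange_big; apply: eq_bigr => j _; apply: eq_bigr => i _.
by rewrite mulrCA (pd_comm _ _ aQ).
Qed.

End LinearChange.

Section AdaptedCoordinates.
Variable R : realType.
Local Notation C := (Cplx R).
Local Notation last n := (rshift n (ord0 : 'I_1)).
Local Notation lz j := (lshift (2 + 1) (lshift 1 j)).
Local Notation lw := (lshift (2 + 1) (last 2)).
Local Notation rz j := (rshift (2 + 1) (lshift 1 j)).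
Local Notation rw := (rshift (2 + 1) (last 2)).
Local Notation i0 := (0 : 'I_2).
Local Notation i1 := (1 : 'I_2).
Variables (U : set (C3 R)) (rho : C3 R -> R) (M : set (C3 R)).
Hypothesis hM : hypersurface U rho M.
Variable theta : C3 R -> cotvec R.
Hypothesis hth : contact_form rho M theta.
Hypothesis hIV2 : class_IV2 rho M theta.

(** The hypotheses on the class of the hypersurface, reduced to conditions on the 3-jet of
    a complexified defining function. *)
Lemma freeman_jet p P : M p -> germ p (to_C rho) P -> (forall X, P (cswap X) = (P X)^*) ->
  exists (l k : C3 R) (kap : C) (E := fun X => DD (row_mx k 0) P X + kap * P X),
  [/\ an E, dot l (gx P) = 0 /\ dot k (gx P) = 0, k != 0,
      cplx_hessian rho p l (conjmx l) != 0 /\ (forall b, dot b (gy P) = 0 -> cplx_hessian rho p k b = 0) &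
      [/\ forall b, Dv (row_mx 0 b) E = 0,
          forall b, dot b (gy P) = 0 -> Dv (row_mx 0 b) (DD (row_mx 0 (conjmx k)) E) = 0 &
          Dv (row_mx 0 (conjmx l)) (DD (row_mx 0 (conjmx l)) E) != 0]].
Proof.
move=> Mp gP hP; have [L hL] := hIV2.
have secL q : M q -> forall j, section10 rho M q (L j) by move=> /hL [[h _] _ _ _].
have basL q : M q -> basis_of (T10 rho q) [:: L 0 q; L 1 q] by move=> /hL [[_ h] _ _ _].
have frameL q : M q -> basis_of (CTM rho q)
    [:: L 0 q; L 1 q; vconj (L 0) q; vconj (L 1) q; lie_bracket (L 0) (vconj (L 0)) q].
  by move=> /hL [].
have rankL q : M q -> \rank (levi_mx theta L q) = 1%N by move=> /hL [].
have frp : freeman_nondegenerate rho M theta p by case: (hL p Mp).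
have [c xc] := gx_neq0 hM Mp gP hP.
have gc : gy P c != 0 by rewrite (gyE gP hP) conjC_eq0.
have [PK gK] := vgermP (kernel_field_section hM secL Mp).1.
have KT := kernel_field_T10 secL Mp; have LT := section10_at Mp (secL p Mp 0).
have tan0 v : v \in T10 rho p -> dot (lsubmx v) (gx P) = 0.
  by rewrite in_T10 (CTM_Dv gP) (Dv_split P) => /andP[/eqP h /eqP e]; rewrite e dot0 addr0 in h.
exists (lsubmx (L 0 p)), (lsubmx (kernel_field rho L p)), (kappa rho L p P c).
split.
- exact: (an_Ef L gP c).
- by split; exact: tan0.
- apply: contra (kernel_field_neq0 hM hth secL basL frameL Mp) => /eqP h.
  by move: KT; rewrite in_T10 => /andP[_ /eqP h2]; rewrite -(hsubmxK (kernel_field _ _ _)) h h2 row_mx0.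
- split; first exact: (levi_coef00_neq0 hM hth secL frameL Mp).
  by move=> b; exact: (kernel_field_annihilates hM hth secL basL rankL Mp gP hP).
split.
- exact: (Ef_first hM hth secL basL rankL Mp gP gc).
- exact: (Ef_degenerate hM hth secL basL rankL Mp gP hP gK gc).
- exact: (Ef_nondegenerate hM hth secL basL frameL rankL Mp frp gP hP gK gc).
Qed.

Definition frame_rows (l k e : C3 R) (i : 'I_(2 + 1)) : C3 R :=
  match fintype.split i with inl j => if j == i0 then l else k | inr _ => e end.

Lemma frame_rowsE l k e : [/\ frame_rows l k e (lshift 1 i0) = l,
  frame_rows l k e (lshift 1 i1) = k & frame_rows l k e (last 2) = e].
Proof.
by rewrite /frame_rows !(unsplitK (inl _)) (unsplitK (inr _)).
Qed.

(** Take a vector l of the frame, the kernel vector k and a transversal vector as the new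
    basis. The defining function is divided by the value of the Levi form at l, which is
    real; the kernel vector and the transversal vector are then scaled to make the
    remaining coefficients equal to 1 and to i/2. *)
Lemma adapted_germ : M 0 -> exists (A : 'M[C]_(2 + 1)) (P : 'rV[C]_((2 + 1) + (2 + 1)) -> C) (kap : C)
    (e := fun X => pd (lz i1) P X + kap * P X),
  [/\ A \in unitmx, \forall q \near (0 : 'rV[C]_(2 + 1)), rho (q *m A) = 0 <-> P (rv q) = 0,
      an P /\ P 0 = 0 /\ forall X, P (cswap X) = (P X)^*,
      [/\ forall j, pd (lz j) P 0 = 0, pd lw P 0 = 'i / 2,
          forall j, pd (rz j) P 0 = 0 & pd rw P 0 = - ('i / 2)] &
      [/\ forall a, pd (rz a) (pd (lz i0) P) 0 = (a == i0)%:R,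
          forall i, pd (rshift (2 + 1) i) e 0 = 0 &
          forall a b : 'I_2, pd (rz b) (pd (rz a) e) 0 = ((a == i0) && (b == i0))%:R]].
Proof.
move=> M0; have [P [gP hP]] := hermitian_germ hM M0.
have [l [k [kap /= [aE [l0 k0] kn [ll kk] [E1 E2 E3]]]]] := freeman_jet M0 gP hP.
set E := fun X => _ in aE E1 E2 E3.
have aP : an P by case: gP.
have [c xc] := gx_neq0 hM M0 gP hP.
pose h := cplx_hessian rho 0 l (conjmx l); pose mu := h^-1.
have hR : h^* = h by rewrite /h (cplx_hessian_conj hM _ _ M0) conjmxK.
have muR : mu^* = mu by rewrite /mu fmorphV /= hR.
have mu0 : mu != 0 by rewrite invr_eq0.
set f := Dv _ _ in E3; pose beta := h / f.
have be0 : beta != 0 by rewrite mulf_neq0 // invr_eq0.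
(* gam and beta normalize the derivative in w and the third-order coefficient *)
pose gam := 'i / 2 / (mu * gx P c); pose ev : C3 R := gam *: delta_mx 0 c.
have [r0 r1 r2] := frame_rowsE l (beta *: k) ev.
pose A : 'M[C]_(2 + 1) := \matrix_i frame_rows l (beta *: k) ev i.
have rA i : row i A = frame_rows l (beta *: k) ev i by exact: rowK.
have evx : mu * dot ev (gx P) = 'i / 2.
  by rewrite dotZ dot_delta /gam mulrCA divfK // mulf_neq0.
have conj_dot v : dot (conjmx v) (gy P) = (dot v (gx P))^*.
  rewrite /dot rmorph_sum; apply: eq_bigr => j _.
  by rewrite rmorphM /= (gyE gP hP) [conjmx v _ _]mxE.
have lbar : dot (conjmx l) (gy P) = 0 by rewrite conj_dot l0 rmorph0.
have kbar : dot (conjmx k) (gy P) = 0 by rewrite conj_dot k0 rmorph0.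
have klH : cplx_hessian rho 0 k (conjmx l) = 0 by exact: kk.
pose P' X := mu * P (lin2 A X).
pose kap' := beta * kap.
have D1 i : \forall X \near (0 : 'rV[C]_(3 + 3)),
    pd i P' X = mu * DD (lin2 A (delta_mx 0 i)) P (lin2 A X).
  by apply: pd_lin2 => //; exact: near_all.
have pl i : pd (lshift 3 i) P' 0 = mu * dot (row i A) (gx P).
  by rewrite (near_at (D1 (lshift 3 i))) lin2_0 lin2_delta_l /DD dot_row0.
have pr i : pd (rshift 3 i) P' 0 = mu * (dot (row i A) (gx P))^*.
  by rewrite (near_at (D1 (rshift 3 i))) lin2_0 lin2_delta_r /DD dot_0row -conj_dot.
have two2 (j : 'I_2) : j = i0 \/ j = i1.
  by case: j => -[|[|//]] hj; [left | right]; exact/val_inj.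
exists A, P', kap'; split.
- rewrite -row_free_unit; apply: inj_row_free => v vA.
  have eA : v *m A = v 0 (lshift 1 i0) *: l + (v 0 (lshift 1 i1) * beta) *: k + v 0 (last 2) *: ev.
    rewrite mulmx_sum_row big_split_ord big_ord1 big_ord_recl big_ord1 /=.
    rewrite (_ : lift ord0 ord0 = i1); last exact/val_inj.
    by rewrite !rA r0 r1 r2 scalerA.
  rewrite eA in vA.
  have v2 : v 0 (last 2) = 0.
    have := congr1 (fun x => mu * dot x (gx P)) vA; rewrite !dotDl !dotZ l0 k0 dot0 !mulr0 !add0r.
    rewrite mulrCA -dotZ evx => /eqP; rewrite mulf_eq0 mulf_eq0 invr_eq0 (negPf (@neq0Ci _)).
    by rewrite pnatr_eq0 !orbF => /eqP.
  rewrite v2 scale0r addr0 in vA.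
  have v0 : v 0 (lshift 1 i0) = 0.
    have := congr1 (fun x => cplx_hessian rho 0 x (conjmx l)) vA; rewrite cplx_hessianDl !cplx_hessianZl klH mulr0 addr0.
    rewrite (_ : cplx_hessian rho 0 0 _ = 0); last by rewrite -(scale0r (0 : C3 R)) cplx_hessianZl mul0r.
    by move/eqP; rewrite mulf_eq0 (negPf ll) orbF => /eqP.
  rewrite v0 scale0r add0r in vA; move/eqP: vA; rewrite scaler_eq0 (negPf kn) orbF.
  rewrite mulf_eq0 (negPf be0) orbF => /eqP v1.
  apply/rowP => i; rewrite [RHS]mxE -(splitK i); case: (fintype.split i) => j /=.
    by case: (two2 j) => ->.
  by rewrite (ord1 j).
- have n1 := near_compose (van_mulmx A (van_id R (n := 3))) (mul0mx _ _) gP.2.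
  apply: filterS n1 => q; rewrite add0r => e; rewrite /P' lin2_rv -e /to_C.
  split=> [->|/eqP]; first by rewrite rmorph0 mulr0.
  rewrite mulf_eq0 (negPf mu0) => /eqP e0; apply: (@complexI R).
  by rewrite rmorph0; exact: e0.
- split; first by apply: an_scale; exact: an_compose aP (van_lin2 A) (lin2_0 A).
  split=> [|X]; first by rewrite /P' lin2_0 (P00 hM M0 gP) mulr0.
  by rewrite /P' lin2_cswap hP rmorphM /= muR.
- split.
  + move=> j; rewrite pl rA; case: (two2 j) => ->; rewrite ?r0 ?r1 ?dotZ ?l0 ?k0 ?mulr0 //.
  + by rewrite pl rA r2.
  + move=> j; rewrite pr rA; case: (two2 j) => ->; rewrite ?r0 ?r1 ?dotZ ?l0 ?k0 ?mulr0 rmorph0 mulr0 //.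
  + by rewrite pr rA r2 -{1}muR -rmorphM evx rmorphM /= conjCi fmorphV /= rmorph_nat mulNr.
have D1l : \forall X \near (0 : 'rV[C]_(3 + 3)),
    pd (lz i0) P' X = mu * DD (row_mx l 0) P (lin2 A X).
  by have := D1 (lz i0); rewrite lin2_delta_l rA r0.
have De : \forall X \near (0 : 'rV[C]_(3 + 3)),
    pd (lz i1) P' X + kap' * P' X = mu * beta * E (lin2 A X).
  apply: filterS (D1 (lz i1)) => X ->; rewrite lin2_delta_l rA r1 /E /P' /kap'.
  have -> : row_mx (beta *: k) (0 : C3 R) = beta *: row_mx k 0.
    by rewrite scale_row_mx scaler0.
  rewrite DDZ; move: (DD _ _ _) (P _) => x y; ring.
have De1 i := pd_lin2 i aE De.
split.
- move=> a; have := near_at (pd_lin2 (rz a) (an_DD _ aP) D1l); rewrite lin2_0 lin2_delta_r rA => ->.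
  have HD u v : DD (row_mx 0 v) (DD (row_mx u 0) P) 0 = cplx_hessian rho 0 u v.
    have e2 : DD (row_mx u 0) P = (fun X => \sum_j u 0 j * pd (lshift 3 j) P X).
      by apply/funext => X; rewrite /DD dot_row0.
    rewrite e2 /DD dot_0row /cplx_hessian /dot.
    under eq_bigr do rewrite (near_at (pd_lincomb _ _ _ (fun j => an_pd (lshift 3 j) aP))) mulr_sumr.
    rewrite exchange_big; apply: eq_bigr => j _; rewrite mulr_sumr; apply: eq_bigr => i _.
    by rewrite mulrCA (hessE gP).
  rewrite HD; case: (two2 a) => ->; rewrite ?r0 ?r1 /=; first by rewrite mulVf.
  have := cplx_hessian_conj hM k (conjmx l) M0; rewrite klH conjmxK rmorph0 => e3.
  by rewrite conjmxZ cplx_hessianZr -e3 !mulr0.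
- move=> i; rewrite (near_at (De1 (rshift (2 + 1) i))) lin2_0 lin2_delta_r.
  by have := E1 (conjmx (row i A)); rewrite /Dv -/(DD _ E 0) => ->; rewrite mulr0.
move=> a b; have := near_at (pd_lin2 (rz b) (an_DD _ aE) (De1 (rz a))).
rewrite lin2_0 !lin2_delta_r !rA => ->.
pose dd u v := DD (row_mx 0 u) (DD (row_mx 0 v) E) 0.
have ddC u v : dd u v = dd v u by exact: DD_comm.
have ddZ t u v : dd (t *: u) v = t * dd u v.
  have e : row_mx (0 : C3 R) (t *: u) = t *: row_mx 0 u by rewrite scale_row_mx scaler0.
  by rewrite /dd e DDZ.
have ddk v : dot v (gy P) = 0 -> dd v (conjmx k) = 0 by exact: E2.
rewrite -/(dd _ _); case: (two2 a) => ->; case: (two2 b) => ->; rewrite ?r0 ?r1 /=.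
- have -> : dd (conjmx l) (conjmx l) = f by [].
  by rewrite /mu /beta; move: ll E3; rewrite -/h; move: (h) (f) => x y x0 y0; field; apply/andP.
- by rewrite conjmxZ ddZ ddC ddk // !mulr0.
- by rewrite conjmxZ ddC ddZ ddC ddk // !mulr0.
by rewrite conjmxZ ddZ ddC ddZ ddk // !mulr0.
Qed.

End AdaptedCoordinates.

(** * The holomorphic coordinates and the normal form *)

Section LinearizedCoordinates.
Variable R : realType.
Local Notation C := (Cplx R).
Local Notation last n := (rshift n (ord0 : 'I_1)).

Lemma near_imp3 n (P1 P2 P3 S : 'rV[C]_n -> Prop) :
  (\forall t \near (0 : 'rV[C]_n), P1 t) -> (\forall t \near (0 : 'rV[C]_n), P2 t) ->
  (\forall t \near (0 : 'rV[C]_n), P3 t) -> (forall t, P1 t -> P2 t -> P3 t -> S t) ->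
  \forall t \near (0 : 'rV[C]_n), S t.
Proof. by move=> h1 h2 h3 h; apply: filterS2 h1 (filterI h2 h3) => t e [k l]; exact: h. Qed.

(** A holomorphic germ is a complexification which depends on the first variables only. *)
Lemma d_z_an k (f : C3 R -> C) a : an f -> cd (fun tau => f (tau *: delta_mx 0 k)) a ->
  d_z k f 0 = a.
Proof.
move=> af df; have gf : germ 0 f (fun X => f (lsubmx X)).
  split; first by apply: (an_compose af); [apply: van_lsub; exact: van_id | rewrite linear0].
  by apply: near_all => h; rewrite row_mxKl add0r.
have := congr1 (fun G : 'cV[C]_(3 + 3) => G (lshift 3 k) 0) (germ_gradient gf).
rewrite /gradient col_mxEu !mxE => ->.
have := cd_pd (delta_mx 0 (lshift 3 k)) gf.1; rewrite dot_delta => h.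
apply: cd_unique h _; apply: cd_ext df => tau; congr f.
by rewrite linearZ /= delta_mx_lshift row_mxKl.
Qed.

Lemma w_part_app1 (z : 'rV[C]_2) v : w_part (app1 z v : C3 R) = v.
Proof.
rewrite /w_part (_ : ord_max = last 2); first exact: app1_last.
exact/val_inj.
Qed.

Lemma z_part_app1 (z : 'rV[C]_2) v : z_part (app1 z v : C3 R) = z.
Proof. exact: lsub_app1. Qed.

(** The differential of the map at the origin is the linear map of the matrix invmx A, as
    g and w have the differentials of the first and last coordinates. *)
Lemma coordinates_of_germs (A : 'M[C]_(2 + 1)) (w : 'rV[C]_(2 + 1) -> C) (g : 'rV[C]_2 -> C) :
  A \in unitmx -> an w -> w 0 = 0 ->
  (forall (a : 'rV[C]_2) b, cd (fun tau => w (tau *: app1 a b)) b) ->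
  an g -> g 0 = 0 -> (forall a : 'rV[C]_2, cd (fun tau => g (tau *: a)) (a 0 0)) ->
  holomorphic_coordinates (fun q : C3 R => let xi := q *m invmx A : 'rV[C]_(2 + 1) in
    app1 (mk2 (g (lsubmx xi)) (lsubmx xi 0 1)) (w xi) : C3 R).
Proof.
move=> uA aw w0 dw ag g0 dg; set B := invmx A.
have vx : van (fun q : C3 R => q *m B : 'rV[C]_(2 + 1)) by apply: van_mulmx; exact: van_id.
have aZ : van (fun q : C3 R => app1 (mk2 (g (lsubmx (q *m B : 'rV[C]_(2 + 1))))
    (lsubmx (q *m B : 'rV[C]_(2 + 1)) 0 1)) (w (q *m B))).
  apply: van_app1; last by apply: (an_compose aw) => //; rewrite mul0mx.
  apply: van_mk2; last exact: (van_lsub vx).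
  by apply: (an_compose ag); [exact: van_lsub | rewrite mul0mx linear0].
have dZ k : vcd (fun tau => app1 (mk2 (g (lsubmx ((tau *: delta_mx 0 k : C3 R) *m B : 'rV[C]_(2 + 1))))
    (lsubmx ((tau *: delta_mx 0 k : C3 R) *m B : 'rV[C]_(2 + 1)) 0 1))
    (w ((tau *: delta_mx 0 k : C3 R) *m B))) (row k B).
  have e tau : (tau *: delta_mx 0 k : C3 R) *m B = tau *: row k B by rewrite -scalemxAl rowE.
  have -> : row k B = app1 (mk2 (lsubmx (row k B : 'rV[C]_(2 + 1)) 0 0)
      (lsubmx (row k B : 'rV[C]_(2 + 1)) 0 1)) ((row k B : 'rV[C]_(2 + 1)) 0 (last 2)).
    by rewrite mk2_eta app1_eta.
  apply: vcd_app1.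
    apply: vcd_mk2.
      by apply: cd_ext (dg (lsubmx (row k B : 'rV[C]_(2 + 1)))) => tau; rewrite e linearZ.
    apply: cd_ext (vcd_scale (lsubmx (row k B : 'rV[C]_(2 + 1))) 1) => tau.
    by rewrite e linearZ.
  have := dw (lsubmx (row k B : 'rV[C]_(2 + 1))) ((row k B : 'rV[C]_(2 + 1)) 0 (last 2)).
  by apply: cd_ext => tau; rewrite e app1_eta.
split.
- have l0 : lsubmx (0 : 'rV[C]_(2 + 1)) = (0 : 'rV[C]_2) by exact: linear0.
  have z0 (xi : 'rV[C]_(2 + 1)) : xi = 0 -> app1 (mk2 (g (lsubmx xi)) (lsubmx xi 0 1)) (w xi) = 0.
    by move=> ->; rewrite l0 g0 w0 mxE mk2_0; exact: app1_0.
  by apply: z0; exact: mul0mx.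
- move=> j; have [c [cc hc]] := aZ j; exists c => //.
  by apply: filterS hc => q; rewrite subr0.
rewrite (_ : \matrix_(j, k) _ = B^T) ?unitmx_tr ?unitmx_inv //.
apply/matrixP => j k; rewrite !mxE (d_z_an (aZ j) (dZ k j)) mxE //.
Qed.

End LinearizedCoordinates.

Theorem mainTheorem6 (R : realType) (U : set (C3 R)) (rho : C3 R -> R)
    (M : set (C3 R)) (theta : C3 R -> cotvec R)
    (hM : hypersurface U rho M) (h0 : M 0)
    (htheta : contact_form rho M theta)
    (hIV2 : class_IV2 rho M theta) :
  exists (Z : C3 R -> C3 R) (R1 : power_series R (2 + 2))
    (R2 Q : power_series R (2 + 2 + 1)),
  [/\ holomorphic_coordinates Z,
      bigO_order 4 R1,
      bigO_order 2 Q /\ R2 = ps_mulvar (rshift (2 + 2) ord0) Q,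
      remainder_normalized R1 /\ remainder_normalized R2 &
      (\forall x \near (0 : C3 R),
         normal_rhs R1 R2 (z_part x) ('Re (w_part x)) \is Num.real) /\
      (\forall p \near (0 : C3 R),
         M p <-> 'Im (w_part (Z p)) =
                 normal_rhs R1 R2 (z_part (Z p)) ('Re (w_part (Z p))))].
Proof.
have [A [P [kap [uA eqP [aP [P0 hP]] [pz pw qz qw] [hl he1 he2]]]]] :=
  adapted_germ hM htheta hIV2 h0.
have hP' : \forall X \near (0 : 'rV[Cplx R]_((2 + 1) + (2 + 1))), P (cswap X) = (P X)^*.
  exact: near_all.
have [w [g [R1 [R2 [Q [[aw w0 dw] [ag g0 dg] [b1 b2 b3] real eqw]]]]]] :=
  normal_coordinates aP hP' P0 pz pw qz qw hl he1 he2.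
exists (fun q : C3 R => let xi := q *m invmx A : 'rV[Cplx R]_(2 + 1) in
    app1 (mk2 (g (lsubmx xi)) (lsubmx xi 0 1)) (w xi) : C3 R), R1, R2, Q.
split; [exact: (coordinates_of_germs uA aw w0 dw ag g0 dg) | exact: b1 | exact: b2 | exact: b3 |].
split.
  apply: filterS real => x; rewrite /w_part (_ : ord_max = rshift 2 (ord0 : 'I_1)) //.
  exact/val_inj.
have MU : \forall q \near (0 : C3 R), M q <-> rho q = 0.
  case: hM h0 => oU _ -> _ [U0 _]; have Un : \forall q \near (0 : C3 R), U q.
    exact: open_nbhs_nbhs.
  by apply: filterS Un => q Uq; split=> [[]|].
have vx : van (fun q : C3 R => q *m invmx A : 'rV[Cplx R]_(2 + 1)).
  by apply: van_mulmx; exact: van_id.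
have x0 : (0 : C3 R) *m invmx A = (0 : 'rV[Cplx R]_(2 + 1)) by exact: mul0mx.
have h1 := near_compose vx x0 eqP; have h2 := near_compose vx x0 eqw.
apply: (near_imp3 MU h1 h2) => q e1 e2 e3 /=.
rewrite e1 w_part_app1 z_part_app1 -e3 -/(rv _) -e2.
by rewrite -mulmxA mulVmx // mulmx1.
Qed.
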